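(* Let $m\ge 2$ be an integer, $\sigma>0$ and $1/2<\gamma<1$. The linear map sending $(R,p,u)$, with $R\in\mathbb{C}$, $p=(p_x,p_y)\in\mathbb{C}^2$ and $u\in J_{1/2,\gamma}^{m,\sigma}(\Pi)$, to $(f,g)$, where $$f(\psi,\theta)=\psi^{-1/2}\Big[\psi^2\partial_\psi^2+2\psi\partial_\psi+\tfrac14(I+\partial_\theta^2)\Big]u(\psi,\theta),$$ $$g(\theta)=R+\tfrac{p_x-ip_y}{2}e^{i\theta}+\tfrac{p_x+ip_y}{2}e^{-i\theta}+u(1,\theta),$$ defines an isomorphism $$\mathbb{C}^3\times J_{1/2,\gamma}^{m,\sigma}(\Pi)\to\widetilde J_{0,\gamma}^{m-2,\sigma}(\Pi)\times X_\sigma^{m-1/2}(\mathbb{T}).$$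
   Context: $\mathbb{T}=\mathbb{R}/2\pi\mathbb{Z}$, $\Pi=[0,1]\times\mathbb{T}$ with coordinates $(\psi,\theta)$; functions are complex-valued; $\hat a_k$ denotes the $k$-th Fourier coefficient in $\theta$. For integer $m\ge0$, $\gamma\in\mathbb{R}$: $\|u\|^2_{K_\gamma^m(\Pi)}=\sum_{0\le p+q\le m}\|\psi^{p-\gamma}\partial_\psi^p\partial_\theta^q u\|^2_{L^2(\Pi)}$. For $\gamma\ge1/2$, $J_{\lambda,\gamma}^m(\Pi)=\{v(\theta)\psi^\lambda+w(\psi,\theta): v\in H^m(\mathbb{T}),\ w\in K_{\lambda+\gamma}^m(\Pi)\}$ with the norm of the direct sum $H^m(\mathbb{T})\oplus K_{\lambda+\gamma}^m(\Pi)$. $J_{\lambda,\gamma}^{m,\sigma}(\Pi)$ is the space of $a\in J_{\lambda,\gamma}^m(\Pi)$ such that $\sum_k\hat a_k(\psi)e^{\sigma|k|}e^{ik\theta}\in J_{\lambda,\gamma}^m(\Pi)$, normed by the $J_{\lambda,\gamma}^m(\Pi)$ norm of the latter. For real $s$, $X_\sigma^s(\mathbb{T})$ is the space of functions on $\mathbb{T}$ with finite norm $\|a\|_{X_\sigma^s}^2=\sum_k(1+k^2)^se^{2\sigma|k|}|\hat a_k|^2$. Finally $\widetilde J_{0,\gamma}^{m,\sigma}(\Pi)=\{v(\theta)+w(\psi,\theta)\in J_{0,\gamma}^{m,\sigma}(\Pi):\int_{\mathbb{T}}v(\theta)e^{\pm2i\theta}\,d\theta=0\}$, where $v$ is the leading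 ($\lambda=0$) component. An isomorphism means a bounded linear bijection with bounded inverse. *)

(* Defs.v *)
(* The complex numbers are [R[i]], from mathcomp-real-closed. *)
From HB Require Import structures.
From mathcomp Require Import all_boot all_order all_algebra.
From mathcomp Require Import all_classical all_reals all_analysis.
From mathcomp Require Import complex.

Set Implicit Arguments.
Unset Strict Implicit.
Unset Printing Implicit Defensive.

Import Order.TTheory GRing.Theory Num.Theory.
Import numFieldNormedType.Exports.
Import ComplexField.Normc.

Local Open Scope classical_set_scope.
Local Open Scope ring_scope.
Local Open Scope complex_scope.

(* A space of functions taken modulo almost everywhere equality: [ns_eq] is the
   equality of the space, and the normed space it denotes is the quotient of
   [ns_mem] by [ns_eq]. *)
Record nspace (R : realType) := NSpace {
  ns_car :> lmodType R[i];
  ns_mem : set ns_car;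
  ns_eq : ns_car -> ns_car -> Prop;
  ns_norm : ns_car -> R }.

Definition scalar_space (R : realType) : nspace R :=
  @NSpace R R[i] setT eq (@normc R).

Definition prod_space (R : realType) (E F : nspace R) : nspace R :=
  @NSpace R (E * F)%type
    [set x | ns_mem x.1 /\ ns_mem x.2]
    (fun x y => ns_eq x.1 y.1 /\ ns_eq x.2 y.2)
    (fun x => ns_norm x.1 + ns_norm x.2).

(* [Phi] induces a bounded linear bijection with bounded inverse between the
   quotients. *)
Definition isomorphism (R : realType) (E F : nspace R) (Phi : E -> F) : Prop :=
  [/\ forall x, ns_mem x -> ns_mem (Phi x),
      forall x y, ns_mem x -> ns_mem y ->
        (ns_eq x y <-> ns_eq (Phi x) (Phi y)),
      forall (c : R[i]) x y, ns_mem x -> ns_mem y ->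
        ns_eq (Phi (c *: x + y)) (c *: Phi x + Phi y),
      forall y, ns_mem y -> exists2 x, ns_mem x & ns_eq (Phi x) y &
      (exists M : R, forall x, ns_mem x -> ns_norm (Phi x) <= M * ns_norm x) /\
      (exists M : R, forall x, ns_mem x -> ns_norm x <= M * ns_norm (Phi x))].

Section Spaces.
Variable R : realType.

Local Notation mu1 := (@lebesgue_measure R).
Local Notation mu2 := (@lebesgue_measure R \x @lebesgue_measure R)%E.

(* Functions on the circle (resp. on Pi) are 2pi-periodic functions of theta in R
   (resp. of (psi, theta) in R * R); the circle is integrated over [0, 2pi], and
   values at psi outside [0, 1] are ignored. *)
Definition circ : set R := `[0, 2 * pi].
Definition Pi_set : set (R * R) := `[0, 1] `*` circ.

Definition expi (x : R) : R[i] := cos x +i* sin x.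

Definition circle_fun (v : R -> R[i]) : Prop :=
  [/\ measurable_fun circ (fun t => complex.Re (v t)),
      measurable_fun circ (fun t => complex.Im (v t)) &
      forall t, v (t + 2 * pi) = v t].

Definition Pi_fun (u : R * R -> R[i]) : Prop :=
  [/\ measurable_fun Pi_set (fun z => complex.Re (u z)),
      measurable_fun Pi_set (fun z => complex.Im (u z)) &
      forall psi t, u (psi, t + 2 * pi) = u (psi, t)].

Definition circ_eq (v w : R -> R[i]) : Prop := ae_eq mu1 circ v w.
Definition Pi_eq (u w : R * R -> R[i]) : Prop := ae_eq mu2 Pi_set u w.

Definition circ_int (f : R -> R[i]) : R[i] :=
  (\int[mu1]_(t in circ) complex.Re (f t)) +i*
  (\int[mu1]_(t in circ) complex.Im (f t)).

Definition Pi_int (f : R * R -> R[i]) : R[i] :=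
  (\int[mu2]_(z in Pi_set) complex.Re (f z)) +i*
  (\int[mu2]_(z in Pi_set) complex.Im (f z)).

Definition circ_L2sq (v : R -> R[i]) : \bar R :=
  (\int[mu1]_(t in circ) (normc (v t) ^+ 2)%:E)%E.

Definition Pi_L2sq (u : R * R -> R[i]) : \bar R :=
  (\int[mu2]_(z in Pi_set) (normc (u z) ^+ 2)%:E)%E.

Definition fourier_coef (v : R -> R[i]) (k : int) : R[i] :=
  ((2 * pi)^-1)%:C * circ_int (fun t => v t * expi (- (k%:~R * t))).

(* f = \sum_(k in Z) c_k e^{ikt}, the series converging in L^2 of the circle. *)
Definition fourier_sum (c : int -> R[i]) (f : R -> R[i]) : Prop :=
  (fun N : nat => circ_L2sq (fun t => f t -
     \sum_(i < N.*2.+1) c (Posz i - Posz N) * expi ((Posz i - Posz N)%:~R * t)))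
  @ \oo --> 0%E.

Definition X_normsq (sigma s : R) (a : R -> R[i]) : \bar R :=
  (\esum_(k in [set: int])
     ((1 + k%:~R ^+ 2) `^ s * expR (2 * sigma * `|k%:~R|)
        * normc (fourier_coef a k) ^+ 2)%:E)%E.

(* Only sigma > 0, or sigma = 0 and s >= 0, is used below; in these cases a
   finite norm forces square integrability, so that no distributions are lost. *)
Definition X_mem (sigma s : R) (a : R -> R[i]) : Prop :=
  [/\ circle_fun a, (circ_L2sq a < +oo)%E & (X_normsq sigma s a < +oo)%E].

Definition X_space (sigma s : R) : nspace R :=
  @NSpace R (R -> R[i]) (X_mem sigma s) circ_eq
    (fun a => Num.sqrt (fine (X_normsq sigma s a))).

(* The Sobolev space H^m of the circle is X^m with sigma = 0. *)
Definition H_mem (m : nat) (v : R -> R[i]) : Prop := X_mem 0 m%:R v.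
Definition H_normsq (m : nat) (v : R -> R[i]) : \bar R := X_normsq 0 m%:R v.

Definition d_psi (phi : R * R -> R) : R * R -> R :=
  fun z => derive1 (fun x => phi (x, z.2)) z.1.
Definition d_theta (phi : R * R -> R) : R * R -> R :=
  fun z => derive1 (fun t => phi (z.1, t)) z.2.
Definition partial (p q : nat) (phi : R * R -> R) : R * R -> R :=
  iter p d_psi (iter q d_theta phi).

Definition smooth (phi : R * R -> R) : Prop :=
  forall p q, continuous (partial p q phi) /\
    forall z, derivable (fun x => partial p q phi (x, z.2)) z.1 1 /\
              derivable (fun t => partial p q phi (z.1, t)) z.2 1.

(* C^oo functions on ]0, 1[ x T with compact support; real-valued ones suffice to
   define weak derivatives of complex-valued functions. *)
Definition test_fun (phi : R * R -> R) : Prop :=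
  [/\ smooth phi,
      forall psi t, phi (psi, t + 2 * pi) = phi (psi, t) &
      exists2 e : R, 0 < e &
        forall z, phi z != 0 -> e <= z.1 <= 1 - e].

(* Local integrability on the open cylinder ]0, 1[ x T. *)
Definition loc_integrable (u : R * R -> R[i]) : Prop :=
  Pi_fun u /\
  forall e : R, 0 < e ->
    (\int[mu2]_(z in `[e, (1 - e)%R] `*` circ) (normc (u z))%:E < +oo)%E.

Definition is_wderiv (p q : nat) (u g : R * R -> R[i]) : Prop :=
  [/\ loc_integrable u, loc_integrable g &
      forall phi, test_fun phi ->
        Pi_int (fun z => g z * (phi z)%:C) =
        (-1) ^+ (p + q) * Pi_int (fun z => u z * (partial p q phi z)%:C)].

(* The weak derivative of order p in psi and q in theta (unique up to [Pi_eq]). *)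
Definition wderiv (p q : nat) (u : R * R -> R[i]) : R * R -> R[i] :=
  xget (fun=> 0) [set g | is_wderiv p q u g].

Definition K_normsq (gamma : R) (m : nat) (u : R * R -> R[i]) : \bar R :=
  (\sum_(p < m.+1) \sum_(q < m.+1 | (p + q <= m)%N)
     Pi_L2sq (fun z => ((z.1 `^ (p%:R - gamma))%:C * wderiv p q u z)%R))%E.

Definition K_mem (gamma : R) (m : nat) (u : R * R -> R[i]) : Prop :=
  [/\ Pi_fun u,
      forall p q : nat, (p + q <= m)%N -> exists g, is_wderiv p q u g &
      (K_normsq gamma m u < +oo)%E].

Definition J_decomp (lambda gamma : R) (m : nat) (a : R * R -> R[i])
    (vw : (R -> R[i]) * (R * R -> R[i])) : Prop :=
  [/\ H_mem m vw.1, K_mem (lambda + gamma) m vw.2 &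
      Pi_eq a (fun z => vw.1 z.2 * (z.1 `^ lambda)%:C + vw.2 z)].

Definition J_mem (lambda gamma : R) (m : nat) (a : R * R -> R[i]) : Prop :=
  Pi_fun a /\ exists vw, J_decomp lambda gamma m a vw.

(* For gamma >= 1/2 the decomposition is unique up to a.e. equality, so the
   choice made here is immaterial. *)
Definition J_norm (lambda gamma : R) (m : nat) (a : R * R -> R[i]) : R :=
  let vw := xget (fun=> 0, fun=> 0) [set vw | J_decomp lambda gamma m a vw] in
  Num.sqrt (fine (H_normsq m vw.1) + fine (K_normsq (lambda + gamma) m vw.2)).

(* b = \sum_k \hat a_k(psi) e^{sigma |k|} e^{i k theta} *)
Definition is_boost (sigma : R) (a b : R * R -> R[i]) : Prop :=
  Pi_fun b /\
  {ae mu1, forall psi, 0 <= psi <= 1 ->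
     fourier_sum
       (fun k => fourier_coef (fun t => a (psi, t)) k
                 * (expR (sigma * `|k%:~R|))%:C)
       (fun t => b (psi, t))}.

Definition boost (sigma : R) (a : R * R -> R[i]) : R * R -> R[i] :=
  xget (fun=> 0) [set b | is_boost sigma a b].

Definition Js_mem (lambda gamma : R) (m : nat) (sigma : R)
    (a : R * R -> R[i]) : Prop :=
  J_mem lambda gamma m a /\
  exists2 b, is_boost sigma a b & J_mem lambda gamma m b.

Definition J_space (lambda gamma : R) (m : nat) (sigma : R) : nspace R :=
  @NSpace R (R * R -> R[i]) (Js_mem lambda gamma m sigma) Pi_eq
    (fun a => J_norm lambda gamma m (boost sigma a)).

Definition Jtilde_space (gamma : R) (m : nat) (sigma : R) : nspace R :=
  @NSpace R (R * R -> R[i])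
    [set a | Js_mem 0 gamma m sigma a /\
       exists2 vw, J_decomp 0 gamma m a vw &
         circ_int (fun t => vw.1 t * expi (2 * t)) = 0 /\
         circ_int (fun t => vw.1 t * expi (- (2 * t))) = 0]
    Pi_eq
    (fun a => J_norm 0 gamma m (boost sigma a)).

(* u(1, .): the value at psi = 1 of the representative of u that is continuous
   on ]0, 1] x T. *)
Definition is_trace (u : R * R -> R[i]) (t : R -> R[i]) : Prop :=
  exists U : R * R -> R[i],
    [/\ {within [set z | 0 < z.1 <= 1], continuous (fun z => complex.Re (U z))},
        {within [set z | 0 < z.1 <= 1], continuous (fun z => complex.Im (U z))},
        forall psi th, U (psi, th + 2 * pi) = U (psi, th),
        Pi_eq u U &
        t = fun th => U (1, th)].

Definition trace (u : R * R -> R[i]) : R -> R[i] :=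
  xget (fun=> 0) [set t | is_trace u t].

Definition f_op (u : R * R -> R[i]) : R * R -> R[i] :=
  fun z => (z.1 `^ (- 2^-1))%:C *
    ((z.1 ^+ 2)%:C * wderiv 2 0 u z + (2 * z.1)%:C * wderiv 1 0 u z
     + 4^-1 * (u z + wderiv 0 2 u z)).

Definition iC : R[i] := 0 +i* 1.

Definition g_op (r px py : R[i]) (u : R * R -> R[i]) : R -> R[i] :=
  fun t => r + (px - iC * py) / 2 * expi t + (px + iC * py) / 2 * expi (- t)
           + trace u t.

Definition source_space (gamma : R) (m : nat) (sigma : R) : nspace R :=
  prod_space (scalar_space R)
    (prod_space (prod_space (scalar_space R) (scalar_space R))
                (J_space 2^-1 gamma m sigma)).

Definition target_space (gamma : R) (m : nat) (sigma : R) : nspace R :=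
  prod_space (Jtilde_space gamma (m - 2) sigma) (X_space sigma (m%:R - 2^-1)).

Definition bvp_map (gamma : R) (m : nat) (sigma : R)
    (x : source_space gamma m sigma) : target_space gamma m sigma :=
  let: (r, ((px, py), u)) := x in (f_op u, g_op r px py u).

End Spaces.

(* Main.v *)
Require Import Defs.
From HB Require Import structures.
From mathcomp Require Import all_boot all_order all_algebra.
From mathcomp Require Import all_classical all_reals all_analysis.
From mathcomp Require Import complex measurable_realfun.
From mathcomp Require Import ring lra zify.

Set Implicit Arguments.
Unset Strict Implicit.
Unset Printing Implicit Defensive.

Import Order.TTheory GRing.Theory Num.Theory.
Import numFieldNormedType.Exports.
Import ComplexField.Normc.

Local Open Scope classical_set_scope.
Local Open Scope ring_scope.
Local Open Scope complex_scope.

Local Notation Re := (@complex.Re _).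
Local Notation Im := (@complex.Im _).

(** Fourier series in the angle turn the problem into ordinary differential equations. An element
    [V(theta) psi^(1/2) + w] of the source space has the modes [V_k x^(1/2) + x^gamma z_k(x)], and
    membership of [w] in the weighted Sobolev space means that [z_k] and its derivatives with respect
    to [ln x] up to order [m] are square integrable for [dx/x], with weights [(1 + k^2)^(m - p)] for
    the derivative of order [p] ([K_wrep], [wrep_K], [J_rep], [rep_J]). The factor [e^(sigma |k|)]
    only changes the weights of the sum over [k] ([Js_rep], [rep_Js], [J_norm_boost]). As
    [gamma >= 1/2], the numbers [V_k] are determined by the function ([modes_uniq]).

    The operator sends these modes to [(4 - k^2)/4 V_k + x^(gamma - 1/2) h_k(x)], where
    [h_k = (D - a)(D - b) z_k], [D = x d/dx], [a = (|k| - 1)/2 - gamma] and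
    [b = - (|k| + 1)/2 - gamma] ([f_rep]). The energy identity
    [|D z - a z|^2 = |D z|^2 + a^2 |z|^2 - a z(1)^2] in the space [L^2(dx/x)] shows that [D - a] is
    invertible for [a < 0], while for [a > 0] the value [z(1)] can be prescribed and is needed for
    the estimate ([solve_neg], [solve_pos], [euler_inverse]). Since [1/2 < gamma < 1], the root [b] is
    always negative, and [a] is negative exactly when [|k| <= 2].

    The boundary condition has the modes [V_k + z_k(1)], up to the contributions of [R] and [p] to the
    modes [|k| <= 1]. Three cases arise. For [|k| >= 3] the equation gives [V_k], and the boundary
    condition gives the free value [z_k(1)]. For [|k| = 2] the factor [(4 - k^2)/4] vanishes: this is
    the orthogonality condition on the right-hand side; the equation gives [z_k] and the boundary
    condition gives [V_k]. For [|k| <= 1] the equation gives [V_k] and [z_k], and the boundary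
    condition gives [R] and [p]. The estimates are uniform in [k] with the weights
    [(1 + k^2)^(m - 1/2)] on the boundary, which are those of the trace theorem for [z_k(1)]
    ([mode_trace], [mode_apriori]), so that the solutions of the single modes can be summed.

    It remains to relate modes and functions. Weak derivatives are tested against products of a
    radial test function and a trigonometric one, which reduces them to the lemma of du Bois-Reymond
    in one variable ([coef_wderiv], [wderiv_chain]); conversely a function built from modes by the
    Riesz-Fischer theorem has the expected weak derivatives ([mode_is_wderiv]). The trace at
    [psi = 1] is that of the sum of the Fourier series, which converges uniformly because of the
    exponential weights ([abs_trig], [u_trace]). *)

(** * Square integrable functions *)

Section SquareIntegrable.
Context d (T : measurableType d) (R : realType) (mu : {measure set T -> \bar R}).
Variables (D : set T) (mD : measurable D).
Implicit Types f g : T -> R.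

Definition sqint f := measurable_fun D f /\ (\int[mu]_(x in D) (f x ^+ 2)%:E < +oo)%E.

Lemma integrable_of_bound f g : measurable_fun D f ->
  mu.-integrable D (EFin \o g) -> (forall x, D x -> `|f x| <= g x) ->
  mu.-integrable D (EFin \o f).
Proof.
move=> mf ig fg; apply: (le_integrable mD _ _ ig); first exact/measurable_EFinP.
by move=> x Dx /=; rewrite lee_fin (le_trans (fg x Dx))// ler_norm.
Qed.

Lemma sqint_sq_integrable f : sqint f ->
  mu.-integrable D (EFin \o (fun x => f x ^+ 2)).
Proof.
move=> [mf foo]; apply/integrableP; split.
  by apply/measurable_EFinP; exact: measurable_funX.
under eq_integral => x _ do rewrite /= ger0_norm ?sqr_ge0//.
exact: foo.
Qed.

Lemma sqint_of_integrable f : measurable_fun D f ->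
  mu.-integrable D (EFin \o (fun x => f x ^+ 2)) -> sqint f.
Proof.
move=> mf /integrableP[_ foo]; split => //.
apply: le_lt_trans foo; apply: ge0_le_integral => //.
- by move=> x _; rewrite lee_fin sqr_ge0.
- by apply/measurable_EFinP; exact: measurable_funX.
- do 2 apply: measurableT_comp => //; exact: measurable_funX.
- by move=> x _; rewrite /= lee_fin ler_norm.
Qed.

Lemma integrableM_sqint f g : sqint f -> sqint g ->
  mu.-integrable D (EFin \o (fun x => f x * g x)).
Proof.
move=> sf sg.
apply: (@integrable_of_bound _ (fun x => f x ^+ 2 + g x ^+ 2)).
- by apply: measurable_funM; [case: sf|case: sg].
- have := integrableD mD (sqint_sq_integrable sf) (sqint_sq_integrable sg).
  by apply: eq_integrable => // x _.
- by move=> x _; rewrite ler_norml; apply/andP; split; nra.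
Qed.

Lemma sqintD f g : sqint f -> sqint g -> sqint (fun x => f x + g x).
Proof.
move=> sf sg; apply: sqint_of_integrable.
  by apply: measurable_funD; [case: sf|case: sg].
apply: (@integrable_of_bound _ (fun x => 2 * f x ^+ 2 + 2 * g x ^+ 2)).
- by apply/measurable_funX/measurable_funD; [case: sf|case: sg].
- have := integrableD mD (integrableZl mD 2 (sqint_sq_integrable sf))
    (integrableZl mD 2 (sqint_sq_integrable sg)).
  by apply: eq_integrable => // x _.
- by move=> x _; rewrite ger0_norm ?sqr_ge0//; have := sqr_ge0 (f x - g x); nra.
Qed.

Lemma sqintZ (c : R) f : sqint f -> sqint (fun x => c * f x).
Proof.
move=> sf; apply: sqint_of_integrable.
  by apply: measurable_funM => //; case: sf.
have := integrableZl mD (c ^+ 2) (sqint_sq_integrable sf).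
by apply: eq_integrable => // x _; rewrite /= exprMn.
Qed.

Lemma sqintB f g : sqint f -> sqint g -> sqint (fun x => f x - g x).
Proof.
move=> sf /(sqintZ (-1)) sg; have := sqintD sf sg.
by under eq_fun do rewrite mulN1r.
Qed.

Lemma sqint0 : sqint (fun=> 0).
Proof.
split => //; rewrite integral0_eq ?ltry// => x _; by rewrite expr0n.
Qed.

Lemma sqint_le f g : measurable_fun D f -> sqint g ->
  (forall x, D x -> `|f x| <= `|g x|) -> sqint f.
Proof.
move=> mf sg fg; apply: sqint_of_integrable => //.
apply: (@integrable_of_bound _ (fun x => g x ^+ 2)).
- exact: measurable_funX.
- exact: sqint_sq_integrable.
- move=> x Dx; rewrite ger0_norm ?sqr_ge0// -(real_normK (num_real (f x))).
  by rewrite -(real_normK (num_real (g x))) lerXn2r ?nnegrE// fg.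
Qed.

Lemma sqint_bounded (h f : T -> R) (M : R) : measurable_fun D h ->
  (forall x, D x -> `|h x| <= M) -> sqint f -> sqint (fun x => h x * f x).
Proof.
move=> mh hM sf; apply: (@sqint_le _ (fun x => M * f x)).
- by apply: measurable_funM => //; case: sf.
- exact: sqintZ.
- move=> x Dx; rewrite !normrM ler_wpM2r//.
  by rewrite (le_trans (hM x Dx))// ler_norm.
Qed.

Lemma sqint_ae f g : measurable_fun D g -> ae_eq mu D f g -> sqint f -> sqint g.
Proof.
move=> mg fg [mf foo]; split => //.
rewrite -(@ge0_ae_eq_integral _ _ _ mu D (fun x => (f x ^+ 2)%:E))//.
- by apply/measurable_EFinP; exact: measurable_funX.
- by apply/measurable_EFinP; exact: measurable_funX.
- by move=> x _; rewrite lee_fin sqr_ge0.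
- by move=> x _; rewrite lee_fin sqr_ge0.
- by apply: filterS fg => x /= h /h ->.
Qed.

Section FiniteMeasure.
Hypothesis finD : (mu D < +oo)%E.

Lemma integrable_cst_fin (c : R) : mu.-integrable D (EFin \o cst c).
Proof.
apply/integrableP; split; first exact/measurable_EFinP.
by rewrite (_ : (fun x => _) = cst (`|c|)%:E)// integral_cst// lte_mul_pinfty.
Qed.

Lemma sqint_integrable f : sqint f -> mu.-integrable D (EFin \o f).
Proof.
move=> sf; apply: (@integrable_of_bound _ (fun x => 1 + f x ^+ 2)).
- by case: sf.
- have := integrableD mD (integrable_cst_fin 1) (sqint_sq_integrable sf).
  by apply: eq_integrable => // x _.
- by move=> x _; rewrite ler_norml; apply/andP; split; nra.
Qed.

Lemma sqint_cst c : sqint (cst c).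
Proof.
apply: sqint_of_integrable => //.
exact: (integrable_cst_fin (c ^+ 2)).
Qed.

Lemma sqint_bounded_fun (h : T -> R) (M : R) : measurable_fun D h ->
  (forall x, D x -> `|h x| <= M) -> sqint h.
Proof.
move=> mh hM; have := sqint_bounded mh hM (sqint_cst 1).
by under eq_fun do rewrite mulr1.
Qed.

End FiniteMeasure.

Lemma cauchy_schwarz_sqint f g : sqint f -> sqint g ->
  (\int[mu]_(x in D) (f x * g x)) ^+ 2 <=
  (\int[mu]_(x in D) (f x ^+ 2)) * (\int[mu]_(x in D) (g x ^+ 2)).
Proof.
move=> sf sg; set A := \int[mu]_(x in D) (f x ^+ 2).
set B := \int[mu]_(x in D) (f x * g x); set C := \int[mu]_(x in D) (g x ^+ 2).
have A0 : 0 <= A by apply: Rintegral_ge0 => x _; exact: sqr_ge0.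
have C0 : 0 <= C by apply: Rintegral_ge0 => x _; exact: sqr_ge0.
have key t : 0 <= t ^+ 2 * A + (2 * t) * B + C.
  have iff := sqint_sq_integrable sf; have igg := sqint_sq_integrable sg.
  have ifg := integrableM_sqint sf sg.
  have i1 : mu.-integrable D (EFin \o (fun x => t ^+ 2 * f x ^+ 2)).
    by have := integrableZl mD (t ^+ 2) iff; apply: eq_integrable.
  have i2 : mu.-integrable D (EFin \o (fun x => (2 * t) * (f x * g x))).
    by have := integrableZl mD (2 * t) ifg; apply: eq_integrable.
  rewrite /A /B -RintegralZl// -RintegralZl// -RintegralD// -RintegralD//; last first.
    by have := integrableD mD i1 i2; apply: eq_integrable.
  apply: Rintegral_ge0 => x _.
  have -> : t ^+ 2 * f x ^+ 2 + 2 * t * (f x * g x) + g x ^+ 2 = (t * f x + g x) ^+ 2.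
    by ring.
  exact: sqr_ge0.
have [A00|A00] := eqVneq A 0.
  have kk t : 0 <= (2 * t) * B + C by have := key t; rewrite A00 mulr0 add0r.
  rewrite A00 mul0r; have := kk (- (C + 1) / (2 * B)).
  have [->|B0] := eqVneq B 0; first by rewrite expr0n.
  have -> : 2 * (- (C + 1) / (2 * B)) * B + C = -1 by field.
  by rewrite ler0N1.
have Ap : 0 < A by rewrite lt_def A00.
have := key (- B / A).
have -> : (- B / A) ^+ 2 * A + 2 * (- B / A) * B + C = C - B ^+ 2 / A by field.
by rewrite subr_ge0 ler_pdivrMr// mulrC.
Qed.

End SquareIntegrable.

Lemma cvg_toEFin (R : realType) (u : nat -> R) (l : R) :
  u @ \oo --> l -> (fun n => (u n)%:E) @ \oo --> l%:E.
Proof. by move=> ul; apply/fine_cvgP; split; [exact: nearW | exact: ul]. Qed.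

Section RieszFischer.
Context d (T : measurableType d) (R : realType) (mu : {measure set T -> \bar R}).
Variables (D : set T) (mD : measurable D) (finD : (mu D < +oo)%E).

Lemma riesz_fischer (f : nat -> T -> R) (eps : nat -> R) :
  (forall n, sqint mu D (f n)) -> eps @ \oo --> (0 : R) ->
  (forall n m, (n <= m)%N -> \int[mu]_(x in D) (f m x - f n x) ^+ 2 <= eps n) ->
  exists2 g, sqint mu D g &
    forall n, \int[mu]_(x in D) (g x - f n x) ^+ 2 <= eps n.
Proof.
move=> sf eps0 Hf.
have /choice[N HN] : forall j, exists k, forall n, (k <= n)%N -> eps n <= (2^-1) ^+ j ^+ 2.
  move=> j.
  have /cvgrPdist_le/(_ ((2^-1) ^+ j ^+ 2)) := eps0.
  have p : 0 < ((2^-1) ^+ j ^+ 2 : R) by rewrite !exprn_gt0// invr_gt0.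
  move=> /(_ p) [k _ Hk]; exists k => n kn.
  by have := Hk n kn; rewrite /= sub0r normrN; apply: le_trans; exact: ler_norm.
pose s j := (\sum_(i < j.+1) (N i).+1)%N.
have sS j : s j.+1 = (s j + (N j.+1).+1)%N by rewrite /s big_ord_recr.
have sN j : (N j <= s j)%N.
  by case: j => [|j]; [rewrite /s big_ord_recr big_ord0 /=; lia | rewrite sS; lia].
have sj j : (j <= s j)%N.
  by elim: j => // j ih; rewrite sS; lia.
have smono j k : (j <= k)%N -> (s j <= s k)%N.
  by move/subnK <-; elim: (k - j)%N => // n ih; rewrite addSn sS; lia.
have mf n : measurable_fun D (f n) by case: (sf n).
pose h : nat -> T -> R := fun j x => `|f (s j.+1) x - f (s j) x|.
have mh j : measurable_fun D (h j).
  by apply: measurableT_comp => //; exact: measurable_funB.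
pose c : R := (1 + fine (mu D)) / 2.
have ih j : (\int[mu]_(x in D) (h j x)%:E <= (c * (2^-1) ^+ j)%:E)%E.
  have sh : sqint mu D (fun x => f (s j.+1) x - f (s j) x) by apply: sqintB.
  set q : R := 2^-1 ^+ j; have q0 : 0 < q by rewrite exprn_gt0// invr_gt0.
  have i1 : mu.-integrable D (EFin \o (fun x => (2 * q)^-1 * (f (s j.+1) x - f (s j) x) ^+ 2)).
    by have := integrableZl mD ((2 * q)^-1) (sqint_sq_integrable sh); apply: eq_integrable.
  have i2 : mu.-integrable D (EFin \o cst (q / 2)) by exact: integrable_cst_fin.
  have i3 : mu.-integrable D (EFin \o (fun x => (2 * q)^-1 * (f (s j.+1) x - f (s j) x) ^+ 2 + cst (q / 2) x)).
    by have := integrableD mD i1 i2; apply: eq_integrable.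
  apply: (@le_trans _ _ (\int[mu]_(x in D) ((2 * q)^-1 * (f (s j.+1) x - f (s j) x) ^+ 2 + cst (q / 2) x)%:E)%E).
    apply: ge0_le_integral => //.
    - by move=> x _; rewrite lee_fin /h normr_ge0.
    - exact/measurable_EFinP.
    - by case/integrableP: i3.
    - move=> x Dx; rewrite lee_fin /h /=; set a := _ - _.
      rewrite -(real_normK (num_real a)); set b := `|a|.
      rewrite -subr_ge0.
      have -> : (2 * q)^-1 * b ^+ 2 + q / 2 - b = (b - q) ^+ 2 / (2 * q).
        by field; rewrite gt_eqF.
      by rewrite divr_ge0 ?sqr_ge0// ltW// mulr_gt0.
  rewrite -(fineK (integrable_fin_num mD i3)) lee_fin.
  rewrite -/(Rintegral _ _ _) RintegralD// RintegralZl//; last exact: sqint_sq_integrable.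
  rewrite Rintegral_cst//.
  have e1 : eps (s j) <= q ^+ 2 by exact: HN.
  have e2 := le_trans (Hf (s j) (s j.+1) (smono _ _ (leqnSn _))) e1.
  set I := Rintegral _ _ _ in e2 *.
  have -> : c * q = (2 * q)^-1 * q ^+ 2 + q / 2 * fine (mu D).
    by rewrite /c; field; rewrite gt_eqF.
  by rewrite lerD2r ler_wpM2l// invr_ge0 ltW// mulr_gt0.
have c0 : 0 <= c by rewrite /c divr_ge0// addr_ge0// fine_ge0.
have iH : mu.-integrable D (fun x => \sum_(0 <= j <oo) (h j x)%:E)%E.
  apply/integrableP; split.
    apply: ge0_emeasurable_sum => [k x Dx _|k _]; first by rewrite lee_fin /h normr_ge0.
    exact/measurable_EFinP.
  under eq_integral.
    move=> x _; rewrite gee0_abs; last by apply: nneseries_ge0 => n _ _; rewrite lee_fin /h normr_ge0.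
    over.
  rewrite integral_nneseries//; first last.
  - by move=> n x _; rewrite lee_fin /h normr_ge0.
  - by move=> n; exact/measurable_EFinP.
  apply: (@le_lt_trans _ _ (\sum_(0 <= j <oo) (c * (2^-1) ^+ j)%:E)%E).
    apply: lee_nneseries => n _ //.
    by move=> _; apply: integral_ge0 => x Dx; rewrite lee_fin /h normr_ge0.
  have /= <- : limn (EFin \o series (geometric c (2^-1 : R))) =
     (\sum_(0 <= j <oo) (c * (2^-1) ^+ j)%:E)%E.
    by congr (limn _); apply/funext => n /=; rewrite /series /= sumEFin.
  rewrite EFin_lim; first exact: ltry.
  by apply: is_cvg_geometric_series; rewrite ger0_norm ?invr_ge0//; lra.
pose g x := fine (limn_esup (fun j => (f (s j) x)%:E)).
have mg : measurable_fun D g.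
  apply: measurableT_comp; first exact: fine_measurable.
  by apply: measurable_fun_limn_esup => n; exact/measurable_EFinP.
have cvg_ae : {ae mu, forall x, D x -> (fun j => f (s j) x) @ \oo --> g x}.
  apply: filterS (integrable_ae mD iH) => x /[apply] fin.
  have ch : cvgn (series (fun j => f (s j.+1) x - f (s j) x)).
    apply: normed_cvg; rewrite /=.
    have nd : nondecreasing_seq (series (fun j => h j x)).
      by apply: nondecreasing_series => n * /=; rewrite /h normr_ge0.
    apply: nondecreasing_is_cvgn => //.
    exists (fine (\sum_(0 <= j <oo) (h j x)%:E)%E) => _ [n _ <-].
    rewrite -lee_fin fineK// /series /= -sumEFin.
    by apply: nneseries_lim_ge => i _ _; rewrite lee_fin /h normr_ge0.
  have tel n : series (fun j => f (s j.+1) x - f (s j) x) n = f (s n) x - f (s 0%N) x.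
    by rewrite /series /= telescope_sumr.
  have cf : (fun j => f (s j) x) @ \oo -->
      f (s 0%N) x + limn (series (fun j => f (s j.+1) x - f (s j) x)).
    have -> : (fun j => f (s j) x) = (fun j => f (s 0%N) x + series (fun j => f (s j.+1) x - f (s j) x) j).
      by apply/funext => n; rewrite tel addrC subrK.
    by apply: cvgD => //; exact: cvg_cst.
  rewrite /g (_ : limn_esup _ = (f (s 0%N) x +
    limn (series (fun j => f (s j.+1) x - f (s j) x)))%:E) //.
  suff /cvg_limn_einf_sup[] : (fun j => (f (s j) x)%:E) @ \oo -->
    (f (s 0%N) x + limn (series (fun j => f (s j.+1) x - f (s j) x)))%:E by [].
  exact: cvg_toEFin.
have Hg n : (\int[mu]_(x in D) ((g x - f n x) ^+ 2)%:E <= (eps n)%:E)%E.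
  rewrite (@ge0_ae_eq_integral _ _ _ mu D _
    (fun x => limn_einf (fun j => ((f (s j) x - f n x) ^+ 2)%:E)))//; first last.
  - apply: filterS cvg_ae => x /[apply] cx.
    apply/esym; suff /cvg_limn_einf_sup[] : (fun j => ((f (s j) x - f n x) ^+ 2)%:E) @ \oo
      --> ((g x - f n x) ^+ 2)%:E by [].
    apply: cvg_toEFin; rewrite expr2; under eq_fun do rewrite expr2.
    apply: cvgM; apply: cvgB => //; exact: cvg_cst.
  - move=> x Dx; rewrite limn_einf_lim; apply: lime_ge; first exact: is_cvg_einfs.
    by near=> k; apply: le_ereal_inf_tmp => _ [i _ <-]; rewrite lee_fin sqr_ge0.
  - by move=> x _; rewrite lee_fin sqr_ge0.
  - rewrite (_ : (fun x => _) = (fun x => - limn_esup (fun j => (- (f (s j) x - f n x) ^+ 2)%:E))%E).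
      apply: measurableT_comp => //; apply: measurable_fun_limn_esup => k.
      apply/measurable_EFinP; apply: measurableT_comp => //.
      by apply: measurable_funX; exact: measurable_funB.
    apply/funext => x; rewrite -limn_einfN; congr limn_einf; apply/funext => j /=.
    by rewrite opprK.
  - by apply/measurable_EFinP; apply: measurable_funX; exact: measurable_funB.
  apply: (le_trans (fatou _ _ _ _)) => //.
  - by move=> k; apply/measurable_EFinP; apply: measurable_funX; exact: measurable_funB.
  - by move=> k x _; rewrite lee_fin sqr_ge0.
  rewrite limn_einf_lim; apply: lime_le; first exact: is_cvg_einfs.
  exists n => // k /= nk; apply: (@le_trans _ _ (\int[mu]_(x in D) ((f (s k) x - f n x) ^+ 2)%:E)%E).
    by apply: ereal_inf_lbound; exists k => //=; rewrite leqnn.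
  have := Hf n (s k) (leq_trans nk (sj k)).
  have i1 : mu.-integrable D (EFin \o (fun x => (f (s k) x - f n x) ^+ 2)).
    by apply: sqint_sq_integrable; exact: sqintB.
  by rewrite -lee_fin /Rintegral fineK// (integrable_fin_num mD i1).
have sg n : sqint mu D (fun x => g x - f n x).
  split; first exact: measurable_funB.
  by apply: (le_lt_trans (Hg n)); rewrite ltry.
exists g.
  by have := sqintD mD (sg 0%N) (sf 0%N); under eq_fun do rewrite subrK.
move=> n; rewrite -lee_fin /Rintegral fineK ?Hg//.
exact: (integrable_fin_num mD (sqint_sq_integrable (sg n))).
Unshelve. all: by end_near. Qed.

End RieszFischer.

(** * Sums over the integers and integrals over rectangles *)

Definition symsum (V : nmodType) (a : int -> V) (N : nat) : V :=
  \sum_(i < N.*2.+1) a (Posz i - Posz N).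

Lemma symsum_recr (V : nmodType) (a : int -> V) N :
  symsum a N.+1 = a (- Posz N.+1) + symsum a N + a (Posz N.+1).
Proof.
rewrite /symsum doubleS big_ord_recr big_ord_recl /=; congr (_ + _ + _).
- by congr (a _); lia.
- by apply: eq_bigr => i _; congr (a _); rewrite /bump /=; lia.
- by congr (a _); lia.
Qed.

Lemma symsum_pick (V : nmodType) (a : int -> V) N k : (`|k| <= N)%N ->
  symsum (fun j => if j == k then a j else 0) N = a k.
Proof.
move=> kN; have lt : (absz (k + Posz N)%R < N.*2.+1)%N by lia.
rewrite /symsum (bigD1 (Ordinal lt)) //= big1 ?addr0.
  rewrite ifT; first by congr (a _); lia.
  by apply/eqP; lia.
move=> i /eqP ni; rewrite ifF//; apply/eqP => E; apply: ni.
by apply/val_inj => /=; lia.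
Qed.

Lemma symsum_out (V : nmodType) (a : int -> V) N k : (N < `|k|)%N ->
  symsum (fun j => if j == k then a j else 0) N = 0.
Proof.
move=> kN; rewrite /symsum big1// => i _; rewrite ifF//; apply/eqP => E.
by have := ltn_ord i; lia.
Qed.

Lemma symsum_homo (R : realType) (a : int -> \bar R) : (forall k, 0 <= a k)%E ->
  {homo symsum a : n m / (n <= m)%N >-> (n <= m)%E}.
Proof.
move=> a0; apply: homo_leq => [x|y x z xy yz|n]; first exact: lexx.
  exact: le_trans xy yz.
rewrite symsum_recr.
by rewrite -addeA addeCA leeDl// adde_ge0.
Qed.

Lemma esum_symsum (R : realType) (a : int -> \bar R) : (forall k, 0 <= a k)%E ->
  symsum a @ \oo --> (\esum_(k in [set: int]) a k)%E.
Proof.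
move=> a0; have := ereal_nondecreasing_cvgn (symsum_homo a0).
pose e N (i : nat) : int := Posz i - Posz N.
have ei N : injective (e N) by move=> i j; rewrite /e => E; lia.
have eN N : symsum a N = (\esum_(k in [set e N i | i in `I_N.*2.+1]) a k)%E.
  rewrite esum_image; last by move=> i j _ _; exact: ei.
  by rewrite esum_fset// /symsum (fsbig_ord _ _ (fun i => a (e N i))).
suff -> : ereal_sup (range (symsum a)) = (\esum_(k in [set: int]) a k)%E by [].
apply/eqP; rewrite eq_le; apply/andP; split.
  apply: ge_ereal_sup => _ [N _ <-]; rewrite eN [leLHS]esum_mkcond.
  by apply: le_esum => i _; case: ifP.
apply: ge_ereal_sup => _ [A [finA _] <-].
rewrite -esum_fset//.
pose N := (\max_(x <- finmap.enum_fset (fset_set A)) absz x)%N.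
apply: (@le_trans _ _ (symsum a N)); last by apply: ereal_sup_ubound; exists N.
rewrite eN [leLHS]esum_mkcond [leRHS]esum_mkcond; apply: le_esum => i _.
case: ifPn => [iA|_]; last by case: ifP.
rewrite ifT// inE /=.
have iN : (`|i| <= N)%N.
  by rewrite /N; apply: (@leq_bigmax_seq _ _ xpredT absz) => //; rewrite in_fset_set.
have lt : (absz (i + Posz N)%R < N.*2.+1)%N by lia.
by exists (absz (i + Posz N)%R) => //; rewrite /e /=; lia.
Qed.

Lemma ae_integrable d (T : measurableType d) (R : realType)
    (mu : {measure set T -> \bar R}) (D : set T) (f g : T -> \bar R) :
  measurable D -> measurable_fun D g -> ae_eq mu D f g ->
  mu.-integrable D f -> mu.-integrable D g.
Proof.
move=> mD mg fg /integrableP[mf foo]; apply/integrableP; split => //.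
rewrite (@ge0_ae_eq_integral _ _ _ mu D _ (fun x => `|f x|)%E)//.
- exact: measurableT_comp.
- exact: measurableT_comp.
- by apply: filterS fg => x /[apply] ->.
Qed.

Section Rectangles.
Context d1 d2 (T1 : measurableType d1) (T2 : measurableType d2) (R : realType).
Variables (m1 : {sigma_finite_measure set T1 -> \bar R})
          (m2 : {sigma_finite_measure set T2 -> \bar R}).
Variables (A : set T1) (B : set T2) (mA : measurable A) (mB : measurable B).

Lemma patch_rect (V : pointedType) (z : V) (f : T1 * T2 -> V) x y :
  patch (cst z) (A `*` B) f (x, y) =
  patch (cst z) A (fun x => patch (cst z) B (fun y => f (x, y)) y) x.
Proof.
rewrite /patch in_setX /=.
by case: (x \in A); case: (y \in B).
Qed.

Lemma measurable_section d3 (T3 : measurableType d3) (f : T1 * T2 -> T3) x :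
  A x -> measurable_fun (A `*` B) f -> measurable_fun B (fun y => f (x, y)).
Proof.
move=> Ax mf.
apply: (@measurable_comp _ _ _ _ _ _ (A `*` B) f _ (fun y => (x, y))) => //.
- exact: measurableX.
- by move=> _ [y By <-].
- by apply: (measurable_funS measurableT) => //; exact: pair1_measurable.
Qed.

Lemma tonelli_rect (f : T1 * T2 -> \bar R) : measurable_fun (A `*` B) f ->
  (forall z, (A `*` B) z -> 0 <= f z)%E ->
  measurable_fun A (fun x => \int[m2]_(y in B) f (x, y))%E /\
  (\int[m1 \x m2]_(z in A `*` B) f z = \int[m1]_(x in A) \int[m2]_(y in B) f (x, y))%E.
Proof.
move=> mf f0; have mAB := measurableX mA mB.
have mg : measurable_fun setT (f \_ (A `*` B)) by exact/(measurable_restrictT _ mAB).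
have g0 z : (0 <= (f \_ (A `*` B)) z)%E by rewrite erestrict_ge0.
have E x : fubini_F m2 (f \_ (A `*` B)) x = ((fun x => \int[m2]_(y in B) f (x, y))%E \_ A) x.
  rewrite /fubini_F; under eq_integral do rewrite patch_rect.
  rewrite /patch; case: ifPn => xA; last by rewrite integral0.
  by rewrite [RHS]integral_mkcond.
split.
  apply/(measurable_restrictT _ mA).
  by rewrite -(funext E); exact: measurable_fun_fubini_tonelli_F.
rewrite integral_mkcond (fubini_tonelli1 _ mg g0) [RHS]integral_mkcond.
by apply: eq_integral => x _; rewrite E.
Qed.

Lemma fubini_rect (f : T1 * T2 -> R) :
  (m1 \x m2)%E.-integrable (A `*` B) (EFin \o f) ->
  [/\ {ae m1, forall x, A x -> m2.-integrable B (EFin \o (fun y => f (x, y)))},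
      m1.-integrable A (EFin \o (fun x => \int[m2]_(y in B) f (x, y))) &
      \int[(m1 \x m2)%E]_(z in A `*` B) f z =
      \int[m1]_(x in A) \int[m2]_(y in B) f (x, y)].
Proof.
move=> intf; have mAB := measurableX mA mB.
have ig : (m1 \x m2)%E.-integrable setT ((EFin \o f) \_ (A `*` B)).
  exact/(integrable_mkcond _ mAB).
have E x : fubini_F m2 ((EFin \o f) \_ (A `*` B)) x =
    ((fun x => \int[m2]_(y in B) (f (x, y))%:E)%E \_ A) x.
  rewrite /fubini_F; under eq_integral do rewrite patch_rect.
  rewrite /patch; case: ifPn => xA; last by rewrite integral0.
  by rewrite [RHS]integral_mkcond.
have ae1 : {ae m1, forall x, A x -> m2.-integrable B (EFin \o (fun y => f (x, y)))}.
  apply: filterS (ae_integrable1 ig) => x + Ax.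
  under eq_fun do rewrite patch_rect.
  rewrite /patch (mem_set Ax) => h; apply/(integrable_mkcond _ mB).
  exact: h.
have iF : m1.-integrable A (fun x => \int[m2]_(y in B) (f (x, y))%:E)%E.
  apply/(integrable_mkcond _ mA).
  rewrite -(funext E).
  exact: integrable_fubini_F.
have ae2 : ae_eq m1 A (fun x => \int[m2]_(y in B) (f (x, y))%:E)%E
    (EFin \o (fun x => \int[m2]_(y in B) f (x, y))).
  apply: filterS ae1 => x /[apply] ix.
  by rewrite /= fineK// (integrable_fin_num mB ix).
have mF : measurable_fun A (EFin \o (fun x => \int[m2]_(y in B) f (x, y))).
  apply/measurable_EFinP; apply: measurableT_comp; first exact: fine_measurable.
  exact: measurable_int iF.
split => //.
  exact: (ae_integrable mA mF ae2 iF).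
rewrite {1}/Rintegral integral_mkcond -(integral12_prod_meas1 ig).
rewrite [in RHS]/Rintegral; congr fine.
have <- : (\int[m1]_(x in A) \int[m2]_(y in B) (f (x, y))%:E =
           \int[m1]_(x in A) (\int[m2]_(y in B) f (x, y))%:E)%E.
  by apply: ae_eq_integral => //; exact: measurable_int iF.
by rewrite [RHS]integral_mkcond; apply: eq_integral => x _; rewrite E.
Qed.

End Rectangles.

(** * Complex-valued integrals *)

Section ComplexParts.
Variable R : realType.
Implicit Types (z w : R[i]) (x y : R).

Lemma ReD z w : Re (z + w) = Re z + Re w.
Proof. by case: z; case: w. Qed.
Lemma ImD z w : Im (z + w) = Im z + Im w.
Proof. by case: z; case: w. Qed.
Lemma ReN z : Re (- z) = - Re z. Proof. by case: z. Qed.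
Lemma ImN z : Im (- z) = - Im z. Proof. by case: z. Qed.
Lemma ReM z w : Re (z * w) = Re z * Re w - Im z * Im w.
Proof. by case: z; case: w. Qed.
Lemma ImM z w : Im (z * w) = Re z * Im w + Im z * Re w.
Proof. by case: z; case: w. Qed.
Definition ReImE := (ReD, ImD, ReN, ImN, ReM, ImM).

Lemma complex_eq z w : Re z = Re w -> Im z = Im w -> z = w.
Proof. by case: z => a b; case: w => c d /= -> ->. Qed.

Lemma normc2 z : normc z ^+ 2 = Re z ^+ 2 + Im z ^+ 2.
Proof. by case: z => a b; rewrite /normc sqr_sqrtr// addr_ge0 ?sqr_ge0. Qed.

Lemma normc_ge0 z : 0 <= normc z.
Proof. by case: z => a b; exact: sqrtr_ge0. Qed.

Lemma normc_Re z : `|Re z| <= normc z.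
Proof.
rewrite -(@ler_pXn2r _ 2)// ?nnegrE ?normc_ge0// normc2.
by rewrite real_normK ?num_real// lerDl sqr_ge0.
Qed.

Lemma normc_Im z : `|Im z| <= normc z.
Proof.
rewrite -(@ler_pXn2r _ 2)// ?nnegrE ?normc_ge0// normc2.
by rewrite real_normK ?num_real// lerDr sqr_ge0.
Qed.

Lemma normc_le z : normc z <= `|Re z| + `|Im z|.
Proof.
rewrite -(@ler_pXn2r _ 2)// ?nnegrE ?normc_ge0 ?addr_ge0// normc2.
rewrite -[X in X + _](real_normK (num_real _)) -[X in _ + X <= _](real_normK (num_real _)).
by rewrite sqrrD -addrA lerD2l lerDr mulrn_wge0// mulr_ge0.
Qed.

Lemma normc_realM z x : normc (z * x%:C) = normc z * `|x|.
Proof.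
by rewrite ComplexField.Normc.normcM /= expr0n addr0 sqrtr_sqr.
Qed.

End ComplexParts.

Lemma eq_sqint d (T : measurableType d) (R : realType)
    (mu : {measure set T -> \bar R}) (D : set T) (f g : T -> R) :
  f =1 g -> sqint mu D f -> sqint mu D g.
Proof. by move=> /funext ->. Qed.

Section ComplexIntegral.
Context d (T : measurableType d) (R : realType) (mu : {measure set T -> \bar R}).
Variables (D : set T) (mD : measurable D).
Implicit Types (f g : T -> R[i]) (c : R[i]).

Definition cint f : R[i] :=
  (\int[mu]_(x in D) Re (f x)) +i* (\int[mu]_(x in D) Im (f x)).

Definition cmeas f := measurable_fun D (Re \o f) /\ measurable_fun D (Im \o f).

Definition cintegrable f := mu.-integrable D (EFin \o (Re \o f)) /\
  mu.-integrable D (EFin \o (Im \o f)).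

Definition csqint f := sqint mu D (Re \o f) /\ sqint mu D (Im \o f).

Definition csqn f : R := \int[mu]_(x in D) (normc (f x) ^+ 2).

Lemma eq_cint f g : {in D, f =1 g} -> cint f = cint g.
Proof.
by move=> fg; rewrite /cint; congr (_ +i* _); apply: eq_Rintegral => x /fg ->.
Qed.

Lemma eq_csqn f g : {in D, f =1 g} -> csqn f = csqn g.
Proof. by move=> fg; apply: eq_Rintegral => x /fg ->. Qed.

Lemma integrable_lin (a b : R) (u v : T -> R) :
  mu.-integrable D (EFin \o u) -> mu.-integrable D (EFin \o v) ->
  mu.-integrable D (EFin \o (fun x => a * u x + b * v x)).
Proof.
move=> iu iv.
have := integrableD mD (integrableZl mD a iu) (integrableZl mD b iv).
by apply: eq_integrable.
Qed.

Lemma Rintegral_lin (a b : R) (u v : T -> R) :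
  mu.-integrable D (EFin \o u) -> mu.-integrable D (EFin \o v) ->
  \int[mu]_(x in D) (a * u x + b * v x) =
  a * \int[mu]_(x in D) u x + b * \int[mu]_(x in D) v x.
Proof.
move=> iu iv; rewrite RintegralD// ?RintegralZl//.
- by have := integrableZl mD a iu; apply: eq_integrable.
- by have := integrableZl mD b iv; apply: eq_integrable.
Qed.

Lemma cmeasD f g : cmeas f -> cmeas g -> cmeas (fun x => f x + g x).
Proof.
move=> [f1 f2] [g1 g2]; split.
- rewrite (_ : _ \o _ = (fun x => Re (f x) + Re (g x))).
    exact: measurable_funD.
  by apply/funext => x; rewrite /= ReD.
- rewrite (_ : _ \o _ = (fun x => Im (f x) + Im (g x))).
    exact: measurable_funD.
  by apply/funext => x; rewrite /= ImD.
Qed.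

Lemma cmeasM f g : cmeas f -> cmeas g -> cmeas (fun x => f x * g x).
Proof.
move=> [f1 f2] [g1 g2]; split.
- rewrite (_ : _ \o _ = (fun x => Re (f x) * Re (g x) -
    Im (f x) * Im (g x))).
    by apply: measurable_funB; exact: measurable_funM.
  by apply/funext => x; rewrite /= ReM.
- rewrite (_ : _ \o _ = (fun x => Re (f x) * Im (g x) +
    Im (f x) * Re (g x))).
    by apply: measurable_funD; exact: measurable_funM.
  by apply/funext => x; rewrite /= ImM.
Qed.

Lemma cmeas_cst c : cmeas (fun=> c). Proof. by split; exact: measurable_cst. Qed.

Lemma cmeasR (u : T -> R) : measurable_fun D u -> cmeas (fun x => (u x)%:C).
Proof. by move=> mu'; split => //; exact: measurable_cst. Qed.

Lemma cmeasZ c f : cmeas f -> cmeas (fun x => c * f x).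
Proof. exact/cmeasM/cmeas_cst. Qed.

Lemma cmeasB f g : cmeas f -> cmeas g -> cmeas (fun x => f x - g x).
Proof.
move=> mf /(cmeasZ (-1)) mg; have := cmeasD mf mg.
by under eq_fun do rewrite mulN1r.
Qed.

Lemma cmeas_normc f : cmeas f -> measurable_fun D (fun x => normc (f x)).
Proof.
move=> [mf1 mf2].
rewrite (_ : (fun x => _) = (fun x => Num.sqrt (Re (f x) ^+ 2 + Im (f x) ^+ 2))).
  apply: measurableT_comp; first by apply: continuous_measurable_fun; exact: sqrt_continuous.
  by apply: measurable_funD; exact: measurable_funX.
by apply/funext => x; case: (f x).
Qed.

Lemma cintegrable_meas f : cintegrable f -> cmeas f.
Proof.
by move=> [/integrableP[+ _] /integrableP[+ _]] => /measurable_EFinP ? /measurable_EFinP ?.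
Qed.

Lemma cintegrable_lin c f g : cintegrable f -> cintegrable g ->
  cintegrable (fun x => c * f x + g x).
Proof.
move=> [f1 f2] [g1 g2]; split.
- have := integrable_lin 1 1 (integrable_lin (Re c) (- Im c) f1 f2) g1.
  by apply: eq_integrable => // x _; rewrite /= !ReImE; congr EFin; ring.
- have := integrable_lin 1 1 (integrable_lin (Re c) (Im c) f2 f1) g2.
  by apply: eq_integrable => // x _; rewrite /= !ReImE; congr EFin; ring.
Qed.

Lemma cint_lin c f g : cintegrable f -> cintegrable g ->
  cint (fun x => c * f x + g x) = c * cint f + cint g.
Proof.
move=> [f1 f2] [g1 g2]; apply: complex_eq; rewrite !ReImE /=.
- transitivity (\int[mu]_(x in D) (1 * (Re c * Re (f x) +
      (- Im c) * Im (f x)) + 1 * Re (g x))).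
    by apply: eq_Rintegral => x _; rewrite !ReImE; ring.
  by rewrite Rintegral_lin ?Rintegral_lin//; [ring|exact: integrable_lin].
- transitivity (\int[mu]_(x in D) (1 * (Re c * Im (f x) +
      (Im c) * Re (f x)) + 1 * Im (g x))).
    by apply: eq_Rintegral => x _; rewrite !ReImE; ring.
  by rewrite Rintegral_lin ?Rintegral_lin//; [ring|exact: integrable_lin].
Qed.

Lemma cintegrable0 : cintegrable (fun=> 0).
Proof. by split; apply: eq_integrable (integrable0 _ _) => //. Qed.

Lemma cint0 : cint (fun=> 0) = 0.
Proof. by rewrite /cint /= !Rintegral_cst// mul0r. Qed.

Lemma cintegrableZ c f : cintegrable f -> cintegrable (fun x => c * f x).
Proof.
move=> cf; have := cintegrable_lin c cf cintegrable0.
by under eq_fun do rewrite addr0.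
Qed.

Lemma cintZ c f : cintegrable f -> cint (fun x => c * f x) = c * cint f.
Proof.
move=> cf; have := cint_lin c cf cintegrable0.
by under eq_fun do rewrite addr0; rewrite cint0 addr0.
Qed.

Lemma cintegrableD f g : cintegrable f -> cintegrable g ->
  cintegrable (fun x => f x + g x).
Proof.
move=> cf cg; have := cintegrable_lin 1 cf cg.
by under eq_fun do rewrite mul1r.
Qed.

Lemma cintD f g : cintegrable f -> cintegrable g ->
  cint (fun x => f x + g x) = cint f + cint g.
Proof.
move=> cf cg; have := cint_lin 1 cf cg.
by under eq_fun do rewrite mul1r; rewrite mul1r.
Qed.

Lemma cintegrableB f g : cintegrable f -> cintegrable g ->
  cintegrable (fun x => f x - g x).
Proof.
move=> cf cg; have := cintegrable_lin (-1) cg cf.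
by under eq_fun do rewrite mulN1r addrC.
Qed.

Lemma cintB f g : cintegrable f -> cintegrable g ->
  cint (fun x => f x - g x) = cint f - cint g.
Proof.
move=> cf cg; have := cint_lin (-1) cg cf.
by under eq_fun do rewrite mulN1r addrC; rewrite mulN1r addrC.
Qed.

Lemma cintegrable_sum n (f : 'I_n -> T -> R[i]) : (forall i, cintegrable (f i)) ->
  cintegrable (fun x => \sum_i f i x).
Proof.
elim: n f => [|n ih] f mf.
  under eq_fun do rewrite big_ord0; exact: cintegrable0.
under eq_fun do rewrite big_ord_recr /=.
by apply: cintegrableD => //; apply: ih => i; exact: mf.
Qed.

Lemma cint_sum n (f : 'I_n -> T -> R[i]) : (forall i, cintegrable (f i)) ->
  cint (fun x => \sum_i f i x) = \sum_i cint (f i).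
Proof.
elim: n f => [|n ih] f mf.
  by under eq_fun do rewrite big_ord0; rewrite cint0 big_ord0.
under eq_fun do rewrite big_ord_recr /=.
rewrite cintD// ?ih ?big_ord_recr//.
by apply: cintegrable_sum => i; exact: mf.
Qed.

Lemma cintegrable_bounded (h f : T -> R[i]) (M : R) : cmeas h ->
  (forall x, D x -> normc (h x) <= M) -> cintegrable f ->
  cintegrable (fun x => f x * h x).
Proof.
move=> mh hM cf; have mf := cintegrable_meas cf; have [m1 m2] := cmeasM mf mh.
have ib : mu.-integrable D (EFin \o (fun x => M * `|Re (f x)| + M * `|Im (f x)|)).
  by apply: integrable_lin; apply: integrable_norm => //; case: cf.
have nb x : D x -> normc (f x * h x) <= M * `|Re (f x)| + M * `|Im (f x)|.
  move=> Dx; rewrite ComplexField.Normc.normcM -mulrDr mulrC.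
  rewrite (@le_trans _ _ (M * normc (f x)))// ?ler_wpM2r ?hM ?normc_ge0//.
  by rewrite ler_wpM2l ?normc_le// (le_trans _ (hM x Dx))// normc_ge0.
split.
- apply: integrable_of_bound ib _ => // x Dx.
  by apply: le_trans (nb x Dx); exact: normc_Re.
- apply: integrable_of_bound ib _ => // x Dx.
  by apply: le_trans (nb x Dx); exact: normc_Im.
Qed.

Lemma csqint_meas f : csqint f -> cmeas f.
Proof. by move=> [[? _] [? _]]. Qed.

Lemma csqint_lin c f g : csqint f -> csqint g -> csqint (fun x => c * f x + g x).
Proof.
move=> [f1 f2] [g1 g2]; split.
- have := sqintD mD (sqintD mD (sqintZ mD (Re c) f1) (sqintZ mD (- Im c) f2)) g1.
  by apply: eq_sqint => x; rewrite /= !ReImE; ring.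
- have := sqintD mD (sqintD mD (sqintZ mD (Re c) f2) (sqintZ mD (Im c) f1)) g2.
  by apply: eq_sqint => x; rewrite /= !ReImE; ring.
Qed.

Lemma csqint0 : csqint (fun=> 0). Proof. by split; exact: sqint0. Qed.

Lemma csqintD f g : csqint f -> csqint g -> csqint (fun x => f x + g x).
Proof.
by move=> cf cg; have := csqint_lin 1 cf cg; under eq_fun do rewrite mul1r.
Qed.

Lemma csqintZ c f : csqint f -> csqint (fun x => c * f x).
Proof.
by move=> cf; have := csqint_lin c cf csqint0; under eq_fun do rewrite addr0.
Qed.

Lemma csqintB f g : csqint f -> csqint g -> csqint (fun x => f x - g x).
Proof.
by move=> cf cg; have := csqint_lin (-1) cg cf; under eq_fun do rewrite mulN1r addrC.
Qed.

Lemma csqint_sum n (f : 'I_n -> T -> R[i]) : (forall i, csqint (f i)) ->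
  csqint (fun x => \sum_i f i x).
Proof.
elim: n f => [|n ih] f mf.
  under eq_fun do rewrite big_ord0; exact: csqint0.
under eq_fun do rewrite big_ord_recr /=.
by apply: csqintD => //; apply: ih => i; exact: mf.
Qed.

Lemma csqint_normcP f : csqint f <->
  cmeas f /\ (\int[mu]_(x in D) (normc (f x) ^+ 2)%:E < +oo)%E.
Proof.
split.
  move=> cf; split; first exact: csqint_meas.
  have [f1 f2] := cf.
  have := integrable_lin 1 1 (sqint_sq_integrable f1) (sqint_sq_integrable f2).
  move=> i1; apply: le_lt_trans (integrable_lty mD i1).
  by under eq_integral do rewrite normc2; under [leRHS]eq_integral do rewrite /= !mul1r.
move=> [mf foo]; have [m1 m2] := mf; have mn := cmeas_normc mf.
have sn : sqint mu D (fun x => normc (f x)) by split.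
split; apply: (sqint_le _ _ sn) => // x Dx.
- by rewrite [leRHS]ger0_norm ?normc_ge0// normc_Re.
- by rewrite [leRHS]ger0_norm ?normc_ge0// normc_Im.
Qed.

Lemma csqint_sqint f : csqint f -> sqint mu D (fun x => normc (f x)).
Proof. by move=> /csqint_normcP[mf foo]; split => //; exact: cmeas_normc. Qed.

Lemma csqnE f : csqint f ->
  (csqn f)%:E = (\int[mu]_(x in D) (normc (f x) ^+ 2)%:E)%E.
Proof.
move=> /csqint_sqint sf; rewrite /csqn /Rintegral fineK//.
exact: (integrable_fin_num mD (sqint_sq_integrable sf)).
Qed.

Lemma csqn_ReIm f : csqint f -> csqn f =
  \int[mu]_(x in D) (Re (f x) ^+ 2) + \int[mu]_(x in D) (Im (f x) ^+ 2).
Proof.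
move=> [f1 f2]; rewrite -RintegralD//; try exact: sqint_sq_integrable.
by apply: eq_Rintegral => x _; rewrite normc2.
Qed.

Lemma csqn_ge0 f : 0 <= csqn f.
Proof. by apply: Rintegral_ge0 => x _; exact: sqr_ge0. Qed.

Lemma csqint_bounded (h f : T -> R[i]) (M : R) : cmeas h ->
  (forall x, D x -> normc (h x) <= M) -> csqint f -> csqint (fun x => f x * h x).
Proof.
move=> mh hM cf; apply/csqint_normcP; split.
  by apply: cmeasM => //; exact: csqint_meas.
have sn := csqint_sqint cf.
have mh' := cmeas_normc mh.
have [_ +] : sqint mu D (fun x => normc (h x) * normc (f x)).
  apply: (sqint_bounded mD (M := M)) => // x Dx.
  by rewrite ger0_norm ?hM ?normc_ge0.
by under eq_integral do rewrite mulrC -ComplexField.Normc.normcM.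
Qed.

Lemma csqint_le (f : T -> R[i]) (g : T -> R) : cmeas f -> sqint mu D g ->
  (forall x, D x -> normc (f x) <= g x) -> csqint f.
Proof.
move=> mf sg fg; apply/csqint_normcP; split => //.
suff [] : sqint mu D (fun x => normc (f x)) by [].
apply: (sqint_le mD _ sg); first exact: cmeas_normc.
by move=> x Dx; rewrite ger0_norm ?normc_ge0// (le_trans (fg x Dx))// ler_norm.
Qed.

Hypothesis finD : (mu D < +oo)%E.

Lemma csqint_integrable f : csqint f -> cintegrable f.
Proof. by move=> [f1 f2]; split; exact: sqint_integrable. Qed.

Lemma csqint_bounded_fun (h : T -> R[i]) (M : R) : cmeas h ->
  (forall x, D x -> normc (h x) <= M) -> csqint h.
Proof.
move=> mh hM; apply: (csqint_le mh (sqint_cst mD finD M)) => x Dx.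
exact: hM.
Qed.

(* [riesz_fischer] applied to the real and imaginary parts doubles the error. *)
Lemma criesz_fischer (f : nat -> T -> R[i]) (eps : nat -> R) :
  (forall n, csqint (f n)) -> eps @ \oo --> (0 : R) ->
  (forall n m, (n <= m)%N -> csqn (fun x => f m x - f n x) <= eps n) ->
  exists2 g, csqint g & forall n, csqn (fun x => g x - f n x) <= 2 * eps n.
Proof.
move=> sf e0 H.
have sB n m : csqint (fun x => f m x - f n x) by exact: csqintB.
have [|n m nm|g1 sg1 H1] := riesz_fischer (f := fun n => Re \o f n) mD finD _ e0.
- by move=> n; case: (sf n).
- apply: le_trans (H n m nm); rewrite csqn_ReIm//.
  under eq_Rintegral do rewrite -ReN -ReD.
  by rewrite lerDl Rintegral_ge0// => x _; exact: sqr_ge0.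
have [|n m nm|g2 sg2 H2] := riesz_fischer (f := fun n => Im \o f n) mD finD _ e0.
- by move=> n; case: (sf n).
- apply: le_trans (H n m nm); rewrite csqn_ReIm//.
  under eq_Rintegral do rewrite -ImN -ImD.
  by rewrite lerDr Rintegral_ge0// => x _; exact: sqr_ge0.
exists (fun x => g1 x +i* g2 x); first by split.
move=> n; rewrite csqn_ReIm; last by apply: csqintB => //; split.
under eq_Rintegral do rewrite ReD ReN /=.
under [X in _ + X <= _]eq_Rintegral do rewrite ImD ImN /=.
by rewrite mulrDl !mul1r lerD ?H1 ?H2.
Qed.

End ComplexIntegral.

(** * Calculus on the line *)

Section Calculus.
Variable R : realType.
Local Notation mu := (@lebesgue_measure R).

Lemma derive_continuous (F f : R -> R) : (forall x : R, is_derive x (1 : R) F (f x)) -> continuous F.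
Proof.
move=> dF x; apply: differentiable_continuous; apply/derivable1_diffP.
by have := dF x; move=> [].
Qed.

Lemma ftc2 (F f : R -> R) a b : a <= b -> (forall x : R, is_derive x (1 : R) F (f x)) ->
  continuous f -> \int[mu]_(x in `[a, b]) f x = F b - F a.
Proof.
rewrite le_eqVlt => /orP[/eqP <-|ab] dF cf.
  by rewrite set_itv1 Rintegral_set1 subrr.
have cF := derive_continuous dF.
rewrite /Rintegral (@continuous_FTC2 _ f F)//.
- exact: continuous_subspaceT.
- split.
  + by move=> x _; have [] := dF x.
  + by apply: cvg_at_right_filter; exact: cF.
  + by apply: cvg_at_left_filter; exact: cF.
- by move=> x _; rewrite derive1E; have [] := dF x.
Qed.

Lemma continuous_integrable_itv (f : R -> R) a b : continuous f ->
  mu.-integrable `[a, b] (EFin \o f).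
Proof.
move=> cf; apply: continuous_compact_integrable; first exact: segment_compact.
exact: continuous_subspaceT.
Qed.

#[global] Instance ae_lebesgue_filter : Filter (nbhs (almost_everywhere mu)) :=
  ae_filter_ringOfSetsType mu.

(* Lebesgue differentiation: a vanishing primitive forces a vanishing density. *)
Lemma ae0_of_primitive0 (f : R -> R) a b : mu.-integrable `[a, b] (EFin \o f) ->
  (forall x, a < x < b -> \int[mu]_(t in `[a, x]) f t = 0) ->
  {ae mu, forall x, a <= x <= b -> f x = 0}.
Proof.
move=> intf F0.
pose g := f \_ `[a, b].
have intg : mu.-integrable setT (EFin \o g).
  rewrite -restrict_EFin; by apply/integrable_restrict => //=; rewrite setTI.
have intgy y : mu.-integrable `]-oo, y] (EFin \o g).
  by apply: integrableS intg.
pose F := fun x : R => \int[mu]_(t in [set` `]-oo, x]]) g t.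
have ae := FTC1Ny intgy (integrable_locally (measurable_itv _) intf).
have nN (c : R) : {ae mu, forall x, x <> c}.
  exists [set c]; split => //; first exact: lebesgue_measure_set1.
  by move=> x /= /contrapT.
near=> x => xab.
have xa : x <> a by near: x; exact: nN.
have xb : x <> b by near: x; exact: nN.
have axb : a < x < b.
  move: xab => /andP[ax xb'].
  by rewrite !lt_neqAle ax xb' !andbT; apply/andP; split; apply/eqP => // /esym.
have [_] : derivable F x 1 /\ derive1 F x = g x by near: x; exact: ae.
have -> : g x = f x by rewrite /g patchE mem_set//= in_itv.
move=> <-; have [ax bx] := andP axb.
rewrite derive1E (@near_eq_derive _ _ _ F (cst 0)) ?derive_cst//.
near=> y.
have ay : a < y by near: y; exact: lt_nbhsr.
have yb : y < b by near: y; exact: lt_nbhsl.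
rewrite /cst -(F0 y) ?ay//.
rewrite /F [LHS]Rintegral_mkcond [RHS]Rintegral_mkcond; apply: eq_Rintegral => t _.
rewrite /g /patch !mem_setE !in_itv /=.
have [ty|] := leP t y; last by rewrite andbF.
by rewrite (le_trans ty (ltW yb)) !andbT.
Unshelve. all: by end_near. Qed.

Lemma dominated_Rint d (T : measurableType d) (m : {measure set T -> \bar R})
    (D : set T) (mD : measurable D) (f_ : nat -> T -> R) (f g : T -> R) :
  (forall n, measurable_fun D (f_ n)) -> measurable_fun D f ->
  (forall x, D x -> (fun n => f_ n x) @ \oo --> f x) ->
  m.-integrable D (EFin \o g) ->
  (forall n x, D x -> `|f_ n x| <= g x) ->
  (fun n => \int[m]_(x in D) f_ n x) @ \oo --> \int[m]_(x in D) f x.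
Proof.
move=> mf_ mf cf ig bg.
have [|||||i1 _ i2] := @dominated_convergence _ T R m D mD (fun n => EFin \o f_ n) (EFin \o f) (EFin \o g).
- by move=> n; exact/measurable_EFinP.
- exact/measurable_EFinP.
- by apply: aeW => x Dx; apply: cvg_toEFin; exact: cf.
- exact: ig.
- by apply: aeW => x n Dx; rewrite lee_fin bg.
rewrite /Rintegral; apply: fine_cvg.
by rewrite fineK//; exact: (integrable_fin_num mD i1).
Qed.

End Calculus.

(** * Fourier series on the circle *)

Arguments fourier_coef : simpl never.
Arguments circ_int : simpl never.
Arguments normc : simpl never.
Arguments pi : simpl never.

Lemma sum_ord_recr (V : nmodType) n (F : 'I_n.+1 -> V) :
  \sum_i F i = \sum_(i < n) F (widen_ord (leqnSn n) i) + F ord_max.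
Proof. exact: big_ord_recr. Qed.

Section Circle.
Variable R : realType.
Local Notation mu := (@lebesgue_measure R).
Local Notation mR := (measurableTypeR R).
Local Notation circ := (@circ R : set mR).

Lemma Re_realM (x : R) (z : R[i]) : Re (x%:C * z) = x * Re z.
Proof. by case: z => a b /=; rewrite mul0r subr0. Qed.

Lemma Im_realM (x : R) (z : R[i]) : Im (x%:C * z) = x * Im z.
Proof. by case: z => a b /=; rewrite mul0r addr0. Qed.

Lemma pi2_gt0 : 0 < 2 * pi :> R.
Proof. by rewrite mulr_gt0// pi_gt0. Qed.

Lemma measurable_circ : measurable circ.
Proof. exact: measurable_itv. Qed.

Lemma mu_circ : mu circ = (2 * pi)%:E.
Proof.
by rewrite /circ lebesgue_measure_itv /= lte_fin pi2_gt0 oppr0 adde0.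
Qed.

Lemma circ_fin : (mu circ < +oo)%E.
Proof. by rewrite mu_circ ltry. Qed.

Lemma expiD (x y : R) : expi (x + y) = expi x * expi y.
Proof. by apply: complex_eq; rewrite ReImE /= ?cosD ?sinD; ring. Qed.

Lemma expi0 : expi (0 : R) = 1.
Proof. by rewrite /expi cos0 sin0. Qed.

Lemma normc_expi (x : R) : normc (expi x) = 1.
Proof. by rewrite /normc /expi cos2Dsin2 sqrtr1. Qed.

Lemma expi2pi : expi (2 * pi : R) = 1.
Proof.
have -> : 2 * pi = pi + pi :> R by ring.
rewrite /expi cosD sinD cospi sinpi; apply: complex_eq => /=; ring.
Qed.

Definition mode (k : int) (t : R) : R[i] := expi (k%:~R * t).

Lemma modeD j k t : mode (j + k) t = mode j t * mode k t.
Proof. by rewrite /mode intrD mulrDl expiD. Qed.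

Lemma mode0 t : mode 0 t = 1.
Proof. by rewrite /mode mul0r expi0. Qed.

Lemma normc_mode k t : normc (mode k t) = 1.
Proof. exact: normc_expi. Qed.

Lemma modeNK k t : mode k t * mode (- k) t = 1.
Proof. by rewrite -modeD subrr mode0. Qed.

Lemma mode_nat2pi (n : nat) : mode n (2 * pi) = 1.
Proof.
elim: n => [|n ih]; first exact: mode0.
by rewrite -addn1 PoszD modeD ih mul1r /mode mul1r expi2pi.
Qed.

Lemma mode2pi k : mode k (2 * pi) = 1.
Proof.
case: (intP k) => [|n|n]; first exact: mode0.
  exact: mode_nat2pi.
by have := modeNK n.+1 (2 * pi); rewrite mode_nat2pi mul1r.
Qed.

Lemma modeD2pi k t : mode k (t + 2 * pi) = mode k t.
Proof. by rewrite /mode mulrDr expiD -[expi (_ * (2 * _))]/(mode k _) mode2pi mulr1. Qed.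

Lemma is_derive_Re_mode k (t : R) : is_derive t (1 : R)
  (fun t => Re (mode k t)) (- k%:~R * Im (mode k t)).
Proof.
have h1 : is_derive t (1 : R) ( *%R (k%:~R : R)) (k%:~R : R).
  by apply: (is_derive_eq (is_deriveZ _ (is_derive_id t (1 : R)))); rewrite /GRing.scale /= mulr1.
have := @is_derive1_comp _ cos _ _ _ _ (is_derive_cos (k%:~R * t : R)) h1.
by move=> h; apply: (is_derive_eq h); rewrite /= !mulNr mulrC.
Qed.

Lemma is_derive_Im_mode k (t : R) : is_derive t (1 : R)
  (fun t => Im (mode k t)) (k%:~R * Re (mode k t)).
Proof.
have h1 : is_derive t (1 : R) ( *%R (k%:~R : R)) (k%:~R : R).
  by apply: (is_derive_eq (is_deriveZ _ (is_derive_id t (1 : R)))); rewrite /GRing.scale /= mulr1.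
have := @is_derive1_comp _ sin _ _ _ _ (is_derive_sin (k%:~R * t : R)) h1.
by move=> h; apply: (is_derive_eq h); rewrite /= mulrC.
Qed.

Lemma continuous_Re_mode k : continuous (fun t => Re (mode k t)).
Proof. exact: derive_continuous (is_derive_Re_mode k). Qed.

Lemma continuous_Im_mode k : continuous (fun t => Im (mode k t)).
Proof. exact: derive_continuous (is_derive_Im_mode k). Qed.

Lemma cmeas_mode k : cmeas circ (mode k).
Proof.
split; apply: measurable_funTS; apply: continuous_measurable_fun.
- exact: continuous_Re_mode.
- exact: continuous_Im_mode.
Qed.

Lemma csqint_mode k : csqint mu circ (mode k).
Proof.
apply: (csqint_bounded_fun measurable_circ circ_fin (M := 1) (cmeas_mode k)).
by move=> x _; rewrite normc_mode.
Qed.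

Lemma circ_intE f : circ_int f = cint mu circ f. Proof. by []. Qed.

Lemma circ_int_mode k : circ_int (mode k) = if k == 0 then (2 * pi)%:C else 0.
Proof.
case: eqVneq => [->|k0].
  rewrite (_ : mode 0 = fun=> 1); last by apply/funext => t; exact: mode0.
  rewrite circ_intE /cint !Rintegral_cst; try exact: measurable_circ.
  have -> : fine (mu circ) = 2 * pi by rewrite mu_circ.
  by rewrite /= mul1r mul0r.
have k1 : k%:~R != 0 :> R by rewrite intr_eq0.
have zR := ftc2 (ltW pi2_gt0) (is_derive_Re_mode k)
  (fun t => continuousM (@cst_continuous _ _ _ t) (@continuous_Im_mode k t)).
have zI := ftc2 (ltW pi2_gt0) (is_derive_Im_mode k)
  (fun t => continuousM (@cst_continuous _ _ _ t) (@continuous_Re_mode k t)).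
move: zR zI; rewrite mode2pi -[mode k 0]/(mode k 0) /mode mulr0 expi0 -/(mode _ _) /= !subrr.
rewrite !RintegralZl; try exact: measurable_itv; try exact: continuous_integrable_itv (@continuous_Im_mode k);
  try exact: continuous_integrable_itv (@continuous_Re_mode k).
move=> /eqP + /eqP; rewrite !mulf_eq0 oppr_eq0 (negbTE k1) /= => /eqP zI /eqP zR.
by rewrite /circ_int zI zR.
Qed.

Lemma fourier_coefE v k : fourier_coef v k =
  ((2 * pi)^-1)%:C * cint mu circ (fun t => v t * mode (- k) t).
Proof.
rewrite /fourier_coef; congr (_ * _).
by apply: eq_cint => t _; rewrite /mode mulrNz mulNr.
Qed.

Lemma cintegrable_modeM v k : cintegrable mu circ v ->
  cintegrable mu circ (fun t => v t * mode k t).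
Proof.
move=> iv; apply: (cintegrable_bounded measurable_circ (M := 1)) => //.
  exact: cmeas_mode.
by move=> x _; rewrite normc_mode.
Qed.

Lemma fourier_coef_lin c v w k : cintegrable mu circ v -> cintegrable mu circ w ->
  fourier_coef (fun t => c * v t + w t) k = c * fourier_coef v k + fourier_coef w k.
Proof.
move=> iv iw; rewrite !fourier_coefE.
under eq_cint do rewrite mulrDl -mulrA.
rewrite cint_lin//; try exact: measurable_circ; try exact: cintegrable_modeM.
by rewrite mulrDr mulrCA.
Qed.

Lemma fourier_coef_mode j k : fourier_coef (mode j) k = if j == k then 1 else 0.
Proof.
rewrite fourier_coefE; under eq_cint do rewrite -modeD.
rewrite -[cint _ _ _]/(circ_int _) circ_int_mode subr_eq0.
case: ifP => _; last by rewrite mulr0.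
by rewrite -rmorphM /= mulVf// gt_eqF// pi2_gt0.
Qed.

Lemma integrable_csqint_circ v : csqint mu circ v -> cintegrable mu circ v.
Proof. exact: csqint_integrable measurable_circ circ_fin _. Qed.

Lemma csqint_modeM v k : csqint mu circ v -> csqint mu circ (fun t => v t * mode k t).
Proof.
move=> iv; apply: (csqint_bounded measurable_circ (M := 1)) => //.
  exact: cmeas_mode.
by move=> x _; rewrite normc_mode.
Qed.

Lemma csqn_sub_mode v c k : csqint mu circ v ->
  csqn mu circ (fun t => v t - c * mode k t) =
  csqn mu circ v + (2 * pi) * (normc (fourier_coef v k - c) ^+ 2 - normc (fourier_coef v k) ^+ 2).
Proof.
move=> sv; pose r t := v t * mode (- k) t.
have sr : csqint mu circ r by exact: csqint_modeM.
have ir := integrable_csqint_circ sr; have [ir1 ir2] := ir.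
have E1 : csqn mu circ v = csqn mu circ r.
  by apply: eq_Rintegral => t _; rewrite /r ComplexField.Normc.normcM normc_mode mulr1.
have E2 : csqn mu circ (fun t => v t - c * mode k t) = csqn mu circ (fun t => r t - c).
  apply: eq_Rintegral => t _; congr (_ ^+ 2).
  rewrite -[LHS]mulr1 -[1](normc_mode (- k) t).
  by rewrite -ComplexField.Normc.normcM mulrBl -mulrA modeNK mulr1.
have E3 : cint mu circ r = (2 * pi)%:C * fourier_coef v k.
  by rewrite fourier_coefE mulrA -rmorphM /= mulfV ?mul1r// gt_eqF// pi2_gt0.
have sn := sqint_sq_integrable (csqint_sqint measurable_circ sr).
rewrite E1 E2; transitivity (\int[mu]_(t in circ) (1 * (1 * normc (r t) ^+ 2 +
   (- 2) * (Re c * Re (r t) + Im c * Im (r t))) + normc c ^+ 2 * 1)).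
  by apply: eq_Rintegral => t _; rewrite !normc2 !ReImE; ring.
have i1 := integrable_lin measurable_circ (Re c) (Im c) ir1 ir2.
have i2 := integrable_lin measurable_circ 1 (- 2) sn i1.
rewrite Rintegral_lin//; try exact: measurable_circ; last first.
  exact: (integrable_cst_fin measurable_circ circ_fin 1).
rewrite Rintegral_lin//; try exact: measurable_circ.
rewrite Rintegral_lin//; try exact: measurable_circ.
rewrite Rintegral_cst; last exact: measurable_circ.
have -> : fine (mu circ) = 2 * pi by rewrite mu_circ.
have ER : \int[mu]_(t in circ) Re (r t) = 2 * pi * Re (fourier_coef v k).
  by rewrite -[LHS]/(Re (cint mu circ r)) E3 Re_realM.
have EI : \int[mu]_(t in circ) Im (r t) = 2 * pi * Im (fourier_coef v k).
  by rewrite -[LHS]/(Im (cint mu circ r)) E3 Im_realM.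
move: ER EI; move: (fourier_coef v k) => F ER EI.
rewrite /= ER EI /csqn !normc2 !ReImE.
by set X := \int[mu]_(x in circ) (normc (r x) ^+ 2); ring.
Qed.

Lemma csqint_trig n (c : 'I_n -> R[i]) (f : 'I_n -> int) :
  csqint mu circ (fun t => \sum_i c i * mode (f i) t).
Proof.
apply: csqint_sum; first exact: measurable_circ.
by move=> i; apply: csqintZ; [exact: measurable_circ|exact: csqint_mode].
Qed.

Lemma fourier_coef_trig n (c : 'I_n -> R[i]) (f : 'I_n -> int) k :
  fourier_coef (fun t => \sum_i c i * mode (f i) t) k =
  \sum_i (if f i == k then c i else 0).
Proof.
elim: n c f => [|n ih] c f.
  under eq_fun do rewrite big_ord0.
  rewrite big_ord0 fourier_coefE; under eq_cint do rewrite mul0r.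
  by rewrite (cint0 mu measurable_circ) mulr0.
under eq_fun do rewrite big_ord_recr /= addrC.
rewrite fourier_coef_lin; first last.
- exact/integrable_csqint_circ/csqint_trig.
- exact/integrable_csqint_circ/csqint_mode.
by rewrite ih fourier_coef_mode big_ord_recr /= addrC; case: ifP; rewrite ?mulr1 ?mulr0.
Qed.

(** The orthogonality relations, as an exact formula for the distance of a
    square integrable function to a trigonometric polynomial. *)
Lemma csqn_sub_trig v n (c : 'I_n -> R[i]) (f : 'I_n -> int) :
  injective f -> csqint mu circ v ->
  csqn mu circ (fun t => v t - \sum_i c i * mode (f i) t) =
  csqn mu circ v + (2 * pi) * \sum_i (normc (fourier_coef v (f i) - c i) ^+ 2 -
                                      normc (fourier_coef v (f i)) ^+ 2).
Proof.
move=> fi sv; elim: n c f fi => [|n ih] c f fi.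
  rewrite big_ord0 mulr0 addr0; apply: eq_csqn => t _.
  by rewrite big_ord0 subr0.
pose c' := fun i : 'I_n => c (widen_ord (leqnSn n) i).
pose f' := fun i : 'I_n => f (widen_ord (leqnSn n) i).
have fi' : injective f' by move=> i j /fi [] /val_inj.
pose w t := v t - \sum_i c' i * mode (f' i) t.
have sw : csqint mu circ w.
  by apply: csqintB; [exact: measurable_circ| |exact: csqint_trig].
transitivity (csqn mu circ (fun t => w t - c ord_max * mode (f ord_max) t)).
  by apply: eq_csqn => t _; rewrite big_ord_recr /= opprD addrA.
have E : fourier_coef w (f ord_max) = fourier_coef v (f ord_max).
  have iv := integrable_csqint_circ sv.
  have it := integrable_csqint_circ (csqint_trig c' f').
  have := fourier_coef_lin (-1) (f ord_max) it iv.
  rewrite /w; under eq_fun do rewrite mulN1r addrC.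
  move=> ->; rewrite fourier_coef_trig big1 ?mulr0 ?add0r// => i _.
  case: eqP => // /fi /(congr1 val) /= F.
  by have := ltn_ord i; rewrite F ltnn.
by rewrite csqn_sub_mode// ih// E [X in _ = _ + _ * X]sum_ord_recr -[LHS]addrA -mulrDr.
Qed.

Definition trigsum (c : int -> R[i]) (N : nat) (t : R) : R[i] :=
  symsum (fun k => c k * mode k t) N.

Lemma csqint_trigsum c N : csqint mu circ (trigsum c N).
Proof. exact: csqint_trig. Qed.

Lemma sym_inj N : injective (fun i : 'I_N.*2.+1 => Posz i - Posz N).
Proof. by move=> i j /= /addIr [] /val_inj. Qed.

Lemma fourier_coef_trigsum c N k :
  fourier_coef (trigsum c N) k = if (`|k| <= N)%N then c k else 0.
Proof.
rewrite /trigsum /symsum fourier_coef_trig.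
rewrite -[LHS](_ : symsum (fun j => if j == k then c j else 0) N = _)//.
by case: leqP => kN; [exact: symsum_pick|exact: symsum_out].
Qed.

Lemma csqn_sub_trigsum v c N : csqint mu circ v ->
  csqn mu circ (fun t => v t - trigsum c N t) =
  csqn mu circ v + (2 * pi) *
   symsum (fun k => normc (fourier_coef v k - c k) ^+ 2 - normc (fourier_coef v k) ^+ 2) N.
Proof. by move=> sv; exact: (csqn_sub_trig _ (@sym_inj N) sv). Qed.

End Circle.

(** * Uniqueness of Fourier coefficients *)

Section StepApproximation.
Variable R : realType.

Lemma bernoulli_le (y : R) n : 0 <= y -> 1 + n%:R * y <= (1 + y) ^+ n.
Proof.
move=> y0; elim: n => [|n ih]; first by rewrite mul0r addr0 expr0.
rewrite exprS (le_trans _ (ler_wpM2l _ ih)) ?addr_ge0//.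
rewrite mulrDl mul1r mulrDr mulr1 -natr1 mulrDl mul1r.
have : 0 <= y * (n%:R * y) by rewrite !mulr_ge0.
by set a := n%:R * y; lra.
Qed.

Lemma bernoulli_sub (y : R) n : 0 <= y <= 1 -> 1 - n%:R * y <= (1 - y) ^+ n.
Proof.
move=> /andP[y0 y1]; elim: n => [|n ih]; first by rewrite mul0r subr0 expr0.
rewrite exprS (le_trans _ (ler_wpM2l _ ih)) ?subr_ge0//.
rewrite mulrBl mul1r mulrBr mulr1 -natr1 mulrDl mul1r.
have : 0 <= y * (n%:R * y) by rewrite !mulr_ge0.
by set a := n%:R * y; lra.
Qed.

Lemma cvg_nat_geometric (q : R) : 0 <= q < 1 -> (fun n => n%:R * q ^+ n) @ \oo --> (0 : R).
Proof.
move=> /andP[q0 q1].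
pose r := Num.sqrt ((1 + q) / 2).
have r2 : r ^+ 2 = (1 + q) / 2 by rewrite sqr_sqrtr//; lra.
have r0 : 0 < r by rewrite sqrtr_gt0; lra.
have r1 : r < 1 by rewrite -(@ltr_pXn2r _ 2)// ?nnegrE ?ltW// r2 expr1n; lra.
pose h := r^-1 - 1.
have h0 : 0 < h by rewrite subr_gt0 invf_gt1.
have key n : n%:R * r ^+ n <= h^-1.
  rewrite -ler_pdivlMr ?exprn_gt0// -exprVn.
  have -> : r^-1 = 1 + h by rewrite /h addrC subrK.
  rewrite mulrC ler_pdivlMr//.
  by apply: le_trans (bernoulli_le n (ltW h0)); rewrite lerDr.
have le n : `|n%:R * q ^+ n| <= h^-1 * r ^+ n.
  rewrite ger0_norm ?mulr_ge0 ?exprn_ge0//.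
  apply: (@le_trans _ _ (n%:R * r ^+ n * r ^+ n)).
    rewrite -mulrA ler_wpM2l// -exprMn lerXn2r ?nnegrE ?mulr_ge0 ?(ltW r0)//.
    by rewrite -expr2 r2; lra.
  by rewrite ler_wpM2r ?exprn_ge0 ?(ltW r0).
apply: norm_cvg0; apply: (@squeeze_cvgr _ _ _ _ (cst 0) (fun n => h^-1 * r ^+ n)).
- by apply: nearW => n; rewrite normr_ge0 le.
- exact: cvg_cst.
- rewrite -[X in _ --> X](mulr0 h^-1); apply: cvgM; first exact: cvg_cst.
  by apply: cvg_expr; rewrite ger0_norm// ltW.
Qed.

(** Polynomials in [s] converging boundedly on [0, 1] to the indicator of
    [s < 1/2]; Bernoulli's inequality gives both halves. *)
Definition steppoly (n : nat) (s : R) : R := (1 - s ^+ n) ^+ (n * 2 ^ n).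

Lemma steppoly_itv n s : 0 <= s <= 1 -> 0 <= steppoly n s <= 1.
Proof.
move=> /andP[s0 s1]; have e0 : 0 <= s ^+ n by rewrite exprn_ge0.
have e1 : s ^+ n <= 1 by rewrite exprn_ile1.
by rewrite exprn_ge0 ?subr_ge0//= exprn_ile1 ?subr_ge0// gerBl.
Qed.

Lemma cvg_steppoly s : 0 <= s <= 1 ->
  (fun n => steppoly n s) @ \oo --> (if s < 2^-1 then 1 else 0 : R).
Proof.
move=> s01; have /andP[s0 s1] := s01; have [sh|sh] := ltP s 2^-1.
  have c : (fun n => n%:R * (2 * s) ^+ n) @ \oo --> (0 : R).
    by apply: cvg_nat_geometric; lra.
  apply: (@squeeze_cvgr _ _ _ _ (fun n => 1 - n%:R * (2 * s) ^+ n) (cst 1)).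
  - apply: nearW => n; have /andP[_ ->] := steppoly_itv n s01; rewrite andbT.
    have e0 : 0 <= s ^+ n by rewrite exprn_ge0.
    have e1 : s ^+ n <= 1 by rewrite exprn_ile1.
    apply: le_trans (bernoulli_sub (n * 2 ^ n) _); last by rewrite e0 e1.
    by rewrite natrM natrX exprMn mulrA.
  - by rewrite -[X in _ --> X]subr0; apply: cvgB => //; exact: cvg_cst.
  - exact: cvg_cst.
have hc : (fun n => n.+1%:R^-1 : R) @ \oo --> (0 : R) by exact: cvg_harmonic.
apply: (@squeeze_cvgr _ _ _ _ (cst 0) (fun n => n.+1%:R^-1)) => //; last exact: cvg_cst.
apply: nearW => n; have /andP[-> _] := steppoly_itv n s01; rewrite /=.
set y := s ^+ n; set N := (n * 2 ^ n)%N.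
have e0 : 0 <= y by rewrite exprn_ge0.
have e1 : y <= 1 by rewrite exprn_ile1.
have Ny : n%:R <= N%:R * y.
  rewrite /N natrM natrX -mulrA -exprMn ler_peMr// exprn_ege1//; lra.
have p : 0 < 1 + N%:R * y by rewrite ltr_wpDr// mulr_ge0.
apply: (@le_trans _ _ (1 + N%:R * y)^-1); last first.
  by rewrite lef_pV2 ?posrE// -natr1 addrC lerD2l.
rewrite -[leRHS]mul1r ler_pdivlMr//.
apply: (@le_trans _ _ ((1 - y) ^+ N * (1 + y) ^+ N)).
  by rewrite ler_wpM2l ?bernoulli_le// exprn_ge0// subr_ge0.
rewrite -exprMn exprn_ile1//; nra.
Qed.

End StepApproximation.

Section Uniqueness.
Variable R : realType.
Local Notation mu := (@lebesgue_measure R).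
Local Notation mR := (measurableTypeR R).
Local Notation circ := (@circ R : set mR).
Variable v : mR -> R[i].
Hypotheses (iv : cintegrable mu circ v) (v0 : forall k, fourier_coef v k = 0).

(* The bounded real weights that keep [v] orthogonal to all modes. *)
Definition annihilates (h : R -> R) : Prop :=
  [/\ measurable_fun circ h, exists M, forall t, circ t -> `|h t| <= M &
      forall k, cint mu circ (fun t => v t * ((h t)%:C * mode k t)) = 0].

Lemma annihilates_integrable h k : annihilates h ->
  cintegrable mu circ (fun t => v t * ((h t)%:C * mode k t)).
Proof.
move=> [mh [M hM] _]; apply: (cintegrable_bounded (M := M) (@measurable_circ R)) => //.
  by apply: cmeasM; [exact: cmeasR|exact: cmeas_mode].
move=> t Dt; rewrite ComplexField.Normc.normcM normc_mode mulr1.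
by rewrite -[(h t)%:C]mul1r normc_realM -[1](mode0 0) normc_mode mul1r hM.
Qed.

Lemma annihilates_one : annihilates (fun=> 1).
Proof.
split; [exact: measurable_cst | by exists 1 => t _; rewrite normr1 | move=> k].
have := v0 (- k); rewrite fourier_coefE opprK => /eqP.
rewrite mulf_eq0 => /orP[/eqP/(congr1 Re) /=|/eqP E].
  by move=> /eqP; rewrite invr_eq0 (gt_eqF (pi2_gt0 R)).
by rewrite -[RHS]E; apply: eq_cint => t _; rewrite mul1r.
Qed.

Lemma annihilates_lin (a b : R) h g : annihilates h -> annihilates g ->
  annihilates (fun t => a * h t + b * g t).
Proof.
move=> Ah Ag; have [mh [M hM] h0] := Ah; have [mg [N gN] g0] := Ag; split.
- by apply: measurable_funD; apply: measurable_funM.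
- exists (`|a| * M + `|b| * N) => t Dt.
  rewrite (le_trans (ler_normD _ _))// !normrM lerD// ler_wpM2l//; [exact: hM|exact: gN].
- move=> k.
  have ih := annihilates_integrable k Ah; have ig := annihilates_integrable k Ag.
  transitivity (a%:C * cint mu circ (fun t => v t * ((h t)%:C * mode k t)) +
    b%:C * cint mu circ (fun t => v t * ((g t)%:C * mode k t))); last first.
    by rewrite h0 g0 !mulr0 addr0.
  rewrite -(cintZ (@measurable_circ R) b%:C ig) -cint_lin//; try exact: measurable_circ.
    apply: eq_cint => t _; rewrite rmorphD /= !rmorphM /=; ring.
  by apply: cintegrableZ => //; exact: measurable_circ.
Qed.

Lemma annihilates_cos h : annihilates h -> annihilates (fun t => h t * cos t).
Proof.
move=> Ah; have [mh [M hM] h0] := Ah; split.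
- apply: measurable_funM => //; apply: measurable_funTS.
  by apply: continuous_measurable_fun; exact: continuous_cos.
- exists M => t Dt; rewrite normrM (le_trans _ (hM t Dt))// ler_piMr//.
  by rewrite ler_norml cos_le1 cos_geN1.
- move=> k.
  have i1 := annihilates_integrable (k + 1) Ah; have i2 := annihilates_integrable (k - 1) Ah.
  transitivity (2^-1 * cint mu circ (fun t => v t * ((h t)%:C * mode (k + 1) t)) +
    2^-1 * cint mu circ (fun t => v t * ((h t)%:C * mode (k - 1) t))); last first.
    by rewrite !h0 !mulr0 addr0.
  rewrite -(cintZ (@measurable_circ R) _ i2) -cint_lin//; try exact: measurable_circ.
    apply: eq_cint => t _; rewrite !modeD rmorphM /=.
    have -> : (cos t)%:C = 2^-1 * (mode 1 t + mode (- 1) t) :> R[i].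
      apply: (@mulfI _ 2); first by rewrite pnatr_eq0.
      rewrite mulrA mulfV ?pnatr_eq0// mul1r /mode mul1r mulN1r /expi cosN sinN.
      by apply: complex_eq; rewrite /=; ring.
    ring.
  by apply: cintegrableZ => //; exact: measurable_circ.
Qed.

Lemma annihilates_sin h : annihilates h -> annihilates (fun t => h t * sin t).
Proof.
move=> Ah; have [mh [M hM] h0] := Ah; split.
- apply: measurable_funM => //; apply: measurable_funTS.
  by apply: continuous_measurable_fun; exact: continuous_sin.
- exists M => t Dt; rewrite normrM (le_trans _ (hM t Dt))// ler_piMr//.
  by rewrite ler_norml sin_le1 sin_geN1.
- move=> k; pose j : R[i] := (0 +i* (- 2^-1)).
  have i1 := annihilates_integrable (k + 1) Ah; have i2 := annihilates_integrable (k - 1) Ah.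
  transitivity (j * cint mu circ (fun t => v t * ((h t)%:C * mode (k + 1) t)) +
    (- j) * cint mu circ (fun t => v t * ((h t)%:C * mode (k - 1) t))); last first.
    by rewrite !h0 !mulr0 addr0.
  rewrite -(cintZ (@measurable_circ R) _ i2) -cint_lin//; try exact: measurable_circ.
    apply: eq_cint => t _; rewrite !modeD rmorphM /=.
    have -> : (sin t)%:C = j * (mode 1 t - mode (- 1) t) :> R[i].
      rewrite /mode mul1r mulN1r /expi cosN sinN /j.
      by apply: complex_eq; rewrite /=; field.
    ring.
  by apply: cintegrableZ => //; exact: measurable_circ.
Qed.

(* [arc x t < 1/2] holds for [0 < t < x] and fails elsewhere on the circle. *)
Definition arc (x t : R) : R := 2^-1 - (cos (t - x / 2) - cos (x / 2)) / 4.

Lemma annihilates_arc x h : annihilates h -> annihilates (fun t => h t * arc x t).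
Proof.
move=> Ah; have A1 := annihilates_lin (- cos (x / 2) / 4) (- sin (x / 2) / 4)
  (annihilates_cos Ah) (annihilates_sin Ah).
have := annihilates_lin 1 (2^-1 + cos (x / 2) / 4) A1 Ah.
congr annihilates; apply/funext => t; by rewrite /arc cosB; field.
Qed.

Lemma annihilates_arcX x n h : annihilates h -> annihilates (fun t => h t * arc x t ^+ n).
Proof.
move=> Ah; elim: n => [|n ih].
  by under eq_fun do rewrite expr0 mulr1.
by under eq_fun do rewrite exprSr mulrA; exact: annihilates_arc.
Qed.

Lemma annihilates_steppoly x n : annihilates (fun t => steppoly n (arc x t)).
Proof.
rewrite /steppoly; elim: (n * 2 ^ n)%N => [|j ih].
  by under eq_fun do rewrite expr0; exact: annihilates_one.
have := annihilates_lin 1 (-1) ih (annihilates_arcX x n ih).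
by congr annihilates; apply/funext => t; rewrite exprSr; ring.
Qed.

Lemma arc_itv x t : 0 <= arc x t <= 1.
Proof.
have := cos_le1 (t - x / 2); have := cos_geN1 (t - x / 2).
have := cos_le1 (x / 2); have := cos_geN1 (x / 2).
rewrite /arc; set a := cos _; set b := cos _; move=> *; apply/andP; split; lra.
Qed.

Lemma arcE x t : arc x t = 2^-1 - sin (t / 2) * sin ((x - t) / 2) / 2.
Proof.
rewrite /arc; have -> : t - x / 2 = t / 2 - (x - t) / 2 by field.
have -> : cos (x / 2) = cos (t / 2 + (x - t) / 2) by congr cos; field.
by rewrite cosB cosD; field.
Qed.

Lemma arc_lt x t : 0 < x < 2 * pi -> 0 <= t <= 2 * pi ->
  (arc x t < 2^-1) = (0 < t < x).
Proof.
move=> /andP[x0 x2] /andP[t0 t2].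
have -> : (arc x t < 2^-1) = (0 < sin (t / 2) * sin ((x - t) / 2)).
  by rewrite arcE; set s := sin _ * _; apply/idP/idP => ?; lra.
have [->|tn0] := eqVneq t 0; first by rewrite mul0r sin0 mul0r !ltxx.
have tp : 0 < t by rewrite lt_def tn0.
have [->|tn2] := eqVneq t (2 * pi).
  rewrite [2 * pi]mulrC -mulrA mulfV// mulr1 sinpi mul0r ltxx.
  by rewrite [pi * 2]mulrC (lt_gtF x2) andbF.
have tlt : t < 2 * pi by rewrite lt_neqAle tn2.
rewrite tp /= pmulr_rgt0; last by apply: sin_gt0_pi; lra.
have [xt|tx|->] := ltgtP t x.
- by apply: sin_gt0_pi; lra.
- apply/negbTE; rewrite -leNgt -oppr_ge0 -sinN ltW//; apply: sin_gt0_pi; lra.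
- by rewrite subrr mul0r sin0 ltxx.
Qed.

Lemma annihilated_primitive x : 0 < x < 2 * pi -> cint mu (`[0, x] : set mR) v = 0.
Proof.
move=> x02; have /andP[x0 x2] := x02.
have mc := @measurable_circ R; have [iv1 iv2] := iv.
have mS n : measurable_fun circ (fun t => steppoly n (arc x t)).
  by have [] := annihilates_steppoly x n.
have sub : (`]0, x[ : set mR) `<=` circ.
  move=> t /=; rewrite in_itv /= => /andP[t0 tx]; rewrite /Defs.circ /= in_itv /=.
  by rewrite ltW//= ltW// (lt_trans tx).
have part (f : mR -> R) : mu.-integrable circ (EFin \o f) ->
    (forall n, \int[mu]_(t in circ) (f t * steppoly n (arc x t)) = 0) ->
    \int[mu]_(t in (`[0, x] : set mR)) f t = 0.
  move=> fi f0; have mf : measurable_fun circ f by case/integrableP: fi => /measurable_EFinP.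
  have := @dominated_Rint R _ mR mu circ mc
    (fun n t => f t * steppoly n (arc x t)) (fun t => f t * \1_(`]0, x[ : set mR) t) (fun t => `|f t|).
  have H1 n : measurable_fun circ (fun t => f t * steppoly n (arc x t)).
    exact: measurable_funM.
  have H2 : measurable_fun circ (fun t => f t * \1_(`]0, x[ : set mR) t).
    by apply: measurable_funM => //; apply: measurable_indic; exact: measurable_itv.
  have H3 t : circ t -> (fun n => f t * steppoly n (arc x t)) @ \oo --> f t * \1_(`]0, x[ : set mR) t.
    rewrite /Defs.circ /= in_itv /= => t02; apply: cvgM; first exact: cvg_cst.
    rewrite indicE mem_setE in_itv /= -(arc_lt x02 t02).
    have := cvg_steppoly (arc_itv x t); by case: (arc x t < 2^-1).
  have H4 : mu.-integrable circ (EFin \o (fun t => `|f t|)) by exact: integrable_norm.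
  have H5 n t : circ t -> `|f t * steppoly n (arc x t)| <= `|f t|.
    move=> _; rewrite normrM ler_piMr//.
    by have /andP[s0 s1] := steppoly_itv n (arc_itv x t); rewrite ger0_norm.
  move=> /(_ H1 H2 H3 H4 H5).
  under eq_fun do rewrite f0.
  move=> /(cvg_unique (@Rhausdorff R) (@cvg_cst _ 0 nat \oo _)) E.
  have ii : mu.-integrable (`[0, x] : set mR) (EFin \o f).
    apply: (integrableS _ _ _ fi); [exact: mc|exact: measurable_itv|].
    move=> t /=; rewrite /Defs.circ /= !in_itv /= => /andP[-> tx] /=.
    exact: le_trans tx (ltW x2).
  rewrite -Rintegral_itv_obnd_cbnd; last first.
    by apply: integrableS ii; [exact: measurable_itv|exact: measurable_itv|exact: subset_itv_oc_cc].
  rewrite -Rintegral_itv_bndo_bndc; last first.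
    by apply: integrableS ii; [exact: measurable_itv|exact: measurable_itv|exact: subset_itv_oo_cc].
  transitivity (\int[mu]_(t in circ) (f t * \1_(`]0, x[ : set mR) t)); last first.
    by rewrite -E.
  rewrite [LHS]Rintegral_mkcond [RHS]Rintegral_mkcond; apply: eq_Rintegral => t _.
  rewrite /patch indicE; case: ifPn => [tx|_].
    by rewrite ifT ?mulr1//; apply/mem_set/sub/set_mem.
  by case: ifP => _ //; rewrite mulr0.
apply: complex_eq; rewrite [RHS]/=; apply: part => // n.
- have [_ _ /(_ 0) /(congr1 Re) E] := annihilates_steppoly x n.
  rewrite -[RHS]E; apply: eq_Rintegral => t _.
  by rewrite mode0 mulr1 [v t * _]mulrC Re_realM mulrC.
- have [_ _ /(_ 0) /(congr1 (Im)) E] := annihilates_steppoly x n.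
  rewrite -[RHS]E; apply: eq_Rintegral => t _.
  by rewrite mode0 mulr1 [v t * _]mulrC Im_realM mulrC.
Qed.

(** An integrable function on the circle is determined by its Fourier
    coefficients: [v] is orthogonal to every trigonometric polynomial, hence, by
    dominated convergence along [steppoly n \o arc x], to the indicators of
    arcs, so its primitive vanishes. *)
Theorem fourier_coef_inj0 : {ae mu, forall t : mR, 0 <= t <= 2 * pi -> v t = 0}.
Proof.
have [iv1 iv2] := iv.
have P x : 0 < x < 2 * pi -> cint mu (`[0, x] : set mR) v = 0 by exact: annihilated_primitive.
have h1 := @ae0_of_primitive0 R (fun t => Re (v t)) 0 (2 * pi) iv1
  (fun x hx => congr1 Re (P x hx)).
have h2 := @ae0_of_primitive0 R (fun t => Im (v t)) 0 (2 * pi) iv2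
  (fun x hx => congr1 (Im) (P x hx)).
apply: filterS2 h1 h2 => t h1 h2 t02.
by apply: complex_eq; [exact: h1|exact: h2].
Qed.

End Uniqueness.

Section Parseval.
Variable R : realType.
Local Notation mu := (@lebesgue_measure R).
Local Notation mR := (measurableTypeR R).
Local Notation circ := (@circ R : set mR).
Implicit Types (v : mR -> R[i]) (c : int -> R[i]).

Lemma csqn_ae v w : csqint mu circ v -> csqint mu circ w ->
  {ae mu, forall t : mR, circ t -> v t = w t} -> csqn mu circ v = csqn mu circ w.
Proof.
move=> sv sw vw; apply: EFin_inj; rewrite !csqnE//; try exact: measurable_circ.
apply: ge0_ae_eq_integral => //.
- exact: measurable_circ.
- apply/measurable_EFinP/measurable_funX/cmeas_normc; exact: (csqint_meas sv).
- apply/measurable_EFinP/measurable_funX/cmeas_normc; exact: (csqint_meas sw).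
- by move=> x _; rewrite lee_fin sqr_ge0.
- by move=> x _; rewrite lee_fin sqr_ge0.
- by apply: filterS vw => t /[apply] ->.
Qed.

Lemma cintegrable_coef_section v k : csqint mu circ v ->
  (2 * pi) * normc (fourier_coef v k) ^+ 2 <= csqn mu circ v.
Proof.
move=> sv; have := csqn_ge0 mu circ (fun t => v t - fourier_coef v k * mode k t).
rewrite csqn_sub_mode// subrr normc0 expr0n sub0r mulrN => h.
by rewrite -subr_ge0.
Qed.

Lemma bessel v N : csqint mu circ v ->
  csqn mu circ (fun t => v t - trigsum (fourier_coef v) N t) =
  csqn mu circ v - (2 * pi) * symsum (fun k => normc (fourier_coef v k) ^+ 2) N.
Proof.
move=> sv; rewrite csqn_sub_trigsum// -mulrN; congr (_ + _ * _).
rewrite /symsum -sumrN; apply: eq_bigr => i _.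
by rewrite subrr normc0 expr0n sub0r.
Qed.

Lemma symsum_nd (a : int -> R) : (forall k, 0 <= a k) -> nondecreasing_seq (symsum a).
Proof.
move=> a0; apply/nondecreasing_seqP => n; rewrite symsum_recr.
by rewrite -addrA addrCA lerDl addr_ge0.
Qed.

Lemma symsum_lim (a : int -> R) B : (forall k, 0 <= a k) -> (forall N, symsum a N <= B) ->
  exists l : R, [/\ symsum a @ \oo --> l, forall N, symsum a N <= l & l <= B].
Proof.
move=> a0 aB; have nd := symsum_nd a0.
have ub : has_ubound (range (symsum a)) by exists B => _ [N _ <-].
have cv := nondecreasing_is_cvgn nd ub; exists (limn (symsum a)); split => //.
- by move=> N; exact: nondecreasing_cvgn_le.
- by apply: limr_le => //; apply: nearW.
Qed.

Lemma trigsumB c N M t : (N <= M)%N ->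
  trigsum c M t - trigsum c N t =
  trigsum (fun k => if (`|k| <= N)%N then 0 else c k) M t.
Proof.
move=> NM; elim: M NM => [|M ih].
  rewrite leqn0 => /eqP ->.
  rewrite subrr /trigsum /symsum big1// => i _.
  by rewrite ifT ?mul0r//; have := ltn_ord i; lia.
rewrite leq_eqVlt => /orP[/eqP <-|NM].
  rewrite subrr /trigsum /symsum big1// => i _.
  by rewrite ifT ?mul0r//; have := ltn_ord i; lia.
have := ih NM; rewrite /trigsum !symsum_recr => <-.
by rewrite ifF 1?ifF; [ring|lia|lia].
Qed.

Lemma csqn_trigsum c N : csqn mu circ (trigsum c N) =
  (2 * pi) * symsum (fun k => normc (c k) ^+ 2) N.
Proof.
have := bessel N (csqint_trigsum c N).
rewrite [LHS](_ : _ = 0); last first.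
  rewrite /csqn; under eq_Rintegral => t _.
    rewrite (_ : trigsum (fourier_coef (trigsum c N)) N t = trigsum c N t); last first.
      rewrite /trigsum /symsum; apply: eq_bigr => i _.
      by rewrite fourier_coef_trigsum ifT//; have := ltn_ord i; lia.
    rewrite subrr normc0 expr0n; over.
  by rewrite Rintegral_cst ?mul0r//; exact: measurable_circ.
move=> /esym/eqP; rewrite subr_eq0 => /eqP ->; congr (_ * _).
rewrite /symsum; apply: eq_bigr => i _.
by rewrite fourier_coef_trigsum ifT//; have := ltn_ord i; lia.
Qed.

Lemma symsum_tail (a : int -> R) N M : (N <= M)%N ->
  symsum (fun k => if (`|k| <= N)%N then 0 else a k) M = symsum a M - symsum a N.
Proof.
move=> NM; elim: M NM => [|M ih].
  rewrite leqn0 => /eqP ->.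
  rewrite subrr /symsum big1// => i _.
  by rewrite ifT//; have := ltn_ord i; lia.
rewrite leq_eqVlt => /orP[/eqP <-|NM].
  rewrite subrr /symsum big1// => i _.
  by rewrite ifT//; have := ltn_ord i; lia.
have := ih NM; rewrite !symsum_recr => ->.
by rewrite ifF 1?ifF; [ring|lia|lia].
Qed.

Lemma eq_symsum (V : nmodType) (a b : int -> V) N : a =1 b -> symsum a N = symsum b N.
Proof. by move=> /funext ->. Qed.

Lemma normc2_if (b : bool) (z : R[i]) :
  normc (if b then 0 else z) ^+ 2 = if b then 0 else normc z ^+ 2.
Proof. by case: b => //; rewrite normc0 expr0n. Qed.

Lemma normc_eq0_lim (z : R[i]) (e : nat -> R) n0 : e @ \oo --> (0 : R) ->
  (forall n, (n0 <= n)%N -> normc z ^+ 2 <= e n) -> z = 0.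
Proof.
move=> e0 ze; apply: ComplexField.Normc.eq0_normc.
suff : normc z ^+ 2 <= 0.
  by move=> h; apply/eqP; rewrite -sqrf_eq0 eq_le h sqr_ge0.
rewrite -(cvg_lim (@Rhausdorff R) e0); apply: limr_ge; first by apply/cvg_ex; exists 0.
by exists n0.
Qed.

Lemma circ_from_coefs c B : (forall N, symsum (fun k => normc (c k) ^+ 2) N <= B) ->
  exists g, [/\ csqint mu circ g, forall k, fourier_coef g k = c k &
    (fun N => csqn mu circ (fun t => g t - trigsum c N t)) @ \oo --> (0 : R)].
Proof.
move=> cB; have mc := @measurable_circ R; have fc := @circ_fin R.
have [l [al lN _]] := symsum_lim (fun k => sqr_ge0 (normc (c k))) cB.
pose e N := (2 * pi) * (l - symsum (fun k => normc (c k) ^+ 2) N).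
have e0 : e @ \oo --> (0 : R).
  rewrite -[X in _ --> X](_ : 2 * pi * (l - l) = 0); last by rewrite subrr mulr0.
  by apply: cvgM; [exact: cvg_cst|apply: cvgB => //; exact: cvg_cst].
have [N M NM|g sg gN] := criesz_fischer mc fc (fun N => csqint_trigsum c N) e0.
  have -> : csqn mu circ (fun t => trigsum c M t - trigsum c N t) =
     csqn mu circ (trigsum (fun k => if (`|k| <= N)%N then 0 else c k) M).
    by apply: eq_csqn => t _; exact: trigsumB.
  rewrite csqn_trigsum /e ler_wpM2l ?(ltW (pi2_gt0 R))//.
  by rewrite (eq_symsum _ (fun k => normc2_if _ _)) symsum_tail// lerD2r.
exists g; split => // [k|]; last first.
  apply: (@squeeze_cvgr _ _ _ _ (cst 0) (fun N => 2 * e N)).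
  - by apply: nearW => N; rewrite csqn_ge0 gN.
  - exact: cvg_cst.
  - rewrite -[X in _ --> X](_ : 2 * 0 = 0 :> R); last by rewrite mulr0.
    by apply: cvgM => //; exact: cvg_cst.
apply/eqP; rewrite -subr_eq0; apply/eqP.
apply: (@normc_eq0_lim _ (fun N => (2 * pi)^-1 * (2 * e N)) `|k|%N).
  rewrite -[X in _ --> X](_ : (2 * pi)^-1 * (2 * 0) = 0 :> R); last by rewrite !mulr0.
  by do 2 (apply: cvgM; first exact: cvg_cst).
move=> N kN; rewrite ler_pdivlMl ?pi2_gt0// (le_trans _ (gN N))//.
have sB : csqint mu circ (fun t => g t - trigsum c N t).
  by apply: csqintB => //; exact: csqint_trigsum.
have := cintegrable_coef_section k sB; congr (_ * normc _ ^+ 2 <= _).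
have := fourier_coef_lin (-1) k (integrable_csqint_circ (csqint_trigsum c N)) (integrable_csqint_circ sg).
under eq_fun do rewrite mulN1r addrC.
by move=> ->; rewrite fourier_coef_trigsum kN mulN1r addrC.
Qed.

Lemma fourier_cvg v : csqint mu circ v ->
  (fun N => csqn mu circ (fun t => v t - trigsum (fourier_coef v) N t)) @ \oo --> (0 : R).
Proof.
move=> sv; have mc := @measurable_circ R.
pose c := fourier_coef v.
have cB N : symsum (fun k => normc (c k) ^+ 2) N <= (2 * pi)^-1 * csqn mu circ v.
  rewrite ler_pdivlMl ?pi2_gt0// -subr_ge0 -bessel//; exact: csqn_ge0.
have [g [sg gc g0]] := circ_from_coefs cB.
have iB : cintegrable mu circ (fun t => v t - g t).
  by apply: integrable_csqint_circ; exact: csqintB.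
have ae0 := fourier_coef_inj0 iB.
have {}ae0 : {ae mu, forall t : mR, circ t -> v t = g t}.
  have /ae0 : forall k, fourier_coef (fun t => v t - g t) k = 0.
    move=> k; have := fourier_coef_lin (-1) k (integrable_csqint_circ sg) (integrable_csqint_circ sv).
    under eq_fun do rewrite mulN1r addrC.
    by move=> ->; rewrite gc mulN1r addrC subrr.
  by apply: filterS => t h ct; apply/eqP; rewrite -subr_eq0 h.
suff -> : (fun N => csqn mu circ (fun t => v t - trigsum (fourier_coef v) N t)) =
  (fun N => csqn mu circ (fun t => g t - trigsum c N t)) by [].
apply/funext => N; apply: csqn_ae.
- by apply: csqintB => //; exact: csqint_trigsum.
- by apply: csqintB => //; exact: csqint_trigsum.
- by apply: filterS ae0 => t /[apply] ->.
Qed.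

Lemma parseval_circ v : csqint mu circ v ->
  (fun N => (2 * pi) * symsum (fun k => normc (fourier_coef v k) ^+ 2) N) @ \oo --> csqn mu circ v.
Proof.
move=> sv; have h := fourier_cvg sv.
rewrite -[X in _ --> X]subr0.
have -> : (fun N => 2 * pi * symsum (fun k => normc (fourier_coef v k) ^+ 2) N) =
  (fun N => csqn mu circ v - csqn mu circ (fun t => v t - trigsum (fourier_coef v) N t)).
  by apply/funext => N; rewrite bessel// opprB addrC subrK.
by apply: cvgB => //; exact: cvg_cst.
Qed.

Lemma symsumE (a : int -> R) N : (symsum a N)%:E = symsum (fun k => (a k)%:E) N.
Proof. by rewrite /symsum sumEFin. Qed.

Lemma parseval_circ_esum v : csqint mu circ v ->
  (csqn mu circ v)%:E =
  ((2 * pi)%:E * \esum_(k in [set: int]) (normc (fourier_coef v k) ^+ 2)%:E)%E.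
Proof.
move=> sv; have h1 := cvg_toEFin (parseval_circ sv).
have h2 : (fun N => (2 * pi * symsum (fun k => normc (fourier_coef v k) ^+ 2) N)%:E) @ \oo -->
  ((2 * pi)%:E * \esum_(k in [set: int]) (normc (fourier_coef v k) ^+ 2)%:E)%E.
  under eq_fun do rewrite EFinM symsumE.
  apply: cvgeZl => //; apply: esum_symsum => k; by rewrite lee_fin sqr_ge0.
exact: (cvg_unique (@ereal_hausdorff R) h1 h2).
Qed.

End Parseval.

(** * Fourier modes of functions on a cylinder *)

Lemma symsum_le_esum (R : realType) (a : int -> \bar R) N : (forall k, 0 <= a k)%E ->
  (symsum a N <= \esum_(k in [set: int]) a k)%E.
Proof.
move=> a0; rewrite -(cvg_lim (@ereal_hausdorff R) (esum_symsum a0)).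
apply: lime_ge; first by apply: ereal_nondecreasing_is_cvgn; exact: symsum_homo.
by exists N => // M /= NM; exact: symsum_homo.
Qed.

Section Cylinder.
Variable R : realType.
Local Notation mu := (@lebesgue_measure R).
Local Notation mR := (measurableTypeR R).
Local Notation mu2 := (mu \x mu)%E.
Local Notation circ := (@circ R : set mR).
Variables (A : set mR) (mA : measurable A).
Local Notation D := (A `*` circ).
Implicit Types (u v : mR * mR -> R[i]) (k : int) (x : mR).

Definition coef u k x : R[i] := fourier_coef (fun t => u (x, t)) k.

Lemma measurable_cyl : measurable D.
Proof. by apply: measurableX => //; exact: measurable_circ. Qed.

Lemma ae_forall_int (P : int -> mR -> Prop) :
  (forall k, {ae mu, forall x, P k x}) -> {ae mu, forall x, forall k, P k x}.
Proof.
move=> h; have h1 := ae_foralln (fun n => h (Posz n)).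
have h2 := ae_foralln (fun n => h (Negz n)).
by apply: filterS2 h1 h2 => x p n [k|k]; [exact: p|exact: n].
Qed.

Lemma cmeas_section u x : A x -> cmeas D u -> cmeas circ (fun t => u (x, t)).
Proof.
by move=> Ax [m1 m2]; split; [exact: (measurable_section mA (@measurable_circ R) Ax m1)|exact: (measurable_section mA (@measurable_circ R) Ax m2)].
Qed.

Lemma cmeas_fst (c : mR -> R[i]) : cmeas A c -> cmeas D (fun z => c z.1).
Proof.
have mf : measurable_fun D (fst : mR * mR -> mR) by apply: measurable_funTS; exact: measurable_fst.
move=> [m1 m2]; split.
- apply: (@measurable_comp _ _ _ _ _ _ A (Re \o c) _ fst) => //.
  by move=> _ [[a b] [/= Aa _] <-].
- apply: (@measurable_comp _ _ _ _ _ _ A (Im \o c) _ fst) => //.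
  by move=> _ [[a b] [/= Aa _] <-].
Qed.

Lemma cmeas_snd (c : mR -> R[i]) : cmeas circ c -> cmeas D (fun z => c z.2).
Proof.
have mf : measurable_fun D (snd : mR * mR -> mR) by apply: measurable_funTS; exact: measurable_snd.
have mc := @measurable_circ R.
move=> [m1 m2]; split.
- apply: (@measurable_comp _ _ _ _ _ _ circ (Re \o c) _ snd) => //.
  by move=> _ [[a b] [/= _ Bb] <-].
- apply: (@measurable_comp _ _ _ _ _ _ circ (Im \o c) _ snd) => //.
  by move=> _ [[a b] [/= _ Bb] <-].
Qed.

Lemma tonelli_csq u : cmeas D u ->
  measurable_fun A (fun x => \int[mu]_(t in circ) (normc (u (x, t)) ^+ 2)%:E)%E /\
  (\int[mu2]_(z in D) (normc (u z) ^+ 2)%:E =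
   \int[mu]_(x in A) \int[mu]_(t in circ) (normc (u (x, t)) ^+ 2)%:E)%E.
Proof.
move=> mu'; apply: (@tonelli_rect _ _ mR mR R mu mu A circ mA (@measurable_circ R)
  (fun z => (normc (u z) ^+ 2)%:E)).
  by apply/measurable_EFinP; apply: measurable_funX; exact: cmeas_normc.
by move=> z _; rewrite lee_fin sqr_ge0.
Qed.

Lemma csqint_section u : csqint mu2 D u ->
  {ae mu, forall x, A x -> csqint mu circ (fun t => u (x, t))}.
Proof.
move=> /(csqint_normcP mu2 measurable_cyl _)[mu' foo].
have [mF E] := tonelli_csq mu'.
have iF : mu.-integrable A (fun x => \int[mu]_(t in circ) (normc (u (x, t)) ^+ 2)%:E)%E.
  apply/integrableP; split => //.
  under eq_integral => x _.
    rewrite gee0_abs; last by apply: integral_ge0 => t _; rewrite lee_fin sqr_ge0.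
    over.
  by rewrite -E.
apply: filterS (integrable_ae mA iF) => x /[swap] Ax /(_ Ax) fin.
apply/(csqint_normcP mu (@measurable_circ R) _); split; first exact: cmeas_section.
by rewrite ltey_eq fin.
Qed.

Lemma cfubini u : cintegrable mu2 D u ->
  [/\ {ae mu, forall x, A x -> cintegrable mu circ (fun t => u (x, t))},
      cintegrable mu A (fun x => cint mu circ (fun t => u (x, t))) &
      cint mu2 D u = cint mu A (fun x => cint mu circ (fun t => u (x, t)))].
Proof.
move=> [i1 i2]; have mc := @measurable_circ R.
have [a1 b1 c1] := @fubini_rect _ _ mR mR R mu mu A circ mA mc (fun z => Re (u z)) i1.
have [a2 b2 c2] := @fubini_rect _ _ mR mR R mu mu A circ mA mc (fun z => Im (u z)) i2.
split; first by apply: filterS2 a1 a2 => x h1 h2 Ax; split; [exact: h1|exact: h2].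
  by split.
by apply: complex_eq; [exact: c1|exact: c2].
Qed.

Lemma cmeas_mode2 k : cmeas D (fun z => mode k z.2).
Proof. by apply: cmeas_snd; exact: cmeas_mode. Qed.

Lemma cintegrable_mode2 u k : cintegrable mu2 D u -> cintegrable mu2 D (fun z => u z * mode k z.2).
Proof.
move=> iu; apply: (cintegrable_bounded measurable_cyl (M := 1)) => //; first exact: cmeas_mode2.
by move=> z _; rewrite normc_mode.
Qed.

Lemma coefE u k x : coef u k x =
  ((2 * pi)^-1)%:C * cint mu circ (fun t => u (x, t) * mode (- k) t).
Proof. exact: fourier_coefE. Qed.

Lemma cintegrable_coef u k : cintegrable mu2 D u -> cintegrable mu A (coef u k).
Proof.
move=> iu; have [_ h _] := cfubini (cintegrable_mode2 (- k) iu).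
rewrite (_ : coef u k = fun x => ((2 * pi)^-1)%:C * cint mu circ (fun t => u (x, t) * mode (- k) t)).
  exact: cintegrableZ.
by apply/funext => x; rewrite coefE.
Qed.

Lemma coef_lin u v (c : R[i]) k : cintegrable mu2 D u -> cintegrable mu2 D v ->
  {ae mu, forall x, A x -> coef (fun z => c * u z + v z) k x = c * coef u k x + coef v k x}.
Proof.
move=> iu iv; have [a1 _ _] := cfubini iu; have [a2 _ _] := cfubini iv.
apply: filterS2 a1 a2 => x h1 h2 Ax.
by rewrite /coef fourier_coef_lin//; [exact: h1|exact: h2].
Qed.

Lemma coefB u v k : cintegrable mu2 D u -> cintegrable mu2 D v ->
  {ae mu, forall x, A x -> coef (fun z => u z - v z) k x = coef u k x - coef v k x}.
Proof.
move=> iu iv; have := coef_lin (-1) k iv iu.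
rewrite (_ : (fun z => -1 * v z + u z) = (fun z => u z - v z)); last first.
  by apply/funext => z; rewrite mulN1r addrC.
by apply: filterS => x h Ax; rewrite h// mulN1r addrC.
Qed.

(** A null set on the cylinder can be checked section by section. *)
Lemma ae_cyl (u : mR * mR -> R[i]) : cmeas D u ->
  {ae mu, forall x, A x -> {ae mu, forall t : mR, circ t -> u (x, t) = 0}} ->
  {ae mu2, forall z, D z -> u z = 0}.
Proof.
move=> mu' h; have mc := @measurable_circ R; have mD := measurable_cyl.
have [mF E] := tonelli_csq mu'.
have mn : measurable_fun D (fun z => (normc (u z) ^+ 2)%:E).
  by apply/measurable_EFinP; apply: measurable_funX; exact: cmeas_normc.
have I0 : (\int[mu2]_(z in D) (normc (u z) ^+ 2)%:E = 0)%E.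
  rewrite E; rewrite (@ge0_ae_eq_integral _ _ _ mu A _ (cst 0%E))//.
  - exact: integral0.
  - by move=> x Ax; apply: integral_ge0 => t _; rewrite lee_fin sqr_ge0.
  - apply: filterS h => x hx Ax /=; have {}hx := hx Ax.
    rewrite (@ge0_ae_eq_integral _ _ _ mu circ _ (cst 0%E))//; first exact: integral0.
    + have /cmeas_normc ? := cmeas_section Ax mu'; apply/measurable_EFinP; exact: measurable_funX.
    + by move=> t _; rewrite lee_fin sqr_ge0.
    + by apply: filterS hx => t /[apply] ->; rewrite normc0 expr0n.
have /(ae_eq_integral_abs mu2 mD mn) : (\int[mu2]_(z in D) `|(normc (u z) ^+ 2)%:E| = 0)%E.
  by rewrite -[RHS]I0; apply: eq_integral => z _; rewrite gee0_abs// lee_fin sqr_ge0.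
apply: filterS => z /[apply] /= [[]] /eqP; rewrite sqrf_eq0 => /eqP.
exact: ComplexField.Normc.eq0_normc.
Qed.

Lemma coef_inj0 u : cintegrable mu2 D u ->
  (forall k, {ae mu, forall x, A x -> coef u k x = 0}) ->
  {ae mu2, forall z, D z -> u z = 0}.
Proof.
move=> iu h; apply: ae_cyl; first exact: (cintegrable_meas iu).
have [a1 _ _] := cfubini iu.
apply: filterS2 a1 (ae_forall_int h) => x ix hx Ax.
have := @fourier_coef_inj0 R _ (ix Ax) (fun k => hx k Ax).
by apply: filterS => t + ct; apply; move: ct; rewrite /Defs.circ /= in_itv.
Qed.

Lemma coef_inj u v : cintegrable mu2 D u -> cintegrable mu2 D v ->
  (forall k, {ae mu, forall x, A x -> coef u k x = coef v k x}) ->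
  {ae mu2, forall z, D z -> u z = v z}.
Proof.
move=> iu iv h.
have := @coef_inj0 (fun z => u z - v z) (cintegrableB measurable_cyl iu iv).
move=> /(_ _)/filterS; apply.
  by move=> z hz Dz; apply/eqP; rewrite -subr_eq0 hz.
move=> k; apply: filterS2 (coefB k iu iv) (h k) => x h1 h2 Ax.
by rewrite h1// h2// subrr.
Qed.

Hypothesis fA : (mu A < +oo)%E.

Lemma cyl_fin : (mu2 D < +oo)%E.
Proof.
rewrite product_measure1E//; last exact: measurable_circ.
rewrite [X in (_ * X)%E](mu_circ R) lte_mul_pinfty//.
  by rewrite ge0_fin_numE.
exact: ltry.
Qed.

Lemma csqint_cyl_int u : csqint mu2 D u -> cintegrable mu2 D u.
Proof. by apply: csqint_integrable; [exact: measurable_cyl|exact: cyl_fin]. Qed.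

Lemma parseval_cyl u : csqint mu2 D u ->
  (\int[mu2]_(z in D) (normc (u z) ^+ 2)%:E =
   (2 * pi)%:E * \esum_(k in [set: int]) \int[mu]_(x in A) (normc (coef u k x) ^+ 2)%:E)%E.
Proof.
move=> su; have mu' := csqint_meas su; have [mF E] := tonelli_csq mu'.
have mck k : measurable_fun A (fun x => (normc (coef u k x) ^+ 2)%:E).
  apply/measurable_EFinP/measurable_funX; apply: cmeas_normc.
  exact: (cintegrable_meas (cintegrable_coef k (csqint_cyl_int su))).
pose g N x := ((2 * pi)%:E * symsum (fun k => (normc (coef u k x) ^+ 2)%:E) N)%E.
have p2 : (0 <= (2 * pi)%:E :> \bar R)%E by rewrite lee_fin (ltW (pi2_gt0 R)).
have ge0 k x : (0 <= (normc (coef u k x) ^+ 2)%:E)%E by rewrite lee_fin sqr_ge0.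
have msum N : measurable_fun A (fun x => symsum (fun k => (normc (coef u k x) ^+ 2)%:E) N).
  by rewrite /symsum; apply: emeasurable_sum => i; exact: mck.
have mg N : measurable_fun A (g N) by exact: measurable_funeM.
have g0 N x : (0 <= g N x)%E by rewrite mule_ge0//; apply: sume_ge0.
have ndg x : A x -> {homo g^~ x : n m / (n <= m)%N >-> (n <= m)%E}.
  by move=> _ n m nm; rewrite lee_wpmul2l// symsum_homo.
have gcvg x : csqint mu circ (fun t => u (x, t)) ->
    g ^~ x @ \oo --> (\int[mu]_(t in circ) (normc (u (x, t)) ^+ 2)%:E)%E.
  move=> sx; rewrite -(csqnE (@measurable_circ R) sx) parseval_circ_esum//.
  by apply: cvgeZl => //; apply: esum_symsum.
rewrite E.
rewrite (@ge0_ae_eq_integral _ _ _ mu A _ (fun x => limn (g ^~ x)))//; first last.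
- apply: filterS (csqint_section su) => x h Ax.
  by apply/esym/cvg_lim; [exact: ereal_hausdorff|exact/gcvg/h].
- move=> x Ax; apply: lime_ge; last by apply: nearW.
  exact: ereal_nondecreasing_is_cvgn (ndg x Ax).
- by move=> x Ax; apply: integral_ge0 => t _; rewrite lee_fin sqr_ge0.
- apply: (emeasurable_fun_cvg g (fun x => limn (g ^~ x)) mg) => x Ax.
  exact: ereal_nondecreasing_is_cvgn (ndg x Ax).
rewrite monotone_convergence//.
have -> : (fun n => \int[mu]_(x in A) g n x)%E =
   (fun n => (2 * pi)%:E * symsum (fun k => \int[mu]_(x in A) (normc (coef u k x) ^+ 2)%:E)%E n)%E.
  apply/funext => N; rewrite /g ge0_integralZl//.
  - by congr (_ * _)%E; rewrite /symsum ge0_integral_sum.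
  - by move=> x _; apply: sume_ge0.
apply/cvg_lim; first exact: ereal_hausdorff.
apply: cvgeZl => //; apply: esum_symsum => k.
by apply: integral_ge0.
Qed.

Lemma csqint_mode_coef (c : mR -> R[i]) k : csqint mu A c ->
  csqint mu2 D (fun z => c z.1 * mode k z.2).
Proof.
move=> /(csqint_normcP mu mA _)[mc foo]; have mw : cmeas D (fun z => c z.1 * mode k z.2).
  by apply: cmeasM; [exact: cmeas_fst|exact: cmeas_mode2].
apply/(csqint_normcP mu2 measurable_cyl _); split => //.
have [_ ->] := tonelli_csq mw; rewrite /=.
under eq_integral => x _.
  under eq_integral => t _ do rewrite ComplexField.Normc.normcM normc_mode mulr1.
  rewrite integral_cst; last exact: measurable_circ.
  rewrite [X in (_ * X)%E](mu_circ R).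
  over.
rewrite ge0_integralZr//.
- have p0 : (0 <= \int[mu]_(x in A) (normc (c x) ^+ 2)%:E)%E.
    by apply: integral_ge0 => x _; rewrite lee_fin sqr_ge0.
  by rewrite lte_mul_pinfty ?ltry// ge0_fin_numE.
- by apply/measurable_EFinP/measurable_funX; exact: cmeas_normc.
- by move=> x _; rewrite lee_fin sqr_ge0.
- by rewrite lee_fin (ltW (pi2_gt0 R)).
Qed.

Definition trig2 (c : int -> mR -> R[i]) N (z : mR * mR) : R[i] :=
  trigsum (fun k => c k z.1) N z.2.

Lemma coef_trig2 c N k x : coef (trig2 c N) k x = if (`|k| <= N)%N then c k x else 0.
Proof. by rewrite /coef /trig2 /= fourier_coef_trigsum. Qed.

Lemma csqint_trig2 c N : (forall k, csqint mu A (c k)) -> csqint mu2 D (trig2 c N).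
Proof.
move=> sc; apply: csqint_sum; first exact: measurable_cyl.
by move=> i; exact: csqint_mode_coef.
Qed.

Lemma csqn_trig2 c N : (forall k, csqint mu A (c k)) ->
  csqn mu2 D (trig2 c N) = (2 * pi) * symsum (fun k => csqn mu A (c k)) N.
Proof.
move=> sc; have st := csqint_trig2 N sc; apply: EFin_inj.
rewrite csqnE//; last exact: measurable_cyl.
have [_ ->] := tonelli_csq (csqint_meas st).
transitivity (\int[mu]_(x in A) ((2 * pi)%:E * symsum (fun k => (normc (c k x) ^+ 2)%:E) N))%E.
  apply: eq_integral => x _.
  rewrite -[LHS](csqnE (@measurable_circ R) (csqint_trigsum (fun k => c k x) N)).
  by rewrite csqn_trigsum [in LHS]EFinM symsumE.
have ge0 k x : (0 <= (normc (c k x) ^+ 2)%:E)%E by rewrite lee_fin sqr_ge0.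
have mck k : measurable_fun A (fun x => (normc (c k x) ^+ 2)%:E).
  by apply/measurable_EFinP/measurable_funX/cmeas_normc; exact: (csqint_meas (sc k)).
rewrite ge0_integralZl//.
- rewrite [in RHS]EFinM symsumE; congr (_ * _)%E; rewrite /symsum ge0_integral_sum//.
  by apply: eq_bigr => i _; rewrite csqnE.
- by rewrite /symsum; apply: emeasurable_sum => i; exact: mck.
- by move=> x _; apply: sume_ge0.
- by rewrite lee_fin (ltW (pi2_gt0 R)).
Qed.

Lemma trig2B c N M z : (N <= M)%N ->
  trig2 c M z - trig2 c N z = trig2 (fun k x => if (`|k| <= N)%N then 0 else c k x) M z.
Proof. exact: trigsumB. Qed.

Lemma csqint_if (b : bool) (c : mR -> R[i]) : csqint mu A c ->
  csqint mu A (fun x => if b then 0 else c x).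
Proof. by case: b => // _; exact: csqint0. Qed.

Lemma csqn_if (b : bool) (c : mR -> R[i]) :
  csqn mu A (fun x => if b then 0 else c x) = if b then 0 else csqn mu A c.
Proof.
case: b => //; rewrite /csqn; under eq_Rintegral do rewrite normc0 expr0n.
by rewrite Rintegral_cst ?mul0r.
Qed.

Lemma csqn_coef_le u k : csqint mu2 D u ->
  ((2 * pi)%:E * \int[mu]_(x in A) (normc (coef u k x) ^+ 2)%:E <= (csqn mu2 D u)%:E)%E.
Proof.
move=> su; rewrite csqnE//; last exact: measurable_cyl.
rewrite parseval_cyl// lee_wpmul2l ?lee_fin ?(ltW (pi2_gt0 R))//.
have p j : (0 <= \int[mu]_(x in A) (normc (coef u j x) ^+ 2)%:E)%E.
  by apply: integral_ge0 => x _; rewrite lee_fin sqr_ge0.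
have -> : (\int[mu]_(x in A) (normc (coef u k x) ^+ 2)%:E =
   \sum_(j \in [set k]) \int[mu]_(x in A) (normc (coef u j x) ^+ 2)%:E)%E.
  by rewrite fsbig_set1.
by apply: esum_ge; exists [set k].
Qed.

Lemma csqint_coef u k : csqint mu2 D u -> csqint mu A (coef u k).
Proof.
move=> su; apply/(csqint_normcP mu mA _); split.
  exact: (cintegrable_meas (cintegrable_coef k (csqint_cyl_int su))).
have h := csqn_coef_le k su.
rewrite -(@lte_pmul2l _ (2 * pi)%:E)// ?lte_fin ?pi2_gt0//.
rewrite mulry gtr0_sg ?pi2_gt0// mul1e.
by apply: le_lt_trans h _; exact: ltry.
Qed.

(** Riesz-Fischer on the cylinder: square summable modes come from a function. *)
Lemma cyl_from_modes c : (forall k, csqint mu A (c k)) ->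
  (\esum_(k in [set: int]) (csqn mu A (c k))%:E < +oo)%E ->
  exists u, [/\ csqint mu2 D u,
    forall k, {ae mu, forall x, A x -> coef u k x = c k x} &
    (fun N => csqn mu2 D (fun z => u z - trig2 c N z)) @ \oo --> (0 : R)].
Proof.
move=> sc foo; have mD := measurable_cyl; have fD := cyl_fin.
pose a k := csqn mu A (c k).
have a0 k : 0 <= a k by exact: csqn_ge0.
have aB N : symsum a N <= fine (\esum_(k in [set: int]) (a k)%:E)%E.
  have a0' k : (0 <= (a k)%:E)%E by rewrite lee_fin.
  rewrite -lee_fin fineK ?ge0_fin_numE ?esum_ge0// symsumE.
  exact: symsum_le_esum.
have [l [al lN _]] := symsum_lim a0 aB.
pose e N := (2 * pi) * (l - symsum a N).
have e0 : e @ \oo --> (0 : R).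
  rewrite -[X in _ --> X](_ : 2 * pi * (l - l) = 0); last by rewrite subrr mulr0.
  by apply: cvgM; [exact: cvg_cst|apply: cvgB => //; exact: cvg_cst].
have [N M NM|g sg gN] := criesz_fischer mD fD (fun N => csqint_trig2 N sc) e0.
  have -> : csqn mu2 D (fun z => trig2 c M z - trig2 c N z) =
     csqn mu2 D (trig2 (fun k x => if (`|k| <= N)%N then 0 else c k x) M).
    by apply: eq_csqn => z _; exact: trig2B.
  rewrite csqn_trig2; last by move=> k; exact: csqint_if.
  rewrite /e ler_wpM2l ?(ltW (pi2_gt0 R))//.
  rewrite (eq_symsum _ (fun k => csqn_if _ _)) symsum_tail// lerD2r; exact: lN.
have se0 : (fun N => 2 * e N) @ \oo --> (0 : R).
  rewrite -[X in _ --> X](_ : 2 * 0 = 0 :> R); last by rewrite mulr0.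
  by apply: cvgM => //; exact: cvg_cst.
have sB N : csqint mu2 D (fun z => g z - trig2 c N z).
  by apply: csqintB => //; exact: csqint_trig2.
exists g; split => // [k|]; last first.
  apply: (@squeeze_cvgr _ _ _ _ (cst 0) (fun N => 2 * e N)) => //; last exact: cvg_cst.
  by apply: nearW => N; rewrite csqn_ge0 gN.
pose f x := coef g k x - c k x.
have sf : csqint mu A f by apply: csqintB => //; exact: csqint_coef.
have fe N : (`|k| <= N)%N -> (2 * pi) * csqn mu A f <= 2 * e N.
  move=> kN; apply: le_trans (gN N); rewrite -lee_fin; apply: le_trans (csqn_coef_le k (sB N)).
  rewrite [in leLHS]EFinM csqnE// lee_wpmul2l ?lee_fin ?(ltW (pi2_gt0 R))//.
  rewrite le_eqVlt; apply/orP; left; apply/eqP; apply: ge0_ae_eq_integral => //.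
  - by apply/measurable_EFinP/measurable_funX/cmeas_normc; exact: (csqint_meas sf).
  - by apply/measurable_EFinP/measurable_funX/cmeas_normc; exact: (csqint_meas (csqint_coef k (sB N))).
  - by move=> x _; rewrite lee_fin sqr_ge0.
  - by move=> x _; rewrite lee_fin sqr_ge0.
  - apply: filterS (coefB k (csqint_cyl_int sg) (csqint_cyl_int (csqint_trig2 N sc))) => x h Ax.
    by rewrite h// coef_trig2 kN.
have f0 : csqn mu A f = 0.
  apply/eqP; rewrite eq_le csqn_ge0 andbT.
  rewrite -(@ler_pM2l _ (2 * pi)) ?pi2_gt0// mulr0.
  rewrite -(cvg_lim (@Rhausdorff R) se0); apply: limr_ge; first by apply/cvg_ex; exists 0.
  by exists `|k|%N => // N /= kN; exact: fe.
have mn : measurable_fun A (fun x => (normc (f x) ^+ 2)%:E).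
  by apply/measurable_EFinP/measurable_funX/cmeas_normc; exact: (csqint_meas sf).
have /(ae_eq_integral_abs mu mA mn) : (\int[mu]_(x in A) `|(normc (f x) ^+ 2)%:E| = 0)%E.
  under eq_integral => x _ do rewrite gee0_abs ?lee_fin ?sqr_ge0//.
  by rewrite -csqnE// f0.
apply: filterS => x /[apply] /= [[]] /eqP; rewrite sqrf_eq0 => /eqP h.
by apply/eqP; rewrite -subr_eq0; apply/eqP/ComplexField.Normc.eq0_normc.
Qed.

Lemma csqn_cyl_ae u v : csqint mu2 D u -> csqint mu2 D v ->
  {ae mu2, forall z, D z -> u z = v z} -> csqn mu2 D u = csqn mu2 D v.
Proof.
move=> sv sw vw; have mD := measurable_cyl; apply: EFin_inj; rewrite !csqnE//.
apply: ge0_ae_eq_integral => //.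
- by apply/measurable_EFinP/measurable_funX/cmeas_normc; exact: (csqint_meas sv).
- by apply/measurable_EFinP/measurable_funX/cmeas_normc; exact: (csqint_meas sw).
- by move=> x _; rewrite lee_fin sqr_ge0.
- by move=> x _; rewrite lee_fin sqr_ge0.
- by apply: filterS vw => t /[apply] ->.
Qed.

Lemma esum_coef_lty u : csqint mu2 D u ->
  (\esum_(k in [set: int]) (csqn mu A (coef u k))%:E < +oo)%E.
Proof.
move=> su; have /(csqint_normcP mu2 measurable_cyl _)[_] := su.
rewrite parseval_cyl// => h.
rewrite -(@lte_pmul2l _ (2 * pi)%:E)// ?lte_fin ?pi2_gt0//.
rewrite mulry gtr0_sg ?pi2_gt0// mul1e; apply: le_lt_trans h.
rewrite le_eqVlt; apply/orP; left; apply/eqP; congr (_ * _)%E.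
by apply: eq_esum => k _; rewrite csqnE//; exact: csqint_coef.
Qed.

Lemma trig2_cvg u : csqint mu2 D u ->
  (fun N => csqn mu2 D (fun z => u z - trig2 (coef u) N z)) @ \oo --> (0 : R).
Proof.
move=> su.
have [g [sg gc g0]] := cyl_from_modes (fun k => csqint_coef k su) (esum_coef_lty su).
have ug := coef_inj (csqint_cyl_int sg) (csqint_cyl_int su) gc.
suff -> : (fun N => csqn mu2 D (fun z => u z - trig2 (coef u) N z)) =
   (fun N => csqn mu2 D (fun z => g z - trig2 (coef u) N z)) by [].
have st N := csqint_trig2 N (fun k => csqint_coef k su).
apply/funext => N; apply: csqn_cyl_ae.
- by apply: csqintB => //; exact: measurable_cyl.
- by apply: csqintB => //; exact: measurable_cyl.
- by apply: filterS ug => z /[apply] ->.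
Qed.

End Cylinder.

(** * Absolutely continuous functions on (0, 1] *)

Section Primitives.
Variable R : realType.
Local Notation mu := (@lebesgue_measure R).
Local Notation mR := (measurableTypeR R).
Implicit Types (y z g h : mR -> R) (a b e x s t : R).

Definition seg a b : set mR := `[a, b].

Lemma segE a b x : seg a b x = (a <= x <= b) :> Prop.
Proof. by rewrite /seg /= in_itv. Qed.

Lemma in_seg a b x : (x \in seg a b) = (a <= x <= b).
Proof. by rewrite /seg mem_setE in_itv. Qed.

Lemma measurable_seg a b : measurable (seg a b). Proof. exact: measurable_itv. Qed.

#[local] Hint Resolve measurable_seg : core.

Lemma seg_fin a b : (mu (seg a b) < +oo)%E.
Proof.
rewrite /seg lebesgue_measure_itv /=; case: ifP => _; last exact: ltry.
by rewrite -EFinB ltry.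
Qed.

Definition locint g := forall e, 0 < e -> mu.-integrable (seg e 1) (EFin \o g).

(** [y] is an absolutely continuous function on (0, 1] with derivative [g]. *)
Definition prim y g := locint g /\
  forall x, 0 < x <= 1 -> y x = y 1 - \int[mu]_(s in seg x 1) g s.

Lemma locint_sub g a b : locint g -> 0 < a -> b <= 1 -> mu.-integrable (seg a b) (EFin \o g).
Proof.
move=> lg a0 b1; apply: (integrableS (measurable_seg a 1) (measurable_seg a b) _ (lg a a0)).
by move=> x; rewrite !segE => /andP[-> /le_trans ->].
Qed.

Lemma Rintegral_seg_split g a b c : a <= b <= c -> mu.-integrable (seg a c) (EFin \o g) ->
  \int[mu]_(s in seg a c) g s = \int[mu]_(s in seg a b) g s + \int[mu]_(s in seg b c) g s.
Proof.
move=> /andP[ab bc] ig.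
have := @Rintegral_itvB R g (BLeft a) (BRight c) b ig.
rewrite !bnd_simp => /(_ ab bc) E.
have i2 : mu.-integrable (`]b, c] : set mR) (EFin \o g).
  apply: (integrableS (measurable_seg a c) (measurable_itv _) _ ig).
  by move=> x; rewrite segE /= in_itv /= => /andP[/ltW/(le_trans ab) -> ->].
by rewrite /seg -(Rintegral_itv_obnd_cbnd i2) -E addrC subrK.
Qed.

Lemma prim_sub y g a b : prim y g -> 0 < a -> a <= b -> b <= 1 ->
  y b - y a = \int[mu]_(s in seg a b) g s.
Proof.
move=> [lg P] a0 ab b1; rewrite (P b) ?(lt_le_trans a0 ab)//.
rewrite (P a) ?a0 ?(le_trans ab)//.
by rewrite (@Rintegral_seg_split g a b 1) ?ab//; [ring|exact: lg].
Qed.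

Lemma prim_continuous y g e : prim y g -> 0 < e -> e <= 1 -> {within `[e, 1], continuous y}.
Proof.
move=> py e0 e1; have [lg _] := py.
have := parameterized_integral_continuous e1 (lg e e0).
move=> h; have : {within `[e, 1], continuous (fun x => y e + \int[mu]_(s in seg e x) g s)}.
  by move=> x; apply: cvgD; [exact: cvg_cst|exact: h].
apply: subspace_eq_continuous => x /=; rewrite inE /= in_itv /= => /andP[ex x1].
change (y e + \int[mu]_(s in seg e x) g s = y x).
by rewrite -(prim_sub py e0 ex x1) addrC subrK.
Qed.

Lemma prim_measurable y g e : prim y g -> 0 < e -> measurable_fun (seg e 1) y.
Proof.
move=> py e0; have [e1|e1] := leP e 1.
  apply: subspace_continuous_measurable_fun; first exact: measurable_itv.
  exact: (prim_continuous py).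
rewrite /seg set_itv_ge ?bnd_simp -?ltNge//; exact: measurable_fun_set0.
Qed.

Lemma prim_bound y g e x : prim y g -> 0 < e -> e <= x <= 1 ->
  `|y x| <= `|y 1| + \int[mu]_(s in seg e 1) `|g s|.
Proof.
move=> py e0 /andP[ex x1]; have [lg P] := py.
have x0 := lt_le_trans e0 ex.
rewrite P ?x0//; apply: le_trans (ler_normB _ _) _; rewrite lerD2l.
apply: le_trans (le_normr_Rintegral (measurable_seg _ _) (lg x x0)) _.
have in_ : mu.-integrable (seg e 1) (EFin \o (fun s => `|g s|)).
  by apply: integrable_norm => //; exact: lg.
rewrite (@Rintegral_seg_split _ e x 1) ?ex// lerDr.
by apply: Rintegral_ge0 => s _; exact: normr_ge0.
Qed.

Lemma locintM_prim y g h : prim y g -> locint h -> locint (fun x => h x * y x).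
Proof.
move=> py lh e e0; apply: integrable_of_bound.
- exact: measurable_seg.
- apply: measurable_funM; last exact: (prim_measurable py).
  by have /integrableP[/measurable_EFinP] := lh e e0.
- have := integrableZl (measurable_seg e 1) (`|y 1| + \int[mu]_(s in seg e 1) `|g s|)
    (integrable_norm (lh e e0)).
  exact.
- move=> x; rewrite segE => xe; rewrite normrM mulrC ler_wpM2r//.
  exact: (prim_bound py).
Qed.

Lemma locint_lin c1 c2 g h : locint g -> locint h -> locint (fun x => c1 * g x + c2 * h x).
Proof. by move=> lg lh e e0; apply: integrable_lin; [exact: measurable_seg|exact: lg|exact: lh]. Qed.

Lemma eq_locint g h : (forall x, 0 < x <= 1 -> g x = h x) -> locint g -> locint h.
Proof.
move=> gh lg e e0; apply: eq_integrable (lg e e0) => //.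
move=> x; rewrite in_seg => /andP[ex x1].
by rewrite /= gh// x1 andbT (lt_le_trans e0).
Qed.

Lemma eq_prim y z g h : (forall x, 0 < x <= 1 -> y x = z x) ->
  (forall x, 0 < x <= 1 -> g x = h x) -> prim y g -> prim z h.
Proof.
move=> yz gh [lg P]; split; first exact: eq_locint gh lg.
move=> x /andP[x0 x1]; rewrite -!yz ?x0 ?ltr01//= ?lexx// P ?x0//; congr (_ - _).
apply: eq_Rintegral => s; rewrite in_seg => /andP[xs s1].
by rewrite gh// s1 andbT (lt_le_trans x0).
Qed.

Lemma prim_lin c1 c2 y z g h : prim y g -> prim z h ->
  prim (fun x => c1 * y x + c2 * z x) (fun x => c1 * g x + c2 * h x).
Proof.
move=> [lg Py] [lh Pz]; split; first exact: locint_lin.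
move=> x /andP[x0 x1]; rewrite Py ?x0// Pz ?x0//.
rewrite Rintegral_lin; [ring|exact: measurable_seg|exact: lg|exact: lh].
Qed.

Lemma prim_cst c : prim (fun=> c) (fun=> 0).
Proof.
split; first by move=> e e0; apply: eq_integrable (integrable0 _ _) => //; exact: measurable_seg.
by move=> x _; rewrite Rintegral_cst ?mul0r ?subr0//; exact: measurable_seg.
Qed.

Lemma prim_of_derive y g : (forall x, 0 < x -> is_derive x (1 : R) y (g x)) ->
  (forall x : R, 0 < x -> {for x, continuous g}) -> prim y g.
Proof.
move=> dy cg.
have cw e : 0 < e -> {within `[e, 1], continuous g}.
  move=> e0; apply: continuous_in_subspaceT => x; rewrite inE /= in_itv /= => /andP[ex _].
  by apply: cg; exact: lt_le_trans e0 ex.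
have lg : locint g.
  move=> e e0; apply: continuous_compact_integrable; first exact: segment_compact.
  exact: cw.
split => // x /andP[x0]; rewrite le_eqVlt => /orP[/eqP ->|x1].
  by rewrite /seg set_itv1 Rintegral_set1 subr0.
have cy t : 0 < t -> {for t, continuous y}.
  move=> t0; apply: differentiable_continuous; apply/derivable1_diffP.
  by have := dy t t0; move=> [].
rewrite /seg /Rintegral (@continuous_FTC2 _ g y)//= ?subKr ?opprB ?addrC ?subrK//.
- exact: cw.
- split.
  + by move=> t; rewrite in_itv /= => /andP[xt _]; have [] := dy t (lt_trans x0 xt).
  + by apply: cvg_at_right_filter; exact: cy.
  + by apply: cvg_at_left_filter; exact: cy.
- by move=> t; rewrite in_itv /= => /andP[xt _]; rewrite derive1E; have [] := dy t (lt_trans x0 xt).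
Qed.

Lemma EFin_Rint (A : set mR) (f : mR -> R) : measurable A -> mu.-integrable A (EFin \o f) ->
  (\int[mu]_(x in A) f x)%:E = (\int[mu]_(x in A) (f x)%:E)%E.
Proof. by move=> mA if_; rewrite /Rintegral fineK// (integrable_fin_num mA if_). Qed.

(* Fubini on the triangle [t <= s] of the square [x, 1]^2. *)
Lemma triangle_swap x g h : mu.-integrable (seg x 1) (EFin \o g) ->
  mu.-integrable (seg x 1) (EFin \o h) ->
  \int[mu]_(s in seg x 1) (g s * \int[mu]_(t in seg x s) h t) =
  \int[mu]_(t in seg x 1) (h t * \int[mu]_(s in seg t 1) g s).
Proof.
move=> ig ih; have mS := measurable_seg x 1.
pose g0 := g \_ (seg x 1); pose h0 := h \_ (seg x 1).
have G (f : mR -> R) : mu.-integrable (seg x 1) (EFin \o f) -> mu.-integrable setT (EFin \o (f \_ (seg x 1))).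
  by move=> if_; rewrite -restrict_EFin; apply/integrable_restrict => //=; rewrite setTI.
have ig0 := G _ ig; have ih0 := G _ ih.
have mg0 : measurable_fun setT g0 by have /integrableP[/measurable_EFinP] := ig0.
have mh0 : measurable_fun setT h0 by have /integrableP[/measurable_EFinP] := ih0.
pose E : set (mR * mR) := [set z | z.2 <= z.1].
have mE : measurable E.
  rewrite (_ : E = (fun z : mR * mR => z.2 <= z.1) @^-1` [set true]); last by apply/seteqP; split => z.
  rewrite -[X in measurable X]setTI.
  apply: (measurable_fun_ler _ _ measurableT) => //.
pose F (z : mR * mR) := (g0 z.1 * h0 z.2) * \1_E z.
have mF : measurable_fun setT F.
  apply: measurable_funM; last exact: measurable_indic.
  by apply: measurable_funM; apply: measurableT_comp => //.
pose aF : mR * mR -> \bar R := fun p => `|(F p)%:E|%E.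
have aF0 p : (0 <= aF p)%E by exact: abse_ge0.
have mAF : measurable_fun setT aF by do 2 apply: measurableT_comp => //.
have iF : (mu \x mu)%E.-integrable setT (EFin \o F).
  apply/integrable12ltyP; first exact/measurable_EFinP.
  apply: (@le_lt_trans _ _ (\int[mu]_s (`|g0 s|%:E * \int[mu]_t `|h0 t|%:E))%E).
    apply: ge0_le_integral => //.
    - by move=> s _; apply: integral_ge0.
    - exact: (measurable_fun_fubini_tonelli_F (m2 := mu) aF mAF aF0).
    - apply: emeasurable_funM => //.
      by apply/measurable_EFinP; apply: measurableT_comp.
    - move=> s _; rewrite -ge0_integralZl//.
      + apply: ge0_le_integral => //.
        * apply/measurable_EFinP; apply: measurableT_comp => //.
          exact: (measurable_fun_pair2 s mF).
        * by apply: measurable_funeM; apply/measurable_EFinP; apply: measurableT_comp.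
        * move=> t _; rewrite /= -EFinM lee_fin /F !normrM ler_piMr ?mulr_ge0//.
          by rewrite indicE; case: (_ \in _); rewrite ?normr0 ?normr1.
      + by apply/measurable_EFinP; apply: measurableT_comp.
  have /integrableP[_ hg] := ig0; have /integrableP[_ hh] := ih0.
  rewrite ge0_integralZr//.
  - apply: lte_mul_pinfty; [exact: integral_ge0| |exact: hh].
    by rewrite ge0_fin_numE; [exact: hg|exact: integral_ge0].
  - by apply/measurable_EFinP; apply: measurableT_comp.
  - by apply: integral_ge0.
have /(congr1 fine) := Fubini iF.
have sub a b : x <= a -> b <= 1 -> seg a b `<=` seg x 1.
  by move=> xa b1 t; rewrite !segE => /andP[/(le_trans xa) -> /le_trans ->].
have L s : (\int[mu]_t (EFin \o F) (s, t))%E =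
   (((fun s => g s * \int[mu]_(t in seg x s) h t) \_ (seg x 1)) s)%:E.
  rewrite /patch in_seg; case: ifPn => [/andP[xs s1]|sN]; last first.
    rewrite integral0_eq// => t _; rewrite /F /g0 /patch /= in_seg (negbTE sN).
    by rewrite !mul0r.
  have ihs : mu.-integrable (seg x s) (EFin \o h).
    by apply: (integrableS mS (measurable_seg x s) _ ih); exact: sub.
  rewrite [RHS]EFinM EFin_Rint//.
  rewrite -integralZl//.
  rewrite [RHS]integral_mkcond; apply: eq_integral => t _.
  have eE : ((s, t) \in E) = (t <= s) by apply/idP/idP; rewrite inE.
  rewrite /= /F /g0 /h0 /patch /= !in_seg xs s1 /= indicE eE.
  have [ts|ts] := leP t s; last by rewrite andbF mulr0.
  rewrite (le_trans ts s1) !andbT mulr1.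
  by case: ifP => _; rewrite -?EFinM// (_ : point = 0 :> R)// mulr0.
have Rr t : (\int[mu]_s (EFin \o F) (s, t))%E =
   (((fun t => h t * \int[mu]_(s in seg t 1) g s) \_ (seg x 1)) t)%:E.
  rewrite /patch in_seg; case: ifPn => [/andP[xt t1]|tN]; last first.
    rewrite integral0_eq// => s _; rewrite /F /h0 /patch /= in_seg (negbTE tN).
    by rewrite mulr0 mul0r.
  have igs : mu.-integrable (seg t 1) (EFin \o g).
    by apply: (integrableS mS (measurable_seg t 1) _ ig); exact: sub.
  rewrite [RHS]EFinM EFin_Rint//.
  rewrite -integralZl//.
  rewrite [RHS]integral_mkcond; apply: eq_integral => s _.
  have eE : ((s, t) \in E) = (t <= s) by apply/idP/idP; rewrite inE.
  rewrite /= /F /g0 /h0 /patch /= !in_seg xt t1 /= indicE eE.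
  have [ts|ts] := leP t s; last by rewrite mulr0.
  rewrite (le_trans xt ts) /= mulr1.
  by case: ifP => _; rewrite -?EFinM 1?mulrC// (_ : point = 0 :> R)// mulr0.
under eq_integral do rewrite L.
under [in X in _ = X -> _]eq_integral do rewrite Rr.
by rewrite -!/(Rintegral _ _ _) -!Rintegral_mkcond.
Qed.

(** The product rule for absolutely continuous functions. *)
Lemma prim_mul y z g h : prim y g -> prim z h ->
  prim (fun x => y x * z x) (fun x => g x * z x + y x * h x).
Proof.
move=> py pz; have [lg Py] := py; have [lh Pz] := pz.
have l1 : locint (fun x => g x * z x) by exact: (locintM_prim pz lg).
have l2 : locint (fun x => h x * y x) by exact: (locintM_prim py lh).
split.
  by apply: eq_locint (locint_lin 1 1 l1 l2) => x _; rewrite !mul1r [h x * _]mulrC.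
move=> x /andP[x0 x1].
have mS := measurable_seg x 1; have ig := lg x x0; have ih := lh x x0.
have x01 : 0 < x <= 1 by rewrite x0.
pose Y t := \int[mu]_(s in seg t 1) g s; pose Z t := \int[mu]_(s in seg t 1) h s.
have hgZ : mu.-integrable (seg x 1) (EFin \o (fun s => g s * Z s)).
  have := locint_lin (z 1) (-1) lg l1 x0; apply: eq_integrable => // s.
  rewrite in_seg => /andP[xs s1]; rewrite /= [in z s]Pz ?s1 ?(lt_le_trans x0)// /Z.
  by congr EFin; ring.
have hhY : mu.-integrable (seg x 1) (EFin \o (fun s => h s * Y s)).
  have := locint_lin (y 1) (-1) lh l2 x0; apply: eq_integrable => // s.
  rewrite in_seg => /andP[xs s1]; rewrite /= [in y s]Py ?s1 ?(lt_le_trans x0)// /Y.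
  by congr EFin; ring.
have key : Y x * Z x = \int[mu]_(s in seg x 1) (g s * Z s) + \int[mu]_(s in seg x 1) (h s * Y s).
  rewrite -(triangle_swap ig ih) -RintegralD//; last first.
    have := integrable_lin mS (Z x) (-1) ig hgZ; apply: eq_integrable => // s.
    rewrite in_seg => sx; rewrite /= /Z (Rintegral_seg_split sx ih).
    by congr EFin; ring.
  rewrite mulrC -RintegralZl//; apply: eq_Rintegral => s; rewrite in_seg => sx.
  by rewrite /Z (Rintegral_seg_split sx ih); ring.
rewrite Py// Pz//.
transitivity (y 1 * z 1 - (\int[mu]_(s in seg x 1) (z 1 * g s + (-1) * (g s * Z s)) +
   \int[mu]_(s in seg x 1) (y 1 * h s + (-1) * (h s * Y s)))).
  rewrite !Rintegral_lin// -/(Y x) -/(Z x).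
  by rewrite mulrBl !mulrBr key; ring.
rewrite -RintegralD//; [|exact: integrable_lin|exact: integrable_lin].
congr (_ - _); apply: eq_Rintegral => s; rewrite in_seg => /andP[xs s1].
have s01 : 0 < s <= 1 by rewrite s1 (lt_le_trans x0).
by rewrite (Py s s01) (Pz s s01) /Y /Z; ring.
Qed.

End Primitives.

(** * Test functions of one variable *)

Section Jets.
Variable R : realType.
Local Notation mu := (@lebesgue_measure R).
Local Notation mR := (measurableTypeR R).
Implicit Types (f g : nat -> R -> R) (x : R).

(** Carrying all the derivatives as a sequence turns smoothness into closure properties. *)
Definition jet f := forall n x, is_derive x (1 : R) (f n) (f n.+1 x).

(** The derivatives of a product; unfolding Leibniz's rule as a recursion makes
    [jet_prod] an induction without binomial coefficients. *)
Fixpoint jprod n f g x : R :=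
  if n is m.+1 then jprod m (fun k => f k.+1) g x + jprod m f (fun k => g k.+1) x
  else f 0%N x * g 0%N x.

Lemma jet_shift f : jet f -> jet (fun k => f k.+1).
Proof. by move=> jf n x; exact: jf. Qed.

Lemma jet_prod f g : jet f -> jet g -> jet (fun n => jprod n f g).
Proof.
move=> + + n; elim: n f g => [|n ih] f g jf jg x.
  apply: (is_derive_eq (is_deriveM (jf 0%N x) (jg 0%N x))).
  by rewrite /= /GRing.scale /= addrC [g 0%N x * _]mulrC.
exact: is_deriveD (ih _ _ (jet_shift jf) jg x) (ih _ _ jf (jet_shift jg) x).
Qed.

Lemma jprod0 n f g x : (forall k, f k x = 0) \/ (forall k, g k x = 0) -> jprod n f g x = 0.
Proof.
elim: n f g => [|n ih] f g [h|h] /=; rewrite ?(h 0%N) ?mul0r ?mulr0//.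
  by rewrite (ih (fun k => f k.+1) g (or_introl (fun k => h k.+1))) (ih f (fun k => g k.+1) (or_introl h)) addr0.
by rewrite (ih (fun k => f k.+1) g (or_intror h)) (ih f (fun k => g k.+1) (or_intror (fun k => h k.+1))) addr0.
Qed.

Lemma jet_lin (a b : R) f g : jet f -> jet g -> jet (fun n x => a * f n x + b * g n x).
Proof.
move=> jf jg n x.
have h1 := is_deriveZ a (jf n x); have h2 := is_deriveZ b (jg n x).
exact: is_deriveD h1 h2.
Qed.

Lemma jet_affine (a b : R) f : jet f -> jet (fun n x => a ^+ n * f n (a * x + b)).
Proof.
move=> jf n x.
have h1 : is_derive x (1 : R) (fun x => a * x + b) a.
  by apply: (is_derive_eq (is_deriveD (is_deriveZ a (is_derive_id x (1 : R))) (is_derive_cst b x (1 : R))));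
    rewrite /GRing.scale /= mulr1 addr0.
have h2 := @is_derive1_comp _ (f n) (fun x => a * x + b) x _ _ (jf n (a * x + b)) h1.
have h3 := is_deriveZ (a ^+ n) h2.
by apply: (is_derive_eq h3); rewrite /GRing.scale /= exprSr; ring.
Qed.

Lemma jet_continuous f n : jet f -> continuous (f n).
Proof. by move=> jf; apply: derive_continuous; exact: jf. Qed.

Definition flat0 (i : nat) x : R := if 0 < x then x^-1 ^+ i * expR (- x^-1) else 0.

Lemma flat0_le i x : `|flat0 i x| <= i.+2%:R ^+ i.+2 * x ^+ 2.
Proof.
rewrite /flat0; case: ifPn => [x0|_]; last by rewrite normr0 mulr_ge0 ?sqr_ge0 ?exprn_ge0 ?ler0n.
have xV : 0 < x^-1 by rewrite invr_gt0.
rewrite ger0_norm; last by rewrite mulr_ge0 ?exprn_ge0 ?expR_ge0// ltW.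
set t := x^-1; set n := i.+2.
have key : t ^+ n <= n%:R ^+ n * expR t.
  have n0 : 0 < n%:R :> R by rewrite ltr0n.
  have h : t / n%:R <= expR (t / n%:R).
    by apply: le_trans (expR_ge1Dx _); rewrite lerDr.
  have := @lerXn2r _ n _ _ _ _ h; rewrite !nnegrE expR_ge0 divr_ge0 ?(ltW n0) ?(ltW xV)//.
  move=> /(_ isT isT); rewrite -expRM_natr -mulrA mulVf ?gt_eqF// mulr1.
  by rewrite expr_div_n ler_pdivrMr ?exprn_gt0// mulrC.
have -> : x ^+ 2 = t ^- 2 by rewrite /t exprVn invrK.
rewrite ler_pdivlMr ?exprn_gt0// mulrAC -exprD addn2 expRN.
by rewrite ler_pdivrMr ?expR_gt0.
Qed.

Lemma flat0_derive i x : is_derive x (1 : R) (flat0 i) (- i%:R * flat0 i.+1 x + flat0 i.+2 x).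
Proof.
have [x0|x0|->] := ltgtP x 0.
- have -> : - i%:R * flat0 i.+1 x + flat0 i.+2 x = 0.
    by rewrite /flat0 ltNge (ltW x0) /= mulr0 addr0.
  apply: (near_eq_is_derive _ (is_derive_cst (0 : R) x (1 : R))).
  near=> y; rewrite /flat0 ifF//; apply/negbTE; rewrite -leNgt ltW//.
  by near: y; exact: lt_nbhsl.
- have xn0 : x != 0 by rewrite gt_eqF.
  pose F (y : R) := y^-1 ^+ i * expR (- y^-1).
  have dV := is_deriveV xn0 (is_derive_id x (1 : R)).
  have dX := is_deriveX i dV.
  have dE : is_derive x (1 : R) (fun y => expR (- y^-1)) (expR (- x^-1) * (x ^- 2)).
    have h := is_deriveN dV.
    have h2 := @is_derive1_comp _ expR _ x _ _ (is_derive_expR (- x^-1)) h.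
    by apply: (is_derive_eq h2); rewrite /GRing.scale /= mulr1 opprK.
  have dF := is_deriveM dX dE.
  have E : - i%:R * flat0 i.+1 x + flat0 i.+2 x =
     x^-1 ^+ i * (expR (- x^-1) * x ^- 2) + expR (- x^-1) * (x^-1 ^+ i.-1 *+ i * (- x ^- 2)).
    rewrite /flat0 x0; case: i {F dX dF} => [|i] /=.
      by rewrite !mulr0n mul0r mulr0 addr0 oppr0 mul0r add0r expr0 mul1r exprVn mulrC.
    rewrite -mulr_natl !exprVn !exprS; field.
    by rewrite ?expf_neq0 ?xn0.
  rewrite E.
  have EF : F = (GRing.inv : R -> R) ^+ i * (fun y => expR (- y^-1)).
    by apply/funext => y; rewrite /F fctE exprfctE.
  apply: (near_eq_is_derive (f := F)); last first.
    by rewrite EF; apply: (is_derive_eq dF); rewrite /GRing.scale /= ?fctE ?exprfctE /= !mulr1 -[_ *+ i]mulr_natl; ring.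
  near=> y; rewrite /flat0 ifT//.
  by near: y; exact: lt_nbhsr.
- have -> : - i%:R * flat0 i.+1 0 + flat0 i.+2 0 = 0 :> R.
    by rewrite /flat0 ltxx mulr0 addr0.
  have f0 : flat0 i 0 = 0 by rewrite /flat0 ltxx.
  have c : (fun h : R => h^-1 *: (flat0 i (h *: 1 + 0) - flat0 i 0)) @ 0^' --> (0 : R).
    apply/cvgrPdist_le => e e0.
    pose C : R := i.+2%:R ^+ i.+2.
    have C0 : 0 < C by rewrite exprn_gt0// ltr0n.
    near=> h.
    have h0 : h != 0 by near: h; exact: nbhs_dnbhs_neq.
    rewrite sub0r normrN f0 subr0 addr0 /GRing.scale /= mulr1 normrM normfV.
    rewrite ler_pdivrMl ?normr_gt0//.
    apply: le_trans (flat0_le _ _) _.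
    rewrite -(real_normK (num_real h)) expr2 mulrCA ler_wpM2l// -/C.
    rewrite -ler_pdivlMl//.
    near: h; rewrite mulrC.
    by apply: dnbhs0_le; rewrite divr_gt0.
  apply: DeriveDef; first by apply/cvg_ex; exists 0.
  exact/cvg_lim.
Unshelve. all: by end_near. Qed.

(** The derivatives of [flat0 i], the smoothness of which is seen by closing the family
    [x^-i e^(-1/x)] under derivation. *)
Fixpoint flat n i x : R :=
  if n is m.+1 then - i%:R * flat m i.+1 x + flat m i.+2 x else flat0 i x.

Lemma jet_flat i : jet (fun n => flat n i).
Proof.
move=> n; elim: n i => [|n ih] i x; first exact: flat0_derive.
have h1 := is_deriveZ (- i%:R) (ih i.+1 x).
exact: is_deriveD h1 (ih i.+2 x).
Qed.

Lemma flat_le0 n i x : x <= 0 -> flat n i x = 0.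
Proof.
move=> x0; elim: n i => [|n ih] i /=; last by rewrite !ih mulr0 addr0.
by rewrite /flat0 ltNge x0.
Qed.

(** The smooth functions with compact support in (0, 1). *)
Definition test1 f := jet f /\
  exists2 e, 0 < e & forall n x, f n x != 0 -> e <= x <= 1 - e.

Definition bump a b (N n : nat) x : R :=
  jprod n (fun k x => N%:R ^+ k * flat k 0 (N%:R * x + (- (N%:R * a))))
          (fun k x => (- N%:R) ^+ k * flat k 0 (- N%:R * x + N%:R * b)) x.

Lemma bump_test a b N : 0 < a -> b < 1 -> test1 (bump a b N).
Proof.
move=> a0 b1; split.
  exact: (jet_prod (jet_affine N%:R (- (N%:R * a)) (jet_flat 0)) (jet_affine (- N%:R) (N%:R * b) (jet_flat 0))).
exists (Num.min a (1 - b)); first by rewrite lt_min a0 subr_gt0.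
move=> n x; apply: contraNT; rewrite negb_and -!ltNge => h; apply/eqP.
have N0 : 0 <= N%:R :> R by exact: ler0n.
case/orP: h => h; apply: jprod0; [left|right] => k; rewrite flat_le0 ?mulr0//.
  have xa : x <= a by rewrite (le_trans (ltW h))// ge_min lexx.
  by rewrite -mulrBr mulr_ge0_le0// subr_le0.
have bx : b <= x.
  have : Num.min a (1 - b) <= 1 - b by rewrite ge_min lexx orbT.
  by move: h; lra.
by rewrite mulNr addrC -mulrBr mulr_ge0_le0// subr_le0.
Qed.

Lemma flat0_01 x : 0 <= flat0 0 x <= 1.
Proof.
rewrite /flat0; case: ifPn => x0; last by rewrite lexx ler01.
by rewrite expr0 mul1r expR_ge0 expR_le1 oppr_le0 invr_ge0 ltW.
Qed.

Lemma bump_01 a b N x : 0 <= bump a b N 0%N x <= 1.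
Proof.
rewrite /bump /= !expr0 !mul1r.
have /andP[h1 h2] := flat0_01 (N%:R * x + (- (N%:R * a))).
have /andP[h3 h4] := flat0_01 (- N%:R * x + N%:R * b).
by rewrite mulr_ge0//= mulr_ile1.
Qed.

Lemma flat0_cvg x : (fun N : nat => flat0 0 (N%:R * x)) @ \oo --> ((0 < x)%R%:R : R).
Proof.
case: ltP => x0 /=; last first.
  rewrite (_ : (fun _ => _) = cst 0); first exact: cvg_cst.
  apply/funext => N; have : N%:R * x <= 0 by rewrite mulr_ge0_le0.
  by move=> /(flat_le0 0 0).
rewrite -(cvg_shiftS (fun N => flat0 0 (N%:R * x))).
have h : (fun N : nat => expR (- (x^-1 * N.+1%:R^-1))) @ \oo --> expR (- (x^-1 * 0)).
  apply: (@cvg_comp _ _ _ _ expR _ (nbhs (- (x^-1 * 0)))); last exact: continuous_expR.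
  by apply: cvgN; apply: cvgMr; exact: cvg_harmonic.
rewrite mulr0 oppr0 expR0 in h.
apply: cvg_trans h; apply: near_eq_cvg; near=> N.
by rewrite /= /flat0 mulr_gt0 ?ltr0n// expr0 mul1r [in RHS]invfM [in RHS]mulrC.
Unshelve. all: by end_near. Qed.

Lemma bump_cvg a b x : (fun N => bump a b N 0%N x) @ \oo --> ((a < x < b)%R%:R : R).
Proof.
have h : (fun N : nat => flat0 0 (N%:R * (x - a)) * flat0 0 (N%:R * (b - x))) @ \oo -->
    (((0 < x - a)%R%:R : R) * ((0 < b - x)%R%:R : R)).
  by apply: cvgM; exact: flat0_cvg.
rewrite !subr_gt0 -natrM mulnb in h.
apply: cvg_trans h; apply: near_eq_cvg; apply: nearW => N.
rewrite /bump /= !expr0 !mul1r !mulrBr mulNr; congr (_ * flat0 _ _); ring.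
Qed.

Lemma test1_out f n x e : (forall n x, f n x != 0 -> e <= x <= 1 - e) ->
  ~~ (e <= x <= 1 - e) -> f n x = 0.
Proof. by move=> h hx; apply/eqP; apply: contraNT hx; exact: h. Qed.

Lemma test1_bounded f n : test1 f -> exists M, forall x, `|f n x| <= M.
Proof.
move=> [jf [e e0 se]].
have c : {within `[0, 1], continuous (fun x => `|f n x|)}.
  apply: continuous_subspaceT => x; apply: cvg_norm; exact: jet_continuous.
have [c0 _ hc] := EVT_max ler01 c.
exists `|f n c0| => x.
have [x0|x0] := boolP (e <= x <= 1 - e); last by rewrite (test1_out n se x0) normr0.
by apply: hc; rewrite in_itv /=; lra.
Qed.

Definition locint0 (g : mR -> R) := forall e, 0 < e -> mu.-integrable (seg e (1 - e)) (EFin \o g).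

Lemma locint_locint0 (g : mR -> R) : locint g -> locint0 g.
Proof. by move=> lg e e0; apply: locint_sub => //; lra. Qed.

Lemma test1_integrable f n (g : mR -> R) (A : set mR) : measurable A ->
  test1 f -> locint0 g -> mu.-integrable A (EFin \o (fun x => g x * f n x)).
Proof.
move=> mA tf lg; have [M hM] := test1_bounded n tf; have [jf [e e0 se]] := tf.
have i0 : mu.-integrable setT (EFin \o (g \_ (seg e (1 - e)))).
  rewrite -restrict_EFin; apply/integrable_restrict; rewrite ?setTI//; first exact: measurable_seg.
  exact: lg.
have E : (fun x => g x * f n x) = (fun x => (g \_ (seg e (1 - e))) x * f n x).
  apply/funext => x; rewrite /patch in_seg; case: ifPn => // h.
  by rewrite (test1_out n se h) !mulr0.
rewrite E; apply: (@integrableS _ mR R mu setT A _ measurableT mA) => //.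
apply: integrable_of_bound.
- exact: measurableT.
- apply: measurable_funM; first by have /integrableP[/measurable_EFinP] := i0.
  exact: (continuous_measurable_fun (jet_continuous jf)).
- have := integrableZl measurableT M (integrable_norm i0); exact.
- by move=> x _ /=; rewrite normrM mulrC ler_wpM2r.
Qed.

(** The fundamental lemma of the calculus of variations: products of two bumps tend to the
    indicator of an interval, on which the integral of [g] therefore vanishes. *)
Lemma test1_sep (g : mR -> R) : locint0 g ->
  (forall f, test1 f -> \int[mu]_(x in seg 0 1) (g x * f 0%N x) = 0) ->
  {ae mu, forall x, 0 < x < 1 -> g x = 0}.
Proof.
move=> lg h.
have Z a b : 0 < a -> a < b -> b < 1 -> \int[mu]_(x in seg a b) g x = 0.
  move=> a0 ab b1.
  have iab : mu.-integrable (seg a b) (EFin \o g).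
    have e0 : 0 < Num.min a (1 - b) by rewrite lt_min a0 subr_gt0.
    apply: (integrableS (measurable_seg _ _) (measurable_seg a b) _ (lg _ e0)).
    move=> x; rewrite !segE => /andP[ax xb]; rewrite ge_min.
    rewrite (le_trans _ ax) ?ge_min ?lexx//=.
    have : Num.min a (1 - b) <= 1 - b by rewrite ge_min lexx orbT.
    lra.
  have s01 : seg a b `<=` seg 0 1 by move=> x; rewrite !segE; lra.
  have F1 (N : nat) : \int[mu]_(x in seg a b) (g x * bump a b N 0%N x) = 0.
    rewrite -(h _ (bump_test N a0 b1)) [LHS]Rintegral_mkcond [RHS]Rintegral_mkcond.
    apply: eq_Rintegral => x _; rewrite /patch !in_seg.
    case: ifPn => hx; first by rewrite ifT//; lra.
    suff -> : bump a b N 0%N x = 0 by rewrite mulr0; case: ifP.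
    rewrite /bump /= !expr0 !mul1r; apply/eqP; rewrite mulf_eq0; apply/orP.
    have N0 : 0 <= N%:R :> R by exact: ler0n.
    move: hx; rewrite negb_and -!ltNge => /orP[hx|hx]; [left|right]; apply/eqP; apply: (flat_le0 0 0).
      by rewrite -mulrBr mulr_ge0_le0// subr_le0 ltW.
    by rewrite mulNr addrC -mulrBr mulr_ge0_le0// subr_le0 ltW.
  have mg : measurable_fun (seg a b) g by have /integrableP[/measurable_EFinP] := iab.
  have mI : measurable_fun (seg a b) (fun x : mR => (a < x < b)%R%:R : R).
    rewrite (_ : (fun x => _) = \1_(`]a, b[ : set mR)).
      exact: measurable_indic.
    by apply/funext => x; rewrite indicE mem_setE in_itv.
  have C : (fun N => \int[mu]_(x in seg a b) (g x * bump a b N 0%N x)) @ \oo -->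
      \int[mu]_(x in seg a b) (g x * (a < x < b)%R%:R).
    apply: (dominated_Rint (measurable_seg a b) (g := fun x => `|g x|)).
    - move=> N; apply: measurable_funM => //; apply: measurable_funTS.
      exact: (continuous_measurable_fun (jet_continuous (bump_test N a0 b1).1)).
    - exact: measurable_funM.
    - by move=> x _; apply: cvgMr; exact: (@bump_cvg a b x).
    - exact: integrable_norm iab.
    - move=> N x _; rewrite normrM ler_piMr//.
      by have /andP[? ?] := bump_01 a b N x; rewrite ger0_norm.
  have E : \int[mu]_(x in seg a b) (g x * (a < x < b)%R%:R) = 0.
    apply: (@cvg_unique _ (@Rhausdorff R) _ _ _ _ C).
    rewrite (_ : (fun N => _) = cst 0); first exact: cvg_cst.
    by apply/funext => N; exact: F1.
  rewrite -[RHS]E.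
  have ioo : mu.-integrable (`]a, b[ : set mR) (EFin \o g).
    apply: (integrableS (measurable_seg a b) (measurable_itv _) _ iab) => x /=.
    by rewrite segE in_itv /= => /andP[/ltW -> /ltW ->].
  have ioc : mu.-integrable (`]a, b] : set mR) (EFin \o g).
    apply: (integrableS (measurable_seg a b) (measurable_itv _) _ iab) => x /=.
    by rewrite segE in_itv /= => /andP[/ltW -> ->].
  transitivity (\int[mu]_(x in `]a, b[) g x).
    by rewrite /seg -(Rintegral_itv_obnd_cbnd ioc) -(Rintegral_itv_bndo_bndc ioo).
  rewrite [LHS]Rintegral_mkcond [RHS]Rintegral_mkcond.
  apply: eq_Rintegral => x _; rewrite /patch in_seg mem_setE in_itv /=.
  case: ifPn => [/andP[h1 h2]|h1]; first by rewrite (ltW h1) (ltW h2) mulr1.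
  by rewrite mulr0; case: ifP.
have A (n : nat) : {ae mu, forall x, n.+2%:R^-1 <= x <= 1 - n.+2%:R^-1 -> g x = 0}.
  have n0 : 0 < n.+2%:R^-1 :> R by rewrite invr_gt0 ltr0n.
  apply: ae0_of_primitive0; first exact: lg.
  by move=> x /andP[h1 h2]; apply: (Z _ _ n0 h1); apply: (lt_trans h2); rewrite gtrBl.
apply: filterS (ae_foralln A) => x hx /andP[x0 x1].
have m0 : 0 < Num.min x (1 - x) by rewrite lt_min x0 subr_gt0.
pose k := Num.bound (Num.min x (1 - x))^-1.
have hk : k.+2%:R^-1 <= Num.min x (1 - x).
  rewrite -[leRHS]invrK lef_pV2 ?posrE ?ltr0n ?invr_gt0//.
  have hV : 0 <= (Num.min x (1 - x))^-1 by rewrite invr_ge0 ltW.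
  by apply: le_trans (ltW (archi_boundP hV)) _; rewrite ler_nat -/k; lia.
by apply: (hx k); move: hk; rewrite le_min => /andP[-> hk] /=; rewrite lerBrDr addrC -lerBrDr.
Qed.

Lemma test1_Rint01 f n (g : mR -> R) x : (forall y, y < x -> f n y = 0) -> 0 <= x ->
  \int[mu]_(y in seg 0 1) (g y * f n y) = \int[mu]_(y in seg x 1) (g y * f n y).
Proof.
move=> h x0; rewrite [LHS]Rintegral_mkcond [RHS]Rintegral_mkcond.
apply: eq_Rintegral => y _; rewrite /patch !in_seg.
have [xy|yx] := leP x y; first by rewrite (le_trans x0 xy).
by rewrite h// mulr0 if_same.
Qed.

Lemma prim_locint (y g : mR -> R) : prim y g -> locint y.
Proof.
move=> py; have lc : locint (cst 1 : mR -> R).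
  by move=> e _; exact: (integrable_cst_fin (measurable_seg _ _) (seg_fin _ _) 1).
by apply: eq_locint (locintM_prim py lc) => x _; rewrite mul1r.
Qed.

(** There are no boundary terms, as the test function vanishes near both ends. *)
Lemma test1_ibp f (y g : mR -> R) : prim y g -> test1 f ->
  \int[mu]_(x in seg 0 1) (g x * f 0%N x) = - \int[mu]_(x in seg 0 1) (y x * f 1%N x).
Proof.
move=> py tf; have [jf [e e0 se]] := tf.
have pf : prim (f 0%N) (f 1%N).
  apply: prim_of_derive => x _; first exact: jf.
  exact: jet_continuous.
have [l0 P] := prim_mul py pf.
pose x := Num.min (e / 2) 1.
have x0 : 0 < x by rewrite lt_min divr_gt0 ?ltr01.
have x1 : x <= 1 by rewrite ge_min lexx orbT.
have xe : x < e by rewrite gt_min ltr_pdivrMr// mulr_natr mulr2n ltrDl e0.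
have Z n t : t < e -> f n t = 0 by move=> te; apply: (test1_out n se); rewrite negb_and -ltNge te.
have Z1 : f 0%N 1 = 0 by apply: (test1_out 0 se); rewrite negb_and -!ltNge gtrBl e0 orbT.
have := P x; rewrite x0 x1 => /(_ isT); rewrite (Z 0%N x xe) Z1 !mulr0 sub0r.
move=> /eqP; rewrite eq_sym oppr_eq0 => /eqP.
have Zx n t : t < x -> f n t = 0 by move=> tx; rewrite Z// (lt_trans tx).
rewrite !(@test1_Rint01 f _ _ x) ?(ltW x0)//; [|exact: Zx|exact: Zx].
rewrite RintegralD//; first by move=> /eqP; rewrite addr_eq0 => /eqP.
- exact: measurable_seg.
- by apply: (test1_integrable _ (measurable_seg _ _) tf); apply: locint_locint0; case: py.
- by apply: (test1_integrable _ (measurable_seg _ _) tf); apply: locint_locint0; exact: prim_locint py.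
Qed.

Lemma test1_lin (a b : R) f g : test1 f -> test1 g -> test1 (fun n x => a * f n x + b * g n x).
Proof.
move=> [jf [e e0 se]] [jg [e' e'0 se']]; split; first exact: jet_lin.
exists (Num.min e e'); first by rewrite lt_min e0.
move=> n x; apply: contraNT => h.
have hm : Num.min e e' <= e by rewrite ge_min lexx.
have hm' : Num.min e e' <= e' by rewrite ge_min lexx orbT.
rewrite (test1_out n se) ?(test1_out n se') ?mulr0 ?addr0//; apply: contraNN h; lra.
Qed.

Lemma test1_shift f : test1 f -> test1 (fun n => f n.+1).
Proof.
move=> [jf [e e0 se]]; split; first exact: jet_shift.
by exists e => // n x; exact: se.
Qed.

(** A test function of mean zero is the derivative of a test function. *)
Lemma test1_prim f : test1 f -> \int[mu]_(x in seg 0 1) f 0%N x = 0 ->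
  exists2 g, test1 g & forall n, g n.+1 = f n.
Proof.
move=> tf f0; have [jf [e e0 se]] := tf.
pose F x := \int[mu]_(t in `]-oo, x]) f 0%N t.
have if0 (A : set mR) : measurable A -> mu.-integrable A (EFin \o f 0%N).
  move=> mA; have l1 : locint0 (cst 1 : mR -> R).
    by move=> e' _; exact: (integrable_cst_fin (measurable_seg _ _) (seg_fin _ _) 1).
  have := test1_integrable 0 mA tf l1; apply: eq_integrable => //.
  by move=> x _ /=; rewrite mul1r.
have dF x : is_derive x (1 : R) F (f 0%N x).
  have [||||d1 d2] := @continuous_FTC1 _ (f 0%N) (BInfty R true) x (x + 1).
  - by rewrite ltrDl.
  - exact: if0.
  - by rewrite /Order.lt /=.
  - exact: jet_continuous.
  by apply: DeriveDef; [exact: d1|rewrite -derive1E].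
pose g n := if n is m.+1 then f m else F.
exists g => //; split; first by case=> [|n] x; [exact: dF|exact: jf].
exists e => // -[|n] x; last exact: se.
apply: contraNT => h; apply/eqP; rewrite /g /F.
have [xe|ex] := ltP x e.
  transitivity (\int[mu]_(t in `]-oo, x]) (0 : R)); last by rewrite Rintegral_cst ?mul0r.
  apply: eq_Rintegral => t; rewrite mem_setE in_itv /= => tx.
  by apply: (test1_out 0 se); rewrite negb_and -ltNge (le_lt_trans tx xe).
rewrite -[RHS]f0 [LHS]Rintegral_mkcond [RHS]Rintegral_mkcond; apply: eq_Rintegral => t _.
rewrite /patch mem_setE in_seg in_itv /=.
have [h1|h1] := boolP (e <= t <= 1 - e).
  by rewrite !ifT//; move: h h1; rewrite negb_and -!ltNge; lra.
by rewrite (test1_out 0 se h1); case: ifP; case: ifP.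
Qed.

(** The lemma of du Bois-Reymond. *)
Lemma weak_derivative_prim (y g : mR -> R) : locint y -> locint g ->
  (forall f, test1 f -> \int[mu]_(x in seg 0 1) (g x * f 0%N x) =
     - \int[mu]_(x in seg 0 1) (y x * f 1%N x)) ->
  exists2 Y, prim Y g & {ae mu, forall x, 0 < x < 1 -> y x = Y x}.
Proof.
move=> ly lg h; have m01 := measurable_seg (0 : R) 1.
pose Y0 x := - \int[mu]_(s in seg x 1) g s.
have pY0 : prim Y0 g.
  split => // x _; rewrite /Y0 /seg set_itv1 Rintegral_set1 oppr0 sub0r.
  by [].
pose d x := 1 * y x + (-1) * Y0 x.
have ld : locint d by apply: locint_lin => //; exact: prim_locint pY0.
have l0 := locint_locint0.
have ti f n (k : mR -> R) : test1 f -> locint k ->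
    mu.-integrable (seg 0 1) (EFin \o (fun x => k x * f n x)).
  by move=> tf lk; apply: test1_integrable => //; exact: l0.
have hd f : test1 f -> \int[mu]_(x in seg 0 1) (d x * f 1%N x) = 0.
  move=> tf; have ip := test1_ibp pY0 tf; have {}h := h f tf.
  transitivity (\int[mu]_(x in seg 0 1) (1 * (y x * f 1%N x) + (-1) * (Y0 x * f 1%N x))).
    by apply: eq_Rintegral => x _; rewrite /d mulrDl -!mulrA.
  rewrite Rintegral_lin//; [|exact: ti|by apply: ti => //; exact: prim_locint pY0].
  by move: ip h => ->; lra.
have l1 : locint (cst 1 : mR -> R).
  by move=> e _; exact: (integrable_cst_fin (measurable_seg _ _) (seg_fin _ _) 1).
have [eta te e1] : exists2 f, test1 f & \int[mu]_(x in seg 0 1) (1 * f 0%N x) != 0.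
  apply: contrapT => hN.
  have : {ae mu, forall x : mR, 0 < x < 1 -> (cst 1 : mR -> R) x = 0}.
    apply: test1_sep; first exact: l0.
    by move=> f tf; apply/eqP; apply: contrapT => /negP hf; apply: hN; exists f.
  move=> [N [mN N0 sN]]; have : (mu (`]0%R, 1%R[ : set mR) <= mu N)%E.
    apply: le_measure; rewrite ?inE; [exact: (measurable_itv `]0 : R, 1[)|exact: mN|].
    move=> x; rewrite /= in_itv /= => hx; apply: sN => /(_ hx) /eqP.
    by rewrite oner_eq0.
  rewrite N0 lebesgue_measure_itv /= lte_fin ltr01 oppr0 adde0 lee_fin.
  by rewrite ler10.
set I := \int[mu]_(x in seg 0 1) (1 * eta 0%N x) in e1.
pose c := \int[mu]_(x in seg 0 1) (d x * eta 0%N x) / I.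
have dc : {ae mu, forall x, 0 < x < 1 -> 1 * d x + (- c) * cst 1 x = 0}.
  apply: test1_sep; first by apply: l0; exact: locint_lin.
  move=> f tf; pose J := \int[mu]_(x in seg 0 1) (1 * f 0%N x).
  have tp := test1_lin 1 (- (J / I)) tf te.
  have [|p tpp Ep] := test1_prim tp.
    transitivity (\int[mu]_(x in seg 0 1) (1 * (1 * f 0%N x) + (- (J / I)) * (1 * eta 0%N x))).
      by apply: eq_Rintegral => x _; rewrite !mul1r.
    rewrite Rintegral_lin//; [|exact: (ti _ _ _ tf l1)|exact: (ti _ _ _ te l1)].
    by rewrite -/I -/J mulNr divfK// mul1r subrr.
  have := hd p tpp; rewrite (Ep 0%N).
  rewrite (_ : Rintegral _ _ _ = \int[mu]_(x in seg 0 1) (1 * (d x * f 0%N x) + (- (J / I)) * (d x * eta 0%N x))); last first.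
    by apply: eq_Rintegral => x _; ring.
  rewrite Rintegral_lin//; [|exact: ti|exact: ti].
  move=> E.
  transitivity (\int[mu]_(x in seg 0 1) (1 * (d x * f 0%N x) + (- c) * (1 * f 0%N x))).
    by apply: eq_Rintegral => x _; rewrite /=; ring.
  rewrite Rintegral_lin//; [|exact: ti|exact: (ti _ _ _ tf l1)].
  rewrite -/J -[RHS]E /c; congr (_ + _); ring.
exists (fun x => 1 * Y0 x + c * 1).
  have := prim_lin 1 c pY0 (prim_cst 1); apply: eq_prim => // x _.
  by rewrite mulr0 addr0 mul1r.
apply: filterS dc => x hx x01; have := hx x01; rewrite /d /=; lra.
Qed.

End Jets.

(** * Weak derivatives and Fourier modes *)

Lemma fubini_rect_swap d1 d2 (T1 : measurableType d1) (T2 : measurableType d2) (R : realType)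
  (m1 : {sigma_finite_measure set T1 -> \bar R}) (m2 : {sigma_finite_measure set T2 -> \bar R})
  (A : set T1) (B : set T2) (f : T1 * T2 -> R) : measurable A -> measurable B ->
  (m1 \x m2)%E.-integrable (A `*` B) (EFin \o f) ->
  \int[(m1 \x m2)%E]_(z in A `*` B) f z =
  \int[m2]_(y in B) \int[m1]_(x in A) f (x, y).
Proof.
move=> mA mB intf; have mAB := measurableX mA mB.
have ig : (m1 \x m2)%E.-integrable setT ((EFin \o f) \_ (A `*` B)).
  exact/(integrable_mkcond _ mAB).
have E y : fubini_G m1 ((EFin \o f) \_ (A `*` B)) y =
    ((fun y => \int[m1]_(x in A) (f (x, y))%:E)%E \_ B) y.
  rewrite /fubini_G; under eq_integral do rewrite patch_rect.
  rewrite /patch; case: ifPn => yB; last by rewrite integral0_eq// => x _; case: ifP.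
  by rewrite [RHS]integral_mkcond.
have ae1 : {ae m2, forall y, B y -> m1.-integrable A (EFin \o (fun x => f (x, y)))}.
  apply: filterS (ae_integrable2 ig) => y + By.
  under eq_fun do rewrite patch_rect.
  rewrite /patch (mem_set By) => h; apply/(integrable_mkcond _ mA).
  exact: h.
have mG0 : measurable_fun B (fun y => \int[m1]_(x in A) (f (x, y))%:E)%E.
  by apply/(measurable_restrictT _ mB); rewrite -(funext E); exact: (measurable_fubini_G ig).
have ae2 : ae_eq m2 B (fun y => \int[m1]_(x in A) (f (x, y))%:E)%E
    (EFin \o (fun y => \int[m1]_(x in A) f (x, y))).
  apply: filterS ae1 => y /[apply] iy.
  by rewrite /= fineK// (integrable_fin_num mA iy).
have mG : measurable_fun B (EFin \o (fun y => \int[m1]_(x in A) f (x, y))).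
  apply/measurable_EFinP; apply: measurableT_comp; first exact: fine_measurable.
  exact: mG0.
rewrite {1}/Rintegral integral_mkcond -(integral21_prod_meas1 ig).
rewrite [in RHS]/Rintegral; congr fine.
have <- : (\int[m2]_(y in B) \int[m1]_(x in A) (f (x, y))%:E =
           \int[m2]_(y in B) (\int[m1]_(x in A) f (x, y))%:E)%E.
  by apply: ae_eq_integral.
by rewrite [RHS]integral_mkcond; apply: eq_integral => y _; rewrite E.
Qed.

Section TestFunctions.
Variable R : realType.
Local Notation mu := (@lebesgue_measure R).
Local Notation mR := (measurableTypeR R).
Local Notation circ := (@circ R : set mR).
Implicit Types (phi : R * R -> R) (k : int).

Lemma open_measurable_prod (O : set (R * R)) : open O -> measurable (O : set (mR * mR)).
Proof.
move=> oO.
pose box (q : (rat * rat) * (rat * rat)) : set (mR * mR) :=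
  (`]ratr q.1.1, ratr q.1.2[ : set mR) `*` (`]ratr q.2.1, ratr q.2.2[ : set mR).
have -> : O = \bigcup_q (if `[< box q `<=` O >] then box q else set0).
  apply/seteqP; split => [[x y] Oxy|z [q _]]; last by case: asboolP => // h; exact: h.
  have /nbhs_ballP[e /= e0 he] : nbhs (x, y) O by exact: open_nbhs_nbhs.
  have sub (t : R) : exists2 p : rat * rat, ratr p.1 < t < ratr p.2 &
     forall s : R, ratr p.1 < s < ratr p.2 -> ball t e s.
    have [|p1 hp1] := @rat_in_itvoo R (t - e) t; first by rewrite gtrBl.
    have [|p2 hp2] := @rat_in_itvoo R t (t + e); first by rewrite ltrDl.
    move: hp1 hp2; rewrite !in_itv /= => /andP[a1 a2] /andP[b1 b2].
    exists (p1, p2); first by rewrite a2.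
    move=> s /= /andP[c1 c2]; rewrite /ball /= ltr_distlC.
    by rewrite (lt_trans a1 c1) (lt_trans c2 b2).
  have [p hp sp] := sub x; have [p' hp' sp'] := sub y.
  exists (p, p') => //; case: asboolP => [_|[]].
    by split; rewrite /= in_itv.
  move=> [s s'] /= [h1 h2]; apply: he; split => /=.
    by apply: sp; move: h1; rewrite /= in_itv.
  by apply: sp'; move: h2; rewrite /= in_itv.
apply: countable_bigcupT_measurable => [|q]; first exact: countableP.
case: ifP => // _.
by apply: measurableX; exact: measurable_itv.
Qed.

Lemma continuous_measurable_prod phi : continuous phi ->
  measurable_fun setT (phi : mR * mR -> R).
Proof.
move=> cphi; apply: (measurability _ (RGenOInfty.measurableE R)) => _ [_ [a ->] <-].
rewrite setTI; apply: open_measurable_prod; apply: open_comp.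
  by move=> z _; exact: cphi.
exact: interval_open.
Qed.

Definition flat_out (e : R) phi := forall z, ~~ (e <= z.1 <= 1 - e) -> phi z = 0.

Lemma flat_out_theta e phi : flat_out e phi -> flat_out e (d_theta phi).
Proof.
move=> h z hz; rewrite /d_theta (_ : (fun t => _) = cst 0) ?derive1_cst//.
by apply/funext => t; rewrite h.
Qed.

Lemma flat_out_psi e phi : flat_out e phi -> flat_out e (d_psi phi).
Proof.
move=> h z hz; rewrite /d_psi derive1E (@near_eq_derive _ _ _ _ (cst 0)) ?derive_cst//.
move: hz; rewrite negb_and -!ltNge => /orP[hz|hz]; near=> x; rewrite h//= negb_and -!ltNge.
  by apply/orP; left; near: x; exact: lt_nbhsl.
by apply/orP; right; near: x; exact: lt_nbhsr.
Unshelve. all: by end_near. Qed.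

Lemma flat_out_partial e p q phi : flat_out e phi -> flat_out e (partial p q phi).
Proof.
move=> h; rewrite /partial; elim: p => [|p ih] /=; last exact: flat_out_psi.
by elim: q => [|q ih] //=; exact: flat_out_theta.
Qed.

Lemma periodic_theta phi : (forall x t, phi (x, t + 2 * pi) = phi (x, t)) ->
  forall x t, d_theta phi (x, t + 2 * pi) = d_theta phi (x, t).
Proof.
move=> h x t.
have E : (fun s : R => s^-1 *: (phi (x, s + (t + 2 * pi)) - phi (x, t + 2 * pi))) =
         (fun s : R => s^-1 *: (phi (x, s + t) - phi (x, t))).
  by apply/funext => s; rewrite addrA !h.
exact: (congr1 (fun F : R -> R => lim (F @ 0^')) E).
Qed.

Lemma periodic_partial p q phi : (forall x t, phi (x, t + 2 * pi) = phi (x, t)) ->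
  forall x t, partial p q phi (x, t + 2 * pi) = partial p q phi (x, t).
Proof.
move=> h; rewrite /partial.
have h0 : forall x t, iter q (@d_theta R) phi (x, t + 2 * pi) = iter q (@d_theta R) phi (x, t).
  by elim: q => [//|q ih]; exact: periodic_theta.
elim: p => [//|p ih] x t.
have E : (fun y : R => iter p (@d_psi R) (iter q (@d_theta R) phi) (y, t + 2 * pi)) =
         (fun y : R => iter p (@d_psi R) (iter q (@d_theta R) phi) (y, t)).
  by apply/funext => y; exact: ih.
exact: (congr1 (fun F : R -> R => derive1 F x) E).
Qed.

(** The lower bound [e] of the distance of the support to the boundary is made a
    parameter, because it determines the part of the cylinder that is integrated. *)
Definition test_in e phi := [/\ smooth phi,
  forall x t, phi (x, t + 2 * pi) = phi (x, t) & flat_out e phi].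

Lemma test_funP phi : test_fun phi <-> exists2 e, 0 < e & test_in e phi.
Proof.
split => [[s p [e e0 h]]|[e e0 [s p h]]].
  by exists e => //; split => // z; apply: contraNeq; exact: h.
by split => //; exists e => // z; apply: contraNT => /h ->.
Qed.

Variables (e : R) (phi : R * R -> R).
Hypotheses (e0 : 0 < e) (tphi : test_in e phi).

Lemma partial_bounded p q : exists M, forall z, circ z.2 -> `|partial p q phi z| <= M.
Proof.
have [s _ fo] := tphi; have [c _] := s p q.
have co : compact (`[0, 1] `*` `[0, 2 * pi] : set (R * R)).
  by apply: compact_setX; exact: segment_compact.
have ne : (`[0, 1] `*` `[0, 2 * pi] : set (R * R)) !=set0.
  by exists (0, 0); split; rewrite /= in_itv /= lexx ?ler01// ltW// pi2_gt0.
have cn : continuous (fun z => `|partial p q phi z|).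
  by move=> z; apply: cvg_norm; exact: c.
have [z0 _ hz] := compact_EVT_max ne co (continuous_subspaceT cn).
exists `|partial p q phi z0| => z cz.
have [h|h] := boolP (e <= z.1 <= 1 - e); last by rewrite (flat_out_partial p q fo h) normr0.
apply: hz; rewrite inE; split => //=; rewrite in_itv /=.
by move/andP: h => [/(le_trans (ltW e0)) -> /le_trans -> //]; rewrite gerBl ltW.
Qed.

Lemma partial_measurable p q (D : set (mR * mR)) :
  measurable_fun D (partial p q phi : mR * mR -> R).
Proof.
have [s _ _] := tphi; have [c _] := s p q.
exact: measurable_funTS (continuous_measurable_prod c).
Qed.

Lemma partial_jet q (t : R) : test1 (fun p x => partial p q phi (x, t)).
Proof.
have [s _ fo] := tphi; split.
  move=> p x; have [_ /(_ (x, t)) /= [dx _]] := s p q.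
  by apply: DeriveDef; [exact: dx|exact: (esym (derive1E _ _))].
exists e => // p x; apply: contraNT => h; apply/eqP.
exact: (flat_out_partial p q fo).
Qed.

Lemma partial_theta (x : R) q : forall t : R,
  is_derive t (1 : R) (fun t => partial 0 q phi (x, t)) (partial 0 q.+1 phi (x, t)).
Proof.
move=> t; have [s _ _] := tphi; have [_ /(_ (x, t)) /= [_ dt]] := s 0%N q.
by apply: DeriveDef; [exact: dt|exact: (esym (derive1E _ _))].
Qed.

End TestFunctions.

Section ModeDerivatives.
Variable R : realType.
Local Notation mu := (@lebesgue_measure R).
Local Notation mR := (measurableTypeR R).
Local Notation mu2 := (mu \x mu)%E.
Local Notation circ := (@circ R : set mR).
Local Notation iC := (@iC R).
Implicit Types (k : int) (w : R[i]).

Lemma Re_Mreal (z : R[i]) (x : R) : Re (z * x%:C) = Re z * x.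
Proof. by rewrite mulrC Re_realM mulrC. Qed.

Lemma Im_Mreal (z : R[i]) (x : R) : Im (z * x%:C) = Im z * x.
Proof. by rewrite mulrC Im_realM mulrC. Qed.

Lemma Im_Re (z : R[i]) : Im z = Re (- iC * z).
Proof. by case: z => a b /=; ring. Qed.

Definition ik k : R[i] := iC * (k%:~R : R)%:C.

Lemma ikN k : ik (- k) = - ik k.
Proof. by rewrite /ik rmorphN /= rmorphN mulrN. Qed.

Definition wave w k (t : R) : R := Re (w * mode k t).

Lemma wave_derive w k (t : R) : is_derive t (1 : R) (wave w k) (wave (w * ik k) k t).
Proof.
have h1 := is_deriveZ (Re w) (is_derive_Re_mode k t).
have h2 := is_deriveZ (Im w) (is_derive_Im_mode k t).
have h := is_deriveB h1 h2.
have -> : wave w k = (Re w) *: (fun t => Re (mode k t)) -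
   (Im w) *: (fun t => Im (mode k t)).
  by apply/funext => s; rewrite /wave ReM.
apply: (is_derive_eq h); rewrite /wave /ik /GRing.scale.
move: (mode k t) (k%:~R : R) => [a b] r; case: w {h h1 h2} => c d; simpl.
ring.
Qed.

Lemma wave_continuous w k : continuous (wave w k).
Proof. by apply: derive_continuous => t; exact: wave_derive. Qed.

Lemma wave2pi w k t : wave w k (t + 2 * pi) = wave w k t.
Proof. by rewrite /wave modeD2pi. Qed.

Lemma Rintegral_supp d (T : measurableType d) (m : {measure set T -> \bar R})
    (D E : set T) (f : T -> R) : D `<=` E -> (forall x, E x -> ~ D x -> f x = 0) ->
  \int[m]_(x in E) f x = \int[m]_(x in D) f x.
Proof.
move=> DE h; rewrite [LHS]Rintegral_mkcond [RHS]Rintegral_mkcond.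
apply: eq_Rintegral => x _; rewrite /patch.
have [xD|xD] := boolP (x \in D); first by rewrite ifT// inE; apply: DE; rewrite inE in xD.
case: ifPn => // xE; apply: h; first by rewrite inE in xE.
by move/mem_set; apply/negP.
Qed.

Lemma cint_supp d (T : measurableType d) (m : {measure set T -> \bar R})
    (D E : set T) (f : T -> R[i]) : D `<=` E -> (forall x, E x -> ~ D x -> f x = 0) ->
  cint m E f = cint m D f.
Proof.
by move=> DE h; congr (_ +i* _); apply: Rintegral_supp => // x Ex nDx; rewrite h.
Qed.

Lemma cint_ae d (T : measurableType d) (m : {measure set T -> \bar R})
    (D : set T) (f g : T -> R[i]) : measurable D -> cmeas D f -> cmeas D g ->
  {ae m, forall x, D x -> f x = g x} -> cint m D f = cint m D g.
Proof.
move=> mD [f1 f2] [g1 g2] fg; congr (_ +i* _); congr fine; apply: ae_eq_integral => //.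
- exact/measurable_EFinP.
- exact/measurable_EFinP.
- by apply: filterS fg => x /[apply] ->.
- exact/measurable_EFinP.
- exact/measurable_EFinP.
- by apply: filterS fg => x /[apply] ->.
Qed.

Definition cprim (y g : mR -> R[i]) :=
  prim (Re \o y) (Re \o g) /\
  prim (Im \o y) (Im \o g).

Definition clocint (y : mR -> R[i]) :=
  locint (Re \o y) /\ locint (Im \o y).

Lemma cprim_locint y g : cprim y g -> clocint y /\ clocint g.
Proof.
move=> [p1 p2]; split; split.
- exact: prim_locint p1.
- exact: prim_locint p2.
- by case: p1.
- by case: p2.
Qed.

Lemma ctest1_ibp (f : nat -> R -> R) (y g : mR -> R[i]) : cprim y g -> test1 f ->
  cint mu (seg 0 1) (fun x => g x * (f 0%N x)%:C) =
  - cint mu (seg 0 1) (fun x => y x * (f 1%N x)%:C).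
Proof.
move=> [p1 p2] tf; apply: complex_eq; rewrite ReImE.
  transitivity (\int[mu]_(x in seg 0 1) ((Re \o g) x * f 0%N x)).
    by apply: eq_Rintegral => x _; rewrite Re_Mreal.
  rewrite (test1_ibp p1 tf); congr (- _).
  by apply: eq_Rintegral => x _; rewrite Re_Mreal.
transitivity (\int[mu]_(x in seg 0 1) ((Im \o g) x * f 0%N x)).
  by apply: eq_Rintegral => x _; rewrite Im_Mreal.
rewrite (test1_ibp p2 tf); congr (- _).
by apply: eq_Rintegral => x _; rewrite Im_Mreal.
Qed.

Lemma ctest1_ibpn (f : nat -> R -> R) (r : nat -> mR -> R[i]) p :
  (forall j, (j < p)%N -> cprim (r j) (r j.+1)) -> test1 f ->
  cint mu (seg 0 1) (fun x => r p x * (f 0%N x)%:C) =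
  (-1) ^+ p * cint mu (seg 0 1) (fun x => r 0%N x * (f p x)%:C).
Proof.
elim: p f => [|p ih] f rp tf; first by rewrite expr0 mul1r.
rewrite (ctest1_ibp (rp p (ltnSn p)) tf) (ih (fun n => f n.+1)).
- by rewrite exprS mulN1r mulNr.
- by move=> j jp; apply: rp; exact: ltnW.
- exact: test1_shift.
Qed.

Lemma ctest1_int (f : nat -> R -> R) n (A : set mR) (g : mR -> R[i]) : measurable A -> test1 f ->
  locint0 (Re \o g) -> locint0 (Im \o g) ->
  cintegrable mu A (fun x => g x * (f n x)%:C).
Proof.
move=> mA tf h1 h2; split.
  have := test1_integrable n mA tf h1; apply: eq_integrable => // x _.
  by rewrite /= -Re_Mreal.
have := test1_integrable n mA tf h2; apply: eq_integrable => // x _.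
by rewrite /= -Im_Mreal.
Qed.

Lemma ctest1_sep (g : mR -> R[i]) :
  locint0 (Re \o g) -> locint0 (Im \o g) ->
  (forall f, test1 f -> cint mu (seg 0 1) (fun x => g x * (f 0%N x)%:C) = 0) ->
  {ae mu, forall x, 0 < x < 1 -> g x = 0}.
Proof.
move=> h1 h2 h.
have a1 : {ae mu, forall x, 0 < x < 1 -> (Re \o g) x = 0}.
  apply: test1_sep => // f tf; have /(congr1 Re) := h f tf.
  move=> E; rewrite -[RHS]E; apply: eq_Rintegral => x _; by rewrite Re_Mreal.
have a2 : {ae mu, forall x, 0 < x < 1 -> (Im \o g) x = 0}.
  apply: test1_sep => // f tf; have /(congr1 (Im)) := h f tf.
  move=> E; rewrite -[RHS]E; apply: eq_Rintegral => x _; by rewrite Im_Mreal.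
by apply: filterS2 a1 a2 => x b1 b2 hx; apply: complex_eq; [exact: b1|exact: b2].
Qed.

(** ** A single mode *)

Section OneMode.
Variables (e : R) (phi : R * R -> R) (e0 : 0 < e) (tphi : test_in e phi).
Local Notation A := (seg e (1 - e)).
Local Notation D := (A `*` circ).
Local Notation chi p q := (partial p q phi).

Lemma cmeas_partial p q (E : set (mR * mR)) : cmeas E (fun z => (chi p q z)%:C).
Proof. by apply: cmeasR; exact: (partial_measurable tphi). Qed.

Lemma partial_normc_bounded p q : exists M, forall z, circ z.2 -> normc ((chi p q z)%:C) <= M.
Proof.
have [M hM] := partial_bounded e0 tphi p q; exists M => z cz.
by rewrite -[X in normc X]mul1r normc_realM normc1 mul1r hM.
Qed.

Lemma cintegrable_partial p q (g : mR * mR -> R[i]) : cintegrable mu2 D g ->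
  cintegrable mu2 D (fun z => g z * (chi p q z)%:C).
Proof.
move=> ig; have [M hM] := partial_normc_bounded p q.
have mD := measurable_cyl (measurable_seg e (1 - e)).
have hM' z : D z -> normc ((chi p q z)%:C) <= M by move=> [_ /hM].
exact: (cintegrable_bounded mD (cmeas_partial p q _) hM' ig).
Qed.

Lemma theta_ibp w k q (x : R) :
  \int[mu]_(t in circ) (wave (w * ik k) k t * chi 0 q (x, t)) =
  - \int[mu]_(t in circ) (wave w k t * chi 0 q.+1 (x, t)).
Proof.
have dc := partial_theta tphi x q.
have cc j : continuous (fun t : R => chi 0 j (x, t)).
  exact: derive_continuous (partial_theta tphi x j).
pose F := wave w k * (fun t : R => chi 0 q (x, t)).
pose f (t : R) := wave (w * ik k) k t * chi 0 q (x, t) + wave w k t * chi 0 q.+1 (x, t).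
have dF (t : R) : is_derive t (1 : R) F (f t).
  apply: (is_derive_eq (is_deriveM (wave_derive w k t) (dc t))).
  by rewrite /f /GRing.scale /= addrC; congr (_ + _); rewrite mulrC.
have c1 : continuous (fun t : R => wave (w * ik k) k t * chi 0 q (x, t)).
  by move=> t; apply: cvgM; [exact: wave_continuous|exact: cc].
have c2 : continuous (fun t : R => wave w k t * chi 0 q.+1 (x, t)).
  by move=> t; apply: cvgM; [exact: wave_continuous|exact: cc].
have cf : continuous f by move=> t; apply: cvgD; [exact: c1|exact: c2].
have := ftc2 (ltW (pi2_gt0 R)) dF cf.
have -> : F (2 * pi) - F 0 = 0.
  have [_ per _] := tphi.
  rewrite /F -[2 * pi]add0r; apply/eqP; rewrite subr_eq0; apply/eqP.
  change (wave w k (0 + 2 * pi) * chi 0 q (x, 0 + 2 * pi) = wave w k 0 * chi 0 q (x, 0)).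
  by rewrite wave2pi (periodic_partial 0 q per).
rewrite /f => h; apply/eqP; rewrite -addr_eq0 -RintegralD.
- by apply/eqP; exact: h.
- exact: measurable_circ.
- exact: (continuous_integrable_itv (f := fun t => wave (w * ik k) k t * chi 0 q (x, t))).
- exact: (continuous_integrable_itv (f := fun t => wave w k t * chi 0 q.+1 (x, t))).
Qed.

Lemma cint_theta k q (x : R) :
  cint mu circ (fun t => ik k * mode k t * (chi 0 q (x, t))%:C) =
  - cint mu circ (fun t => mode k t * (chi 0 q.+1 (x, t))%:C).
Proof.
apply: complex_eq; rewrite ReImE.
  transitivity (\int[mu]_(t in circ) (wave (1 * ik k) k t * chi 0 q (x, t))).
    by apply: eq_Rintegral => t _; rewrite Re_Mreal mul1r.
  rewrite theta_ibp; congr (- _).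
  by apply: eq_Rintegral => t _; rewrite Re_Mreal /wave mul1r.
transitivity (\int[mu]_(t in circ) (wave (- iC * ik k) k t * chi 0 q (x, t))).
  by apply: eq_Rintegral => t _; rewrite Im_Mreal Im_Re /wave mulrA.
rewrite theta_ibp; congr (- _).
by apply: eq_Rintegral => t _; rewrite Im_Mreal Im_Re.
Qed.

Lemma cintegrable_theta k q (x : R) :
  cintegrable mu circ (fun t => mode k t * (chi 0 q (x, t))%:C).
Proof.
have cc : continuous (fun t : R => chi 0 q (x, t)).
  exact: derive_continuous (partial_theta tphi x q).
have ci w : mu.-integrable circ (EFin \o (fun t : R => wave w k t * chi 0 q (x, t))).
  apply: (continuous_integrable_itv (f := fun t => wave w k t * chi 0 q (x, t))) => t.
  by apply: cvgM; [exact: wave_continuous|exact: cc].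
split.
  apply: eq_integrable (ci 1); first exact: measurable_circ.
  move=> t _; apply: (congr1 EFin); symmetry.
  by apply: etrans (Re_Mreal (mode k t) _) _; rewrite /wave mul1r.
apply: eq_integrable (ci (- iC)); first exact: measurable_circ.
move=> t _; apply: (congr1 EFin); symmetry.
by apply: etrans (Im_Mreal (mode k t) _) _; rewrite Im_Re.
Qed.

Lemma cint_thetan k q (x : R) :
  ik k ^+ q * cint mu circ (fun t => mode k t * (chi 0 0 (x, t))%:C) =
  (-1) ^+ q * cint mu circ (fun t => mode k t * (chi 0 q (x, t))%:C).
Proof.
elim: q => [|q ih]; first by rewrite !expr0.
rewrite exprS -mulrA ih mulrCA -cintZ; last first.
- exact: cintegrable_theta.
- exact: measurable_circ.
under eq_fun do rewrite mulrA.
by rewrite cint_theta mulrN exprS mulN1r mulNr.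
Qed.

(** Integration by parts against a single mode: first in the angle for fixed radius, then
    in the radius for fixed angle; so only the derivatives [partial j q] occur and mixed
    partial derivatives need not be exchanged. *)
Lemma mode_wderiv k p q (r : nat -> mR -> R[i]) :
  (forall j, (j < p)%N -> cprim (r j) (r j.+1)) ->
  csqint mu A (r 0%N) -> csqint mu A (r p) ->
  ik k ^+ q * cint mu2 D (fun z => r p z.1 * mode k z.2 * (phi z)%:C) =
  (-1) ^+ (p + q) * cint mu2 D (fun z => r 0%N z.1 * mode k z.2 * (chi p q z)%:C).
Proof.
move=> rp s0 sp; have mA := measurable_seg e (1 - e); have mc := @measurable_circ R.
have fA := seg_fin e (1 - e).
have I j i l : csqint mu A (r j) ->
    cintegrable mu2 D (fun z => r j z.1 * mode k z.2 * (chi i l z)%:C).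
  move=> sj; apply: cintegrable_partial; apply: csqint_cyl_int => //.
  exact: (csqint_mode_coef mA k sj).
have I0 := I p 0%N 0%N sp; have Iq := I p 0%N q sp; have Ipq := I 0%N p q s0.
have [_ j1 ->] := cfubini mA I0.
rewrite -cintZ//.
transitivity (cint mu A (fun x => (-1) ^+ q * cint mu circ (fun t => r p x * mode k t * (chi 0 q (x, t))%:C))).
  apply: eq_cint => x _ /=.
  have E l j : cint mu circ (fun t => r j x * mode k t * (chi 0 l (x, t))%:C) =
      r j x * cint mu circ (fun t => mode k t * (chi 0 l (x, t))%:C).
    rewrite -cintZ//; last exact: cintegrable_theta.
    by apply: eq_cint => t _; rewrite mulrA.
  by rewrite (E 0%N p) (E q p) mulrCA cint_thetan mulrCA.
have [_ j2 E2] := cfubini mA Iq.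
rewrite cintZ// -E2.
have sw (g : mR * mR -> R[i]) : cintegrable mu2 D g ->
   cint mu2 D g = cint mu circ (fun t => cint mu A (fun x => g (x, t))).
  move=> [h1 h2]; apply: complex_eq.
    exact: (@fubini_rect_swap _ _ mR mR R mu mu A circ _ mA mc h1).
  exact: (@fubini_rect_swap _ _ mR mR R mu mu A circ _ mA mc h2).
rewrite (sw _ Iq) addnC exprD -mulrA; congr (_ * _).
have mD := measurable_cyl mA.
rewrite -(cintZ mD _ Ipq) (sw _ (cintegrableZ mD _ Ipq)).
apply: eq_cint => t ct; rewrite inE in ct.
have In j i l : csqint mu A (r j) -> cintegrable mu A (fun x => r j x * (chi i l (x, t))%:C).
  move=> sj; have [M hM] := partial_normc_bounded i l.
  have ms : cmeas A (fun x => (chi i l (x, t))%:C).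
    have [m1 m2] := cmeas_partial i l setT.
    by split; apply: measurable_funTS; [exact: (measurable_fun_pair1 t m1)|exact: (measurable_fun_pair1 t m2)].
  have hM' x : A x -> normc ((chi i l (x, t))%:C) <= M by move=> _; exact: (hM (x, t)).
  exact: (cintegrable_bounded mA ms hM' (csqint_integrable mA fA sj)).
have E j i l : csqint mu A (r j) -> cint mu A (fun x => r j x * mode k t * (chi i l (x, t))%:C) =
    mode k t * cint mu (seg 0 1) (fun x => r j x * (chi i l (x, t))%:C).
  move=> sj; rewrite (@cint_supp _ _ _ A).
  - rewrite -(cintZ mA _ (In j i l sj)); apply: eq_cint => x _.
    by rewrite mulrA [mode k t * _]mulrC.
  - by move=> x; rewrite !segE => /andP[/(le_trans (ltW e0)) -> /le_trans -> //]; rewrite gerBl ltW.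
  - move=> x _ nA; have h : ~~ (e <= x <= 1 - e) by apply/negP => h; apply: nA; rewrite segE.
    by have [_ _ fo] := tphi; rewrite (flat_out_partial i l fo (z := (x, t)) h) mulr0.
rewrite (cintZ mA _ _) /=; last first.
  have := In 0%N p q s0 => /(cintegrableZ mA (mode k t)); congr (cintegrable _ _ _).
  by apply/funext => x; rewrite mulrA [mode k t * _]mulrC.
rewrite (E p 0%N q sp) (E 0%N p q s0).
by rewrite (ctest1_ibpn rp (partial_jet e0 tphi q t)) mulrCA.
Qed.

End OneMode.

End ModeDerivatives.
Arguments ik {R} k.

(** ** Coefficients of weak derivatives *)

Section CoefficientsOfWeakDerivatives.
Variable R : realType.
Local Notation mu := (@lebesgue_measure R).
Local Notation mR := (measurableTypeR R).
Local Notation mu2 := (mu \x mu)%E.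
Local Notation circ := (@circ R : set mR).
Local Notation iC := (@iC R).
Local Notation Pi := (seg (0 : R) 1 `*` circ).
Local Notation cyl e := (seg e (1 - e) `*` circ).
Implicit Types (k : int) (w : R[i]) (u g U G : mR * mR -> R[i]).

Definition tens (f g : nat -> R -> R) (z : R * R) : R := f 0%N z.1 * g 0%N z.2.

Lemma partial_tens (f g : nat -> R -> R) p q : jet f -> jet g ->
  partial p q (tens f g) = fun z => f p z.1 * g q z.2.
Proof.
move=> jf jg; rewrite /partial.
have -> : iter q (@d_theta R) (tens f g) = fun z => f 0%N z.1 * g q z.2.
  elim: q => [//|q ih]; rewrite iterS ih; apply/funext => z; rewrite /d_theta derive1E.
  by have [_ E] := is_deriveZ (f 0%N z.1) (jg q z.2); exact: E.
elim: p => [//|p ih]; rewrite iterS ih; apply/funext => z; rewrite /d_psi derive1E mulrC.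
have EF : (fun x : R => f p (x, z.2).1 * g q (x, z.2).2) = g q z.2 *: f p.
  by apply/funext => x; rewrite /= mulrC.
by rewrite EF; have [_ E] := is_deriveZ (g q z.2) (jf p z.1); exact: E.
Qed.

Lemma tens_test (f g : nat -> R -> R) e : jet f -> jet g ->
  (forall n x, f n x != 0 -> e <= x <= 1 - e) ->
  (forall t, g 0%N (t + 2 * pi) = g 0%N t) -> test_in e (tens f g).
Proof.
move=> jf jg se pg; split; first last.
- by move=> z h; rewrite /tens (test1_out 0 se h) mul0r.
- by move=> x t; rewrite /tens /= pg.
move=> p q; rewrite partial_tens//; split.
  move=> z; apply: cvgM.
    apply: (@cvg_comp _ _ _ fst (f p) _ (nbhs z.1)); first exact: cvg_fst.
    exact: (jet_continuous jf).
  apply: (@cvg_comp _ _ _ snd (g q) _ (nbhs z.2)); first exact: cvg_snd.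
  exact: (jet_continuous jg).
move=> z; split.
  have -> : (fun x => f p (x, z.2).1 * g q (x, z.2).2) = (g q z.2) *: f p.
    by apply/funext => x; rewrite /= mulrC.
  by have [] := is_deriveZ (g q z.2) (jf p z.1).
by have [] := is_deriveZ (f p z.1) (jg q z.2).
Qed.

Lemma jet_wave w k : jet (fun q => wave (w * ik k ^+ q) k).
Proof. by move=> q t; have := wave_derive (w * ik k ^+ q) k t; rewrite -mulrA -exprSr. Qed.

Lemma wave_pair w k t : (wave w k t)%:C + iC * (wave (- iC * w) k t)%:C = w * mode k t.
Proof.
rewrite /wave -mulrA -Im_Re; move: (w * mode k t) => [a b].
by apply: complex_eq; rewrite /=; ring.
Qed.

Lemma loc_integrable_cyl g e : loc_integrable (g : R * R -> R[i]) -> 0 < e ->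
  cintegrable mu2 (cyl e) g.
Proof.
move=> [[m1 m2 _] h] e0; have mD := measurable_cyl (measurable_seg e (1 - e)).
have sub : cyl e `<=` Pi.
  move=> z []; rewrite !segE => /andP[a1 a2] cz; split => //=.
  by rewrite segE (le_trans (ltW e0) a1) (le_trans a2)// gerBl ltW.
have cm : cmeas (cyl e) g.
  have mP := measurable_cyl (measurable_seg (0 : R) 1).
  by split; [exact: (measurable_funS mP sub m1)|exact: (measurable_funS mP sub m2)].
have [c1 c2] := cm.
have ig : mu2.-integrable (cyl e) (EFin \o (fun z => normc (g z))).
  apply/integrableP; split; first by apply/measurable_EFinP; exact: cmeas_normc.
  apply: le_lt_trans (h e e0); apply: ge0_le_integral => //.
  - by apply/measurable_EFinP; apply: measurableT_comp => //; exact: cmeas_normc.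
  - by apply/measurable_EFinP; exact: cmeas_normc.
  - by move=> z _; rewrite /= ger0_norm ?normc_ge0.
split.
  by apply: (integrable_of_bound mD c1 ig) => z _; exact: normc_Re.
by apply: (integrable_of_bound mD c2 ig) => z _; exact: normc_Im.
Qed.

Lemma Pi_int_cyl (F : mR * mR -> R[i]) e : 0 < e ->
  (forall z : mR * mR, ~~ (e <= z.1 <= 1 - e) -> F z = 0) -> Pi_int F = cint mu2 (cyl e) F.
Proof.
move=> e0 h; rewrite -(@cint_supp _ _ _ _ (cyl e) Pi)//.
  move=> z [] /=; rewrite !segE => /andP[a1 a2] cz; split => //=.
  by rewrite (le_trans (ltW e0) a1) (le_trans a2)// gerBl ltW.
by move=> z [_ cz] nz; apply: h; apply/negP => hz; apply: nz; split => //=; rewrite segE.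
Qed.

Lemma coef_locint0 g k : (forall e, 0 < e -> cintegrable mu2 (cyl e) g) ->
  locint0 (Re \o coef g k) /\ locint0 (Im \o coef g k).
Proof.
move=> ig; split => e e0; have [] := cintegrable_coef (measurable_seg e (1 - e)) k (ig e e0) => //.
Qed.

Lemma cint_tens_mode g k (f : nat -> R -> R) n e : test1 f -> 0 < e ->
  (forall n x, f n x != 0 -> e <= x <= 1 - e) -> cintegrable mu2 (cyl e) g ->
  cint mu2 (cyl e) (fun z => g z * (f n z.1)%:C * mode (- k) z.2) =
  (2 * pi)%:C * cint mu (seg 0 1) (fun x => coef g k x * (f n x)%:C).
Proof.
move=> tf e0 se ig; have mA := measurable_seg e (1 - e); have mD := measurable_cyl mA.
have [M hM] := test1_bounded n tf; have [jf _] := tf.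
have mf : measurable_fun (seg e (1 - e)) (f n : mR -> R).
  by apply: measurable_funTS; exact: (continuous_measurable_fun (jet_continuous jf)).
have hM' (z : mR * mR) : cyl e z -> normc ((f n z.1)%:C) <= M.
  by move=> _; rewrite -[X in normc X]mul1r normc_realM normc1 mul1r hM.
have igf := cintegrable_bounded mD (cmeas_fst mA (cmeasR mf)) hM' ig.
have [a1 a2 ->] := cfubini mA (cintegrable_mode2 mA (- k) igf).
have [b1 b2 _] := cfubini mA (cintegrable_mode2 mA (- k) ig).
have hM1 (x : mR) : seg e (1 - e) x -> normc ((f n x)%:C) <= M.
  by move=> _; rewrite -[X in normc X]mul1r normc_realM normc1 mul1r hM.
have iR := cintegrable_bounded mA (cmeasR mf) hM1 (cintegrable_coef mA k ig).
rewrite (@cint_supp _ _ _ _ (seg e (1 - e)) (seg 0 1)).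
- rewrite -cintZ//; apply: cint_ae => //.
  + exact: cintegrable_meas a2.
  + by apply: cintegrable_meas; apply: (cintegrableZ mA); exact: iR.
  apply: filterS b1 => x hx Ax.
  transitivity (cint mu circ (fun t => (f n x)%:C * (g (x, t) * mode (- k) t))).
    by apply: eq_cint => t _; rewrite -mulrA mulrCA.
  rewrite cintZ; [|exact: measurable_circ|exact: hx].
  have e1 : (2 * pi : R)%:C * ((2 * pi)^-1)%:C = 1.
    by rewrite -rmorphM mulfV ?rmorph1// gt_eqF// pi2_gt0.
  by rewrite coefE [RHS]mulrA [X in _ = X * _]mulrA e1 mul1r mulrC.
- move=> x; rewrite !segE => /andP[/(le_trans (ltW e0)) -> /le_trans -> //].
  by rewrite gerBl ltW.
- move=> x _ nA; rewrite (test1_out n se) ?mulr0//.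
  by apply/negP => h; apply: nA; rewrite segE.
Qed.

(** Testing against [f(psi) e^(-ik theta)], whose real and imaginary parts are test functions. *)
Lemma wderiv_mode_test p q U g k (f : nat -> R -> R) : is_wderiv p q (U : R * R -> R[i]) g ->
  test1 f ->
  cint mu (seg 0 1) (fun x => coef g k x * (f 0%N x)%:C) =
  (-1) ^+ p * ik k ^+ q * cint mu (seg 0 1) (fun x => coef U k x * (f p x)%:C).
Proof.
move=> [lU lg h] tf; have [jf [e e0 se]] := tf.
have iU := loc_integrable_cyl lU e0; have ig := loc_integrable_cyl lg e0.
have mA := measurable_seg e (1 - e); have mD := measurable_cyl mA.
pose T n v w := cint mu2 (cyl e) (fun z => v z * (f n z.1 * wave w (- k) z.2)%:C).
have step w : T 0%N g w = (-1) ^+ (p + q) * T p U (w * ik (- k) ^+ q).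
  pose W := fun q => wave (w * ik (- k) ^+ q) (- k).
  have tt : test_in e (tens f W).
    by apply: tens_test => //; [exact: jet_wave|move=> t; rewrite /W wave2pi].
  have := h (tens f W); rewrite (test_funP (tens f W)) => /(_ (ex_intro2 _ _ e e0 tt)).
  rewrite partial_tens//; last exact: jet_wave.
  rewrite !(@Pi_int_cyl _ e)//.
  - move=> E; have <- : cint mu2 (cyl e) (fun z => g z * (tens f W z)%:C) = T 0%N g w.
      by apply: eq_cint => z _; rewrite /tens /W expr0 mulr1.
    exact: E.
  - by move=> z hz; rewrite (test1_out p se hz) mul0r mulr0.
  - by move=> z hz; rewrite /tens (test1_out 0 se hz) mul0r mulr0.
have M2 n v w : cintegrable mu2 (cyl e) v ->
   w * cint mu2 (cyl e) (fun z => v z * (f n z.1)%:C * mode (- k) z.2) =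
   T n v w + iC * T n v (- iC * w).
  move=> iv; have [M hM] := test1_bounded n tf.
  have mf : measurable_fun (seg e (1 - e)) (f n : mR -> R).
    by apply: measurable_funTS; exact: (continuous_measurable_fun (jet_continuous jf)).
  have hM' (z : mR * mR) : cyl e z -> normc ((f n z.1)%:C) <= M.
    by move=> _; rewrite -[X in normc X]mul1r normc_realM normc1 mul1r hM.
  have ivf := cintegrable_bounded mD (cmeas_fst mA (cmeasR mf)) hM' iv.
  have hw v' (z : mR * mR) : cyl e z -> normc ((wave v' (- k) z.2)%:C) <= normc v'.
    move=> _; rewrite -[X in normc X]mul1r normc_realM normc1 mul1r.
    by apply: le_trans (normc_Re _) _; rewrite normcM normc_mode mulr1.
  have mw v' : cmeas (cyl e) (fun z => (wave v' (- k) z.2)%:C).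
    apply: (@cmeas_snd R _ (fun t => (wave v' (- k) t)%:C)); apply: cmeasR.
    by apply: measurable_funTS; exact: (continuous_measurable_fun (@wave_continuous R v' (- k))).
  have iT v' : cintegrable mu2 (cyl e) (fun z => v z * (f n z.1 * wave v' (- k) z.2)%:C).
    have := cintegrable_bounded mD (mw v') (@hw v') ivf; congr (cintegrable _ _ _).
    by apply/funext => z; rewrite rmorphM mulrA.
  rewrite /T -cintZ//; last exact: cintegrable_mode2.
  rewrite -cintZ// -cintD//; last exact: cintegrableZ.
  apply: eq_cint => z _; rewrite !rmorphM /=.
  transitivity (v z * (f n z.1)%:C * ((wave w (- k) z.2)%:C + iC * (wave (- iC * w) (- k) z.2)%:C)).
    by rewrite wave_pair; ring.
  by ring.
have E := M2 0%N g 1 ig.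
rewrite mul1r !step mulr1 in E.
have E2 := M2 p U (1 * ik (- k) ^+ q) iU.
rewrite mulrA mulr1 in E2.
have {}E : cint mu2 (cyl e) (fun z => g z * (f 0%N z.1)%:C * mode (- k) z.2) =
   (-1) ^+ (p + q) * (ik (- k) ^+ q * cint mu2 (cyl e) (fun z => U z * (f p z.1)%:C * mode (- k) z.2)).
  rewrite E; move: E2; rewrite mul1r => ->.
  by rewrite mulrDr; congr (_ + _); rewrite mulrCA.
move: E; rewrite (cint_tens_mode k 0 tf e0 se ig) (cint_tens_mode k p tf e0 se iU).
have p0 : (2 * pi : R)%:C != 0.
  by rewrite (inj_eq (@complexI R)) gt_eqF// pi2_gt0.
move=> E; apply: (mulfI p0); rewrite E ikN (exprNn (ik k)) exprD.
have s2 : (-1) ^+ q * (-1) ^+ q = 1 :> R[i] by rewrite -expr2 sqrr_sign.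
set X := cint _ _ _.
transitivity (((-1) ^+ q * (-1) ^+ q) * ((2 * pi)%:C * ((-1) ^+ p * ik k ^+ q * X))); first by ring.
by rewrite s2 mul1r.
Qed.

(** If the modes of [U] are absolutely continuous, then those of the weak derivative are the
    classical derivatives, multiplied by the symbol of the angular derivative. *)
Lemma coef_wderiv p q U g k (r : nat -> mR -> R[i]) : is_wderiv p q (U : R * R -> R[i]) g ->
  (forall j, (j < p)%N -> cprim (r j) (r j.+1)) -> clocint (r 0%N) ->
  {ae mu, forall x, 0 < x < 1 -> coef U k x = r 0%N x} ->
  {ae mu, forall x, 0 < x < 1 -> coef g k x = ik k ^+ q * r p x}.
Proof.
move=> wd rp l0 ae0; have [lU lg _] := wd.
have lp : clocint (r p).
  by case: p rp {wd} => [//|p] rp; have [_] := cprim_locint (rp p (ltnSn p)).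
have [g1 g2] := coef_locint0 k (fun e => loc_integrable_cyl lg (e := e)).
have [u1 u2] := coef_locint0 k (fun e => loc_integrable_cyl lU (e := e)).
have m01 := measurable_seg (0 : R) 1.
pose h x := coef g k x - ik k ^+ q * r p x.
have [r1 r2] := lp.
have hl : locint0 (Re \o h) /\ locint0 (Im \o h).
  have H e : 0 < e -> cintegrable mu (seg e (1 - e)) h.
    move=> e0; apply: cintegrableB; [exact: measurable_seg|split; [exact: g1|exact: g2]|].
    apply: cintegrableZ; first exact: measurable_seg.
    by split; [exact: (locint_locint0 r1)|exact: (locint_locint0 r2)].
  by split => e e0; have [] := H e e0.
have [h1 h2] := hl.
have Z : {ae mu, forall x, 0 < x < 1 -> h x = 0}.
  apply: ctest1_sep => // f tf.
  have if0 := ctest1_int 0 m01 tf g1 g2.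
  have rf0 := ctest1_int 0 m01 tf (locint_locint0 r1) (locint_locint0 r2).
  have ufp := ctest1_int p m01 tf u1 u2.
  have [r01 r02] := l0.
  have rfp := ctest1_int p m01 tf (locint_locint0 r01) (locint_locint0 r02).
  transitivity (cint mu (seg 0 1) (fun x => coef g k x * (f 0%N x)%:C - ik k ^+ q * (r p x * (f 0%N x)%:C))).
    by apply: eq_cint => x _; rewrite /h mulrBl mulrA.
  rewrite cintB//; last exact: cintegrableZ.
  rewrite cintZ// (wderiv_mode_test k wd tf) (ctest1_ibpn rp tf).
  rewrite (_ : cint _ _ (fun x => coef U k x * _) = cint mu (seg 0 1) (fun x => r 0%N x * (f p x)%:C)); first by ring.
  apply: cint_ae => //; [exact: cintegrable_meas ufp|exact: cintegrable_meas rfp|].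
  apply: filterS ae0 => x hx; rewrite segE => x01.
  have [xi|xo] := boolP (0 < x < 1); first by rewrite hx.
  have [_ [e e0 se]] := tf; rewrite (test1_out p se) ?mulr0//.
  apply: contra xo => /andP[a1 a2]; rewrite (lt_le_trans e0 a1) (le_lt_trans a2)// gtrBl//.
by apply: filterS Z => x hx x01; apply/eqP; rewrite -subr_eq0 -/(h x) hx.
Qed.

Lemma ae_prim (y g h : mR -> R) : prim y g -> locint h ->
  {ae mu, forall x, 0 < x < 1 -> g x = h x} -> prim y h.
Proof.
move=> [lg P] lh gh; split => // x x01; rewrite P//; congr (_ - fine _).
move/andP: x01 => [x0 x1].
have N1 : {ae mu, forall x : mR, x <> 1}.
  exists [set 1]; split; [exact: measurable_set1|exact: lebesgue_measure_set1|].
  by move=> t /= /contrapT.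
have m1 := measurable_seg x 1.
apply: ae_eq_integral => //.
- by have /integrableP[] := lg x x0.
- by have /integrableP[] := lh x x0.
- apply: filterS2 gh N1 => t ht t1; rewrite segE => /andP[xt t1']; rewrite /= ht//.
  by rewrite (lt_le_trans x0 xt) lt_neqAle t1' andbT; apply/eqP.
Qed.

(** The modes of the weak radial derivatives form a chain of absolutely continuous functions. *)
Lemma wderiv_chain m U (g : nat -> mR * mR -> R[i]) k :
  (forall p, (p <= m)%N -> is_wderiv p 0 (U : R * R -> R[i]) (g p)) ->
  (forall p, (p <= m)%N -> clocint (coef (g p) k)) ->
  exists r, [/\ forall j, (j < m)%N -> cprim (r j) (r j.+1),
    forall j, (j <= m)%N -> clocint (r j) &
    forall j, (j <= m)%N -> {ae mu, forall x, 0 < x < 1 -> coef (g j) k x = r j x}].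
Proof.
move=> wd lc.
have E p f : (p <= m)%N -> test1 f ->
    cint mu (seg 0 1) (fun x => coef (g p) k x * (f 0%N x)%:C) =
    (-1) ^+ p * cint mu (seg 0 1) (fun x => coef U k x * (f p x)%:C).
  by move=> pm tf; rewrite (wderiv_mode_test k (wd p pm) tf) expr0 mulr1.
have S p : (p < m)%N -> exists Y, cprim Y (coef (g p.+1) k) /\
    {ae mu, forall x, 0 < x < 1 -> coef (g p) k x = Y x}.
  move=> pm.
  have W f : test1 f -> cint mu (seg 0 1) (fun x => coef (g p.+1) k x * (f 0%N x)%:C) =
     - cint mu (seg 0 1) (fun x => coef (g p) k x * (f 1%N x)%:C).
    by move=> tf; rewrite E// (E p _ (ltnW pm) (test1_shift tf)) exprS mulN1r mulNr.
  have [a1 a2] := lc p (ltnW pm); have [b1 b2] := lc p.+1 pm.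
  have [|Y1 p1 e1] := weak_derivative_prim a1 b1.
    move=> f tf; have /(congr1 Re) := W f tf; rewrite ReImE => W1.
    transitivity (Re (cint mu (seg 0 1) (fun x => coef (g p.+1) k x * (f 0%N x)%:C))).
      by apply: eq_Rintegral => x _; rewrite Re_Mreal.
    by rewrite W1; congr (- _); apply: eq_Rintegral => x _; rewrite Re_Mreal.
  have [|Y2 p2 e2] := weak_derivative_prim a2 b2.
    move=> f tf; have /(congr1 (Im)) := W f tf; rewrite ReImE => W1.
    transitivity (Im (cint mu (seg 0 1) (fun x => coef (g p.+1) k x * (f 0%N x)%:C))).
      by apply: eq_Rintegral => x _; rewrite Im_Mreal.
    by rewrite W1; congr (- _); apply: eq_Rintegral => x _; rewrite Im_Mreal.
  exists (fun x => Y1 x +i* Y2 x); split; first by split.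
  by apply: filterS2 e1 e2 => x h1 h2 hx; apply: complex_eq; [exact: h1|exact: h2].
pose Q p Y := (p < m)%N -> cprim Y (coef (g p.+1) k) /\
    {ae mu, forall x, 0 < x < 1 -> coef (g p) k x = Y x}.
have /choice[Y HY] : forall p, exists Y, Q p Y.
  move=> p; have [pm|pm] := boolP (p < m)%N; last by exists (fun=> 0) => h; rewrite h in pm.
  by have [Y hY] := S p pm; exists Y.
pose r j := if (j < m)%N then Y j else coef (g j) k.
have rl j : (j <= m)%N -> clocint (r j).
  move=> jm; rewrite /r; case: ifPn => h; last exact: lc.
  by have [h1 _] := HY j h; have [] := cprim_locint h1.
have rae j : (j <= m)%N -> {ae mu, forall x, 0 < x < 1 -> coef (g j) k x = r j x}.
  move=> jm; rewrite /r; case: ifPn => h; last by apply: aeW.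
  by have [_] := HY j h.
exists r; split => // j jm; have [[p1 p2] _] := HY j jm.
have [l1 l2] := rl j.+1 jm; have ae := rae j.+1 jm.
have rj : r j = Y j by rewrite /r jm.
rewrite rj; split.
  by apply: ae_prim p1 l1 _; apply: filterS ae => x hx x01; exact: (congr1 Re (hx x01)).
by apply: ae_prim p2 l2 _; apply: filterS ae => x hx x01; exact: (congr1 (Im) (hx x01)).
Qed.

(** ** Weak derivatives from modes *)

Lemma csqint_ae (A : set mR) (f g : mR -> R[i]) : measurable A -> cmeas A g ->
  {ae mu, forall x, A x -> f x = g x} -> csqint mu A f -> csqint mu A g.
Proof.
move=> mA [m1 m2] fg [s1 s2]; split.
  by apply: (sqint_ae mA m1 _ s1); apply: filterS fg => x h Ax; rewrite /= (h Ax).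
by apply: (sqint_ae mA m2 _ s2); apply: filterS fg => x h Ax; rewrite /= (h Ax).
Qed.

Lemma cint_real_CS d (T : measurableType d) (m : {measure set T -> \bar R}) (D : set T)
    (f : T -> R[i]) (c : T -> R) : measurable D -> csqint m D f -> sqint m D c ->
  normc (cint m D (fun z => f z * (c z)%:C)) ^+ 2 <= csqn m D f * \int[m]_(z in D) (c z ^+ 2).
Proof.
move=> mD sf sc; rewrite normc2 (csqn_ReIm mD sf) mulrDl; have [s1 s2] := sf.
apply: lerD.
  apply: le_trans (cauchy_schwarz_sqint mD s1 sc); rewrite le_eqVlt; apply/orP; left.
  by apply/eqP; congr (_ ^+ 2); apply: eq_Rintegral => z _; rewrite Re_Mreal.
apply: le_trans (cauchy_schwarz_sqint mD s2 sc); rewrite le_eqVlt; apply/orP; left.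
by apply/eqP; congr (_ ^+ 2); apply: eq_Rintegral => z _; rewrite Im_Mreal.
Qed.

Lemma normc2_sub (v w : R[i]) : normc (v - w) ^+ 2 <= 2 * normc v ^+ 2 + 2 * normc w ^+ 2.
Proof.
rewrite !normc2 !ReImE; move: (Re v) (Im v) (Re w) (Im w) => v1 v2 w1 w2.
rewrite -subr_ge0 (_ : _ - _ = (v1 + w1) ^+ 2 + (v2 + w2) ^+ 2); last by ring.
by rewrite addr_ge0 ?sqr_ge0.
Qed.

Lemma ae_fst (A : set mR) (c c' : mR -> R[i]) : measurable A -> cmeas A c -> cmeas A c' ->
  {ae mu, forall x, A x -> c x = c' x} ->
  {ae mu2, forall z : mR * mR, (A `*` circ) z -> c z.1 = c' z.1}.
Proof.
move=> mA mc mc' h.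
have Z : {ae mu2, forall z : mR * mR, (A `*` circ) z -> c z.1 - c' z.1 = 0}.
  apply: (ae_cyl mA); first exact: (cmeas_fst mA (cmeasB mc mc')).
  by apply: filterS h => x hx Ax; apply: aeW => t _; rewrite hx// subrr.
by apply: filterS Z => z hz Dz; apply/eqP; rewrite -subr_eq0 hz.
Qed.

Lemma ae_seg (P : mR -> Prop) e : 0 < e -> {ae mu, forall x, 0 < x < 1 -> P x} ->
  {ae mu, forall x, seg e (1 - e) x -> P x}.
Proof.
move=> e0; apply: filterS => x h; rewrite segE => /andP[a1 a2]; apply: h.
by rewrite (lt_le_trans e0 a1) (le_lt_trans a2)// gtrBl.
Qed.

Lemma csqint_loc_integrable (u : R * R -> R[i]) : Pi_fun u ->
  (forall e, 0 < e -> csqint mu2 (cyl e) u) -> loc_integrable u.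
Proof.
move=> pu h; split => // e e0; have mA := measurable_seg e (1 - e).
have fD := cyl_fin mA (seg_fin e (1 - e)).
have := sqint_integrable (measurable_cyl mA) fD (csqint_sqint (measurable_cyl mA) (h e e0)).
move=> /integrableP[_]; apply: le_lt_trans.
rewrite le_eqVlt; apply/orP; left; apply/eqP; apply: eq_integral => z _.
by rewrite /= ger0_norm ?normc_ge0.
Qed.

(** Conversely, the modes determine the weak derivatives: by convergence of the Fourier series
    in [L^2] it suffices to integrate by parts against single modes. *)
Lemma mode_is_wderiv p q U G (r : int -> nat -> mR -> R[i]) :
  Pi_fun (U : R * R -> R[i]) -> Pi_fun (G : R * R -> R[i]) ->
  (forall e, 0 < e -> csqint mu2 (cyl e) U) -> (forall e, 0 < e -> csqint mu2 (cyl e) G) ->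
  (forall k j, (j < p)%N -> cprim (r k j) (r k j.+1)) ->
  (forall k e, 0 < e -> csqint mu (seg e (1 - e)) (r k 0%N)) ->
  (forall k e, 0 < e -> csqint mu (seg e (1 - e)) (r k p)) ->
  (forall k, {ae mu, forall x, 0 < x < 1 -> coef U k x = r k 0%N x}) ->
  (forall k, {ae mu, forall x, 0 < x < 1 -> coef G k x = ik k ^+ q * r k p x}) ->
  is_wderiv p q (U : R * R -> R[i]) G.
Proof.
move=> pU pG sU sG rp s0 sp cU cG.
split; [exact: csqint_loc_integrable|exact: csqint_loc_integrable|].
move=> phi /test_funP[e e0 tphi]; have [_ _ fo] := tphi.
have mA := measurable_seg e (1 - e); have mD := measurable_cyl mA.
have fA := seg_fin e (1 - e); have fD := cyl_fin mA fA.
rewrite !(@Pi_int_cyl _ e)//; first last.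
- by move=> z hz; rewrite (fo z hz) mulr0.
- by move=> z hz; rewrite (flat_out_partial p q fo hz) mulr0.
have sq i j : sqint mu2 (cyl e) (partial i j phi : mR * mR -> R).
  have [M hM] := partial_bounded e0 tphi i j.
  have hM' (z : mR * mR) : cyl e z -> `|partial i j phi z| <= M by move=> [_ /hM].
  exact: (sqint_bounded_fun mD fD (partial_measurable tphi i j (D := cyl e)) hM').
have cmr k j : csqint mu (seg e (1 - e)) (r k j) -> cmeas (seg e (1 - e)) (r k j).
  exact: csqint_meas.
have TM k i j (c c' : mR -> R[i]) : csqint mu (seg e (1 - e)) c -> csqint mu (seg e (1 - e)) c' ->
   {ae mu, forall x, seg e (1 - e) x -> c x = c' x} ->
   cint mu2 (cyl e) (fun z => c z.1 * mode k z.2 * (partial i j phi z)%:C) =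
   cint mu2 (cyl e) (fun z => c' z.1 * mode k z.2 * (partial i j phi z)%:C).
  move=> sc sc' h.
  have I c0 : csqint mu (seg e (1 - e)) c0 ->
      cmeas (cyl e) (fun z => c0 z.1 * mode k z.2 * (partial i j phi z)%:C).
    move=> s; apply: cmeasM; last exact: (cmeas_partial tphi).
    exact: (csqint_meas (csqint_mode_coef mA k s)).
  apply: cint_ae => //; [exact: I|exact: I|].
  have := ae_fst mA (csqint_meas sc) (csqint_meas sc') h.
  by apply: filterS => z hz Dz; rewrite (hz Dz).
have S N i j (u : mR * mR -> R[i]) : csqint mu2 (cyl e) u ->
   cint mu2 (cyl e) (fun z => trig2 (coef u) N z * (partial i j phi z)%:C) =
   symsum (fun k => cint mu2 (cyl e) (fun z => coef u k z.1 * mode k z.2 * (partial i j phi z)%:C)) N.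
  move=> su; rewrite /symsum -cint_sum//.
    by apply: eq_cint => z _; rewrite /trig2 /trigsum /symsum mulr_suml.
  move=> l; apply: (cintegrable_partial e0 tphi); apply: csqint_cyl_int => //.
  exact: (csqint_mode_coef mA _ (csqint_coef mA fA _ su)).
have SE N : cint mu2 (cyl e) (fun z => trig2 (coef G) N z * (partial 0 0 phi z)%:C) =
  (-1) ^+ (p + q) * cint mu2 (cyl e) (fun z => trig2 (coef U) N z * (partial p q phi z)%:C).
  rewrite (S _ _ _ _ (sG e e0)) (S _ _ _ _ (sU e e0)) /symsum mulr_sumr.
  apply: eq_bigr => l _; set k := Posz l - Posz N.
  have cGk := csqint_coef mA fA k (sG e e0); have cUk := csqint_coef mA fA k (sU e e0).
  rewrite (TM k 0%N 0%N _ _ cGk (csqintZ mA (ik k ^+ q) (sp k e e0)) (ae_seg e0 (cG k))).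
  rewrite (TM k p q _ _ cUk (s0 k e e0) (ae_seg e0 (cU k))).
  rewrite -(mode_wderiv e0 tphi k q (rp k) (s0 k e e0) (sp k e e0)) -cintZ//.
    by apply: eq_cint => z _; rewrite !mulrA.
  apply: (cintegrable_partial e0 tphi 0 0); apply: csqint_cyl_int => //.
  exact: (csqint_mode_coef mA k (sp k e e0)).
have B i j (u : mR * mR -> R[i]) N : csqint mu2 (cyl e) u ->
   normc (cint mu2 (cyl e) (fun z => u z * (partial i j phi z)%:C) -
     cint mu2 (cyl e) (fun z => trig2 (coef u) N z * (partial i j phi z)%:C)) ^+ 2 <=
   csqn mu2 (cyl e) (fun z => u z - trig2 (coef u) N z) * \int[mu2]_(z in cyl e) (partial i j phi z ^+ 2).
  move=> su; have st : csqint mu2 (cyl e) (trig2 (coef u) N).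
    by apply: (csqint_trig2 mA) => k; exact: csqint_coef.
  have I v : csqint mu2 (cyl e) v -> cintegrable mu2 (cyl e) (fun z => v z * (partial i j phi z)%:C).
    by move=> sv; apply: (cintegrable_partial e0 tphi); exact: csqint_cyl_int.
  rewrite -(cintB mD (I _ su) (I _ st)).
  have := cint_real_CS mD (csqintB mD su st) (sq i j).
  congr (normc _ ^+ 2 <= _); apply: eq_cint => z _; by rewrite mulrBl.
apply/eqP; rewrite -subr_eq0; apply/eqP.
pose dN := fun N => csqn mu2 (cyl e) (fun z => G z - trig2 (coef G) N z).
pose dU := fun N => csqn mu2 (cyl e) (fun z => U z - trig2 (coef U) N z).
pose a := \int[mu2]_(z in cyl e) (partial 0 0 phi z ^+ 2).
pose b := \int[mu2]_(z in cyl e) (partial p q phi z ^+ 2).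
apply: (@normc_eq0_lim R _ (fun N => 2 * (dN N * a) + 2 * (dU N * b)) 0%N).
  have h1 : dN @ \oo --> (0 : R) := trig2_cvg mA fA (sG e e0).
  have h2 : dU @ \oo --> (0 : R) := trig2_cvg mA fA (sU e e0).
  clearbody dN dU a b.
  rewrite -[0 in X in _ --> X](_ : 2 * (0 * a) + 2 * (0 * b) = 0); last by ring.
  by apply: cvgD; [apply: cvgMr; apply: cvgMl; exact: h1|apply: cvgMr; apply: cvgMl; exact: h2].
move=> N _.
have b1 := B 0%N 0%N G N (sG e e0); have b2 := B p q U N (sU e e0).
rewrite SE in b1.
set x := cint mu2 (cyl e) (fun z => G z * _) in b1 *.
set y := cint mu2 (cyl e) (fun z => U z * _) in b2 *.
set t := cint mu2 (cyl e) (fun z => trig2 (coef U) N z * _) in b1 b2.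
have sgn (v : R[i]) : normc ((-1) ^+ (p + q) * v) ^+ 2 = normc v ^+ 2.
  rewrite -signr_odd; case: (odd _); rewrite ?expr1 ?expr0 ?mul1r//.
  by rewrite mulN1r !normc2 !ReImE !sqrrN.
have -> : x - (-1) ^+ (p + q) * y = (x - (-1) ^+ (p + q) * t) - (-1) ^+ (p + q) * (y - t) by ring.
apply: le_trans (normc2_sub _ _) _; rewrite sgn.
by apply: lerD; rewrite ler_pM2l ?ltr0n.
Qed.

End CoefficientsOfWeakDerivatives.

(** * The Euler equation on (0, 1] in weighted spaces *)

Section EulerEquation.
Variable R : realType.
Local Notation mu := (@lebesgue_measure R).
Local Notation mR := (measurableTypeR R).
Implicit Types (y z g h f : mR -> R) (a b c e x s t : R).
Local Notation ms := (measurable_seg _ _).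
#[local] Hint Resolve measurable_seg : core.

Definition wt x : R := x `^ (- 2^-1).

Lemma wt_ge0 x : 0 <= wt x. Proof. exact: powR_ge0. Qed.

Lemma wt2 x : 0 < x -> wt x * wt x = x^-1.
Proof.
move=> x0; rewrite /wt -powRD; last by rewrite (gt_eqF x0) implybT.
by rewrite (_ : - 2^-1 - 2^-1 = -1); [rewrite powR_inv1// ltW|lra].
Qed.

Lemma wt_sqrt x : 0 < x -> x `^ 2^-1 * wt x = 1.
Proof.
move=> x0; rewrite /wt -powRD; last by rewrite (gt_eqF x0) implybT.
by rewrite subrr powRr0.
Qed.

Lemma wt_measurable (A : set mR) : measurable_fun A wt.
Proof. exact: (measurable_funTS (measurable_powR _)). Qed.

Lemma powR_continuous a x : 0 < x -> {for x, continuous (fun s => s `^ a)}.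
Proof.
move=> x0; apply: differentiable_continuous; apply/derivable1_diffP.
by have [] := is_derive1_powR a x0.
Qed.

(** The weight is normalised to [1/x], for which [x d/dx] is antisymmetric up to a boundary
    term; a different weight would be absorbed into the unknown as a power of [x]. *)
Definition wsq y := sqint mu (seg 0 1) (fun x => wt x * y x).
Definition wnorm y := \int[mu]_(x in seg 0 1) ((wt x * y x) ^+ 2).
Definition winn y z := \int[mu]_(x in seg 0 1) ((wt x * y x) * (wt x * z x)).

(** [y] has the derivative [y1] with respect to [ln x]. *)
Definition dprim y y1 := prim y (fun x => x^-1 * y1 x).

Lemma wnorm_ge0 y : 0 <= wnorm y.
Proof. by apply: Rintegral_ge0 => x _; exact: sqr_ge0. Qed.

Lemma wsq_lin a b y z : wsq y -> wsq z -> wsq (fun x => a * y x + b * z x).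
Proof.
move=> sy sz; apply: eq_sqint (sqintD ms (sqintZ ms a sy) (sqintZ ms b sz)) => x /=; ring.
Qed.

Lemma eq_wsq y z : (forall x, y x = z x) -> wsq y -> wsq z.
Proof. by move=> yz; apply: eq_sqint => x; rewrite yz. Qed.

Lemma ln_prim : prim (@ln R) (fun x => x^-1).
Proof.
by apply: prim_of_derive => x x0; apply: inv_continuous; rewrite gt_eqF.
Qed.

Lemma wsq_locint y : wsq y -> locint y /\ locint (fun x => x^-1 * y x).
Proof.
move=> sy; have i01 := sqint_integrable ms (seg_fin 0 1) sy.
have ly : locint y.
  move=> e e0; have ie : mu.-integrable (seg e 1) (EFin \o (fun x => wt x * y x)).
    apply: (integrableS (measurable_seg 0 1) (measurable_seg e 1) _ i01) => x.
    by rewrite !segE => /andP[/(le_trans (ltW e0)) -> ->].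
  have h : mu.-integrable (seg e 1) (EFin \o (fun x : mR => x `^ 2^-1 * (wt x * y x))).
    apply: (@integrable_of_bound _ _ _ _ _ ms _ (fun x => `|wt x * y x|)).
    - apply: measurable_funM; first exact: (measurable_funTS (measurable_powR _)).
      by have /integrableP[/measurable_EFinP] := ie.
    - exact: integrable_norm.
    - move=> x; rewrite segE => /andP[ex x1]; rewrite normrM ler_piMl//.
      rewrite ger0_norm ?powR_ge0//.
      have := @ge0_ler_powR R 2^-1 _ x 1; rewrite powR1 /=; apply; rewrite ?nnegrE ?invr_ge0 ?ler0n ?ler01//.
      exact: le_trans (ltW e0) ex.
  apply: eq_integrable h; first exact: measurable_seg.
  move=> x; rewrite in_seg => /andP[ex _].
  by rewrite /= mulrA wt_sqrt ?mul1r// (lt_le_trans e0).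
split => // e e0.
apply: (@integrable_of_bound _ _ _ _ _ ms _ (fun x => e^-1 * `|y x|)).
- apply: measurable_funM; last by have /integrableP[/measurable_EFinP] := ly e e0.
  by have [li _] := ln_prim; have /integrableP[/measurable_EFinP] := li e e0.
- have := integrableZl (measurable_seg e 1) e^-1 (integrable_norm (ly e e0)); exact.
- move=> x; rewrite segE => /andP[ex _]; rewrite normrM ler_wpM2r//.
  by rewrite ger0_norm ?invr_ge0 ?lef_pV2 ?posrE ?(lt_le_trans e0 ex)// (ltW (lt_le_trans e0 ex)).
Qed.

Lemma Rintegral_sub f (A B : set mR) : measurable A -> measurable B -> A `<=` B ->
  mu.-integrable B (EFin \o f) -> (forall x, 0 <= f x) ->
  \int[mu]_(x in A) f x <= \int[mu]_(x in B) f x.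
Proof.
move=> mA mB AB iB f0; have iA := integrableS mB mA AB iB.
rewrite -lee_fin !EFin_Rint//; apply: ge0_subset_integral => //.
  by have /integrableP[] := iB.
by move=> x _; rewrite lee_fin.
Qed.

(** The weight [1/x] is not integrable at the origin. *)
Lemma wsq_bounded_below y c e : wsq y -> 0 < e -> e <= 1 ->
  (forall x, 0 < x <= e -> c <= y x ^+ 2) -> c <= 0.
Proof.
move=> sy e0 e1 hc; rewrite leNgt; apply/negP => c0.
pose N := wnorm y; pose d := e * expR (- ((N + 1) / c)).
have N0 : 0 <= N by exact: wnorm_ge0.
have d0 : 0 < d by rewrite mulr_gt0 ?expR_gt0.
have de : d <= e.
  by rewrite ler_piMr ?(ltW e0)// expR_le1 oppr_le0 divr_ge0 ?(ltW c0)// addr_ge0.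
have ld : ln e - ln d = (N + 1) / c.
  by rewrite lnM ?posrE ?expR_gt0// expRK; ring.
have h1 := prim_sub ln_prim d0 de e1.
have i2 := sqint_sq_integrable sy.
have sub : seg d e `<=` seg 0 1.
  by move=> x; rewrite !segE => /andP[/(le_trans (ltW d0)) -> /le_trans ->].
have i3 := integrableS (measurable_seg 0 1) (measurable_seg d e) sub i2.
have [li _] := ln_prim.
have i4 := locint_sub li d0 e1.
have : \int[mu]_(x in seg d e) (c * x^-1) <= N.
  apply: le_trans (Rintegral_sub ms ms sub i2 _); last by move=> x; exact: sqr_ge0.
  apply: le_Rintegral => //.
    by have := integrableZl (measurable_seg d e) c i4; exact.
  move=> x; rewrite segE => /andP[dx xe]; have x0 := lt_le_trans d0 dx.
  rewrite exprMn expr2 wt2// mulrC ler_wpM2l ?invr_ge0 ?(ltW x0)//.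
  by apply: hc; rewrite x0.
rewrite RintegralZl// -h1 ld mulrCA mulfV ?gt_eqF// mulr1; lra.
Qed.

Lemma dprim_sq y y1 e : dprim y y1 -> 0 < e -> e <= 1 ->
  y 1 ^+ 2 - y e ^+ 2 = \int[mu]_(x in seg e 1) (2 * ((wt x * y x) * (wt x * y1 x))).
Proof.
move=> dy e0 e1; have := prim_sub (prim_mul dy dy) e0 e1 (lexx 1).
rewrite !expr2 => ->; apply: eq_Rintegral => x; rewrite in_seg => /andP[ex _].
by rewrite mulrACA wt2 ?(lt_le_trans e0 ex)//; ring.
Qed.

(** The energy identity: the boundary term at the origin vanishes, since otherwise [y] would
    be bounded away from zero there. *)
Lemma energy y y1 : dprim y y1 -> wsq y -> wsq y1 -> y 1 ^+ 2 = 2 * winn y y1.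
Proof.
move=> dy sy sy1.
pose F x := (wt x * y x) * (wt x * y1 x).
have iF : mu.-integrable (seg 0 1) (EFin \o F) := integrableM_sqint ms sy sy1.
pose L := y 1 ^+ 2 - 2 * winn y y1.
have sub e : 0 < e -> seg e 1 `<=` seg 0 1.
  by move=> e0 x; rewrite !segE => /andP[/(le_trans (ltW e0)) -> ->].
have yE e : 0 < e -> e <= 1 -> y e ^+ 2 = L + 2 * \int[mu]_(x in seg 0 e) F x.
  move=> e0 e1; have := dprim_sq dy e0 e1.
  rewrite RintegralZl//; last exact: (integrableS (measurable_seg 0 1) (measurable_seg e 1) (sub e e0) iF).
  have := @Rintegral_seg_split R F 0 e 1; rewrite (ltW e0) e1 => /(_ isT iF).
  by rewrite /L /winn -/F => ->; lra.
suff : L = 0 by rewrite /L => /eqP; rewrite subr_eq0 => /eqP.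
apply: contrapT => /eqP L0.
have [r r0 hr] : exists2 r, 0 < r & forall e, 0 < e < r -> e <= 1 ->
    `|2 * \int[mu]_(x in seg 0 e) F x| < `|L| / 2.
  have := parameterized_integral_continuous ler01 iF.
  move=> /(continuous_within_itvP _ ltr01)[_ + _].
  rewrite {2}/parameterized_integral /seg set_itv1 Rintegral_set1.
  move=> /cvgrPdist_lt /(_ (`|L| / 4)).
  rewrite divr_gt0 ?normr_gt0// => /(_ isT)[r /= r0 hr].
  exists r => // e /andP[e0 er] e1; have := hr e; rewrite /= sub0r normrN gtr0_norm//.
  move=> /(_ er e0); rewrite sub0r normrN /parameterized_integral normrM ger0_norm//; lra.
pose e := Num.min (r / 2) 1.
have e0 : 0 < e by rewrite lt_min divr_gt0 ?ltr01.
have e1 : e <= 1 by rewrite ge_min lexx orbT.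
have er : e < r by rewrite gt_min ltr_pdivrMr// mulr_natr mulr2n ltrDl r0.
have Lp : 0 < L.
  rewrite lt_neqAle eq_sym L0 /=; have := hr e; rewrite e0 er e1 => /(_ isT isT).
  have := yE e e0 e1; have := sqr_ge0 (y e).
  move: (2 * Rintegral _ _ _) => I h1 h2 h3; rewrite leNgt; apply/negP => Ln.
  by move: h3; rewrite ltr_norml ltr0_norm//; lra.
have : L / 2 <= 0.
  apply: (wsq_bounded_below sy e0 e1) => x /andP[x0 xe].
  have x1 := le_trans xe e1; rewrite (yE x)//.
  have := hr x; rewrite x0 (le_lt_trans xe er) x1 => /(_ isT isT).
  move: (2 * Rintegral _ _ _) => I; rewrite ltr_norml gtr0_norm//; lra.
by lra.
Qed.

Lemma energy_shift a y y1 : dprim y y1 -> wsq y -> wsq y1 ->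
  wnorm (fun x => y1 x - a * y x) = wnorm y1 + a ^+ 2 * wnorm y - a * y 1 ^+ 2.
Proof.
move=> dy sy sy1; rewrite (energy dy sy sy1).
have i1 := sqint_sq_integrable sy; have i2 := sqint_sq_integrable sy1.
have i3 := integrableM_sqint ms sy sy1.
transitivity (\int[mu]_(x in seg 0 1) (1 * (1 * (wt x * y1 x) ^+ 2 + a ^+ 2 * (wt x * y x) ^+ 2) +
    (- (2 * a)) * ((wt x * y x) * (wt x * y1 x)))).
  by apply: eq_Rintegral => x _; ring.
rewrite Rintegral_lin//; last exact: (integrable_lin (measurable_seg 0 1) 1 (a ^+ 2) i2 i1).
rewrite Rintegral_lin//.
rewrite /wnorm /winn; ring.
Qed.

(** The trace is controlled by the product of the norms of [y] and [x y']. *)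
Lemma trace_bound t y y1 : 0 < t -> dprim y y1 -> wsq y -> wsq y1 ->
  y 1 ^+ 2 <= t * wnorm y + t^-1 * wnorm y1.
Proof.
move=> t0 dy sy sy1; rewrite (energy dy sy sy1) /winn -RintegralZl//; last exact: (integrableM_sqint (measurable_seg 0 1) sy sy1).
have i1 := sqint_sq_integrable sy; have i2 := sqint_sq_integrable sy1.
rewrite /wnorm -Rintegral_lin//.
apply: le_Rintegral; [exact: ms| |exact: (integrable_lin (measurable_seg 0 1) t t^-1 i1 i2)|].
  have := integrableZl (measurable_seg 0 1) 2 (integrableM_sqint ms sy sy1); exact.
move=> x _; move: (wt x * y x) (wt x * y1 x) => u v.
rewrite -subr_ge0 (_ : _ - _ = t^-1 * (t * u - v) ^+ 2); last by field; rewrite gt_eqF.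
by rewrite mulr_ge0 ?sqr_ge0// invr_ge0 ltW.
Qed.

(** ** First order equations *)

Lemma prim_measurable01 y g : prim y g -> measurable_fun (seg 0 1) y.
Proof.
move=> py; pose E n : set mR := if n is k.+1 then seg k.+1%:R^-1 1 else [set 0].
have -> : seg 0 1 = \bigcup_n E n.
  apply/seteqP; split => [x|x [[|n] _]] /=.
  - rewrite segE => /andP[]; rewrite le_eqVlt => /orP[/eqP <- _|x0 x1]; first by exists 0%N.
    exists (Num.bound x^-1).+1 => //=; rewrite segE x1 andbT.
    have xV : 0 <= x^-1 by rewrite invr_ge0 ltW.
    rewrite -[leRHS]invrK lef_pV2 ?posrE ?ltr0n ?invr_gt0//.
    by apply: le_trans (ltW (archi_boundP xV)) _; rewrite ler_nat.
  - by move=> ->; rewrite segE lexx ler01.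
  - by rewrite !segE => /andP[h ->]; rewrite andbT (le_trans _ h)// invr_ge0.
apply/measurable_fun_bigcup; first by case=> [|n]; [exact: measurable_set1|exact: ms].
case=> [|n]; first exact: measurable_fun_set1.
by apply: (prim_measurable py); rewrite invr_gt0 ltr0n.
Qed.

Lemma trunc_le f b M : 0 < b -> measurable_fun (seg 0 b) f -> (forall x, 0 <= f x) ->
  (forall e, 0 < e -> e <= b -> (\int[mu]_(x in seg e b) (f x)%:E <= M%:E)%E) ->
  (\int[mu]_(x in seg 0 b) (f x)%:E <= M%:E)%E.
Proof.
move=> b0 mf f0 h; pose F n : set mR := seg (b * n.+1%:R^-1) b.
have mF n : measurable (F n) by exact: ms.
have p0 n : 0 < b * n.+1%:R^-1 by rewrite mulr_gt0// invr_gt0 ltr0n.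
have F0 : \bigcup_n F n = (`]0, b]%classic : set mR).
  apply/seteqP; split => [x [n _]|x].
    rewrite /F segE => /andP[h1 h2].
    by rewrite /= in_itv /= h2 (lt_le_trans (p0 n) h1).
  rewrite /= in_itv /= => /andP[x0 xb]; exists (Num.bound (b / x)) => //; rewrite /F segE xb andbT.
  have xV : 0 <= b / x by rewrite divr_ge0 ?(ltW b0) ?(ltW x0).
  rewrite ler_pdivrMr ?ltr0n// mulrC -ler_pdivrMr//.
  by apply: le_trans (ltW (archi_boundP xV)) _; rewrite ler_nat.
have sub n : F n `<=` seg 0 b.
  by move=> x; rewrite /F !segE => /andP[/(le_trans (ltW (p0 n))) -> ->].
have mfE : measurable_fun (seg 0 b) (EFin \o f) by exact/measurable_EFinP.
have := @ge0_nondecreasing_set_cvg_integral _ mR R F (EFin \o f) mu.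
rewrite F0 => /(_ _ mF _ _) C.
have {}C : (fun n => \int[mu]_(x in F n) (f x)%:E)%E @ \oo --> (\int[mu]_(x in `]0%R, b]) (f x)%:E)%E.
  apply: C.
  - move=> n k nk; apply/subsetPset => x; rewrite /F !segE => /andP[h1 ->]; rewrite andbT.
    by apply: le_trans h1; rewrite ler_pM2l// lef_pV2 ?posrE ?ltr0n// ler_nat.
  - by move=> n; apply: (measurable_funS ms (sub n)).
  - by move=> n x _; rewrite /= lee_fin.
rewrite /seg -integral_itv_obnd_cbnd; last first.
  by apply: (measurable_funS (measurable_seg 0 b) _ mfE) => x /=; rewrite segE in_itv /= => /andP[/ltW -> ->].
have <- := cvg_lim (@ereal_hausdorff R) C.
apply: lime_le; first by apply/cvg_ex; eexists; exact: C.
apply: nearW => n; apply: h => //.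
by rewrite ler_piMr ?(ltW b0)// invf_le1 ?ltr0n// ler1n.
Qed.

Lemma powR_sq b x : (x `^ (b - 2^-1)) ^+ 2 = x `^ (2 * b - 1).
Proof. by rewrite -powR_mulrn ?powR_ge0// -powRrM; congr (_ `^ _); field. Qed.

Lemma powR_prim b : prim (fun x => x `^ b) (fun x => b * x `^ (b - 1)).
Proof.
apply: prim_of_derive => x x0.
by apply: cvgMr; exact: powR_continuous.
Qed.

Lemma powR_sqint b e : 0 < b -> 0 < e -> e <= 1 ->
  sqint mu (seg 0 e) (fun x : mR => x `^ (b - 2^-1)) /\
  \int[mu]_(x in seg 0 e) ((x `^ (b - 2^-1)) ^+ 2) <= e `^ (2 * b) / (2 * b).
Proof.
move=> b0 e0 e1; have b2 : 0 < 2 * b by rewrite mulr_gt0.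
have mp : measurable_fun (seg 0 e) (fun x : mR => x `^ (b - 2^-1)).
  exact: (measurable_funTS (measurable_powR _)).
have key : (\int[mu]_(x in seg 0 e) ((x `^ (b - 2^-1)) ^+ 2)%:E <= (e `^ (2 * b) / (2 * b))%:E)%E.
  apply: trunc_le => //; [exact: measurable_funX|by move=> x; exact: sqr_ge0|].
  move=> d d0 de; have h := prim_sub (powR_prim (2 * b)) d0 de e1.
  have [li _] := powR_prim (2 * b); have il := locint_sub li d0 e1.
  have il' : mu.-integrable (seg d e) (EFin \o (fun x : mR => (x `^ (b - 2^-1)) ^+ 2)).
    have := integrableZl (measurable_seg d e) (2 * b)^-1 il; apply: eq_integrable; first exact: measurable_seg.
    by move=> x _; rewrite /= -EFinM powR_sq mulrA mulVf ?mul1r// gt_eqF.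
  rewrite -EFin_Rint//.
  rewrite lee_fin ler_pdivlMr// mulrC -RintegralZl//.
  have -> : \int[mu]_(x in seg d e) (2 * b * (x `^ (b - 2^-1)) ^+ 2) = e `^ (2 * b) - d `^ (2 * b).
    by rewrite h; apply: eq_Rintegral => x _; rewrite powR_sq.
  by rewrite gerBl powR_ge0.
have s : sqint mu (seg 0 e) (fun x : mR => x `^ (b - 2^-1)).
  by split => //; apply: le_lt_trans key _; exact: ltry.
split => //; rewrite -lee_fin EFin_Rint//; exact: sqint_sq_integrable.
Qed.

Lemma young b (u v : R) : 0 < b -> `|2 * (u * v)| <= b * u ^+ 2 + b^-1 * v ^+ 2.
Proof.
move=> b0; have bn : b != 0 by rewrite gt_eqF.
have p w : 0 <= b^-1 * (b * u + w * v) ^+ 2 by rewrite mulr_ge0 ?sqr_ge0// invr_ge0 ltW.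
have e w : b^-1 * (b * u + w * v) ^+ 2 = b * u ^+ 2 + w * (2 * (u * v)) + w ^+ 2 * (b^-1 * v ^+ 2).
  by field.
have := p 1; have := p (-1); rewrite !e expr1n sqrrN expr1n !mul1r mulN1r.
move: (b * _) (2 * _) (b^-1 * _) => A B C h1 h2; rewrite ler_norml; lra.
Qed.

Lemma powR_m1 b x : 0 < x -> x `^ (b - 1) = x `^ b * x^-1.
Proof.
move=> x0; rewrite powRD; last by rewrite (gt_eqF x0) implybT.
by rewrite powR_inv1// ltW.
Qed.

Section FirstOrder.
Variables (a : R) (h : mR -> R) (sh : wsq h).

Let K (x : mR) := x `^ (- a - 1) * h x.
Let sol c x := x `^ a * (c - \int[mu]_(s in seg x 1) K s).

Lemma K_locint : locint K.
Proof.
have [_ lh] := wsq_locint sh.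
apply: eq_locint (locintM_prim (powR_prim (- a)) lh) => x /andP[x0 _].
by rewrite /K powR_m1//; ring.
Qed.

Lemma sol_prim c : dprim (sol c) (fun x => a * sol c x + h x).
Proof.
have pP : prim (fun x => c - \int[mu]_(s in seg x 1) K s) K.
  split; first exact: K_locint.
  by move=> x _; rewrite [in X in _ = X - _]/seg set_itv1 Rintegral_set1 subr0.
apply: eq_prim (prim_mul (powR_prim a) pP) => // x /andP[x0 _].
have e1 : x `^ a * x `^ (- a) = 1.
  by rewrite -powRD ?subrr ?powRr0// (gt_eqF x0) implybT.
rewrite /sol /K !powR_m1//; move: (c - _) => v.
transitivity (x^-1 * (a * (x `^ a * v)) + (x `^ a * x `^ (- a)) * (x^-1 * h x)); first by ring.
by rewrite e1; ring.
Qed.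

Lemma sol1 c : sol c 1 = c.
Proof. by rewrite /sol powR1 /= mul1r /seg set_itv1 Rintegral_set1 subr0. Qed.

Lemma trunc_energy c e b : 0 < b -> 0 < e -> e <= 1 ->
  exists I E : R, [/\ E = \int[mu]_(x in seg e 1) ((wt x * sol c x) ^+ 2),
    mu.-integrable (seg e 1) (EFin \o (fun x => (wt x * sol c x) ^+ 2)),
    c ^+ 2 - sol c e ^+ 2 = 2 * a * E + I & `|I| <= b * E + b^-1 * wnorm h].
Proof.
move=> b0 e0 e1; have dy := sol_prim c; set y := sol c in dy *.
have ly := prim_locint dy.
have i1 : mu.-integrable (seg e 1) (EFin \o (fun x => (wt x * y x) ^+ 2)).
  have [ly1 _] := prim_mul (powR_prim (-1)) (prim_mul dy dy).
  have := locintM_prim (prim_mul dy dy) (_ : locint (fun x => x^-1)).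
  have [li _] := ln_prim; move=> /(_ li e e0); apply: eq_integrable; first exact: ms.
  by move=> x; rewrite in_seg => /andP[ex _]; rewrite /= exprMn expr2 wt2 ?expr2// (lt_le_trans e0).
have ish := sqint_sq_integrable sh.
have sub : seg e 1 `<=` seg 0 1.
  by move=> x; rewrite !segE => /andP[/(le_trans (ltW e0)) -> ->].
have i2 := integrableS (measurable_seg 0 1) (measurable_seg e 1) sub ish.
have mwh : measurable_fun (seg e 1) (fun x => wt x * h x).
  by apply: (measurable_funS (measurable_seg 0 1) sub); case: sh.
have mwy : measurable_fun (seg e 1) (fun x => wt x * y x).
  by apply: measurable_funM; [exact: wt_measurable|exact: (prim_measurable dy)].
have s1 := sqint_of_integrable (measurable_seg e 1) mwy i1; have s2 := sqint_of_integrable (measurable_seg e 1) mwh i2.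
have i3 := integrableM_sqint ms s1 s2.
exists (\int[mu]_(x in seg e 1) (2 * ((wt x * y x) * (wt x * h x)))), (\int[mu]_(x in seg e 1) ((wt x * y x) ^+ 2)).
have i4 : mu.-integrable (seg e 1) (EFin \o (fun x => 2 * ((wt x * y x) * (wt x * h x)))).
  have := integrableZl (measurable_seg e 1) 2 i3; exact.
split => //.
  have := dprim_sq dy e0 e1; rewrite {1}/y sol1 => ->.
  rewrite -[X in _ = _ + X]mul1r -Rintegral_lin//.
  by apply: eq_Rintegral => x _; ring.
apply: le_trans (le_normr_Rintegral ms i4) _.
apply: (@le_trans _ _ (\int[mu]_(x in seg e 1) (b * (wt x * y x) ^+ 2 + b^-1 * (wt x * h x) ^+ 2))).
  apply: le_Rintegral; [exact: ms|exact: integrable_norm|exact: (integrable_lin (measurable_seg e 1) b b^-1 i1 i2)|].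
  move=> x _; move: (wt x * y x) (wt x * h x) => u v.
  exact: young.
rewrite Rintegral_lin//.
rewrite lerD2l ler_wpM2l ?invr_ge0 ?(ltW b0)//.
by apply: Rintegral_sub => //; [by move=> x; exact: sqr_ge0].
Qed.

Lemma sol_wsq c M : (forall e, 0 < e -> e <= 1 ->
    \int[mu]_(x in seg e 1) ((wt x * sol c x) ^+ 2) <= M) -> wsq (sol c).
Proof.
move=> hM; have dy := sol_prim c.
have mw : measurable_fun (seg 0 1) (fun x => wt x * sol c x).
  by apply: measurable_funM; [exact: wt_measurable|exact: (prim_measurable01 dy)].
split => //; apply: (@le_lt_trans _ _ M%:E); last exact: ltry.
apply: trunc_le => //; [exact: measurable_funX|by move=> x; exact: sqr_ge0|].
move=> e e0 e1; have [I [E [_ i _ _]]] := trunc_energy c ltr01 e0 e1.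
by rewrite -EFin_Rint//; rewrite lee_fin; exact: hM.
Qed.

Lemma solve_pos c : 0 < a -> exists y, [/\ dprim y (fun x => a * y x + h x), wsq y & y 1 = c].
Proof.
move=> a0; exists (sol c); split; [exact: sol_prim| |exact: sol1].
apply: (@sol_wsq _ (a^-1 * (c ^+ 2 + a^-1 * wnorm h))) => e e0 e1.
have [I [E [EE _ h1 h2]]] := trunc_energy c a0 e0 e1.
rewrite -EE mulrC ler_pdivlMr//; have := sqr_ge0 (sol c e).
move: h2; rewrite ler_norml => /andP[h2 _]; lra.
Qed.

(** For [a < 0] the boundary value is forced by the condition at the origin. *)
Lemma solve_neg : a < 0 -> exists y, dprim y (fun x => a * y x + h x) /\ wsq y.
Proof.
rewrite -oppr_gt0 => b0; set b := - a in b0.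
have [sp _] := powR_sqint b0 ltr01 (lexx 1).
pose G (x : mR) := x `^ (b - 2^-1) * (wt x * h x).
have iG : mu.-integrable (seg 0 1) (EFin \o G) := integrableM_sqint ms sp sh.
pose c := \int[mu]_(x in seg 0 1) G x.
have N0 := wnorm_ge0 h.
have solE e : 0 < e -> e <= 1 -> sol c e = e `^ a * \int[mu]_(x in seg 0 e) G x.
  move=> e0 e1; rewrite /sol; congr (_ * _).
  have := @Rintegral_seg_split R G 0 e 1; rewrite (ltW e0) e1 /c => /(_ isT iG) ->.
  rewrite -addrA [X in _ + X](_ : _ = 0) ?addr0//; apply/eqP; rewrite subr_eq0; apply/eqP.
  apply: eq_Rintegral => x; rewrite in_seg => /andP[ex _]; have x0 := lt_le_trans e0 ex.
  rewrite /G /K /wt mulrA -powRD; last by rewrite (gt_eqF x0) implybT.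
  by congr (_ `^ _ * _); rewrite /b; field.
have bd e : 0 < e -> e <= 1 -> sol c e ^+ 2 <= wnorm h / (2 * b).
  move=> e0 e1; rewrite solE// exprMn.
  have [sp1 le1] := powR_sqint b0 e0 e1.
  have sub : seg 0 e `<=` seg 0 1 by move=> x; rewrite !segE => /andP[-> /le_trans ->].
  have ish := sqint_sq_integrable sh.
  have mwh : measurable_fun (seg 0 e) (fun x => wt x * h x).
    by apply: (measurable_funS (measurable_seg 0 1) sub); case: sh.
  have s2 := sqint_of_integrable (measurable_seg 0 e) mwh (integrableS (measurable_seg 0 1) (measurable_seg 0 e) sub ish).
  have := cauchy_schwarz_sqint (measurable_seg 0 e) sp1 s2.
  have le2 : \int[mu]_(x in seg 0 e) ((wt x * h x) ^+ 2) <= wnorm h.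
    by apply: Rintegral_sub => //; [by move=> x; exact: sqr_ge0].
  move=> cs.
  have {}cs : (\int[mu]_(x in seg 0 e) G x) ^+ 2 <= e `^ (2 * b) / (2 * b) * wnorm h.
    apply: le_trans cs _; apply: ler_pM => //; apply: Rintegral_ge0 => x _; exact: sqr_ge0.
  apply: le_trans (ler_wpM2l (sqr_ge0 _) cs) _.
  rewrite -powR_mulrn ?powR_ge0// -powRrM mulrA mulrA -powRD; last by rewrite (gt_eqF e0) implybT.
  by rewrite (_ : a * 2%:R + 2 * b = 0) ?powRr0 ?mul1r 1?mulrC// /b; ring.
exists (sol c); split; first exact: sol_prim.
apply: (@sol_wsq _ (b^-1 * (wnorm h / (2 * b) + b^-1 * wnorm h))) => e e0 e1.
have [I [E [EE _ h1 h2]]] := trunc_energy c b0 e0 e1.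
rewrite -EE mulrC ler_pdivlMr//; have := bd e e0 e1; have := sqr_ge0 c.
move: h2; rewrite ler_norml => /andP[_ h2].
by move: h1; rewrite /b in h2 *; lra.
Qed.

End FirstOrder.

End EulerEquation.

(** * The Euler equation for a single mode *)

Section Modes.
Variable R : realType.
Local Notation mR := (measurableTypeR R).
Implicit Types (a b : R).

Lemma dprim_lin a b (y z y1 z1 : mR -> R) : dprim y y1 -> dprim z z1 ->
  dprim (fun x => a * y x + b * z x) (fun x => a * y1 x + b * z1 x).
Proof. by move=> h1 h2; apply: eq_prim (prim_lin a b h1 h2) => // x _; ring. Qed.

Lemma eq_dprim (y z y1 z1 : mR -> R) : y =1 z -> y1 =1 z1 -> dprim y y1 -> dprim z z1.
Proof. by move=> e1 e2; apply: eq_prim => x _; rewrite ?e1 ?e2. Qed.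

Lemma wnorm_lin_le a b (y z : mR -> R) : wsq y -> wsq z ->
  wnorm (fun x => a * y x + b * z x) <= 2 * (a ^+ 2 * wnorm y + b ^+ 2 * wnorm z).
Proof.
move=> sy sz; have ms := measurable_seg (0 : R) 1.
have i1 := sqint_sq_integrable sy; have i2 := sqint_sq_integrable sz.
have i3 := sqint_sq_integrable (wsq_lin a b sy sz).
rewrite mulrDr !mulrA -Rintegral_lin//.
apply: le_Rintegral => //; first exact: integrable_lin.
move=> x _; rewrite -subr_ge0 (_ : _ - _ = (wt x * (a * y x - b * z x)) ^+ 2) ?sqr_ge0//; ring.
Qed.

Lemma real_solve2 n (h : nat -> mR -> R) a b c : b < 0 -> a != 0 ->
  (forall j, (j < n)%N -> dprim (h j) (h j.+1)) -> (forall j, (j <= n)%N -> wsq (h j)) ->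
  exists z : nat -> mR -> R, [/\ forall j, (j < n.+2)%N -> dprim (z j) (z j.+1),
    forall j, (j <= n.+2)%N -> wsq (z j),
    forall j x, z j.+2 x = h j x + (a + b) * z j.+1 x - a * b * z j x &
    0 < a -> z 0%N 1 = c].
Proof.
move=> b0 a0 hp hs.
have [w [dw sw]] := solve_neg (hs 0%N isT) b0.
have [y [dy sy y1]] : exists y, [/\ dprim y (fun x => a * y x + w x), wsq y & 0 < a -> y 1 = c].
  have [an|ap|ae] := ltgtP a 0; last by rewrite ae eqxx in a0.
    by have [y [dy sy]] := solve_neg sw an; exists y; split => // h1; have := lt_trans an h1; rewrite ltxx.
  by have [y [dy sy y1]] := solve_pos sw c ap; exists y.
pose fix F j (x : mR) {struct j} : R * R := if j is i.+1
  then ((F i x).2, h i x + (a + b) * (F i x).2 - a * b * (F i x).1)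
  else (y x, a * y x + w x).
pose z j x := (F j x).1.
have zE j x : z j.+2 x = h j x + (a + b) * z j.+1 x - a * b * z j x by [].
have s1 : wsq (z 1%N) by apply: eq_wsq (wsq_lin a 1 sy sw) => x; rewrite /z /= mul1r.
have d1 : dprim (z 1%N) (z 2%N).
  apply: eq_dprim (dprim_lin a 1 dy dw) => x; rewrite ?zE /z /=; ring.
have S j : (j <= n.+1)%N -> wsq (z j) /\ wsq (z j.+1).
  elim: j => [|j ih] jn; first by split; [exact: sy|exact: s1].
  have [h1 h2] := ih (ltnW jn); split => //.
  by apply: eq_wsq (wsq_lin 1 1 (hs j jn) (wsq_lin (a + b) (- (a * b)) h2 h1)) => x; rewrite zE; ring.
have Dp j : (j <= n)%N -> dprim (z j) (z j.+1) /\ dprim (z j.+1) (z j.+2).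
  elim: j => [|j ih] jn; first by split; [exact: dy|exact: d1].
  have [h1 h2] := ih (ltnW jn); split => //.
  by apply: eq_dprim (dprim_lin 1 1 (hp j jn) (dprim_lin (a + b) (- (a * b)) h2 h1)) => x; rewrite !zE; ring.
exists z; split => //.
- case=> [|j] jn; first by have [] := Dp 0%N isT.
  by have [] := Dp j jn.
- case=> [|j] jn; first by have [] := S 0%N isT.
  by have [] := S j jn.
Qed.

Definition cwsq (z : mR -> R[i]) := wsq (Re \o z) /\ wsq (Im \o z).
Definition cwn (z : mR -> R[i]) := wnorm (Re \o z) + wnorm (Im \o z).
Definition cdprim (y y1 : mR -> R[i]) := dprim (Re \o y) (Re \o y1) /\ dprim (Im \o y) (Im \o y1).

(** A function whose first [m] derivatives with respect to [ln x] are square integrable for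
    [dx/x]; the [j]-th derivative is the [j]-th member of the sequence. *)
Definition chain m (z : nat -> mR -> R[i]) :=
  (forall j, (j < m)%N -> cdprim (z j) (z j.+1)) /\ (forall j, (j <= m)%N -> cwsq (z j)).

Lemma cwn_ge0 (z : mR -> R[i]) : 0 <= cwn z. Proof. by rewrite addr_ge0 ?wnorm_ge0. Qed.

Definition lin2 a b (y z : mR -> R[i]) : mR -> R[i] := fun x => a%:C * y x + b%:C * z x.

Lemma Re_lin2 a b y z : Re \o lin2 a b y z = fun x => a * (Re \o y) x + b * (Re \o z) x.
Proof. by apply/funext => x; rewrite /= ReD !Re_realM. Qed.

Lemma Im_lin2 a b y z : Im \o lin2 a b y z = fun x => a * (Im \o y) x + b * (Im \o z) x.
Proof. by apply/funext => x; rewrite /= ImD !Im_realM. Qed.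

Lemma cwsq_lin a b y z : cwsq y -> cwsq z -> cwsq (lin2 a b y z).
Proof. by move=> [y1 y2] [z1 z2]; split; rewrite ?Re_lin2 ?Im_lin2; exact: wsq_lin. Qed.

Lemma cdprim_lin a b y z y1 z1 : cdprim y y1 -> cdprim z z1 ->
  cdprim (lin2 a b y z) (lin2 a b y1 z1).
Proof. by move=> [h1 h2] [h3 h4]; split; rewrite ?Re_lin2 ?Im_lin2; exact: dprim_lin. Qed.

Lemma cwn_lin_le a b y z : cwsq y -> cwsq z ->
  cwn (lin2 a b y z) <= 2 * (a ^+ 2 * cwn y + b ^+ 2 * cwn z).
Proof.
move=> [y1 y2] [z1 z2]; rewrite /cwn Re_lin2 Im_lin2.
have := wnorm_lin_le a b y1 z1; have := wnorm_lin_le a b y2 z2.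
rewrite !mulrDr; lra.
Qed.

Lemma cenergy_shift a y y1 : cdprim y y1 -> cwsq y -> cwsq y1 ->
  cwn (lin2 1 (- a) y1 y) = cwn y1 + a ^+ 2 * cwn y - a * normc (y 1) ^+ 2.
Proof.
move=> [d1 d2] [s1 s2] [s3 s4]; rewrite /cwn Re_lin2 Im_lin2 normc2.
have E (u v : mR -> R) : (fun x => 1 * u x + - a * v x) = (fun x => u x - a * v x).
  by apply/funext => x; ring.
rewrite !E (energy_shift a d1 s1 s3) (energy_shift a d2 s2 s4) /=; ring.
Qed.

Lemma ctrace_bound t y y1 : 0 < t -> cdprim y y1 -> cwsq y -> cwsq y1 ->
  normc (y 1) ^+ 2 <= t * cwn y + t^-1 * cwn y1.
Proof.
move=> t0 [d1 d2] [s1 s2] [s3 s4]; rewrite /cwn normc2.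
have := trace_bound t0 d1 s1 s3; have := trace_bound t0 d2 s2 s4.
by rewrite !mulrDr /=; lra.
Qed.

Lemma mode_solve2 n (h : nat -> mR -> R[i]) a b (c : R[i]) : b < 0 -> a != 0 -> chain n h ->
  exists z, [/\ chain n.+2 z,
    forall j x, z j.+2 x = h j x + (a + b)%:C * z j.+1 x - (a * b)%:C * z j x &
    0 < a -> z 0%N 1 = c].
Proof.
move=> b0 a0 [hp hs].
have [z1 [p1 s1 e1 b1]] := real_solve2 (Re c) b0 a0 (fun j jn => (hp j jn).1) (fun j jn => (hs j jn).1).
have [z2 [p2 s2 e2 b2]] := real_solve2 (Im c) b0 a0 (fun j jn => (hp j jn).2) (fun j jn => (hs j jn).2).
exists (fun j x => z1 j x +i* z2 j x); split.
- split => j jn; split.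
  + exact: (p1 j jn).
  + exact: (p2 j jn).
  + exact: (s1 j jn).
  + exact: (s2 j jn).
- by move=> j x; apply: complex_eq; rewrite !ReImE /= ?e1 ?e2 /=; ring.
- by move=> a1; apply: complex_eq; [exact: b1|exact: b2].
Qed.

(** ** Changing the derivation *)

(** If [D] is the derivation [d/d(ln x)], a sequence with [D y_j = y_(j+1) - c_j y_j] consists
    of the values of the products [(D + c_(j-1)) ... (D + c_0)] at [y_0]. The operator [dshift]
    applies [D] to such a sequence, and [conv] expresses the products for other constants
    [c'] through it. *)
Definition gchain (c : nat -> R) m (y : nat -> mR -> R[i]) :=
  (forall j, (j < m)%N -> cdprim (y j) (lin2 1 (- c j) (y j.+1) (y j))) /\
  (forall j, (j <= m)%N -> cwsq (y j)).

Definition dshift (c : nat -> R) (y : nat -> mR -> R[i]) j := lin2 1 (- c j) (y j.+1) (y j).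

Fixpoint conv (c c' : nat -> R) p (y : nat -> mR -> R[i]) : mR -> R[i] :=
  if p is i.+1 then lin2 1 (c' i) (conv c c' i (dshift c y)) (conv c c' i y) else y 0%N.

Lemma gchain_dshift c m y : gchain c m.+1 y -> gchain c m (dshift c y).
Proof.
move=> [d s]; split => j jm; last by apply: cwsq_lin; apply: s => //; exact: ltnW.
have h := cdprim_lin 1 (- c j) (d j.+1 jm) (d j (ltnW jm)).
by congr (cdprim _ _) : h; apply/funext => x; rewrite /dshift /lin2; ring.
Qed.

Lemma conv_cdprim c c' m p y : gchain c m y -> (p < m)%N ->
  cdprim (conv c c' p y) (conv c c' p (dshift c y)).
Proof.
elim: p m y => [|p ih] [//|m] y gy pm; first by have [d _] := gy; exact: d.
have gs := gchain_dshift gy.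
exact: (cdprim_lin 1 (c' p) (ih m _ gs pm) (ih m.+1 y gy (ltnW pm))).
Qed.

Lemma conv_bound c c' p : exists2 C, 0 <= C & forall m y, gchain c m y -> (p <= m)%N ->
  cwsq (conv c c' p y) /\ cwn (conv c c' p y) <= C * \sum_(j < p.+1) cwn (y j).
Proof.
elim: p => [|p [C C0 ih]].
  exists 1; first by [].
  move=> m y [_ s] _; split; first exact: s.
  by rewrite mul1r big_ord_recl big_ord0 addr0.
pose B := \sum_(j < p.+1) (c j) ^+ 2.
have B0 : 0 <= B by apply: sumr_ge0 => j _; exact: sqr_ge0.
exists (2 * (C * (2 * (1 + B)) + (c' p) ^+ 2 * C)).
  have h1 : 0 <= 2 * (1 + B) by lra.
  by rewrite mulr_ge0// addr_ge0// mulr_ge0// sqr_ge0.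
move=> [//|m] y gy pm; have gs := gchain_dshift gy; have [_ s] := gy.
have [s1 b1] := ih m _ gs pm; have [s2 b2] := ih m.+1 y gy (ltnW pm).
split; first exact: cwsq_lin.
set S := \sum_(j < p.+2) cwn (y j).
have le1 : \sum_(j < p.+1) cwn (y j) <= S by rewrite /S [leRHS]big_ord_recr /= lerDl cwn_ge0.
have le2 : \sum_(j < p.+1) cwn (y j.+1) <= S by rewrite /S [leRHS]big_ord_recl /= lerDr cwn_ge0.
have le3 : \sum_(j < p.+1) cwn (dshift c y j) <= 2 * (1 + B) * S.
  apply: (@le_trans _ _ (\sum_(j < p.+1) (2 * (cwn (y j.+1) + B * cwn (y j))))).
    apply: ler_sum => j _; have jm : (j < m.+1)%N by exact: leq_trans (ltn_ord j) pm.
    apply: le_trans (cwn_lin_le _ _ (s j.+1 jm) (s j (ltnW jm))) _.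
    rewrite expr1n mul1r ler_pM2l// lerD2l sqrrN ler_wpM2r ?cwn_ge0//.
    by rewrite /B (bigD1 j)//= lerDl sumr_ge0// => i _; exact: sqr_ge0.
  rewrite -mulr_sumr big_split /= -mulr_sumr -mulrA ler_pM2l// mulrDl mul1r.
  by apply: lerD => //; rewrite ler_wpM2l.
apply: le_trans (cwn_lin_le _ _ s1 s2) _.
rewrite expr1n mul1r -mulrA ler_pM2l// [leRHS]mulrDl; apply: lerD.
  by apply: le_trans b1 _; rewrite -mulrA ler_wpM2l.
apply: le_trans (ler_wpM2l (sqr_ge0 (c' p)) b2) _; rewrite -(mulrA _ C S).
by apply: ler_wpM2l; [exact: sqr_ge0|exact: ler_wpM2l].
Qed.

Lemma conv_gchain c c' m y : gchain c m y -> gchain c' m (fun p => conv c c' p y).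
Proof.
move=> gy; split => j jm; last first.
  by have [C _ h] := conv_bound c c' j; have [] := h m y gy jm.
have := conv_cdprim c' gy jm; congr (cdprim _ _).
by apply/funext => x; rewrite /lin2 /=; rewrite /lin2; ring.
Qed.

Lemma chain_gchain m z : chain m z <-> gchain (fun=> 0) m z.
Proof.
have E j : lin2 1 (- 0) (z j.+1) (z j) = z j.+1.
  by apply/funext => x; rewrite /lin2 oppr0 mul0r addr0 mul1r.
by split => -[d s]; split => // j jm; have := d j jm; rewrite E.
Qed.

(** ** Estimates uniform in the mode *)

Definition Lam (k : int) : R := 1 + k%:~R ^+ 2.

Lemma Lam_ge1 k : 1 <= Lam k. Proof. by rewrite /Lam lerDl sqr_ge0. Qed.
Lemma Lam_gt0 k : 0 < Lam k. Proof. exact: lt_le_trans ltr01 (Lam_ge1 k). Qed.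

Definition zsum k m (z : nat -> mR -> R[i]) : R := \sum_(p < m.+1) Lam k ^+ (m - p) * cwn (z p).

Definition eq0 (g : R) (k : int) : R := g ^+ 2 + g + (1 - k%:~R ^+ 2) / 4.
Definition euler (g : R) k (z : nat -> mR -> R[i]) j : mR -> R[i] :=
  lin2 1 1 (z j.+2) (lin2 (2 * g + 1) (eq0 g k) (z j.+1) (z j)).

Lemma zsum_term k m z p : (p <= m)%N -> Lam k ^+ (m - p) * cwn (z p) <= zsum k m z.
Proof.
move=> pm; have pm' : (p < m.+1)%N by [].
rewrite /zsum (bigD1 (Ordinal pm'))//= lerDl; apply: sumr_ge0 => i _.
by rewrite mulr_ge0 ?cwn_ge0// exprn_ge0// ltW// Lam_gt0.
Qed.

Lemma zsum_le k m z B : (forall p, (p <= m)%N -> Lam k ^+ (m - p) * cwn (z p) <= B) ->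
  zsum k m z <= m.+1%:R * B.
Proof.
move=> h; rewrite /zsum mulr_natl -[m.+1 in leRHS]card_ord -sumr_const; apply: ler_sum => p _.
by apply: h; rewrite -ltnS.
Qed.

Lemma zsum_ge0 k m z : 0 <= zsum k m z.
Proof. by apply: sumr_ge0 => i _; rewrite mulr_ge0 ?cwn_ge0// exprn_ge0// ltW// Lam_gt0. Qed.

Lemma eq0_bound (g : R) k : 0 < g < 1 -> eq0 g k ^+ 2 <= 9 * Lam k ^+ 2.
Proof.
move=> /andP[g0 g1]; rewrite /eq0 /Lam.
have : 0 <= k%:~R ^+ 2 :> R by exact: sqr_ge0.
move: (k%:~R ^+ 2 : R) => s s0; rewrite -subr_ge0.
have -> : 9 * (1 + s) ^+ 2 - (g ^+ 2 + g + (1 - s) / 4) ^+ 2 =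
  (3 * (1 + s) - (g ^+ 2 + g + (1 - s) / 4)) * (3 * (1 + s) + (g ^+ 2 + g + (1 - s) / 4)) by ring.
have g2 : 0 <= g ^+ 2 <= 1 by rewrite sqr_ge0 expr_le1// ltW.
by apply: mulr_ge0; lra.
Qed.

Lemma three_terms (g : R) k a b (u v w : mR -> R[i]) : 0 < g < 1 -> cwsq u -> cwsq v -> cwsq w ->
  a ^+ 2 = (2 * g + 1) ^+ 2 -> b ^+ 2 = eq0 g k ^+ 2 ->
  cwn (lin2 1 1 u (lin2 a b v w)) <= 2 * cwn u + 36 * cwn v + 36 * (Lam k ^+ 2 * cwn w).
Proof.
move=> g01 su sv sw ea eb; apply: le_trans (cwn_lin_le 1 1 su (cwsq_lin a b sv sw)) _.
have := cwn_lin_le a b sv sw; rewrite ea eb !expr1n !mul1r => h.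
have h1 : (2 * g + 1) ^+ 2 * cwn v <= 9 * cwn v.
  by rewrite ler_wpM2r ?cwn_ge0//; move/andP: g01 => [? ?]; nra.
have h2 : eq0 g k ^+ 2 * cwn w <= 9 * Lam k ^+ 2 * cwn w.
  by rewrite ler_wpM2r ?cwn_ge0//; exact: eq0_bound.
move: h h1 h2; rewrite -(mulrA 9 (Lam k ^+ 2)).
move: (cwn (lin2 _ _ _ _)) (cwn u) (cwn v) (Lam k ^+ 2 * _) ((2 * g + 1) ^+ 2 * _) (eq0 g k ^+ 2 * _).
by move=> A B C D E F; lra.
Qed.

Lemma chain_euler (g : R) k n z : chain n.+2 z -> chain n (euler g k z).
Proof.
move=> [d s]; split => j jn; last first.
  by apply: cwsq_lin; [exact: s|apply: cwsq_lin; apply: s; rewrite ltnW// ltnW].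
by apply: cdprim_lin; [exact: d|apply: cdprim_lin; apply: d; rewrite ltnW// ltnW].
Qed.

Lemma Lam_scale k i j (t : R) : 0 <= t -> (i <= j)%N -> Lam k ^+ i * t <= Lam k ^+ j * t.
Proof. by move=> t0 ij; rewrite ler_wpM2r// ler_weXn2l// Lam_ge1. Qed.

Lemma euler_bound (g : R) k n z : 0 < g < 1 -> chain n.+2 z ->
  zsum k n (euler g k z) <= n.+1%:R * (74 * zsum k n.+2 z).
Proof.
move=> g01 [d s]; apply: zsum_le => j jn.
have s0 := s j (leqW (leqW jn)); have s1 := s j.+1 (leqW jn : (j.+1 <= n.+2)%N).
have s2 := s j.+2 (jn : (j.+2 <= n.+2)%N).
have L0 : 0 <= Lam k ^+ (n - j) by rewrite exprn_ge0// ltW// Lam_gt0.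
have h3 := @three_terms g k (2 * g + 1) (eq0 g k) _ _ _ g01 s2 s1 s0 erefl erefl.
apply: le_trans (ler_wpM2l L0 h3) _.
have t2 := zsum_term k z (jn : (j.+2 <= n.+2)%N).
have t1 := zsum_term k z (leqW jn : (j.+1 <= n.+2)%N).
have t0 := zsum_term k z (leqW (leqW jn)).
rewrite !subSS in t2 t1.
have t1' := Lam_scale k (cwn_ge0 (z j.+1)) (leq_sub2r j (leqnSn n)).
have e0 : Lam k ^+ (n - j) * (Lam k ^+ 2 * cwn (z j)) = Lam k ^+ (n.+2 - j) * cwn (z j).
  by rewrite mulrA -exprD addnBAC ?addn2.
rewrite mulrDr mulrDr (mulrCA _ 2) (mulrCA _ 36) (mulrCA _ 36 (Lam k ^+ 2 * _)) e0.
lra.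
Qed.

Definition alpha (g : R) (k : int) : R := (`|k|%N%:R - 1) / 2 - g.
Definition beta (g : R) (k : int) : R := - ((`|k|%N%:R + 1) / 2) - g.

Lemma absk2 k : (k%:~R : R) ^+ 2 = `|k|%N%:R ^+ 2.
Proof. by rewrite -[`|k|%N%:R]/(`|k|%N%:~R) abszE intr_norm real_normK ?num_real. Qed.

Lemma alphaDbeta g k : alpha g k + beta g k = - (2 * g + 1).
Proof. by rewrite /alpha /beta; field. Qed.

Lemma alphaMbeta g k : alpha g k * beta g k = eq0 g k.
Proof. by rewrite /alpha /beta /eq0 absk2; field. Qed.

Lemma beta_sq g k : 0 < g -> beta g k < 0 /\ Lam k <= 4 * beta g k ^+ 2.
Proof.
move=> g0; rewrite /beta /Lam absk2; have : 0 <= `|k|%N%:R :> R by exact: ler0n.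
by move: (`|k|%N%:R : R) => s s0; split; [lra|nra].
Qed.

Lemma alpha_low g k : 2^-1 < g -> (`|k| <= 2)%N -> alpha g k < 0 /\
  (g - 2^-1) ^+ 2 / 5 * Lam k <= alpha g k ^+ 2.
Proof.
move=> g0 k2; rewrite /alpha /Lam absk2.
have : `|k|%N%:R <= 2 :> R by rewrite (ler_nat R _ 2).
have : 0 <= `|k|%N%:R :> R by exact: ler0n.
move: (`|k|%N%:R : R) => s s0 s2; split; first by lra.
have h1 : (g - 2^-1) ^+ 2 <= ((s - 1) / 2 - g) ^+ 2.
  by rewrite -[leRHS]sqrrN ler_sqr ?nnegrE; lra.
apply: le_trans h1; rewrite -mulrA ler_piMr ?sqr_ge0//; nra.
Qed.

Lemma alpha_high g k : 0 < g -> g < 1 -> (2 < `|k|)%N -> [/\ 0 < alpha g k,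
  (1 - g) ^+ 2 / 10 * Lam k <= alpha g k ^+ 2 & alpha g k <= Num.sqrt (Lam k)].
Proof.
move=> g0 g1 k2; have L0 := Lam_gt0 k; rewrite /alpha.
have s3 : 3 <= `|k|%N%:R :> R by rewrite (ler_nat R 3).
have LE : Lam k = 1 + `|k|%N%:R ^+ 2 by rewrite /Lam absk2.
rewrite LE in L0 *; move: (`|k|%N%:R : R) L0 s3 => s L0 s3; clear LE.
have h : (1 - g) * s / 3 <= (s - 1) / 2 - g.
  have p1 : 0 <= s - 3 by lra.
  have p2 : 0 <= 2^-1 - (1 - g) / 3 by lra.
  have := mulr_ge0 p1 p2; lra.
split.
- by lra.
- have h0 : 0 <= (1 - g) * s / 3 by rewrite divr_ge0// mulr_ge0; lra.
  have h1 : ((1 - g) * s / 3) ^+ 2 <= ((s - 1) / 2 - g) ^+ 2 by rewrite ler_sqr ?nnegrE; lra.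
  apply: le_trans h1; rewrite !exprMn -!mulrA ler_wpM2l ?sqr_ge0//; nra.
- rewrite -[leLHS]ger0_norm; last by lra.
  by rewrite -sqrtr_sqr ler_wsqrtr//; nra.
Qed.

Definition bdry n k (z : nat -> mR -> R[i]) : R :=
  if (2 < `|k|)%N then Lam k ^+ n.+1 * Num.sqrt (Lam k) * normc (z 0%N 1) ^+ 2 else 0.

Lemma bdry_ge0 n k (z : nat -> mR -> R[i]) : 0 <= bdry n k z.
Proof.
rewrite /bdry; case: ifP => // _; apply: mulr_ge0; last exact: sqr_ge0.
by apply: mulr_ge0; [apply: exprn_ge0; exact: ltW (Lam_gt0 k)|exact: sqrtr_ge0].
Qed.

Lemma euler_low (g : R) : 2^-1 < g < 1 -> exists2 C, 0 <= C & forall n k z, chain n.+2 z ->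
  Lam k ^+ n.+2 * cwn (z 0%N) <= C * (zsum k n (euler g k z) + bdry n k z) /\
  Lam k ^+ n.+1 * cwn (z 1%N) <= C * (zsum k n (euler g k z) + bdry n k z).
Proof.
move=> /andP[g1 g2]; pose c0 := Num.min ((g - 2^-1) ^+ 2 / 5) ((1 - g) ^+ 2 / 10).
have c0p : 0 < c0 by rewrite lt_min !divr_gt0// exprn_gt0// subr_gt0.
exists (4 / c0 + 4); first by rewrite addr_ge0// divr_ge0// ltW.
move=> n k z cz; have [d s] := cz; have L0 := Lam_gt0 k.
have g0 : 0 < g by lra.
set a := alpha g k; set b := beta g k.
have [bn bs] := beta_sq k g0; rewrite -/b in bn bs.
have sz0 := s 0%N isT; have sz1 := s 1%N isT; have sz2 := s 2%N isT.
have dz0 := d 0%N isT; have dz1 := d 1%N isT.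
pose w := lin2 1 (- a) (z 1%N) (z 0%N).
have sw : cwsq w by exact: cwsq_lin.
have dw : cdprim w (lin2 1 (- a) (z 2%N) (z 1%N)) by exact: cdprim_lin.
have E1 := cenergy_shift b dw sw (cwsq_lin 1 (- a) sz2 sz1).
have EE : lin2 1 (- b) (lin2 1 (- a) (z 2%N) (z 1%N)) w = euler g k z 0%N.
  apply/funext => x; rewrite /euler /w /lin2 -alphaMbeta -/a -/b.
  have -> : 2 * g + 1 = - (a + b) by rewrite /a /b alphaDbeta opprK.
  by rewrite !(rmorphN, rmorphD, rmorphM) /=; ring.
rewrite EE in E1.
have E2 := cenergy_shift a dz0 sz0 sz1; rewrite -/w in E2.
have e1 : Lam k * cwn w <= 4 * cwn (euler g k z 0%N).
  rewrite E1; apply: le_trans (ler_wpM2r (cwn_ge0 w) bs) _.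
  have := cwn_ge0 (lin2 1 (- a) (z 2%N) (z 1%N)).
  have : 0 <= - (b * normc (w 1) ^+ 2) by rewrite -mulNr mulr_ge0 ?sqr_ge0// oppr_ge0 ltW.
  lra.
have t0 := zsum_term k (euler g k z) (leq0n n); rewrite subn0 in t0.
have Ln : 0 <= Lam k ^+ n by rewrite exprn_ge0// ltW.
have Ln1 : 0 <= Lam k ^+ n.+1 by rewrite exprn_ge0// ltW.
set X := zsum k n (euler g k z) in t0 *; set B := bdry n k z.
have B0 : 0 <= B by exact: bdry_ge0.
have X0 : 0 <= X by exact: zsum_ge0.
have e2 : Lam k ^+ n.+1 * cwn w <= 4 * X.
  rewrite exprSr -mulrA; apply: le_trans (ler_wpM2l Ln e1) _; rewrite mulrCA; lra.
have [c0a hB] : c0 * Lam k <= a ^+ 2 /\ Lam k ^+ n.+1 * (a * normc (z 0%N 1) ^+ 2) <= B.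
  rewrite /B /bdry; case: ltnP => hk.
    have [a0 a1 a2] := alpha_high g0 g2 hk; split.
      by apply: le_trans a1; rewrite ler_wpM2r ?(ltW L0)// ge_min lexx orbT.
    by rewrite -mulrA ler_wpM2l// ler_wpM2r ?sqr_ge0// a2.
  have [a0 a1] := alpha_low g1 hk; split.
    by apply: le_trans a1; rewrite ler_wpM2r ?(ltW L0)// ge_min lexx.
  by rewrite mulr_ge0_le0// mulr_le0_ge0 ?sqr_ge0// ltW.
have e3 : Lam k ^+ n.+1 * (cwn (z 1%N) + a ^+ 2 * cwn (z 0%N)) <= 4 * (X + B).
  have -> : cwn (z 1%N) + a ^+ 2 * cwn (z 0%N) = cwn w + a * normc (z 0%N 1) ^+ 2 by rewrite E2; ring.
  by rewrite mulrDr; lra.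
have p1 : 0 <= Lam k ^+ n.+1 * cwn (z 1%N) by rewrite mulr_ge0 ?cwn_ge0.
have p0 : 0 <= Lam k ^+ n.+1 * (a ^+ 2 * cwn (z 0%N)).
  by apply: mulr_ge0 => //; apply: mulr_ge0; [exact: sqr_ge0|exact: cwn_ge0].
rewrite mulrDr in e3.
have XB : 0 <= 4 / c0 * (X + B) by rewrite mulr_ge0 ?addr_ge0// divr_ge0// ltW.
split; last by rewrite mulrDl; lra.
have : c0 * (Lam k ^+ n.+2 * cwn (z 0%N)) <= Lam k ^+ n.+1 * (a ^+ 2 * cwn (z 0%N)).
  have -> : c0 * (Lam k ^+ n.+2 * cwn (z 0%N)) = Lam k ^+ n.+1 * ((c0 * Lam k) * cwn (z 0%N)).
    by rewrite [Lam k ^+ n.+2]exprSr; ring.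
  by rewrite ler_wpM2l// ler_wpM2r// cwn_ge0.
move=> h; have h' : Lam k ^+ n.+2 * cwn (z 0%N) <= 4 / c0 * (X + B).
  have -> : 4 / c0 * (X + B) = 4 * (X + B) / c0 by ring.
  by rewrite ler_pdivlMr// mulrC; lra.
by rewrite mulrDl; lra.
Qed.

(** The norm of a solution is controlled by the right-hand side and, in the modes in which
    the indicial root [alpha] is admissible, by the boundary value. *)
Lemma euler_inverse (g : R) n : 2^-1 < g < 1 -> exists2 C, 0 <= C & forall k z, chain n.+2 z ->
  zsum k n.+2 z <= C * (zsum k n (euler g k z) + bdry n k z).
Proof.
move=> hg; have g01 : 0 < g < 1 by move/andP: hg => [? ?]; apply/andP; split; lra.
have [C C0 hC] := euler_low hg.
have [D D0 hD] : exists2 D, 0 <= D & forall p k z, (p <= n.+1)%N -> chain n.+2 z ->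
    Lam k ^+ (n.+2 - p) * cwn (z p) <= D * (zsum k n (euler g k z) + bdry n k z) /\
    Lam k ^+ (n.+1 - p) * cwn (z p.+1) <= D * (zsum k n (euler g k z) + bdry n k z).
  suff [D hD] : exists D : nat -> R, (forall p, 0 <= D p /\ D p <= D p.+1) /\
     forall p k z, (p <= n.+1)%N -> chain n.+2 z ->
     Lam k ^+ (n.+2 - p) * cwn (z p) <= D p * (zsum k n (euler g k z) + bdry n k z) /\
     Lam k ^+ (n.+1 - p) * cwn (z p.+1) <= D p * (zsum k n (euler g k z) + bdry n k z).
    have [D1 D2] := hD; exists (D n.+1); first by have [] := D1 n.+1.
    move=> p k z pn cz; have mono : D p <= D n.+1.
      by apply: (@homo_leq _ D (fun x y => x <= y)) => //; [exact: le_trans|move=> i; have [] := D1 i].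
    have [h1 h2] := D2 p k z pn cz.
    have X0 : 0 <= zsum k n (euler g k z) + bdry n k z by rewrite addr_ge0 ?zsum_ge0 ?bdry_ge0.
    by split; [apply: le_trans h1 _|apply: le_trans h2 _]; rewrite ler_wpM2r.
  pose D := fix D p := if p is i.+1 then 2 + 72 * D i else C.
  have Dp p : 0 <= D p by elim: p => [//|p ih] /=; lra.
  exists D; split; first by move=> p; split => //=; have := Dp p; lra.
  elim=> [|p ih] k z pn cz; first by rewrite !subn0; exact: hC.
  have [h1 h2] := ih k z (ltnW pn) cz; have [d s] := cz.
  set X := zsum k n (euler g k z) + bdry n k z in h1 h2 *.
  have X0 : 0 <= X by rewrite addr_ge0 ?zsum_ge0 ?bdry_ge0.
  have DX : 0 <= D p * X by rewrite mulr_ge0.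
  have Dle : D p.+1 * X = 2 * X + 72 * (D p * X) by rewrite /=; ring.
  split; first by rewrite subSS Dle; lra.
  rewrite Dle subSS.
  have s0 := s p (leqW (leqW (pn : (p <= n)%N))).
  have s1 := s p.+1 (leqW pn).
  have se := (chain_euler g k cz).2 p pn.
  have ZE : z p.+2 = lin2 1 1 (euler g k z p) (lin2 (- (2 * g + 1)) (- eq0 g k) (z p.+1) (z p)).
    by apply/funext => x; rewrite /euler /lin2 !rmorphN /=; ring.
  have L0 : 0 <= Lam k ^+ (n - p) by rewrite exprn_ge0// ltW// Lam_gt0.
  have h3 := @three_terms g k (- (2 * g + 1)) (- eq0 g k) _ _ _ g01 se s1 s0 (sqrrN _) (sqrrN _).
  rewrite ZE; apply: le_trans (ler_wpM2l L0 h3) _.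
  have t0 := zsum_term k (euler g k z) (pn : (p <= n)%N).
  have B0 := bdry_ge0 n k z.
  have t1' := Lam_scale k (cwn_ge0 (z p.+1)) (leq_sub2r p (leqnSn n)).
  have e0 : Lam k ^+ (n - p) * (Lam k ^+ 2 * cwn (z p)) = Lam k ^+ (n.+2 - p) * cwn (z p).
    by rewrite mulrA -exprD addnBAC ?addn2.
  rewrite mulrDr mulrDr (mulrCA _ 2) (mulrCA _ 36) (mulrCA _ 36 (Lam k ^+ 2 * _)) e0.
  have tX : Lam k ^+ (n - p) * cwn (euler g k z p) <= X by rewrite /X; lra.
  lra.
exists (n.+3%:R * D); first by rewrite mulr_ge0.
move=> k z cz; rewrite -mulrA; apply: zsum_le => -[|p] pn.
  by have [] := hD 0%N k z isT cz.
by have [_] := hD p k z pn cz; rewrite subSS.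
Qed.

Lemma mode_solve (g : R) k n (h : nat -> mR -> R[i]) (c : R[i]) : 2^-1 < g < 1 -> chain n h ->
  exists z, [/\ chain n.+2 z, forall j, euler g k z j = h j & (2 < `|k|)%N -> z 0%N 1 = c].
Proof.
move=> /andP[g1 g2] ch; have g0 : 0 < g by lra.
have [bn _] := beta_sq k g0.
have an : alpha g k != 0.
  case: (leqP `|k|%N 2) => hk; first by have [a0 _] := alpha_low g1 hk; rewrite lt_eqF.
  by have [a0 _ _] := alpha_high g0 g2 hk; rewrite gt_eqF.
have [z [cz ez bz]] := mode_solve2 c bn an ch.
exists z; split => //.
  move=> j; apply/funext => x; rewrite /euler /lin2 ez alphaDbeta alphaMbeta.
  by rewrite !(rmorphN, rmorph1) /=; ring.
by move=> hk; apply: bz; have [] := alpha_high g0 g2 hk.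
Qed.

(** The parameter of [ctrace_bound] is chosen to balance the two terms. *)
Lemma mode_trace n k z : chain n.+2 z ->
  Lam k ^+ n.+1 * Num.sqrt (Lam k) * normc (z 0%N 1) ^+ 2 <= 2 * zsum k n.+2 z.
Proof.
move=> [d s]; have L0 := Lam_gt0 k; have q0 : 0 < Num.sqrt (Lam k) by rewrite sqrtr_gt0.
have q2 : Num.sqrt (Lam k) * Num.sqrt (Lam k) = Lam k by rewrite -expr2 sqr_sqrtr// ltW.
have h := ctrace_bound q0 (d 0%N isT) (s 0%N isT) (s 1%N isT).
have t0 := zsum_term k z (leq0n n.+2); have t1 := zsum_term k z (isT : (1 <= n.+2)%N).
rewrite subn0 in t0; rewrite subSS subn0 in t1.
have L1 : 0 <= Lam k ^+ n.+1 * Num.sqrt (Lam k) by rewrite mulr_ge0 ?exprn_ge0 ?(ltW q0)// ltW.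
apply: le_trans (ler_wpM2l L1 h) _.
have -> : Lam k ^+ n.+1 * Num.sqrt (Lam k) * (Num.sqrt (Lam k) * cwn (z 0%N) + (Num.sqrt (Lam k))^-1 * cwn (z 1%N)) =
  Lam k ^+ n.+1 * (Num.sqrt (Lam k) * Num.sqrt (Lam k)) * cwn (z 0%N) + Lam k ^+ n.+1 * cwn (z 1%N).
  by field; rewrite gt_eqF.
by rewrite q2 -exprSr; lra.
Qed.

End Modes.

(** * Uniformly convergent Fourier series and traces *)

Section UniformLimits.
Variable R : realType.

(* The limit is the supremum of the nondecreasing sequence [f N - C q^N / (1 - q)]. *)
Lemma geometric_limit (T : topologicalType) (f : nat -> T -> R) (C q : R) : 0 <= C -> 0 <= q < 1 ->
  (forall N z, `|f N.+1 z - f N z| <= C * q ^+ N) ->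
  exists F : T -> R, (forall N z, `|F z - f N z| <= C / (1 - q) * q ^+ N) /\
    ((forall N, continuous (f N)) -> continuous F).
Proof.
move=> C0 /andP[q0 q1] h; have q1' : 0 < 1 - q by rewrite subr_gt0.
pose D := C / (1 - q); have D0 : 0 <= D by rewrite divr_ge0// ltW.
pose lo N z := f N z - D * q ^+ N; pose hi N z := f N z + D * q ^+ N.
have CD : C = D * (1 - q) by rewrite /D divfK// gt_eqF.
have lo_nd z : nondecreasing_seq (lo^~ z).
  apply/nondecreasing_seqP => N; have := h N z; rewrite ler_norml => /andP[h1 _].
  by move: h1; rewrite /lo exprS CD; move: (q ^+ N) => Q; nra.
have hi_ni N M z : (N <= M)%N -> hi M z <= hi N z.
  move=> /subnK <-; elim: (M - N)%N => [//|j ih]; apply: le_trans ih.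
  have := h (j + N)%N z; rewrite addSn ler_norml => /andP[_ h1].
  by move: h1; rewrite /hi exprS CD; move: (q ^+ (j + N)) => Q; nra.
have lohi N M z : lo N z <= hi M z.
  apply: (@le_trans _ _ (lo (maxn N M) z)); first by apply: lo_nd; exact: leq_maxl.
  apply: (@le_trans _ _ (hi (maxn N M) z)); last by apply: hi_ni; exact: leq_maxr.
  have p : 0 <= D * q ^+ maxn N M by rewrite mulr_ge0// exprn_ge0.
  by rewrite /lo /hi; lra.
pose F z := sup (range (lo^~ z)).
have F1 N z : lo N z <= F z.
  apply: sup_upper_bound; last by exists N.
  by split; [exists (lo 0%N z); exists 0%N|exists (hi 0%N z) => _ [M _ <-]; exact: lohi].
have F2 N z : F z <= hi N z.
  apply: ge_sup; first by exists (lo 0%N z); exists 0%N.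
  by move=> _ [M _ <-]; exact: lohi.
have FB N z : `|F z - f N z| <= D * q ^+ N.
  by rewrite ler_distl; apply/andP; split; [exact: F1|exact: F2].
exists F; split => // cf z; apply/cvgrPdist_lt => e e0.
have [N hN] : exists N, D * q ^+ N < e / 3.
  have /cvgrPdist_lt /(_ (e / 3)) : (fun n => D * q ^+ n) @ \oo --> D * 0.
    by apply: cvgMr; apply: cvg_expr; rewrite ger0_norm.
  rewrite mulr0 divr_gt0// => /(_ isT)[N _ /(_ N (leqnn N))] /= hN.
  by exists N; move: hN; rewrite sub0r normrN ger0_norm// mulr_ge0// exprn_ge0.
have /cvgrPdist_lt /(_ (e / 3)) := cf N z; rewrite divr_gt0// => /(_ isT) H.
apply: filterS H => y hy.
have h1 := FB N z; have h2 := FB N y.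
have -> : F z - F y = (F z - f N z) + (f N z - f N y) - (F y - f N y) by ring.
apply: le_lt_trans (ler_normB _ _) _; apply: le_lt_trans (lerD (ler_normD _ _) (lexx _)) _.
by lra.
Qed.

End UniformLimits.

Section Traces.
Variable R : realType.
Local Notation mu := (@lebesgue_measure R).
Local Notation mR := (measurableTypeR R).
Local Notation mu2 := (mu \x mu)%E.
Local Notation circ := (@circ R : set mR).
Local Notation Pi := (seg (0 : R) 1 `*` circ).
Local Notation half := [set z : R * R | 0 < z.1 <= 1].

Lemma prim_continuous0 (y g : mR -> R) : prim y g -> {within `]0 : R, 1], continuous y}.
Proof.
move=> py; apply/subspace_continuousP => x; rewrite /= in_itv /= => /andP[x0 x1].
have x2 : 0 < x / 2 by rewrite divr_gt0.
have x21 : x / 2 < x by rewrite ltr_pdivrMr// mulr_natr mulr2n ltrDl.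
have /subspace_continuousP := prim_continuous py x2 (le_trans (ltW x21) x1).
move=> /(_ x); rewrite /= in_itv /= (ltW x21) x1 => /(_ isT) h.
apply: cvg_trans h; apply: cvg_app => P [e /= e0 he].
exists (Num.min e (x / 2)) => /=; first by rewrite lt_min e0.
move=> s hs; rewrite in_itv /= => /andP[s0 s1]; apply: he.
  by apply: lt_le_trans hs _; rewrite ge_min lexx.
rewrite /= in_itv /= s1 andbT; have hx : `|x - s| < x / 2.
  by apply: lt_le_trans hs _; rewrite ge_min lexx orbT.
by move: hx; rewrite ltr_norml => /andP[_]; lra.
Qed.

Lemma continuous_fst_within (y : R -> R) : {within `]0 : R, 1], continuous y} ->
  {within half, continuous (fun z : R * R => y z.1)}.
Proof.
move=> /subspace_continuousP h; apply/subspace_continuousP => -[x t] /= hx.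
have {}h := h x; rewrite /= in_itv /= hx in h; have {}h := h isT.
apply: (@cvg_comp _ _ _ fst y _ (within (`]0 : R, 1]%classic) (nbhs x))) h.
move=> P [e /= e0 he]; exists (ball x e, setT) => /=.
  by split; [exact: nbhsx_ballx|exact: filterT].
by move=> [x' t'] /= [b1 _] hx'; apply: he => //; rewrite /= in_itv.
Qed.

Lemma continuous_sum (T : topologicalType) n (f : 'I_n -> T -> R) :
  (forall i, continuous (f i)) -> continuous (fun z => \sum_i f i z).
Proof.
elim: n f => [|n ih] f cf.
  rewrite (_ : (fun z => _) = cst 0); first by move=> z; exact: cvg_cst.
  by apply/funext => z; rewrite big_ord0.
rewrite (_ : (fun z => _) = (fun z => \sum_(i < n) f (widen_ord (leqnSn n) i) z + f ord_max z)).
  by move=> z; apply: cvgD; [exact: (ih (fun i => f (widen_ord (leqnSn n) i)))|exact: cf].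
by apply/funext => z; rewrite big_ord_recr.
Qed.

(** A Fourier series with exponentially decreasing, continuous coefficients. *)
Lemma abs_trig (c : int -> R -> R[i]) (M sigma : R) : 0 <= M -> 0 < sigma ->
  (forall k x, 0 < x <= 1 -> normc (c k x) <= M * expR (- (sigma * `|k%:~R|))) ->
  (forall k, {within `]0 : R, 1], continuous (fun x => Re (c k x))}) ->
  (forall k, {within `]0 : R, 1], continuous (fun x => Im (c k x))}) ->
  exists U : R * R -> R[i],
    [/\ {within half, continuous (fun z => Re (U z))},
        {within half, continuous (fun z => Im (U z))},
        forall x t, U (x, t + 2 * pi) = U (x, t),
        csqint mu2 Pi (U : mR * mR -> R[i]) &
        forall x, 0 < x <= 1 -> csqint mu circ (fun t => U (x, t)) /\
           forall k, fourier_coef (fun t => U (x, t)) k = c k x].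
Proof.
move=> M0 s0 bc c1 c2.
pose c' k x := if 0 < x <= 1 then c k x else 0.
pose q := expR (- sigma).
have q0 : 0 <= q < 1 by rewrite expR_ge0 expR_lt1 oppr_lt0.
have bc' k x : normc (c' k x) <= M * q ^+ `|k|%N.
  rewrite /c'; case: ifP => hx; last by rewrite normc0 mulr_ge0 ?exprn_ge0 ?expR_ge0.
  apply: le_trans (bc k x hx) _; rewrite -expRM_natr mulNr.
  by rewrite -[(`|k|%N)%:R]/((`|k|%N)%:~R) abszE intr_norm.
pose S N (z : R * R) : R[i] := symsum (fun k => c' k z.1 * mode k z.2) N.
pose C := 2 * M * q.
have C0 : 0 <= C by rewrite !mulr_ge0 ?expR_ge0.
have Sd N z : normc (S N.+1 z - S N z) <= C * q ^+ N.
  rewrite /S symsum_recr.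
  have -> (u v w : R[i]) : u + v + w - v = u + w by ring.
  apply: le_trans (le_normcD _ _) _.
  rewrite !normcM !normc_mode !mulr1.
  apply: le_trans (lerD (bc' _ _) (bc' _ _)) _.
  have -> : `|- Posz N.+1|%N = N.+1 by rewrite abszN.
  have -> : `|Posz N.+1|%N = N.+1 by [].
  by rewrite le_eqVlt; apply/orP; left; apply/eqP; rewrite /C exprS; ring.
have S2 N x t : S N (x, t + 2 * pi) = S N (x, t).
  by rewrite /S; apply: eq_symsum => k; rewrite modeD2pi.
have hr N (z : subspace half) : `|Re (S N.+1 z) - Re (S N z)| <= C * q ^+ N.
  by apply: le_trans (Sd N z); rewrite -ReN -ReD; exact: normc_Re.
have hi N (z : subspace half) : `|Im (S N.+1 z) - Im (S N z)| <= C * q ^+ N.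
  by apply: le_trans (Sd N z); rewrite -ImN -ImD; exact: normc_Im.
have [F [F1 F2]] := @geometric_limit R (subspace half) (fun N z => Re (S N z)) C q C0 q0 hr.
have [G [G1 G2]] := @geometric_limit R (subspace half) (fun N z => Im (S N z)) C q C0 q0 hi.
have cc k : {within half, continuous (fun z : R * R => Re (c' k z.1))} /\
            {within half, continuous (fun z : R * R => Im (c' k z.1))}.
  split.
    apply: subspace_eq_continuous (continuous_fst_within (c1 k)) => z; rewrite inE /= => hz.
    change (Re (c k z.1) = Re (c' k z.1)).
    by rewrite /c' ifT.
  apply: subspace_eq_continuous (continuous_fst_within (c2 k)) => z; rewrite inE /= => hz.
  change (Im (c k z.1) = Im (c' k z.1)).
  by rewrite /c' ifT.
have cm k : {within half, continuous (fun z : R * R => Re (mode k z.2))} /\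
            {within half, continuous (fun z : R * R => Im (mode k z.2))}.
  split; apply: continuous_subspaceT => z.
    by apply: (@cvg_comp _ _ _ snd (fun t : R => Re (mode k t)) _ (nbhs z.2)); [exact: cvg_snd|exact: continuous_Re_mode].
  by apply: (@cvg_comp _ _ _ snd (fun t : R => Im (mode k t)) _ (nbhs z.2)); [exact: cvg_snd|exact: continuous_Im_mode].
have cS N : continuous (fun z : subspace half => Re (S N z)) /\
            continuous (fun z : subspace half => Im (S N z)).
  pose k (i : 'I_N.*2.+1) := Posz i - Posz N.
  have E : (fun z : subspace half => Re (S N z)) =
    (fun z => \sum_(i < N.*2.+1) (Re (c' (k i) z.1) * Re (mode (k i) z.2) -
       Im (c' (k i) z.1) * Im (mode (k i) z.2))).
    apply/funext => z; rewrite /S /symsum (big_morph _ (@ReD R) (erefl _ : Re 0 = 0)).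
    by apply: eq_bigr => i _; rewrite ReM.
  have E' : (fun z : subspace half => Im (S N z)) =
    (fun z => \sum_(i < N.*2.+1) (Re (c' (k i) z.1) * Im (mode (k i) z.2) +
       Im (c' (k i) z.1) * Re (mode (k i) z.2))).
    apply/funext => z; rewrite /S /symsum (big_morph _ (@ImD R) (erefl _ : Im 0 = 0)).
    by apply: eq_bigr => i _; rewrite ImM.
  rewrite E E'; split; apply: continuous_sum => i z; have [a1 a2] := cc (k i); have [b1 b2] := cm (k i).
    by apply: cvgB; apply: cvgM; [exact: a1|exact: b1|exact: a2|exact: b2].
  by apply: cvgD; apply: cvgM; [exact: a1|exact: b2|exact: a2|exact: b1].
pose B := C / (1 - q).
have B0 : 0 <= B by rewrite divr_ge0// subr_ge0 ltW//; case/andP: q0.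
have q0' : `|q| < 1 by rewrite ger0_norm; case/andP: q0.
have qlim (K : R) : (fun N => K * q ^+ N) @ \oo --> (0 : R).
  by rewrite -[X in _ --> X](mulr0 K); apply: cvgMr; exact: cvg_expr.
have qn N : 0 <= q ^+ N by rewrite exprn_ge0// expR_ge0.
pose U (z : R * R) : R[i] := F z +i* G z.
have US N z : normc (U z - S N z) <= 2 * B * q ^+ N.
  apply: le_trans (normc_le _) _; rewrite !ReImE /=.
  by have := F1 N z; have := G1 N z; rewrite -/B; lra.
have lim0 (a K : R) : (forall N, `|a| <= K * q ^+ N) -> a = 0.
  move=> h; apply/eqP; rewrite -normr_le0.
  have := cvg_lim (@Rhausdorff R) (qlim K) => <-.
  by apply: limr_ge; [apply/cvg_ex; exists 0; exact: qlim|exact: nearW].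
have Fp x t : F (x, t + 2 * pi) = F (x, t).
  apply/eqP; rewrite -subr_eq0; apply/eqP; apply: (lim0 _ (2 * B)) => N.
  have -> : F (x, t + 2 * pi) - F (x, t) = (F (x, t + 2 * pi) - Re (S N (x, t + 2 * pi))) - (F (x, t) - Re (S N (x, t))).
    by rewrite S2; ring.
  apply: le_trans (ler_normB _ _) _; have := F1 N (x, t + 2 * pi); have := F1 N (x, t).
  rewrite -/B; lra.
have Gp x t : G (x, t + 2 * pi) = G (x, t).
  apply/eqP; rewrite -subr_eq0; apply/eqP; apply: (lim0 _ (2 * B)) => N.
  have -> : G (x, t + 2 * pi) - G (x, t) = (G (x, t + 2 * pi) - Im (S N (x, t + 2 * pi))) - (G (x, t) - Im (S N (x, t))).
    by rewrite S2; ring.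
  apply: le_trans (ler_normB _ _) _; have := G1 N (x, t + 2 * pi); have := G1 N (x, t).
  rewrite -/B; lra.
have m01 := measurable_seg (0 : R) 1; have mD := measurable_cyl m01.
have f01 := seg_fin (0 : R) 1; have fD := cyl_fin m01 f01.
have sc k : csqint mu (seg 0 1) (c' k : mR -> R[i]).
  have mm (p : R[i] -> R) : p 0 = 0 -> {within `]0 : R, 1], continuous (fun x => p (c k x))} ->
      measurable_fun (seg 0 1) (fun x : mR => p (c' k x)).
    move=> p0 cp.
    have -> : seg 0 1 = ([set 0] `|` `]0 : R, 1]%classic : set mR).
      apply/seteqP; split => x; rewrite segE /= in_itv /=.
        move=> /andP[h0 h1]; have [/eqP x0|x0] := boolP (x == 0); first by left.
        by right; rewrite h1 andbT lt_neqAle eq_sym x0.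
      by move=> [->|/andP[/ltW -> ->]//]; rewrite lexx ler01.
    apply/measurable_funU; [exact: measurable_set1|exact: measurable_itv|split].
      exact: measurable_fun_set1.
    apply: (@eq_measurable_fun _ _ _ _ _ (fun x => p (c k x))).
      by move=> x; rewrite inE /= in_itv /= /c' => ->.
    by apply: subspace_continuous_measurable_fun => //; exact: measurable_itv.
  have mc : cmeas (seg 0 1) (c' k : mR -> R[i]) by split; [exact: (mm Re)|exact: (mm (Im))].
  have bk (x : mR) : seg 0 1 x -> normc (c' k x) <= M.
    move=> _; apply: le_trans (bc' k x) _; rewrite ler_piMr// exprn_ile1//; case/andP: q0 => // _ /ltW.
    by [].
  exact: (csqint_bounded_fun m01 f01 mc bk).
have mS N : cmeas Pi (S N : mR * mR -> R[i]).
  exact: (csqint_meas (csqint_trig2 m01 N sc)).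
have Fc z : (fun N => Re (S N z)) @ \oo --> F z.
  apply/cvgrPdist_le => e e0; have /cvgrPdist_le /(_ e e0) := qlim B.
  apply: filterS => N; rewrite sub0r normrN => h; apply: le_trans (F1 N z) _.
  by apply: le_trans h; rewrite ler_norm.
have Gc z : (fun N => Im (S N z)) @ \oo --> G z.
  apply/cvgrPdist_le => e e0; have /cvgrPdist_le /(_ e e0) := qlim B.
  apply: filterS => N; rewrite sub0r normrN => h; apply: le_trans (G1 N z) _.
  by apply: le_trans h; rewrite ler_norm.
have mU : cmeas Pi (U : mR * mR -> R[i]).
  split.
    apply: (measurable_fun_cvg (h := fun N (z : mR * mR) => Re (S N z))) => //.
    by move=> N; have [] := mS N.
  apply: (measurable_fun_cvg (h := fun N (z : mR * mR) => Im (S N z))) => //.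
  by move=> N; have [] := mS N.
have UB z : normc (U z) <= M + 2 * B.
  have h := US 0%N z; rewrite expr0 mulr1 in h.
  have -> : U z = S 0%N z + (U z - S 0%N z) by ring.
  apply: le_trans (le_normcD _ _) _; apply: lerD => //.
  rewrite /S /symsum big_ord_recl big_ord0 addr0 normcM normc_mode mulr1.
  by apply: le_trans (bc' _ _) _; rewrite ler_piMr// exprn_ile1//; case/andP: q0 => // _ /ltW.
exists U; split => //.
- exact: (F2 (fun N => (cS N).1)).
- exact: (G2 (fun N => (cS N).2)).
- by move=> x t; rewrite /U Fp Gp.
- have UB' (z : mR * mR) : Pi z -> normc (U z) <= M + 2 * B by move=> _; exact: UB.
  exact: (csqint_bounded_fun mD fD mU UB').
move=> x hx; have Ax : seg 0 1 x by rewrite segE; case/andP: hx => /ltW -> ->.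
have mUx := cmeas_section m01 Ax mU.
have UBx (t : mR) : circ t -> normc (U (x, t)) <= M + 2 * B by move=> _; exact: UB.
have sU := csqint_bounded_fun (@measurable_circ R) (@circ_fin R) mUx UBx.
split => // k; pose e N := (2 * B * q ^+ N) ^+ 2.
have -> : c k x = c' k x by rewrite /c' hx.
apply/eqP; rewrite -subr_eq0; apply/eqP; apply: (@normc_eq0_lim R _ e `|k|%N).
  by rewrite -[X in _ --> X](mulr0 (0 : R)) /e; under eq_fun do rewrite expr2; apply: cvgM; exact: qlim.
move=> N kN; have sS : csqint mu circ (fun t => S N (x, t)) := csqint_trigsum (c'^~ x) N.
have sub := csqintB (@measurable_circ R) sU sS.
have := cintegrable_coef_section k sub.
have -> : fourier_coef (fun t => U (x, t) - S N (x, t)) k = fourier_coef (fun t => U (x, t)) k - c' k x.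
  have := fourier_coef_lin (-1) k (integrable_csqint_circ sS) (integrable_csqint_circ sU).
  rewrite [fourier_coef (fun t => S N (x, t)) k](fourier_coef_trigsum (c'^~ x) N k) kN mulN1r addrC => <-.
  by congr fourier_coef; apply/funext => t; rewrite mulN1r addrC.
move=> h; rewrite -(ler_pM2l (pi2_gt0 R)); apply: le_trans h _.
rewrite /csqn /e; apply: le_trans (le_Rintegral (@measurable_circ R) _ (integrable_cst_fin (@measurable_circ R) (@circ_fin R) ((2 * B * q ^+ N) ^+ 2)) _) _.
- exact: sqint_sq_integrable (csqint_sqint (@measurable_circ R) sub).
- move=> t _; have h1 := US N (x, t); have h0 := normc_ge0 (U (x, t) - S N (x, t)).
  have h2 := le_trans h0 h1; exact: (lerXn2r 2 h0 h2 h1).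
rewrite Rintegral_cst; last exact: measurable_circ.
have -> : fine (mu circ) = 2 * pi by exact: (congr1 fine (mu_circ R)).
by rewrite mulrC.
Qed.

(** Two functions continuous on the half-open cylinder and equal almost everywhere agree,
    because every relatively open set contains a rectangle of positive measure. *)
Lemma ae_half_eq0 (f : R * R -> R) : {within half, continuous f} ->
  (forall x t, f (x, t + 2 * pi) = f (x, t)) ->
  {ae mu2, forall z : mR * mR, Pi z -> f z = 0} ->
  forall x t, 0 < x <= 1 -> 0 <= t <= 2 * pi -> f (x, t) = 0.
Proof.
move=> /subspace_continuousP cf per [N [mN N0 sN]] x t x01 t02.
apply: contrapT => /eqP fn; have hx : half (x, t) by [].
have /cvgrPdist_lt /(_ `|f (x, t)|) := cf (x, t) hx; rewrite normr_gt0 => /(_ fn).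
rewrite near_withinE => -[[P Q] /= [/nbhs_ballP[e /= e0 hP] /nbhs_ballP[e' /= e'0 hQ]] hPQ].
have [/andP[x0 x1] /andP[t0 t2]] := (x01, t02).
pose d := Num.min e x; have d0 : 0 < d by rewrite lt_min e0.
have [a [b [ab hab]]] : exists a b : R, a < b /\ forall s, a < s < b -> ball t e' s /\ 0 <= s <= 2 * pi.
  have p0 := pi2_gt0 R.
  have [tp|tn] := ltP 0 t.
    exists (t - Num.min e' t), t; split; first by rewrite gtrBl lt_min e'0.
    move=> s /andP[s1 s2]; have h1 : Num.min e' t <= e' by rewrite ge_min lexx.
    have h2 : Num.min e' t <= t by rewrite ge_min lexx orbT.
    split; last by apply/andP; split; lra.
    by rewrite /ball /= ltr_norml; apply/andP; split; lra.
  have -> : t = 0 by apply/eqP; rewrite eq_le tn t0.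
  exists 0, (Num.min e' (2 * pi)); split; first by rewrite lt_min e'0.
  move=> s /andP[s1 s2]; have h1 : Num.min e' (2 * pi) <= e' by rewrite ge_min lexx.
  have h2 : Num.min e' (2 * pi) <= 2 * pi by rewrite ge_min lexx orbT.
  split; last by apply/andP; split; lra.
  by rewrite /ball /= ltr_norml; apply/andP; split; lra.
have h1 : d <= e by rewrite ge_min lexx.
have h2 : d <= x by rewrite ge_min lexx orbT.
pose I : set mR := `]x - d, x[%classic; pose J : set mR := `]a, b[%classic.
have mI : measurable I by exact: measurable_itv.
have mJ : measurable J by exact: measurable_itv.
have sub : I `*` J `<=` N.
  move=> [y s] [/= ]; rewrite /I /J /= !in_itv /= => /andP[y1 y2] hs.
  have [bs c1] := hab s hs; apply: sN => /=.
  have y0 : 0 < y by lra.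
  have yle : y <= 1 by lra.
  have cy : circ s by rewrite /Defs.circ /= in_itv.
  have Py : Pi (y, s) by split => //=; rewrite segE yle (ltW y0).
  move=> /(_ Py) fz; have hy : half (y, s) by rewrite /= y0.
  have H : `|f (x, t) - f (y, s)| < `|f (x, t)|.
    apply: (hPQ (y, s)) => //; split => /=; last exact: hQ.
    by apply: hP; rewrite /ball /= ltr_norml; apply/andP; split; lra.
  by move: H; rewrite fz subr0 ltxx.
have : (mu2 (I `*` J) <= mu2 N)%E.
  by apply: le_measure; rewrite ?inE//; exact: measurableX.
rewrite N0 (_ : mu2 (I `*` J) = (mu I * mu J)%E); last exact: product_measure1E.
rewrite /I /J !lebesgue_measure_itv /= !lte_fin ab gtrBl d0 -!EFinD -EFinM lee_fin leNgt => /negP; apply.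
by rewrite opprB addrCA subrr addr0 mulr_gt0// subr_gt0.
Qed.

Lemma circ_reduce (v : R -> R[i]) : (forall t, v (t + 2 * pi) = v t) ->
  (forall t, 0 <= t <= 2 * pi -> v t = 0) -> forall t, v t = 0.
Proof.
move=> per h t; have p0 := pi2_gt0 R.
have perN n s : v (s + n%:R * (2 * pi)) = v s.
  elim: n s => [|n ih] s; first by rewrite mul0r addr0.
  by rewrite -natr1 mulrDl mul1r addrA per ih.
pose m := Num.floor (t / (2 * pi)).
have h1 : m%:~R <= t / (2 * pi) by exact: floor_le_tmp.
have h2 : t / (2 * pi) < m%:~R + 1 by have := floorD1_gt (t / (2 * pi)); rewrite intrD.
have E : v t = v (t - m%:~R * (2 * pi)).
  case: m {h1 h2} => n; first by rewrite -[RHS](perN n) subrK.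
  rewrite -[LHS](perN n.+1) NegzE; congr v; rewrite mulrNz; ring.
rewrite E; apply: h; move: h1 h2; rewrite ler_pdivlMr// ltr_pdivrMr// mulrDl mul1r.
by move=> h1 h2; apply/andP; split; lra.
Qed.

Lemma trace_uniq (u : R * R -> R[i]) t1 t2 : is_trace u t1 -> is_trace u t2 -> t1 = t2.
Proof.
move=> [U1 [a1 b1 p1 e1 ->]] [U2 [a2 b2 p2 e2 ->]]; apply/funext => th.
have part (p : R[i] -> R) : {morph p : x y / x - y} ->
   {within half, continuous (fun z => p (U1 z))} -> {within half, continuous (fun z => p (U2 z))} ->
   forall t, 0 <= t <= 2 * pi -> p (U1 (1, t)) - p (U2 (1, t)) = 0.
  move=> pB c1 c2 t ht.
  apply: (ae_half_eq0 (f := fun z => p (U1 z) - p (U2 z))).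
  - by move=> z; apply: cvgB; [exact: c1|exact: c2].
  - by move=> x s; rewrite p1 p2.
  - by apply: filterS2 e1 e2 => z h1 h2 Pz; rewrite -h1// -h2// subrr.
  - by rewrite ltr01 lexx.
  - exact: ht.
apply/eqP; rewrite -subr_eq0; apply/eqP.
apply: (circ_reduce (v := fun t => U1 (1, t) - U2 (1, t))) => [t|t ht]; first by rewrite p1 p2.
apply: complex_eq; rewrite !ReImE.
  by apply: (part Re) => // x y; rewrite !ReImE.
by apply: (part (Im)) => // x y; rewrite !ReImE.
Qed.

End Traces.

(** * The spaces K and J in terms of modes *)

Section Periodization.
Variable R : realType.
Local Notation mu := (@lebesgue_measure R).
Local Notation mR := (measurableTypeR R).
Local Notation mu2 := (mu \x mu)%E.
Local Notation circ := (@circ R : set mR).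
Local Notation D01 := (seg (0 : R) 1).
Local Notation Pi := (D01 `*` circ).

Definition red (t : R) : R := t - (Num.floor (t / (2 * pi)))%:~R * (2 * pi).

Lemma red_period t : red (t + 2 * pi) = red t.
Proof.
have p0 : 2 * pi != 0 :> R by rewrite gt_eqF// pi2_gt0.
have E : (t + 2 * pi) / (2 * pi) = t / (2 * pi) + 1 by rewrite (mulrDl t) divff.
rewrite /red E (_ : Num.floor (t / (2 * pi) + 1) = Num.floor (t / (2 * pi)) + 1).
  by rewrite intrD mulrDl mul1r; ring.
apply: floor_def; rewrite !intrD lerD2r ltrD2r -intrD.
by rewrite floor_le_tmp floorD1_gt.
Qed.

Lemma red_id t : 0 <= t < 2 * pi -> red t = t.
Proof.
move=> /andP[t0 t1]; rewrite /red (_ : Num.floor _ = 0) ?mul0r ?subr0//.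
apply: floor_def; rewrite add0r divr_ge0//= ?(ltW (pi2_gt0 R))//.
by rewrite ltr_pdivrMr ?pi2_gt0// mul1r.
Qed.

(** The periodic function that agrees with [v] on the open period. The end point is given
    the value 0, so that measurability on the closed interval is preserved. *)
Definition pert (v : R -> R[i]) (t : R) : R[i] := if 0 < red t < 2 * pi then v (red t) else 0.

Lemma pert_period v t : pert v (t + 2 * pi) = pert v t.
Proof. by rewrite /pert red_period. Qed.

Lemma pert_circ v t : circ t -> pert v t = if 0 < t < 2 * pi then v t else 0.
Proof.
rewrite /Defs.circ /= in_itv /= => /andP[t0 t1]; rewrite /pert.
have [t2|t2] := ltP t (2 * pi); first by rewrite red_id ?t0// t2.
have -> : t = 0 + 2 * pi by apply/eqP; rewrite add0r eq_le t1 t2.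
by rewrite red_period (@red_id 0) ?lexx ?pi2_gt0// ltxx andbF.
Qed.

Lemma ae_inner : {ae mu, forall t : mR, circ t -> 0 < t < 2 * pi}.
Proof.
have N (a : R) : {ae mu, forall t : mR, t <> a}.
  exists [set a]; split; [exact: measurable_set1|exact: lebesgue_measure_set1|].
  by move=> t /= /contrapT.
apply: filterS2 (N 0) (N (2 * pi)) => t /eqP t0 /eqP t2.
rewrite /Defs.circ /= in_itv /= => /andP[h1 h2].
by rewrite !lt_neqAle eq_sym t0 t2 h1 h2.
Qed.

Lemma cmeas_pert (v : mR -> R[i]) : cmeas circ v -> cmeas circ (pert v).
Proof.
move=> mv; have mI : measurable (`]0 : R, 2 * pi[%classic : set mR) by exact: measurable_itv.
have h := cmeasM mv (cmeasR (measurable_funTS (measurable_indic mI)) : cmeas circ _).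
have E : {in circ, (fun t => v t * (\1_(`]0 : R, 2 * pi[%classic : set mR) t)%:C) =1 pert v}.
  move=> t; rewrite inE => ct; rewrite pert_circ// indicE mem_setE in_itv.
  by case: ifP => _; rewrite ?mulr1 ?mulr0.
have [h1 h2] := h; split.
  by apply: eq_measurable_fun h1 => t tc; rewrite /= E.
by apply: eq_measurable_fun h2 => t tc; rewrite /= E.
Qed.

Lemma pert_ae (v : mR -> R[i]) : {ae mu, forall t : mR, circ t -> v t = pert v t}.
Proof. by apply: filterS ae_inner => t h ct; rewrite pert_circ// h. Qed.

Definition perz (u : R * R -> R[i]) (z : R * R) : R[i] := pert (fun t => u (z.1, t)) z.2.

Lemma cmeas_perz (u : mR * mR -> R[i]) : cmeas Pi u -> cmeas Pi (perz u).
Proof.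
move=> mv; have mI : measurable (`]0 : R, 2 * pi[%classic : set mR) by exact: measurable_itv.
have h := cmeasM mv (@cmeas_snd R D01 _ (cmeasR (measurable_funTS (measurable_indic mI)) : cmeas circ _)).
have E : {in Pi, (fun z => u z * (\1_(`]0 : R, 2 * pi[%classic : set mR) z.2)%:C) =1 perz u}.
  move=> [x t]; rewrite inE => -[_ ct]; rewrite /perz /= pert_circ// indicE mem_setE in_itv.
  by case: ifP => _; rewrite ?mulr1 ?mulr0.
have [h1 h2] := h; split.
  by apply: eq_measurable_fun h1 => t tc; rewrite /= E.
by apply: eq_measurable_fun h2 => t tc; rewrite /= E.
Qed.

Lemma normc_perz u z : Pi z -> normc (perz u z) <= normc (u z).
Proof.
move=> [_ cz]; rewrite /perz pert_circ//; case: ifP => _; first by case: z cz.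
by rewrite normc0 normc_ge0.
Qed.

Lemma coef_perz (u : mR * mR -> R[i]) k x : cmeas Pi u -> D01 x -> coef (perz u) k x = coef u k x.
Proof.
move=> mu_ Dx; rewrite !coefE; congr (_ * _).
have mx := cmeas_section (measurable_seg _ _) Dx mu_.
apply: cint_ae; first exact: measurable_circ.
- by apply: cmeasM; [exact: (cmeas_pert mx)|exact: cmeas_mode].
- by apply: cmeasM; [exact: mx|exact: cmeas_mode].
- by apply: filterS (pert_ae (fun t => u (x, t))) => t h ct; rewrite /perz /= -h.
Qed.

Lemma build (c : int -> mR -> R[i]) : (forall k, csqint mu D01 (c k)) ->
  (\esum_(k in [set: int]) (csqn mu D01 (c k))%:E < +oo)%E ->
  exists u : R * R -> R[i], [/\ Pi_fun u, csqint mu2 Pi (u : mR * mR -> R[i]) &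
    forall k, {ae mu, forall x, D01 x -> coef u k x = c k x}].
Proof.
move=> sc lc; have mA := measurable_seg (0 : R) 1.
have [u [su cu _]] := cyl_from_modes mA (seg_fin _ _) sc lc.
have mu_ := csqint_meas su; have mp := cmeas_perz mu_.
exists (perz u); split.
- have [m1 m2] := mp; split; [exact: m1|exact: m2|].
  by move=> x t; rewrite /perz /= pert_period.
- apply: (csqint_le (measurable_cyl mA) mp (csqint_sqint (measurable_cyl mA) su)).
  exact: normc_perz.
- by move=> k; apply: filterS (cu k) => x h Dx; rewrite coef_perz// h.
Qed.

Lemma build_circ (V : int -> R[i]) : (\esum_(k in [set: int]) (normc (V k) ^+ 2)%:E < +oo)%E ->
  exists v : R -> R[i], [/\ circle_fun v, csqint mu circ (v : mR -> R[i]) &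
    forall k, fourier_coef v k = V k].
Proof.
move=> lV; pose B := fine (\esum_(k in [set: int]) (normc (V k) ^+ 2)%:E).
have [|g [sg cg _]] := @circ_from_coefs R V B.
  move=> N; rewrite -lee_fin symsumE /B fineK.
    by apply: symsum_le_esum => k; rewrite lee_fin sqr_ge0.
  by rewrite ge0_fin_numE ?esum_ge0// => k _; rewrite lee_fin sqr_ge0.
have mp := cmeas_pert (csqint_meas sg).
have mc := @measurable_circ R.
exists (pert g); split.
- by have [m1 m2] := mp; split; [exact: m1|exact: m2|exact: pert_period].
- apply: (csqint_le mc mp (csqint_sqint mc sg)) => t ct; rewrite pert_circ//.
  by case: ifP => // _; rewrite normc0 normc_ge0.
- move=> k; rewrite -cg !fourier_coefE; congr (_ * _); apply: cint_ae => //.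
  + by apply: cmeasM; [exact: mp|exact: cmeas_mode].
  + by apply: cmeasM; [exact: csqint_meas sg|exact: cmeas_mode].
  + by apply: filterS (pert_ae g) => t h ct; rewrite -h.
Qed.

End Periodization.

Section KSpace.
Variable R : realType.
Local Notation mu := (@lebesgue_measure R).
Local Notation mR := (measurableTypeR R).
Local Notation mu2 := (mu \x mu)%E.
Local Notation circ := (@circ R : set mR).
Local Notation D01 := (seg (0 : R) 1).
Local Notation Pi := (D01 `*` circ).
Local Notation cyl e := (seg e (1 - e) `*` circ).
Local Notation wtC := (fun x : mR => (wt x)%:C).
Let m01 := measurable_seg (0 : R) 1.

Lemma normc2_meas d (T : measurableType d) (m : {measure set T -> \bar R}) (D : set T) (f : T -> R[i]) :
  measurable D -> csqint m D f -> measurable_fun D (fun x => (normc (f x) ^+ 2)%:E).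
Proof.
move=> mD s; apply/measurable_EFinP; apply: measurable_funX; apply: cmeas_normc => //.
exact: csqint_meas s.
Qed.

Lemma le_of_eq (x y : \bar R) : x = y -> (x <= y)%E. Proof. by move=> ->. Qed.

Lemma normc_reM (r : R) (w : R[i]) : 0 <= r -> normc (r%:C * w) = r * normc w.
Proof. by move=> r0; rewrite mulrC normc_realM ger0_norm// mulrC. Qed.

Lemma powR_le1 (q x : R) : 0 <= q -> 0 <= x <= 1 -> x `^ q <= 1.
Proof.
move=> q0 /andP[x0 x1]; have := @ge0_ler_powR R q q0 x 1.
by rewrite !nnegrE ler01 x0 powR1 => /(_ isT isT x1).
Qed.

Lemma powC_le1 (q x : R) : 0 <= q -> 0 <= x <= 1 -> normc ((x `^ q)%:C : R[i]) <= 1.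
Proof. by move=> q0 x01; rewrite -[X in normc X]mulr1 normc_reM ?powR_ge0// normc1 mulr1 powR_le1. Qed.

Definition ae01 (f g : mR -> R[i]) : Prop := {ae mu, forall x, 0 < x < 1 -> f x = g x}.

Lemma ae01D : {ae mu, forall x : mR, D01 x -> 0 < x < 1}.
Proof.
have N (a : R) : {ae mu, forall t : mR, t <> a}.
  exists [set a]; split; [exact: measurable_set1|exact: lebesgue_measure_set1|].
  by move=> t /= /contrapT.
apply: filterS2 (N 0) (N 1) => x h0 h1; rewrite segE => /andP[x0 x1].
by rewrite !lt_neqAle x0 x1 !andbT eq_sym; apply/andP; split; apply/eqP.
Qed.

Lemma ae01P f g : ae01 f g <-> {ae mu, forall x, D01 x -> f x = g x}.
Proof.
split => h; first by apply: filterS2 h ae01D => x h1 h2 Dx; exact: h1 (h2 Dx).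
by apply: filterS h => x h1 /andP[x0 x1]; apply: h1; rewrite segE !ltW.
Qed.

Lemma ae01_sym f g : ae01 f g -> ae01 g f.
Proof. by apply: filterS => x h x01; rewrite h. Qed.

Lemma ae01_trans f g h : ae01 f g -> ae01 g h -> ae01 f h.
Proof. by move=> h1 h2; apply: filterS2 h1 h2 => x e1 e2 x01; rewrite e1// e2. Qed.

Lemma is_wderiv00 (w : R * R -> R[i]) : loc_integrable w -> is_wderiv 0 0 w w.
Proof. by split=> // phi _; rewrite expr0 mul1r. Qed.

(** Testing against one mode at a time reduces this to functions of the radius. *)
Lemma wderiv_coef_uniq p q (w G G' : R * R -> R[i]) k : is_wderiv p q w G -> is_wderiv p q w G' ->
  ae01 (coef G k) (coef G' k).
Proof.
move=> h h'; have [_ lG _] := h; have [_ lG' _] := h'.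
have [w1 w2] := coef_locint0 k (fun e => loc_integrable_cyl lG (e := e)).
have [g1 g2] := coef_locint0 k (fun e => loc_integrable_cyl lG' (e := e)).
pose d x := coef G k x - coef G' k x.
have dl e : 0 < e -> cintegrable mu (seg e (1 - e)) d.
  by move=> e0; apply: cintegrableB; [exact: measurable_seg|split; [exact: w1|exact: w2]|split; [exact: g1|exact: g2]].
have Z : {ae mu, forall x, 0 < x < 1 -> d x = 0}.
  apply: ctest1_sep; [by move=> e e0; have [] := dl e e0|by move=> e e0; have [] := dl e e0|].
  move=> f tf.
  transitivity (cint mu D01 (fun x => coef G k x * (f 0%N x)%:C - coef G' k x * (f 0%N x)%:C)).
    by apply: eq_cint => x _; rewrite mulrBl.
  rewrite (cintB m01 (ctest1_int 0%N m01 tf w1 w2) (ctest1_int 0%N m01 tf g1 g2)).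
  by rewrite (wderiv_mode_test k h tf) (wderiv_mode_test k h' tf) subrr.
by apply: filterS Z => x h1 x01; apply/eqP; rewrite -subr_eq0 -/(d x) h1.
Qed.

Lemma locint_measurable01 (y : mR -> R) : locint y -> measurable_fun D01 y.
Proof.
move=> ly; pose Y x := - \int[mu]_(s in seg x 1) y s.
have pY : prim Y y.
  by split => // x _; rewrite /Y /seg set_itv1 Rintegral_set1 oppr0 sub0r.
pose E n : set mR := if n is k.+1 then seg k.+1%:R^-1 1 else [set 0].
have -> : D01 = \bigcup_n E n.
  apply/seteqP; split => [x|x [[|n] _]].
  - rewrite segE => /andP[h0 x1]; have [x0|x0] := eqVneq x 0; first by exists 0%N.
    have xp : 0 < x by rewrite lt_neqAle eq_sym x0.
    exists (Num.bound x^-1).+1 => //=; rewrite segE x1 andbT.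
    have xV : 0 <= x^-1 by rewrite invr_ge0.
    rewrite -[leRHS]invrK lef_pV2 ?posrE ?ltr0n ?invr_gt0//.
    by apply: le_trans (ltW (archi_boundP xV)) _; rewrite ler_nat.
  - by move=> -> ; rewrite segE lexx ler01.
  - by rewrite /= !segE => /andP[h ->]; rewrite andbT (le_trans _ h)// invr_ge0.
apply/measurable_fun_bigcup; first by case=> [|n]; [exact: measurable_set1|exact: measurable_seg].
case=> [|n]; first exact: measurable_fun_set1.
have n0 : 0 < n.+1%:R^-1 :> R by rewrite invr_gt0 ltr0n.
by have /integrableP[/measurable_EFinP] := ly _ n0.
Qed.

Lemma csqn_wt (P : mR -> R[i]) : cwsq P ->
  csqint mu D01 (fun x => wtC x * P x) /\ csqn mu D01 (fun x => wtC x * P x) = cwn P.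
Proof.
move=> [s1 s2].
have s : csqint mu D01 (fun x => wtC x * P x).
  by split; [apply: eq_sqint s1|apply: eq_sqint s2] => x; rewrite /= ?Re_realM ?Im_realM.
split => //; rewrite (csqn_ReIm (measurable_seg _ _) s) /cwn /wnorm.
by congr (_ + _); apply: eq_Rintegral => x _; rewrite ?Re_realM ?Im_realM.
Qed.

Lemma cwsq_of_csqint (P : mR -> R[i]) : csqint mu D01 (fun x => wtC x * P x) -> cwsq P.
Proof.
by move=> [s1 s2]; split; [apply: eq_sqint s1|apply: eq_sqint s2] => x; rewrite /= ?Re_realM ?Im_realM.
Qed.

Lemma powC_bounded (s e : R) : 0 < e -> exists M, forall x, e <= x <= 1 -> normc ((x `^ s)%:C) <= M.
Proof.
move=> e0; exists (1 + e `^ s) => x /andP[ex x1]; have x0 := lt_le_trans e0 ex.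
rewrite -[X in normc X]mul1r normc_realM normc1 mul1r ger0_norm ?powR_ge0//.
have [s0|s0] := leP 0 s.
  have := @ge0_ler_powR R s s0 x 1; rewrite !nnegrE ler01 (ltW x0) powR1 /= => h.
  by apply: le_trans (h isT isT x1) _; rewrite lerDl powR_ge0.
have := @ge0_ler_powR R (- s) _ e x; rewrite !nnegrE oppr_ge0 (ltW s0) (ltW e0) (ltW x0).
move=> /(_ isT isT isT ex); rewrite !powRN lef_pV2 ?posrE ?powR_gt0// => h.
by apply: le_trans h _; rewrite lerDr ler01.
Qed.

Lemma cmeas_pow (s : R) (A : set mR) : cmeas A (fun x => (x `^ s)%:C).
Proof. by apply: cmeasR; exact: (measurable_funTS (measurable_powR _)). Qed.

Lemma cmeas_pow2 (s : R) (A : set mR) : measurable A -> cmeas (A `*` circ) (fun z => (z.1 `^ s)%:C).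
Proof. by move=> mA; exact: (cmeas_fst mA (cmeas_pow s A)). Qed.

Lemma csqint_pow_cyl (s e b : R) (u : mR * mR -> R[i]) : 0 < e -> b <= 1 ->
  csqint mu2 (seg e b `*` circ) u -> csqint mu2 (seg e b `*` circ) (fun z => (z.1 `^ s)%:C * u z).
Proof.
move=> e0 b1 su; have [M hM] := powC_bounded s e0.
have mA := measurable_seg e b.
have hM' (z : mR * mR) : (seg e b `*` circ) z -> normc ((z.1 `^ s)%:C) <= M.
  by move=> [/= + _]; rewrite segE => /andP[h1 h2]; apply: hM; rewrite h1 (le_trans h2).
have := csqint_bounded (measurable_cyl mA) (cmeas_pow2 s mA) hM' su.
by congr (csqint _ _ _); apply/funext => z; rewrite mulrC.
Qed.

Lemma csqint_pow_seg (s e b : R) (c : mR -> R[i]) : 0 < e -> b <= 1 ->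
  csqint mu (seg e b) c -> csqint mu (seg e b) (fun x => (x `^ s)%:C * c x).
Proof.
move=> e0 b1 su; have [M hM] := powC_bounded s e0.
have hM' (x : mR) : seg e b x -> normc ((x `^ s)%:C) <= M.
  by rewrite segE => /andP[h1 h2]; apply: hM; rewrite h1 (le_trans h2).
have := csqint_bounded (measurable_seg e b) (cmeas_pow s _) hM' su.
by congr (csqint _ _ _); apply/funext => z; rewrite mulrC.
Qed.

Lemma csqint_sub d (T : measurableType d) (m : {measure set T -> \bar R}) (A B : set T) (f : T -> R[i]) :
  measurable A -> measurable B -> A `<=` B -> csqint m B f -> csqint m A f.
Proof.
move=> mA mB AB /(csqint_normcP m mB)[mf lf]; apply/(csqint_normcP m mA).
have mfA : cmeas A f by have [m1 m2] := mf; split; exact: measurable_funS m1 || exact: (measurable_funS mB AB).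
split => //; apply: le_lt_trans lf; apply: ge0_subset_integral => //.
  by apply/measurable_EFinP; apply: measurable_funX; exact: cmeas_normc.
by move=> x _; rewrite lee_fin sqr_ge0.
Qed.

(** On almost every circle the factor is a constant. *)
Lemma coef_pow (s : R) (u : mR * mR -> R[i]) k (A : set mR) : measurable A -> (mu A < +oo)%E ->
  csqint mu2 (A `*` circ) u ->
  {ae mu, forall x, A x -> coef (fun z => (z.1 `^ s)%:C * u z) k x = (x `^ s)%:C * coef u k x}.
Proof.
move=> mA fA su; apply: filterS (csqint_section mA su) => x h Ax.
have ih := integrable_csqint_circ (h Ax).
rewrite !coefE [RHS]mulrCA; congr (_ * _).
rewrite -cintZ; [|exact: measurable_circ|exact: cintegrable_modeM].
by apply: eq_cint => t _; rewrite mulrA.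
Qed.

Lemma coef_pow_inv (s : R) (u : mR * mR -> R[i]) k (A : set mR) : measurable A -> (mu A < +oo)%E ->
  csqint mu2 (A `*` circ) (fun z => (z.1 `^ s)%:C * u z) ->
  {ae mu, forall x, A x -> 0 < x -> coef (fun z => (z.1 `^ s)%:C * u z) k x = (x `^ s)%:C * coef u k x}.
Proof.
move=> mA fA su; apply: filterS (csqint_section mA su) => x h Ax x0.
have ih := integrable_csqint_circ (h Ax).
have p0 : (x `^ s)%:C != 0 by rewrite (inj_eq (@complexI R)) gt_eqF// powR_gt0.
have iu : cintegrable mu circ (fun t => u (x, t)).
  have := cintegrableZ (@measurable_circ R) ((x `^ s)%:C)^-1 ih; congr (cintegrable _ _ _).
  by apply/funext => t /=; rewrite mulrA mulVf// mul1r.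
rewrite !coefE [RHS]mulrCA; congr (_ * _).
rewrite -cintZ; [|exact: measurable_circ|exact: cintegrable_modeM].
by apply: eq_cint => t _; rewrite mulrA.
Qed.

Definition wrep (l : R) m (w : R * R -> R[i]) (P : int -> nat -> mR -> R[i]) :=
  [/\ Pi_fun w, forall k, gchain (fun p => l - p%:R) m (P k) &
      forall k, {ae mu, forall x, 0 < x < 1 -> coef w k x = (x `^ l)%:C * P k 0%N x}].

Definition rder (l : R) (P : nat -> mR -> R[i]) p : mR -> R[i] := fun x => (x `^ (l - p%:R))%:C * P p x.

Lemma rder_cprim l m P p : gchain (fun p => l - p%:R) m P -> (p < m)%N ->
  cprim (rder l P p) (rder l P p.+1).
Proof.
move=> [d _] pm; have := d p pm; rewrite /cdprim Re_lin2 Im_lin2 => -[d1 d2].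
have E (u v : mR -> R) : dprim u (fun x => 1 * v x + - (l - p%:R) * u x) ->
    prim (fun x => x `^ (l - p%:R) * u x) (fun x => x `^ (l - p.+1%:R) * v x).
  move=> du; apply: eq_prim (prim_mul (powR_prim (l - p%:R)) du) => // x /andP[x0 _].
  have -> : l - p.+1%:R = (l - p%:R) - 1 by rewrite -(natr1 p); ring.
  by rewrite !powR_m1//; ring.
split; [apply: eq_prim (E _ _ d1)|apply: eq_prim (E _ _ d2)] => x _; by rewrite /rder /= ?Re_realM ?Im_realM.
Qed.

Lemma rder_csqint l m P p e : gchain (fun p => l - p%:R) m P -> (p <= m)%N -> 0 < e ->
  csqint mu (seg e 1) (rder l P p).
Proof.
move=> [_ s] pm e0; have [sw _] := csqn_wt (s p pm).
have sub : seg e 1 `<=` D01 by move=> x; rewrite !segE => /andP[/(le_trans (ltW e0)) -> ->].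
have se := csqint_sub (measurable_seg e 1) (measurable_seg 0 1) sub sw.
have := csqint_pow_seg (l - p%:R + 2^-1) e0 (lexx 1) se.
have mr : cmeas (seg e 1) (rder l P p).
  apply: cmeasM; first exact: cmeas_pow.
  have [/wsq_locint[l1 _] /wsq_locint[l2 _]] := s p pm.
  split; first by have /integrableP[/measurable_EFinP] := l1 e e0.
  by have /integrableP[/measurable_EFinP] := l2 e e0.
apply: csqint_ae => //; first exact: measurable_seg.
apply: aeW => x; rewrite segE => /andP[ex _]; have x0 := lt_le_trans e0 ex.
rewrite /rder mulrA -rmorphM /wt -powRD; last by rewrite (gt_eqF x0) implybT.
by rewrite addrK.
Qed.

Lemma rder_clocint l m P : gchain (fun p => l - p%:R) m P -> clocint (rder l P 0).
Proof.
move=> g; split => e e0; have [i1 i2] := csqint_integrable (measurable_seg e 1) (seg_fin e 1) (rder_csqint g (leq0n m) e0).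
  exact: i1.
exact: i2.
Qed.

Lemma normc_ik k q : normc (ik k ^+ q : R[i]) ^+ 2 = (k%:~R ^+ 2) ^+ q.
Proof.
elim: q => [|q ih]; first by rewrite !expr0 normc1 expr1n.
rewrite [ik k ^+ q.+1]exprS normcM exprMn ih [RHS]exprS; congr (_ * _).
have n1 : normc (@iC R) = 1 by rewrite /iC /normc expr0n expr1n add0r sqrtr1.
by rewrite /ik normc_realM exprMn real_normK ?num_real// n1 expr1n mul1r.
Qed.

(** The weighted norm of a weak derivative, by Parseval's identity. *)
Lemma wrep_norm l m w P p q G : wrep l m w P -> (p <= m)%N -> is_wderiv p q w G ->
  csqint mu2 Pi (fun z => (z.1 `^ (p%:R - (l + 2^-1)))%:C * G z : R[i]) ->
  Pi_L2sq (fun z => (z.1 `^ (p%:R - (l + 2^-1)))%:C * G z) =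
  ((2 * pi)%:E * \esum_(k in [set: int]) ((k%:~R ^+ 2) ^+ q * cwn (P k p))%:E)%E.
Proof.
move=> [pw gP cw] pm wd sG.
rewrite [LHS](parseval_cyl m01 (seg_fin _ _) sG); congr (_ * _)%E.
apply: eq_esum => k _; rewrite -(csqnE m01 (csqint_coef m01 (seg_fin _ _) k sG)).
congr EFin; have [_ s] := gP k; have [sw <-] := csqn_wt (s p pm).
have cw' : {ae mu, forall x, 0 < x < 1 -> coef w k x = rder l (P k) 0%N x}.
  by apply: filterS (cw k) => x h x01; rewrite h// /rder subr0.
have ck := coef_wderiv wd (fun j jp => rder_cprim (gP k) (leq_trans jp pm)) (rder_clocint (gP k)) cw'.
have ck2 := coef_pow_inv k m01 (seg_fin _ _) sG.
have nik := normc_ik k q.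
have sR : csqint mu D01 (fun x => ik k ^+ q * (wtC x * P k p x)) by exact: csqintZ.
rewrite -nik.
have -> : normc (ik k ^+ q) ^+ 2 * csqn mu D01 (fun x => wtC x * P k p x) =
   csqn mu D01 (fun x => ik k ^+ q * (wtC x * P k p x)).
  rewrite /csqn -RintegralZl//; last exact: sqint_sq_integrable (csqint_sqint m01 sw).
  by apply: eq_Rintegral => x _; rewrite [in RHS]normcM [RHS]exprMn.
apply: EFin_inj; rewrite (csqnE m01 sR) (csqnE m01 (csqint_coef m01 (seg_fin _ _) k sG)).
apply: ae_eq_integral => //.
- apply/measurable_EFinP; apply: measurable_funX; apply: cmeas_normc => //.
  exact: csqint_meas (csqint_coef m01 (seg_fin _ _) k sG).
- exact: normc2_meas m01 sR.
apply: filterS3 ck ck2 ae01D => x h1 h2 h3 Dx; congr ((normc _ ^+ 2)%:E).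
have /andP[xp xl] := h3 Dx.
rewrite h2// h1 ?xp//= /rder mulrCA; congr (_ * _); rewrite mulrA -rmorphM -powRD; last by rewrite (gt_eqF xp) implybT.
by rewrite /wt; congr ((_ `^ _)%:C * _); field.
Qed.

(** The weak derivative is built from the modes it must have, whose weighted norms are summable
    by assumption. *)
Lemma wrep_wderiv l m w P p q : wrep l m w P -> csqint mu2 Pi (w : mR * mR -> R[i]) -> (p <= m)%N ->
  (\esum_(k in [set: int]) ((k%:~R ^+ 2) ^+ q * cwn (P k p))%:E < +oo)%E ->
  exists2 G, is_wderiv p q w G & csqint mu2 Pi (fun z => (z.1 `^ (p%:R - (l + 2^-1)))%:C * G z : R[i]).
Proof.
move=> [pw gP cw] sw pm lt; have mD := measurable_cyl m01.
have sP k := csqn_wt ((gP k).2 p pm).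
pose c k (x : mR) := ik k ^+ q * (wtC x * P k p x).
have nik k := normc_ik k q.
have sc k : csqint mu D01 (c k) by apply: csqintZ => //; exact: (sP k).1.
have cn k : csqn mu D01 (c k) = (k%:~R ^+ 2) ^+ q * cwn (P k p).
  rewrite -(sP k).2 -nik /csqn -RintegralZl//; last exact: sqint_sq_integrable (csqint_sqint m01 (sP k).1).
  by apply: eq_Rintegral => x _; rewrite /c [in LHS]normcM [LHS]exprMn.
have [|H [pH sH cH]] := build sc; first by rewrite (eq_esum (fun k _ => congr1 EFin (cn k))).
set s := p%:R - (l + 2^-1).
pose G z : R[i] := (z.1 `^ (- s))%:C * H z.
have subc e : 0 < e -> cyl e `<=` Pi.
  move=> e0 z [+ cz]; rewrite segE => /andP[a1 a2]; split => //; rewrite segE.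
  by rewrite (le_trans (ltW e0) a1) (le_trans a2)// gerBl ltW.
have sGe e : 0 < e -> csqint mu2 (cyl e) (G : mR * mR -> R[i]).
  move=> e0; have mA := measurable_seg e (1 - e).
  apply: csqint_pow_cyl => //; first by rewrite gerBl ltW.
  exact: (csqint_sub (measurable_cyl mA) mD (subc e e0) sH).
have pG : Pi_fun G.
  have [m1 m2 per] := pH.
  have [g1 g2] : cmeas Pi (G : mR * mR -> R[i]).
    by apply: cmeasM; [exact: (cmeas_pow2 _ m01)|split; [exact: m1|exact: m2]].
  by split; [exact: g1|exact: g2|move=> x t; rewrite /G /= per].
have sG : csqint mu2 Pi (fun z => (z.1 `^ s)%:C * G z : R[i]).
  have mG : cmeas Pi (fun z => (z.1 `^ s)%:C * G z : R[i]).
    by have [g1 g2 _] := pG; apply: cmeasM; [exact: (cmeas_pow2 _ m01)|split; [exact: g1|exact: g2]].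
  apply: (csqint_le mD mG (csqint_sqint mD sH)) => z [+ _]; rewrite segE => /andP[].
  rewrite le_eqVlt => /orP[/eqP z0 _|z0 _]; last first.
    by rewrite /G mulrA -rmorphM -powRD ?subrr ?powRr0 ?mul1r// (gt_eqF z0) implybT.
  rewrite /G -z0 mulrA normcM ler_piMl ?normc_ge0//.
  rewrite -rmorphM -[X in normc X]mul1r normc_realM normc1 mul1r ger0_norm ?mulr_ge0 ?powR_ge0//.
  have [->|s0] := eqVneq s 0; first by rewrite oppr0 !powRr0 mulr1.
  by rewrite powR0// mul0r ler01.
exists G => //.
apply: (mode_is_wderiv (r := fun k => rder l (P k))) => //.
- by move=> e e0; exact: (csqint_sub (measurable_cyl (measurable_seg _ _)) mD (subc e e0) sw).
- by move=> k j jp; apply: rder_cprim (gP k) _; exact: leq_trans jp pm.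
- move=> k e e0; have sb : seg e (1 - e) `<=` seg e 1.
    by move=> x; rewrite !segE => /andP[-> h]; rewrite (le_trans h)// gerBl ltW.
  exact: (csqint_sub (measurable_seg _ _) (measurable_seg _ _) sb (rder_csqint (gP k) (leq0n m) e0)).
- move=> k e e0; have sb : seg e (1 - e) `<=` seg e 1.
    by move=> x; rewrite !segE => /andP[-> h]; rewrite (le_trans h)// gerBl ltW.
  exact: (csqint_sub (measurable_seg _ _) (measurable_seg _ _) sb (rder_csqint (gP k) pm e0)).
- move=> k; apply: filterS (cw k) => x h x01; rewrite h// /rder subr0.
  by [].
- move=> k; apply: filterS2 (coef_pow (- s) k m01 (seg_fin _ _) sH) (cH k) => x h1 h2 /andP[x0 x1].
  have Dx : D01 x by rewrite segE (ltW x0) (ltW x1).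
  rewrite h1// h2// /c mulrCA /rder; congr (_ * _); rewrite mulrA -rmorphM -powRD; last by rewrite (gt_eqF x0) implybT.
  by congr ((_ `^ _)%:C * _); rewrite /s; field.
Qed.

Lemma term_le_sum2 (F : nat -> nat -> \bar R) m p q : (forall i j, 0 <= F i j)%E -> (p + q <= m)%N ->
  (F p q <= \sum_(i < m.+1) \sum_(j < m.+1 | (i + j <= m)%N) F i j)%E.
Proof.
move=> F0 pq; have pm : (p < m.+1)%N by rewrite ltnS (leq_trans _ pq)// leq_addr.
have qm : (q < m.+1)%N by rewrite ltnS (leq_trans _ pq)// leq_addl.
rewrite (bigD1 (Ordinal pm))//= (bigD1 (Ordinal qm))//=.
rewrite -addeA leeDl// adde_ge0// sume_ge0// => i _; exact: sume_ge0.
Qed.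

Lemma Pi_L2sq_ge0 (v : R * R -> R[i]) : (0 <= Pi_L2sq v)%E.
Proof. by apply: integral_ge0 => z _; rewrite lee_fin sqr_ge0. Qed.

Lemma K_term (d : R) m (w : R * R -> R[i]) p q : (p + q <= m)%N ->
  (Pi_L2sq (fun z => ((z.1 `^ (p%:R - d))%:C * wderiv p q w z)%R) <= K_normsq d m w)%E.
Proof.
move=> pq; apply: (term_le_sum2 (F := fun p q => Pi_L2sq (fun z => ((z.1 `^ (p%:R - d))%:C * wderiv p q w z)%R))) => //.
by move=> i j; exact: Pi_L2sq_ge0.
Qed.

(** Conversely, the modes of an element of K are obtained from its weak derivatives. *)
Lemma K_wrep l m w : K_mem (l + 2^-1) m w -> exists P, wrep l m w P.
Proof.
move=> [pw ex fin]; have mD := measurable_cyl m01.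
pose g p : mR * mR -> R[i] := wderiv p 0 w.
have wd p : (p <= m)%N -> is_wderiv p 0 w (g p).
  by move=> pm; have [g0 hg] := ex p 0%N (etrans (congr1 (fun n => (n <= m)%N) (addn0 p)) pm); exact: (xgetPex (fun=> 0) (ex_intro _ g0 hg)).
have sg p : (p <= m)%N -> csqint mu2 Pi (fun z => (z.1 `^ (p%:R - (l + 2^-1)))%:C * g p z : R[i]).
  move=> pm; apply/(csqint_normcP mu2 mD); split.
    have [_ [[m1 m2 _] _] _] := wd p pm.
    by apply: cmeasM; [exact: (cmeas_pow2 _ m01)|split; [exact: m1|exact: m2]].
  by apply: le_lt_trans fin; apply: (K_term _ _ (q := 0%N)); rewrite addn0.
have lg p k : (p <= m)%N -> clocint (coef (g p) k).
  move=> pm; have H e : 0 < e -> csqint mu2 (seg e 1 `*` circ) (g p).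
    move=> e0; have mA := measurable_seg e 1.
    have sub : seg e 1 `*` circ `<=` Pi.
      by move=> z [+ cz]; rewrite segE => /andP[a1 a2]; split => //; rewrite segE (le_trans (ltW e0) a1).
    have := csqint_pow_cyl (- (p%:R - (l + 2^-1))) e0 (lexx 1) (csqint_sub (measurable_cyl mA) mD sub (sg p pm)).
    move=> /(csqint_normcP mu2 (measurable_cyl mA))[_ L].
    apply/(csqint_normcP mu2 (measurable_cyl mA)); split.
      have [_ [[m1 m2 _] _] _] := wd p pm.
      by split; [exact: (measurable_funS mD sub m1)|exact: (measurable_funS mD sub m2)].
    apply: le_lt_trans L; rewrite le_eqVlt; apply/orP; left; apply/eqP; apply: eq_integral => z.
    rewrite inE => -[+ _]; rewrite segE => /andP[ez _]; have z0 := lt_le_trans e0 ez.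
    by rewrite mulrA -rmorphM -powRD ?addNr ?powRr0 ?mul1r// (gt_eqF z0) implybT.
  by split => e e0; have [i1 i2] := csqint_integrable (measurable_seg e 1) (seg_fin e 1) (csqint_coef (measurable_seg e 1) (seg_fin e 1) k (H e e0)).
have /choice[r hr] : forall k, exists r, [/\ forall j, (j < m)%N -> cprim (r j) (r j.+1),
    forall j, (j <= m)%N -> clocint (r j) &
    forall j, (j <= m)%N -> {ae mu, forall x, 0 < x < 1 -> coef (g j) k x = r j x}].
  by move=> k; apply: wderiv_chain wd _ => p pm; exact: lg.
pose P k p (x : mR) : R[i] := (x `^ (p%:R - l))%:C * r k p x.
have U0 k : {ae mu, forall x, 0 < x < 1 -> coef w k x = r k 0%N x}.
  have [r1 r2 r3] := hr k.
  have [lw _ _] := wd 0%N isT.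
  exact: ae01_trans (wderiv_coef_uniq k (is_wderiv00 lw) (wd 0%N isT)) (r3 0%N isT).
exists P; split => //; last first.
  move=> k; apply: filterS (U0 k) => x h x01; rewrite h// /P sub0r mulrA -rmorphM.
  by case/andP: x01 => x0 _; rewrite -powRD ?subrr ?powRr0 ?mul1r// (gt_eqF x0) implybT.
move=> k; have [r1 r2 r3] := hr k; split => p pm.
  have [p1 p2] := r1 p pm.
  have E (u v : mR -> R) : prim u v -> dprim (fun x => x `^ (p%:R - l) * u x)
      (fun x => 1 * (x `^ (p.+1%:R - l) * v x) + - (l - p%:R) * (x `^ (p%:R - l) * u x)).
    move=> puv; apply: eq_prim (prim_mul (powR_prim (p%:R - l)) puv) => // x /andP[x0 _].
    have -> : p.+1%:R - l = (p%:R - l) + 1 by rewrite -(natr1 p); ring.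
    rewrite powR_m1// [x `^ (_ + 1)]powRD; last by rewrite (gt_eqF x0) implybT.
    by rewrite powRr1 ?(ltW x0)//; field; rewrite gt_eqF.
  split; rewrite ?Re_lin2 ?Im_lin2.
    by apply: eq_prim (E _ _ p1) => x _; rewrite /P /= !Re_realM.
  by apply: eq_prim (E _ _ p2) => x _; rewrite /P /= !Im_realM.
apply: cwsq_of_csqint.
have [/locint_measurable01 q1 /locint_measurable01 q2] := r2 p pm.
have sc := csqint_coef m01 (seg_fin _ _) k (sg p pm).
have ck2 := coef_pow_inv k m01 (seg_fin _ _) (sg p pm).
apply: csqint_ae sc => //.
  apply: cmeasM; first by apply: cmeasR; exact: wt_measurable.
  by apply: cmeasM; [exact: cmeas_pow|split; [exact: q1|exact: q2]].
apply: filterS3 ck2 (r3 p pm) ae01D => x h2 h3 h4 Dx; have /andP[xp xl] := h4 Dx.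
rewrite h2// h3 ?xp// /P mulrA -rmorphM /wt -powRD; last by rewrite (gt_eqF xp) implybT.
by congr ((_ `^ _)%:C * _); field.
Qed.

End KSpace.

(** * Modes of functions and weighted Sobolev norms *)

Section Msum.
Variable R : realType.
Implicit Types (a b : int -> R).

Definition msum a : \bar R := (\esum_(k in [set: int]) (a k)%:E)%E.

Lemma eq_msum a b : a =1 b -> msum a = msum b.
Proof. by move=> h; apply: eq_esum => k _; rewrite h. Qed.

Lemma msum_ge0 a : (forall k, 0 <= a k) -> (0 <= msum a)%E.
Proof. by move=> h; apply: esum_ge0 => k _; rewrite lee_fin. Qed.

Lemma msum_ub a M : (forall k, 0 <= a k) -> (forall N, symsum a N <= M) -> (msum a <= M%:E)%E.
Proof.
move=> a0 h; have a0' k : (0 <= (a k)%:E)%E by rewrite lee_fin.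
have c := esum_symsum a0'; rewrite /msum -(cvg_lim _ c)//.
apply: lime_le; first by apply/cvg_ex; eexists; exact: c.
by apply: nearW => N; rewrite -symsumE lee_fin.
Qed.

Lemma symsum_le_msum a N : (forall k, 0 <= a k) -> ((symsum a N)%:E <= msum a)%E.
Proof. by move=> a0; rewrite symsumE; apply: symsum_le_esum => k; rewrite lee_fin. Qed.

Lemma msum_fin a : (forall k, 0 <= a k) -> (msum a < +oo)%E -> msum a = (fine (msum a))%:E.
Proof. by move=> a0 h; rewrite fineK// ge0_fin_numE// msum_ge0. Qed.

Lemma msum_le C a b : 0 <= C -> (forall k, 0 <= a k) -> (forall k, 0 <= b k) ->
  (forall k, a k <= C * b k) -> (msum b < +oo)%E ->
  (msum a < +oo)%E /\ fine (msum a) <= C * fine (msum b).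
Proof.
move=> C0 a0 b0 ab fb.
have H : (msum a <= (C * fine (msum b))%:E)%E.
  apply: msum_ub => // N; apply: (@le_trans _ _ (C * symsum b N)).
    by rewrite /symsum mulr_sumr; apply: ler_sum => i _.
  by apply: ler_wpM2l => //; rewrite -lee_fin -msum_fin//; exact: symsum_le_msum.
have fa : (msum a < +oo)%E by apply: le_lt_trans H _; rewrite ltry.
by split => //; rewrite -lee_fin -msum_fin.
Qed.

Lemma msum_fin_le C a b : 0 <= C -> (forall k, 0 <= a k) -> (forall k, 0 <= b k) ->
  (forall k, a k <= C * b k) -> (msum b < +oo)%E -> (msum a < +oo)%E.
Proof. by move=> C0 a0 b0 ab fb; have [] := msum_le C0 a0 b0 ab fb. Qed.

Lemma msumD a b : (forall k, 0 <= a k) -> (forall k, 0 <= b k) ->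
  msum (fun k => a k + b k) = (msum a + msum b)%E.
Proof. by move=> a0 b0; rewrite /msum -esumD//= => k _; rewrite lee_fin. Qed.

Lemma msumZ C a : (forall k, 0 <= a k) -> 0 <= C ->
  msum (fun k => C * a k) = (C%:E * msum a)%E.
Proof.
move=> a0 C0; have a0' k : (0 <= (a k)%:E)%E by rewrite lee_fin.
have b0' k : (0 <= (C * a k)%:E)%E by rewrite lee_fin mulr_ge0.
have h1 := esum_symsum b0'; have h2 := cvgeZl (isT : C%:E \is a fin_num) (esum_symsum a0').
apply: (cvg_unique _ h1) => //; apply: cvg_trans h2.
apply: near_eq_cvg; apply: nearW => N.
by rewrite -!symsumE -EFinM /symsum mulr_sumr.
Qed.

Lemma msum_term a k : (forall k, 0 <= a k) -> ((a k)%:E <= msum a)%E.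
Proof.
move=> a0; apply: le_trans (symsum_le_msum `|k|%N a0); rewrite lee_fin.
rewrite -(symsum_pick a (leqnn `|k|%N)); apply: ler_sum => i _.
by case: eqP => // _; exact: a0.
Qed.

End Msum.

Section Uniqueness.
Variable R : realType.
Local Notation mu := (@lebesgue_measure R).
Local Notation mR := (measurableTypeR R).
Local Notation circ := (@circ R : set mR).
Local Notation D01 := (seg (0 : R) 1).
Local Notation wtC := (fun x : mR => (wt x)%:C).

Let m01 := measurable_seg (0 : R) 1.

Lemma cwn_ae (f g : mR -> R[i]) : cwsq f -> cwsq g -> ae01 f g -> cwn f = cwn g.
Proof.
move=> /csqn_wt[sf <-] /csqn_wt[sg <-] /ae01P fg.
apply: EFin_inj; rewrite (csqnE m01 sf) (csqnE m01 sg).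
apply: ae_eq_integral => //.
- exact: normc2_meas m01 sf.
- exact: normc2_meas m01 sg.
by apply: filterS fg => x h Dx; rewrite h.
Qed.

Lemma cwn0_ae (f : mR -> R[i]) : cwsq f -> cwn f = 0 -> ae01 f (fun=> 0).
Proof.
move=> /csqn_wt[sf <-] f0.
have mf : measurable_fun D01 (fun x => (normc (wtC x * f x) ^+ 2)%:E).
  exact: normc2_meas m01 sf.
have /(ae_eq_integral_abs mu m01 mf) h : (\int[mu]_(x in D01) `|(normc (wtC x * f x) ^+ 2)%:E|)%E = 0.
  transitivity (\int[mu]_(x in D01) (normc (wtC x * f x) ^+ 2)%:E)%E; last first.
    by rewrite -(csqnE m01 sf) f0.
  apply: eq_integral => x _.
  by rewrite gee0_abs// lee_fin sqr_ge0.
apply: filterS h => x h /andP[x0 x1]; have Dx : D01 x by rewrite segE !ltW.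
have := h Dx; rewrite /= => -[] /eqP; rewrite sqrf_eq0 => /eqP /eq0_normc /eqP.
rewrite mulf_eq0 => /orP[/eqP w0|/eqP//].
by have := wt_sqrt x0; move: w0 => [->]; rewrite mulr0 => /eqP; rewrite eq_sym oner_eq0.
Qed.

Lemma cdprim_cprim (y y1 : mR -> R[i]) : cdprim y y1 -> cprim y (fun x => (x^-1)%:C * y1 x).
Proof. by move=> [h1 h2]; split; [apply: eq_prim h1|apply: eq_prim h2] => x _; rewrite /= ?Re_realM ?Im_realM. Qed.

Lemma cprim_ae0 (y g : mR -> R[i]) : cprim y g -> ae01 y (fun=> 0) -> ae01 g (fun=> 0).
Proof.
move=> pyg /ae01P y0; have [[l1 l2] [l3 l4]] := cprim_locint pyg.
apply: ctest1_sep; [exact: locint_locint0|exact: locint_locint0|] => f tf.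
have iy := ctest1_int 1%N m01 tf (locint_locint0 l1) (locint_locint0 l2).
have E : cint mu D01 (fun x => y x * (f 1%N x)%:C) = 0.
  transitivity (cint mu D01 (fun=> 0 : R[i])); last exact: cint0.
  apply: (cint_ae m01 (cintegrable_meas iy) (cmeas_cst D01 0)).
  by apply: filterS y0 => x h Dx; rewrite h// mul0r.
rewrite (ctest1_ibp pyg tf) E; exact: oppr0.
Qed.

Lemma cdprim_clin (a : R[i]) y z y1 z1 : cdprim y y1 -> cdprim z z1 ->
  cdprim (fun x => a * y x + z x) (fun x => a * y1 x + z1 x).
Proof.
move=> [h1 h2] [h3 h4]; split.
  by apply: eq_prim (prim_lin 1 1 (prim_lin (Re a) (- Im a) h1 h2) h3) => x _;
    rewrite /= ReD ReM; ring.
by apply: eq_prim (prim_lin 1 1 (prim_lin (Re a) (Im a) h2 h1) h4) => x _;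
  rewrite /= ImD ImM; ring.
Qed.

Lemma cwsq_clin (a : R[i]) y z : cwsq y -> cwsq z -> cwsq (fun x => a * y x + z x).
Proof.
move=> /csqn_wt[sy _] /csqn_wt[sz _]; apply: cwsq_of_csqint.
have := csqint_lin m01 a sy sz; congr (csqint _ _ _).
by apply/funext => x; ring.
Qed.

Lemma cwsqZ (a : R[i]) y : cwsq y -> cwsq (fun x => a * y x).
Proof.
move=> /csqn_wt[sy _]; apply: cwsq_of_csqint.
have := csqintZ m01 a sy; congr (csqint _ _ _).
by apply/funext => x; ring.
Qed.

Lemma cwnZ (a : R[i]) y : cwsq y -> cwn (fun x => a * y x) = normc a ^+ 2 * cwn y.
Proof.
move=> sy.
have [s1 <-] := csqn_wt sy; have [s2 <-] := csqn_wt (cwsqZ a sy).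
rewrite /csqn -RintegralZl//; last exact: sqint_sq_integrable (csqint_sqint m01 s1).
by apply: eq_Rintegral => x _; rewrite mulrCA [in LHS]normcM [LHS]exprMn.
Qed.

Lemma cwsq0 : cwsq (fun=> 0 : R[i]).
Proof.
by apply: cwsq_of_csqint; have := csqint0 mu D01; congr (csqint _ _ _); apply/funext => x; rewrite mulr0.
Qed.

Lemma gchain_clin c m (a : R[i]) y z : gchain c m y -> gchain c m z ->
  gchain c m (fun p x => a * y p x + z p x : R[i]).
Proof.
move=> [d1 s1] [d2 s2]; split => j jm; last by apply: cwsq_clin; [exact: s1|exact: s2].
have := cdprim_clin a (d1 j jm) (d2 j jm); congr (cdprim _ _).
by apply/funext => x; rewrite /lin2; ring.
Qed.

Lemma chain_clin m (a : R[i]) y z : chain m y -> chain m z ->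
  chain m (fun p x => a * y p x + z p x : R[i]).
Proof. by rewrite !chain_gchain; exact: gchain_clin. Qed.

Lemma chain0 m : chain m (fun _ _ => 0 : R[i]).
Proof.
split => j jm; last exact: cwsq0.
by split; apply: eq_prim (prim_cst 0) => x _ //=; rewrite mulr0.
Qed.

Lemma chainZ m (a : R[i]) y : chain m y -> chain m (fun p x => a * y p x : R[i]).
Proof.
move=> cy; have := chain_clin a cy (chain0 m); congr (chain _ _).
by apply/funext => p; apply/funext => x; rewrite addr0.
Qed.

(** The members of a chain are the successive derivatives of the first one. *)
Lemma gchain_uniq c m (y y' : nat -> mR -> R[i]) : gchain c m y -> gchain c m y' -> ae01 (y 0%N) (y' 0%N) ->
  forall p, (p <= m)%N -> ae01 (y p) (y' p).
Proof.
move=> gy gy' h0; have [d _] := gchain_clin (- 1) gy' gy.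
have H p : (p <= m)%N -> ae01 (fun x => - 1 * y' p x + y p x) (fun=> 0).
  elim: p => [|p ih] pm; first by apply: filterS h0 => x h x01; rewrite h// mulN1r addNr.
  have ih' := ih (ltnW pm); have := cprim_ae0 (cdprim_cprim (d p pm)) ih'.
  apply: filterS2 ih' => x i1 i2 x01; have := i2 x01; rewrite /lin2 (i1 x01) mulr0 addr0 mul1r.
  move/eqP; rewrite mulf_eq0 => /orP[|/eqP//]; case/andP: x01 => x0 _.
  by rewrite (inj_eq (@complexI R)) invr_eq0 gt_eqF.
move=> p pm; apply: filterS (H p pm) => x h x01; have := h x01.
by rewrite mulN1r addrC => /eqP; rewrite subr_eq0 => /eqP.
Qed.

Lemma chain_uniq m (y y' : nat -> mR -> R[i]) : chain m y -> chain m y' -> ae01 (y 0%N) (y' 0%N) ->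
  forall p, (p <= m)%N -> ae01 (y p) (y' p).
Proof. by rewrite !chain_gchain; exact: gchain_uniq. Qed.

Lemma zsum_gae c m (y y' : nat -> mR -> R[i]) : gchain c m y -> gchain c m y' -> ae01 (y 0%N) (y' 0%N) ->
  forall k, zsum k m y = zsum k m y'.
Proof.
move=> cy cy' h k; rewrite /zsum; apply: eq_bigr => p _; congr (_ * _).
have pm : (p <= m)%N by rewrite -ltnS.
by apply: cwn_ae; [exact: cy.2|exact: cy'.2|exact: gchain_uniq cy cy' h p pm].
Qed.

Lemma zsum_ae m (y y' : nat -> mR -> R[i]) : chain m y -> chain m y' -> ae01 (y 0%N) (y' 0%N) ->
  forall k, zsum k m y = zsum k m y'.
Proof. by rewrite !chain_gchain; exact: zsum_gae. Qed.

Lemma zsumZ (a : R[i]) m y k : chain m y -> zsum k m (fun p x => a * y p x) = normc a ^+ 2 * zsum k m y.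
Proof.
move=> [_ s]; rewrite /zsum mulr_sumr; apply: eq_bigr => p _.
have sp : cwsq (y p) by apply: s; rewrite -ltnS.
by rewrite (cwnZ a sp) mulrCA.
Qed.

Lemma zsum0 m k : zsum k m (fun _ _ => 0 : R[i]) = 0.
Proof.
transitivity (normc (0 : R[i]) ^+ 2 * zsum k m (fun _ _ => 0 : R[i])); last by rewrite normc0 expr0n mul0r.
rewrite -(zsumZ 0 k (chain0 m)).
by congr (zsum _ _ _); apply/funext => p; apply/funext => x; rewrite mul0r.
Qed.

(** Each order of derivation costs one power of [Lam], whatever the derivation. *)
Lemma conv_zsum (c c' : nat -> R) m : exists2 C, 0 <= C & forall k (y : nat -> mR -> R[i]), gchain c m y ->
  zsum k m (fun p => conv c c' p y) <= C * zsum k m y.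
Proof.
have /choice[C hC] : forall p, exists C, 0 <= C /\ forall m y, gchain c m y -> (p <= m)%N ->
    cwn (conv c c' p y) <= C * \sum_(j < p.+1) cwn (y j).
  by move=> p; have [C C0 h] := conv_bound c c' p; exists C; split => // n y gy pn; have [] := h n y gy pn.
pose B := \sum_(p < m.+1) C p * m.+1%:R.
have B0 : 0 <= B by apply: sumr_ge0 => p _; rewrite mulr_ge0//; exact: (hC _).1.
exists (m.+1%:R * B); first by rewrite mulr_ge0.
move=> k y gy; rewrite -mulrA; apply: zsum_le => p pm; have [C0 h] := hC p.
have Z0 : 0 <= zsum k m y by exact: zsum_ge0.
have L1 := Lam_ge1 R k; have L0 : 0 <= Lam R k by exact: le_trans L1.
have H : Lam R k ^+ (m - p) * cwn (conv c c' p y) <= C p * (m.+1%:R * zsum k m y).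
  apply: (@le_trans _ _ (Lam R k ^+ (m - p) * (C p * \sum_(j < p.+1) cwn (y j)))).
    by apply: ler_wpM2l; [exact: exprn_ge0|exact: (h m y gy pm)].
  rewrite mulrCA; apply: ler_wpM2l => //; rewrite mulr_sumr.
  apply: (@le_trans _ _ (\sum_(j < p.+1) zsum k m y)); last first.
    by rewrite sumr_const card_ord -[leLHS]mulr_natl; apply: ler_wpM2r => //; rewrite ler_nat ltnS.
  apply: ler_sum => j _; have jp : (j <= p)%N by rewrite -ltnS.
  apply: le_trans (zsum_term k y (leq_trans jp pm)).
  by apply: ler_wpM2r; [exact: cwn_ge0|apply: ler_weXn2l => //; exact: leq_sub2l].
apply: le_trans H _; rewrite mulrA; apply: ler_wpM2r => //.
rewrite /B (bigD1 (Ordinal (pm : (p < m.+1)%N)))//= lerDl; apply: sumr_ge0 => i _.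
by rewrite mulr_ge0//; exact: (hC _).1.
Qed.

Definition ksum k m (P : nat -> mR -> R[i]) : R :=
  \sum_(p < m.+1) \sum_(q < m.+1 | (p + q <= m)%N) (k%:~R ^+ 2) ^+ q * cwn (P p).

Lemma kterm_ge0 (k : int) q (P : mR -> R[i]) : 0 <= (k%:~R ^+ 2) ^+ q * cwn P.
Proof. by rewrite mulr_ge0 ?cwn_ge0// exprn_ge0// sqr_ge0. Qed.

Lemma ksum_ge0 k m P : 0 <= ksum k m P.
Proof. by apply: sumr_ge0 => p _; apply: sumr_ge0 => q _; exact: kterm_ge0. Qed.

Lemma ksum_term k m P p q : (p + q <= m)%N -> (k%:~R ^+ 2) ^+ q * cwn (P p) <= ksum k m P.
Proof.
move=> pq; have pm : (p < m.+1)%N by rewrite ltnS (leq_trans _ pq)// leq_addr.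
have qm : (q < m.+1)%N by rewrite ltnS (leq_trans _ pq)// leq_addl.
rewrite /ksum (bigD1 (Ordinal pm))//= (bigD1 (Ordinal qm))//= -addrA lerDl addr_ge0//.
  by apply: sumr_ge0 => i _; exact: kterm_ge0.
by apply: sumr_ge0 => i _; apply: sumr_ge0 => j _; exact: kterm_ge0.
Qed.

Lemma ksum_le k m P : ksum k m P <= m.+1%:R * zsum k m P.
Proof.
rewrite /ksum /zsum mulr_sumr; apply: ler_sum => p _.
apply: (@le_trans _ _ (\sum_(q < m.+1) Lam R k ^+ (m - p) * cwn (P p))); last first.
  by rewrite sumr_const card_ord mulr_natl.
rewrite big_mkcond; apply: ler_sum => q _; have L1 := Lam_ge1 R k.
case: ifP => [pq|_]; last by rewrite mulr_ge0 ?cwn_ge0// exprn_ge0// (le_trans ler01).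
apply: ler_wpM2r; first exact: cwn_ge0.
apply: (@le_trans _ _ (Lam R k ^+ q)).
  by apply: lerXn2r; rewrite ?nnegrE ?sqr_ge0 ?(le_trans ler01)// lerDr ler01.
have pm : (p <= m)%N := ltn_ord p.
by apply: ler_weXn2l; [exact: L1|rewrite (leq_subRL _ pm)].
Qed.

Lemma ksum_ge k m P : zsum k m P <= m.+1%:R * (2 ^+ m * ksum k m P).
Proof.
apply: zsum_le => p pm; have C0 := cwn_ge0 (P p); set x : R := k%:~R ^+ 2.
have x0 : 0 <= x by exact: sqr_ge0.
have two : (2 : R) ^+ (m - p) <= 2 ^+ m by apply: ler_weXn2l; [exact: ler1n|exact: leq_subr].
have [x1|x1] := leP x 1.
  have h : Lam R k ^+ (m - p) <= 2 ^+ m.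
    apply: le_trans two; apply: lerXn2r; rewrite ?nnegrE ?(le_trans ler01 (Lam_ge1 R k))//.
    by rewrite /Lam -/x -[leRHS](natrD _ 1 1) lerD2l.
  apply: (@le_trans _ _ (2 ^+ m * cwn (P p))); first exact: ler_wpM2r.
  apply: ler_wpM2l; first by rewrite exprn_ge0.
  by have := ksum_term k P (etrans (congr1 (fun n => (n <= m)%N) (addn0 p)) pm); rewrite expr0 mul1r.
have h : Lam R k ^+ (m - p) <= 2 ^+ m * x ^+ (m - p).
  apply: (@le_trans _ _ ((2 * x) ^+ (m - p))).
    apply: lerXn2r; rewrite ?nnegrE ?(le_trans ler01 (Lam_ge1 R k))//; first by rewrite mulr_ge0.
    by rewrite /Lam -/x mulr_natl mulr2n lerD2r ltW.
  by rewrite exprMn; apply: ler_wpM2r => //; exact: exprn_ge0.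
apply: (@le_trans _ _ (2 ^+ m * x ^+ (m - p) * cwn (P p))); first exact: ler_wpM2r.
rewrite -mulrA; apply: ler_wpM2l; first by rewrite exprn_ge0.
by apply: ksum_term; rewrite subnKC.
Qed.

End Uniqueness.

Section JModes.
Variable R : realType.
Local Notation mu := (@lebesgue_measure R).
Local Notation mR := (measurableTypeR R).
Local Notation mu2 := (mu \x mu)%E.
Local Notation circ := (@circ R : set mR).
Local Notation D01 := (seg (0 : R) 1).
Local Notation Pi := (D01 `*` circ).
Local Notation cyl e := (seg e (1 - e) `*` circ).
Local Notation wtC := (fun x : mR => (wt x)%:C).
Let m01 := measurable_seg (0 : R) 1.
Let f01 := seg_fin (0 : R) 1.
Let mPi : measurable Pi := measurable_cyl m01.
Let mc := @measurable_circ R.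

Lemma normc2_add (v w : R[i]) : normc (v + w) ^+ 2 <= 2 * normc v ^+ 2 + 2 * normc w ^+ 2.
Proof. by have := normc2_sub v (- w); rewrite opprK !normc2 ReN ImN !sqrrN. Qed.

Lemma csqint_aeG d (T : measurableType d) (m : {measure set T -> \bar R}) (A : set T)
    (f g : T -> R[i]) : measurable A -> cmeas A g ->
  {ae m, forall x, A x -> f x = g x} -> csqint m A f -> csqint m A g.
Proof.
move=> mA [m1 m2] fg [s1 s2]; split.
  by apply: (sqint_ae mA m1 _ s1); apply: filterS fg => x h Ax; rewrite /= h.
by apply: (sqint_ae mA m2 _ s2); apply: filterS fg => x h Ax; rewrite /= h.
Qed.

Lemma aePi01 : {ae mu2, forall z : mR * mR, Pi z -> 0 < z.1 < 1}.
Proof.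
pose c (x : mR) : R[i] := (\1_(`]0, 1[%classic : set mR) x)%:C.
have mc' : cmeas D01 c by apply: cmeasR; apply: measurable_indic; exact: measurable_itv.
have h : {ae mu, forall x, D01 x -> c x = 1}.
  apply: filterS (ae01D R) => x h Dx; rewrite /c indicE mem_set//=.
  by rewrite in_itv /= h.
apply: filterS (ae_fst m01 mc' (cmeas_cst D01 1) h) => z h1 Dz.
have := h1 Dz; rewrite /c indicE; case: (asboolP (`]0, 1[%classic z.1)) => [|n].
  by rewrite /= in_itv.
by rewrite memNset// => /eqP; rewrite eq_sym oner_eq0.
Qed.

Lemma cyl_ae_Pi (Q : mR * mR -> Prop) : (forall e, 0 < e -> {ae mu2, forall z, cyl e z -> Q z}) ->
  {ae mu2, forall z, Pi z -> Q z}.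
Proof.
move=> h; have V n : 0 < n.+1%:R^-1 :> R by rewrite invr_gt0 ltr0n.
have H := ae_foralln (fun n => h _ (V n)).
apply: filterS2 H aePi01 => z h1 h2 Dz; have /andP[z0 z1] := h2 Dz.
pose d := Num.min z.1 (1 - z.1); have d0 : 0 < d by rewrite lt_min z0 subr_gt0.
have dV : 0 <= d^-1 by rewrite invr_ge0 ltW.
have hb : (Num.bound d^-1).+1%:R^-1 <= d.
  rewrite -[leRHS]invrK lef_pV2 ?posrE ?ltr0n ?invr_gt0//.
  by apply: le_trans (ltW (archi_boundP dV)) _; rewrite ler_nat.
apply: (h1 (Num.bound d^-1)); case: Dz => _ cz; split => //.
have hd1 : d <= z.1 by rewrite ge_min lexx.
have hd2 : d <= 1 - z.1 by rewrite ge_min lexx orbT.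
rewrite segE (le_trans hb hd1)/= lerBrDr -lerBrDl; exact: le_trans hb hd2.
Qed.

Lemma Pi_fun_cmeas (u : R * R -> R[i]) : Pi_fun u -> cmeas Pi (u : mR * mR -> R[i]).
Proof. by move=> [m1 m2 _]; split; [exact: m1|exact: m2]. Qed.

Lemma wderiv_uniq p q (w G G' : R * R -> R[i]) : is_wderiv p q w G -> is_wderiv p q w G' ->
  {ae mu2, forall z : mR * mR, Pi z -> G z = G' z}.
Proof.
move=> h h'; have [_ lG _] := h; have [_ lG' _] := h'.
apply: cyl_ae_Pi => e e0; have mA := measurable_seg e (1 - e).
apply: (coef_inj mA (loc_integrable_cyl lG e0) (loc_integrable_cyl lG' e0)) => k.
exact: ae_seg e0 (wderiv_coef_uniq k h h').
Qed.

Lemma K_term_csqint d m (w : R * R -> R[i]) p q : K_mem d m w -> (p + q <= m)%N ->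
  is_wderiv p q w (wderiv p q w) /\
  csqint mu2 Pi (fun z => (z.1 `^ (p%:R - d))%:C * wderiv p q w z : R[i]).
Proof.
move=> [pw ex fin] pq; have [g0 hg] := ex p q pq.
have wd : is_wderiv p q w (wderiv p q w) := xgetPex (fun=> 0) (ex_intro _ g0 hg).
split => //; apply/(csqint_normcP mu2 mPi); split.
  have [_ [pg _] _] := wd.
  by apply: cmeasM; [exact: (cmeas_pow2 _ m01)|exact: Pi_fun_cmeas].
exact: le_lt_trans (K_term _ _ pq) fin.
Qed.

Lemma K_csqint d m (w : R * R -> R[i]) : 0 <= d -> K_mem d m w -> csqint mu2 Pi (w : mR * mR -> R[i]).
Proof.
move=> d0 Kw; have [wd s] := K_term_csqint Kw (leq0n m : (0 + 0 <= m)%N).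
have [pw _ _] := Kw; have [lw _ _] := wd.
have b (z : mR * mR) : Pi z -> normc ((z.1 `^ d)%:C : R[i]) <= 1.
  by move=> [+ _]; rewrite segE; exact: powC_le1.
apply: csqint_aeG (csqint_bounded mPi (cmeas_pow2 d m01) b s); [exact: mPi|exact: Pi_fun_cmeas|].
apply: filterS2 (wderiv_uniq wd (is_wderiv00 lw)) aePi01 => z h1 h2 Dz.
have /andP[z0 _] := h2 Dz; rewrite h1// mulrC mulrA -rmorphM -powRD; last by rewrite (gt_eqF z0) implybT.
by rewrite sub0r subrr powRr0 mul1r.
Qed.

Lemma K_norm_modes l m (w : R * R -> R[i]) P : K_mem (l + 2^-1) m w -> wrep l m w P ->
  K_normsq (l + 2^-1) m w = msum (fun k => 2 * pi * ksum k m (P k)).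
Proof.
move=> Kw wr; have p0 : 0 <= 2 * pi :> R by rewrite ltW// pi2_gt0.
rewrite msumZ//; last by move=> k; exact: ksum_ge0.
have T p q : (p + q <= m)%N -> Pi_L2sq (fun z => (z.1 `^ (p%:R - (l + 2^-1)))%:C * wderiv p q w z) =
    ((2 * pi)%:E * msum (fun k => ((k%:~R ^+ 2) ^+ q * cwn (P k p))%R))%E.
  move=> pq; have [wd s] := K_term_csqint Kw pq.
  exact: (wrep_norm wr (leq_trans (leq_addr q p) pq) wd s).
have t0 p q : (0 <= msum (fun k => ((k%:~R ^+ 2) ^+ q * cwn (P k p))%R))%E.
  by apply: msum_ge0 => k; exact: kterm_ge0.
transitivity ((2 * pi)%:E * \sum_(p < m.+1) \sum_(q < m.+1 | (p + q <= m)%N)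
    msum (fun k => ((k%:~R ^+ 2) ^+ q * cwn (P k p))%R))%E.
  rewrite ge0_sume_distrr//; last by move=> p _; exact: sume_ge0.
  apply: eq_bigr => p _; rewrite ge0_sume_distrr//.
  by apply: eq_bigr => q pq; exact: T.
congr (_ * _)%E.
transitivity (\esum_(k in [set: int]) \sum_(p < m.+1) \sum_(q < m.+1 | (p + q <= m)%N)
    ((k%:~R ^+ 2) ^+ q * cwn (P k p))%:E)%E.
  rewrite esum_sum; last by move=> k p _ _; apply: sume_ge0 => q _; rewrite lee_fin kterm_ge0.
  apply: eq_bigr => p _; rewrite esum_sum// => k q _ _; by rewrite lee_fin kterm_ge0.
apply: eq_esum => k _; rewrite /ksum -sumEFin; apply: eq_bigr => p _; by rewrite sumEFin.
Qed.

(** The chosen weak derivatives agree almost everywhere with those built from the modes. *)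
Lemma wrep_K l m (w : R * R -> R[i]) P : wrep l m w P -> csqint mu2 Pi (w : mR * mR -> R[i]) ->
  (msum (fun k => (ksum k m (P k))%R) < +oo)%E -> K_mem (l + 2^-1) m w.
Proof.
move=> wr sw fin; have [pw _ _] := wr.
have Ex p q : (p + q <= m)%N -> exists2 G, is_wderiv p q w G &
    csqint mu2 Pi (fun z => (z.1 `^ (p%:R - (l + 2^-1)))%:C * G z : R[i]).
  move=> pq; apply: (wrep_wderiv wr sw (leq_trans (leq_addr q p) pq)).
  have [] // := @msum_le R 1 (fun k => (k%:~R ^+ 2) ^+ q * cwn (P k p)) (fun k => ksum k m (P k)) ler01 _ _ _ fin.
  - by move=> k; exact: kterm_ge0.
  - by move=> k; exact: ksum_ge0.
  - by move=> k; rewrite mul1r; exact: ksum_term.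
split => //; first by move=> p q pq; have [G h _] := Ex p q pq; exists G.
apply: lte_sum_pinfty => p _; apply: lte_sum_pinfty => q pq.
have [G h s] := Ex p q pq; have wd : is_wderiv p q w (wderiv p q w) := xgetPex (fun=> 0) (ex_intro _ G h).
have [_ [pg _] _] := wd.
have mg : cmeas Pi (fun z => (z.1 `^ (p%:R - (l + 2^-1)))%:C * wderiv p q w z : R[i]).
  by apply: cmeasM; [exact: (cmeas_pow2 _ m01)|exact: Pi_fun_cmeas].
have s' : csqint mu2 Pi (fun z => (z.1 `^ (p%:R - (l + 2^-1)))%:C * wderiv p q w z : R[i]).
  by apply: csqint_aeG mPi mg _ s; apply: filterS (wderiv_uniq h wd) => z e Dz; rewrite e.
by have /(csqint_normcP mu2 mPi)[_ L] := s'.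
Qed.

(** A function [V(theta) x^la + w] with [w] in the weighted space of exponent [la + ga] has modes
    [V_k x^la + x^(la + ga - 1/2) z_k], where [z_k] and its first [m] derivatives with respect to
    [ln x] are square integrable for [dx/x]. *)
Definition rep (la ga : R) m (a : R * R -> R[i]) (V : int -> R[i]) (z : int -> nat -> mR -> R[i]) :=
  [/\ Pi_fun a, csqint mu2 Pi (a : mR * mR -> R[i]), forall k, chain m (z k) &
      forall k, ae01 (coef a k)
        (fun x => (x `^ la)%:C * V k + (x `^ (la + ga - 2^-1))%:C * z k 0%N x)].

Definition mn m k (V : R[i]) (z : nat -> mR -> R[i]) : R := Lam R k ^+ m * normc V ^+ 2 + zsum k m z.

Definition sn (s : R) m (V : int -> R[i]) (z : int -> nat -> mR -> R[i]) : \bar R :=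
  msum (fun k => expR (2 * s * `|k%:~R|) * mn m k (V k) (z k)).

Lemma LamX_ge0 k m : 0 <= Lam R k ^+ m.
Proof. by rewrite exprn_ge0// (le_trans ler01)// Lam_ge1. Qed.

Lemma mnV_ge0 m k (V : R[i]) : 0 <= Lam R k ^+ m * normc V ^+ 2.
Proof. by rewrite mulr_ge0 ?LamX_ge0 ?sqr_ge0. Qed.

Lemma mn_ge0 m k V z : 0 <= mn m k V z.
Proof. by rewrite addr_ge0 ?mnV_ge0 ?zsum_ge0. Qed.

Lemma sn_term_ge0 s m k V z : 0 <= expR (2 * s * `|k%:~R|) * mn m k V z.
Proof. by rewrite mulr_ge0 ?expR_ge0 ?mn_ge0. Qed.

Lemma sn0E m V z : sn 0 m V z = msum (fun k => mn m k (V k) (z k)).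
Proof. by apply: eq_msum => k; rewrite mulr0 mul0r expR0 mul1r. Qed.

Lemma csqint_circ2 (v : mR -> R[i]) : csqint mu circ v -> csqint mu2 Pi (fun z => v z.2).
Proof.
move=> sv; have mm := @cmeas_snd R D01 v (csqint_meas sv).
apply/(csqint_normcP mu2 mPi); split; first exact: mm.
rewrite (tonelli_csq m01 mm).2 /=.
rewrite -(csqnE (@measurable_circ R) sv) integral_cst//= lte_mul_pinfty ?lee_fin ?csqn_ge0//.
Qed.

Lemma csqint_vpow la (v : mR -> R[i]) : 0 <= la -> csqint mu circ v ->
  csqint mu2 Pi (fun y => v y.2 * (y.1 `^ la)%:C : R[i]).
Proof.
move=> la0 sv; have b (y : mR * mR) : Pi y -> normc ((y.1 `^ la)%:C : R[i]) <= 1.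
  by move=> [+ _]; rewrite segE; exact: powC_le1.
have H := csqint_bounded mPi (cmeas_pow2 la m01) b (csqint_circ2 sv); exact: H.
Qed.

Lemma coef_circ2 (v : mR -> R[i]) (c : mR -> R[i]) k x : cintegrable mu circ v ->
  coef (fun z => v z.2 * c z.1) k x = c x * fourier_coef v k.
Proof.
move=> iv; rewrite coefE fourier_coefE mulrCA; congr (_ * _).
rewrite -cintZ; [|exact: measurable_circ|exact: cintegrable_modeM].
by apply: eq_cint => t _; rewrite /= mulrA [c x * _]mulrC.
Qed.

Lemma coef_ae (u u' : mR * mR -> R[i]) k : csqint mu2 Pi u -> csqint mu2 Pi u' ->
  {ae mu2, forall z, Pi z -> u z = u' z} -> ae01 (coef u k) (coef u' k).
Proof.
move=> su su' h; pose d z := - 1 * u' z + u z.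
have sd : csqint mu2 Pi d by exact: csqint_lin.
have s0 := csqint0 mu2 Pi.
have n0 : csqn mu2 Pi d = 0.
  rewrite (csqn_cyl_ae m01 sd s0); last by apply: filterS h => z e Dz; rewrite /d e// mulN1r addNr.
  apply: EFin_inj; rewrite (csqnE mPi s0); apply: integral0_eq => z _.
  by rewrite normc0 expr0n.
have := csqn_coef_le m01 f01 k sd; rewrite n0 pmule_rle0 ?lte_fin ?pi2_gt0// => le0.
have sc := csqint_coef m01 f01 k sd.
have mf : measurable_fun D01 (fun x => (normc (coef d k x) ^+ 2)%:E).
  exact: normc2_meas m01 sc.
have /(ae_eq_integral_abs mu m01 mf) z0 : (\int[mu]_(x in D01) `|(normc (coef d k x) ^+ 2)%:E|)%E = 0.
  apply/eqP; rewrite eq_le integral_ge0// andbT; apply: le_trans le0.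
  by rewrite le_of_eq//; apply: eq_integral => x _; rewrite gee0_abs// lee_fin sqr_ge0.
have L := coef_lin m01 (- 1) k (csqint_cyl_int m01 f01 su') (csqint_cyl_int m01 f01 su).
apply/ae01P; apply: filterS2 z0 L => x h1 h2 Dx.
have := h1 Dx; rewrite /= => -[] /eqP; rewrite sqrf_eq0 => /eqP /eq0_normc.
by rewrite h2// mulN1r addrC => /eqP; rewrite subr_eq0 => /eqP.
Qed.

Lemma circ_fun_csqint (v : R -> R[i]) : circle_fun v -> (circ_L2sq v < +oo)%E -> csqint mu circ (v : mR -> R[i]).
Proof.
by move=> [m1 m2 _] l; apply/(csqint_normcP mu (@measurable_circ R)); split; [split; [exact: m1|exact: m2]|exact: l].
Qed.

Lemma H_norm m (v : R -> R[i]) :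
  H_normsq m v = msum (fun k => Lam R k ^+ m * normc (fourier_coef v k) ^+ 2).
Proof.
apply: eq_esum => k _; congr EFin; rewrite mulr0 mul0r expR0 mulr1 powR_mulrn//.
exact: le_trans ler01 (Lam_ge1 R k).
Qed.

(** The passage from [psi^p d_psi^p] to powers of [x d/dx] is [conv]; by Parseval's identity
    both norms become sums over the modes, which are compared one by one. *)
Lemma J_rep la ga m : 0 <= la -> 0 <= la + ga -> exists2 C, 0 <= C & forall a vw, Pi_fun a ->
  J_decomp la ga m a vw -> exists z, [/\ rep la ga m a (fourier_coef vw.1) z,
    (sn 0 m (fourier_coef vw.1) z < +oo)%E,
    fine (sn 0 m (fourier_coef vw.1) z) <= C * (fine (H_normsq m vw.1) + fine (K_normsq (la + ga) m vw.2)) &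
    fine (H_normsq m vw.1) + fine (K_normsq (la + ga) m vw.2) <= C * fine (sn 0 m (fourier_coef vw.1) z)].
Proof.
have p1 : 1 <= 2 * pi :> R by have := @pi_ge2 R; move: (pi : R) => x; lra.
move=> la0 lg0; pose l := la + ga - 2^-1; have el : la + ga = l + 2^-1 by rewrite /l subrK.
pose c p : R := l - p%:R.
have [C1 C10 h1] := conv_zsum c (fun=> 0) m; have [C2 C20 h2] := conv_zsum (fun=> 0) c m.
have p0 : 0 <= 2 * pi :> R by apply: le_trans p1.
pose A := C1 * (m.+1%:R * 2 ^+ m); pose B := 2 * pi * (m.+1%:R * C2).
have A0 : 0 <= A by rewrite !mulr_ge0// exprn_ge0.
have B0 : 0 <= B by apply: mulr_ge0 => //; exact: mulr_ge0.
exists (1 + A + B); first by rewrite !addr_ge0.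
move=> a [v w] pa [/= Hv Kw eqa]; rewrite el in Kw *.
have [P wr] := K_wrep Kw; have [pw gP cw] := wr.
pose z k p := conv c (fun=> 0) p (P k).
have gz k : gchain (fun=> 0) m (z k) by apply: conv_gchain; exact: gP.
have gz' k : gchain c m (fun p => conv (fun=> 0) c p (z k)) by apply: conv_gchain; exact: gz.
have zP k : zsum k m (z k) <= A * ksum k m (P k).
  apply: le_trans (h1 k _ (gP k)) _; rewrite /A -!mulrA; apply: ler_wpM2l => //; exact: ksum_ge.
have Pz k : 2 * pi * ksum k m (P k) <= B * zsum k m (z k).
  rewrite /B -!mulrA ler_pM2l//; rewrite ler_wpM2l ?pi_ge0//.
  apply: le_trans (ksum_le _ _ _) _; apply: ler_wpM2l => //.
  have -> : zsum k m (P k) = zsum k m (fun p => conv (fun=> 0) c p (z k)).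
    by apply: (zsum_gae (gP k) (gz' k)); apply: aeW.
  exact: h2.
have [cv l2 fH] := Hv; have sv := circ_fun_csqint cv l2.
have sw := K_csqint (eq_ind _ (fun x => 0 <= x) lg0 _ el) Kw.
have sx := csqint_vpow la0 sv.
have sr : csqint mu2 Pi (fun z => v z.2 * (z.1 `^ la)%:C + w z : R[i]) by exact: csqintD.
have sa : csqint mu2 Pi (a : mR * mR -> R[i]).
  apply: csqint_aeG mPi (Pi_fun_cmeas pa) _ sr; apply: filterS eqa => x h Dx; by rewrite h.
have R1 : rep la ga m a (fourier_coef v) z.
  split => //; first by move=> k; apply/chain_gchain; exact: gz.
  move=> k; have e1 := coef_ae k sa sr eqa.
  have e2 := coef_lin m01 1 k (csqint_cyl_int m01 f01 sx) (csqint_cyl_int m01 f01 sw).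
  apply: ae01_trans e1 _; apply/ae01P; move/ae01P: (cw k) => cw'.
  apply: filterS2 e2 cw' => x i1 i2 Dx; rewrite -i2//.
  have -> : (fun z => v z.2 * (z.1 `^ la)%:C + w z) = (fun z => 1 * (v z.2 * (z.1 `^ la)%:C) + w z).
    by apply/funext => y; rewrite mul1r.
  rewrite i1// mul1r; congr (_ + _).
  by rewrite (coef_circ2 (fun x => (x `^ la)%:C) k x (integrable_csqint_circ sv)).
exists z.
pose aH k := Lam R k ^+ m * normc (fourier_coef v k) ^+ 2.
pose bK k := 2 * pi * ksum k m (P k).
have aH0 k : 0 <= aH k by exact: mnV_ge0.
have bK0 k : 0 <= bK k by rewrite mulr_ge0// ksum_ge0.
have fK : (K_normsq (l + 2^-1) m w < +oo)%E by have [] := Kw.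
have eH := H_norm m v; have eK := K_norm_modes Kw wr.
have ejn : fine (H_normsq m v) + fine (K_normsq (l + 2^-1) m w) = fine (msum (fun k => aH k + bK k)).
  rewrite msumD// fineD ?eH ?eK// ge0_fin_numE ?msum_ge0// -?eK// -?eH//.
have fj : (msum (fun k => (aH k + bK k)%R) < +oo)%E.
  by rewrite msumD// lte_add_pinfty//; [rewrite /aH -eH|rewrite /bK -eK].
have ab0 k : 0 <= aH k + bK k by rewrite addr_ge0.
have esn := sn0E m (fourier_coef v) z.
have mn0 k := mn_ge0 m k (fourier_coef v k) (z k).
have K0 k := ksum_ge0 k m (P k).
have [fs le1] : (msum (fun k => (mn m k (fourier_coef v k) (z k))%R) < +oo)%E /\
   fine (msum (fun k => mn m k (fourier_coef v k) (z k))) <= (1 + A + B) * fine (msum (fun k => aH k + bK k)).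
  apply: msum_le => //; first by rewrite !addr_ge0.
  move=> k; rewrite /mn -/(aH k) -addrA mulrDl mul1r -addrA lerD2l.
  apply: (@le_trans _ _ (A * bK k)).
    apply: le_trans (zP k) _; apply: ler_wpM2l => //.
    by rewrite /bK -[leLHS]mul1r; exact: ler_wpM2r.
  have := mulr_ge0 B0 (aH0 k); have := mulr_ge0 B0 (bK0 k); have := mulr_ge0 A0 (aH0 k); have := bK0 k.
  move: (aH k) (bK k) => x y; rewrite !mulrDl !mulrDr; move: (A * x) (A * y) (B * x) (B * y) => *; lra.
have [_ le2] : (msum (fun k => (aH k + bK k)%R) < +oo)%E /\ fine (msum (fun k => aH k + bK k)) <=
   (1 + A + B) * fine (msum (fun k => mn m k (fourier_coef v k) (z k))).
  apply: msum_le => //; first by rewrite !addr_ge0.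
  move=> k; have := Pz k; rewrite -/(bK k) /mn -/(aH k).
  have Z0 : 0 <= zsum k m (z k) by exact: zsum_ge0.
  have := mulr_ge0 B0 (aH0 k); have := mulr_ge0 A0 Z0; have := mulr_ge0 A0 (aH0 k); have := Z0.
  move: (aH k) (bK k) (zsum k m (z k)) => x y t; rewrite !mulrDl !mulrDr.
  move: (A * x) (A * t) (B * x) (B * t) => *; lra.
by split => //; rewrite ?esn ?ejn.
Qed.

(** The leading component is built from the [V_k], and the rest is what remains. *)
Lemma rep_J la ga m a V z : 0 <= la -> rep la ga m a V z -> (sn 0 m V z < +oo)%E ->
  exists2 vw, J_decomp la ga m a vw & forall k, fourier_coef vw.1 k = V k.
Proof.
move=> la0 [pa sa cz ca] fs; pose l := la + ga - 2^-1; have el : la + ga = l + 2^-1 by rewrite /l subrK.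
have mn0 k := mn_ge0 m k (V k) (z k).
have esn := sn0E m V z.
rewrite esn in fs.
have fH : (msum (fun k => (Lam R k ^+ m * normc (V k) ^+ 2)%R) < +oo)%E.
  apply: (msum_fin_le ler01 _ mn0 _ fs) => k; first exact: mnV_ge0.
  by rewrite mul1r lerDl zsum_ge0.
have fV : (msum (fun k => (normc (V k) ^+ 2)%R) < +oo)%E.
  apply: (msum_fin_le ler01 _ _ _ fH) => k; [exact: sqr_ge0|exact: mnV_ge0|].
  by rewrite mul1r ler_peMl ?sqr_ge0// exprn_ege1// Lam_ge1.
have [v [pv sv cv]] := build_circ fV.
pose c p : R := l - p%:R.
have [C2 C20 h2] := conv_zsum (fun=> 0) c m.
pose P k p := conv (fun=> 0) c p (z k).
have gz k : gchain (fun=> 0) m (z k) by apply/chain_gchain.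
pose w (y : R * R) := a y - v y.2 * (y.1 `^ la)%:C.
have mx : cmeas Pi (fun y => v y.2 * (y.1 `^ la)%:C : R[i]).
  by apply: cmeasM; [exact: (@cmeas_snd R D01 v (csqint_meas sv))|exact: cmeas_pow2].
have sx := csqint_vpow la0 sv.
have sw : csqint mu2 Pi (w : mR * mR -> R[i]) by exact: csqintB.
have pw : Pi_fun w.
  have [m1 m2] := csqint_meas sw; have [_ _ pera] := pa; have [_ _ perv] := pv.
  by split; [exact: m1|exact: m2|move=> x t; rewrite /w /= pera perv].
have wr : wrep l m w P.
  split => //; first by move=> k; apply: conv_gchain; exact: gz.
  move=> k; have e2 := coefB m01 k (csqint_cyl_int m01 f01 sa) (csqint_cyl_int m01 f01 sx).
  move/ae01P: (ca k) => ca'; apply/ae01P; apply: filterS2 e2 ca' => x i1 i2 Dx.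
  rewrite i1// i2// (coef_circ2 (fun x => (x `^ la)%:C) k x (integrable_csqint_circ sv)) cv.
  by rewrite addrC addKr.
have Kw : K_mem (l + 2^-1) m w.
  apply: (wrep_K wr sw).
  have [] // := @msum_le R (m.+1%:R * C2) (fun k => ksum k m (P k)) (fun k => mn m k (V k) (z k)) _ _ mn0 _ fs.
  - by rewrite mulr_ge0.
  - by move=> k; exact: ksum_ge0.
  - move=> k; apply: le_trans (ksum_le _ _ _) _; rewrite -mulrA ler_wpM2l//.
    apply: le_trans (h2 k _ (gz k)) _; rewrite ler_wpM2l//.
    by rewrite lerDr mnV_ge0.
exists (v, w); last exact: cv.
have [_ l2] := (csqint_normcP mu (@measurable_circ R) v).1 sv.
split; last first.
- by apply: aeW => y _; symmetry; rewrite [LHS]addrC; exact: subrK.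
- by rewrite el.
split => //; have := H_norm m v; rewrite /H_normsq => ->.
by rewrite (eq_msum (fun k => congr1 (fun t => Lam R k ^+ m * normc t ^+ 2) (cv k))).
Qed.

(** For [ga >= 1/2] a nonzero multiple of [x^(1/2 - ga)] is not square integrable for [dx/x]. *)
Lemma modes_uniq la ga (V V' : R[i]) (z z' : mR -> R[i]) : 2^-1 <= ga -> cwsq z -> cwsq z' ->
  ae01 (fun x => (x `^ la)%:C * V + (x `^ (la + ga - 2^-1))%:C * z x)
       (fun x => (x `^ la)%:C * V' + (x `^ (la + ga - 2^-1))%:C * z' x) ->
  V = V' /\ ae01 z z'.
Proof.
move=> hg sz sz' h; pose W := V - V'; pose d x := - 1 * z x + z' x.
have sd : cwsq d by exact: cwsq_clin.
have hd : ae01 d (fun x => (x `^ (2^-1 - ga))%:C * W).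
  apply: filterS h => x h x01; have /andP[x0 _] := x01.
  have px : (x `^ (la + ga - 2^-1))%:C != 0 :> R[i] by rewrite (inj_eq (@complexI R)) gt_eqF// powR_gt0.
  apply: (mulfI px); have := h x01 => E.
  rewrite mulrA -rmorphM -powRD; last by rewrite (gt_eqF x0) implybT.
  have -> : la + ga - 2^-1 + (2^-1 - ga) = la by ring.
  rewrite /d /W mulrBr mulrDr mulN1r mulrN [RHS]addrC.
  by apply/eqP; rewrite -subr_eq0; apply/eqP; move: E => /eqP; rewrite -subr_eq0 => /eqP E; rewrite -oppr0 -E; ring.
have W0 : W = 0.
  have sc : cwsq (fun x => (x `^ (2^-1 - ga))%:C * W).
    apply: cwsq_of_csqint; have [s _] := csqn_wt sd.
    apply: csqint_ae s => //.
      apply: cmeasM; first by apply: cmeasR; exact: wt_measurable.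
      by apply: cmeasM; [exact: cmeas_pow|exact: cmeas_cst].
    by move/ae01P: hd; apply: filterS => x h' Dx; rewrite h'.
  have pw (x t : R) : 0 < x <= 1 -> t ^+ 2 <= (x `^ (2^-1 - ga) * t) ^+ 2.
    move=> /andP[x0 x1]; rewrite exprMn ler_peMl ?sqr_ge0// exprn_ege1//.
    rewrite -[2^-1 - ga]opprB powRN invf_ge1 ?powR_gt0//.
    have := @ge0_ler_powR R (ga - 2^-1) _ x 1; rewrite !nnegrE ler01 (ltW x0) powR1 subr_ge0.
    by move=> /(_ hg isT isT x1).
  have [s1 s2] := sc.
  apply: complex_eq; apply/eqP; rewrite -sqrf_eq0 eq_le sqr_ge0 andbT.
    by apply: (wsq_bounded_below s1 ltr01 (lexx 1)) => x x01; rewrite /= Re_realM; exact: pw.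
  by apply: (wsq_bounded_below s2 ltr01 (lexx 1)) => x x01; rewrite /= Im_realM; exact: pw.
split; first by apply/eqP; rewrite -subr_eq0 -/W W0.
apply: filterS hd => x h' x01; have := h' x01; rewrite W0 mulr0 /d mulN1r addrC => /eqP.
by rewrite subr_eq0 eq_sym => /eqP.
Qed.

Lemma rep_uniq la ga m a V V' z z' : 2^-1 <= ga -> rep la ga m a V z -> rep la ga m a V' z' ->
  (forall k, V k = V' k) /\ forall k, ae01 (z k 0%N) (z' k 0%N).
Proof.
move=> hg [_ _ c1 e1] [_ _ c2 e2].
have H k : V k = V' k /\ ae01 (z k 0%N) (z' k 0%N).
  apply: (modes_uniq (la := la) hg); [exact: (c1 k).2|exact: (c2 k).2|].
  exact: ae01_trans (ae01_sym (e1 k)) (e2 k).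
by split => k; have [] := H k.
Qed.

Lemma sn_uniq la ga m a V V' z z' s : 2^-1 <= ga -> rep la ga m a V z -> rep la ga m a V' z' ->
  sn s m V z = sn s m V' z'.
Proof.
move=> hg r1 r2; have [hV hz] := rep_uniq hg r1 r2; have [_ _ c1 _] := r1; have [_ _ c2 _] := r2.
by apply: eq_msum => k; rewrite hV /mn (zsum_ae (c1 k) (c2 k) (hz k)).
Qed.

(** * Analytic functions of the angle *)

Definition ew (s : R) (k : int) : R := expR (s * `|k%:~R|).

Lemma ew2 s k : normc ((ew s k)%:C : R[i]) ^+ 2 = expR (2 * s * `|k%:~R|).
Proof.
rewrite -[X in normc X]mulr1 normc_reM ?expR_ge0// normc1 mulr1.
by rewrite expr2 -expRD; congr expR; ring.
Qed.

Lemma csqn_norm_ge1 (x : R) : 0 <= x -> x <= 2 * pi * x.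
Proof.
move=> x0; rewrite -[leLHS]mul1r ler_wpM2r//.
by have := @pi_ge2 R; move: (pi : R) => y; lra.
Qed.

(** Convergence in the mean of the partial sums passes to the coefficients. *)
Lemma fourier_sum_coef (c : int -> R[i]) (v : R -> R[i]) : cmeas circ (v : mR -> R[i]) -> fourier_sum c v ->
  csqint mu circ (v : mR -> R[i]) /\ forall k, fourier_coef v k = c k.
Proof.
move=> mv /fine_cvgP[[N0 _ hN] hc].
have sT N := csqint_trigsum c N.
have sd N : (N0 <= N)%N -> csqint mu circ (fun t => v t - trigsum c N t).
  move=> le; apply/(csqint_normcP mu mc); split; first by apply: cmeasB => //; exact: csqint_meas (sT N).
  by have := hN N le; rewrite fin_numElt => /andP[].
have sv : csqint mu circ (v : mR -> R[i]).
  have := csqintD mc (sd N0 (leqnn N0)) (sT N0); congr (csqint _ _ _).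
  by apply/funext => t; rewrite subrK.
split => // k; apply/eqP; rewrite -subr_eq0; apply/eqP.
apply: (normc_eq0_lim (n0 := maxn N0 `|k|%N) hc) => N; rewrite geq_max => /andP[n1 n2].
have E : fourier_coef v k - c k = fourier_coef (fun t => v t - trigsum c N t) k.
  have -> : (fun t => v t - trigsum c N t) = (fun t => - 1 * trigsum c N t + v t).
    by apply/funext => t; rewrite mulN1r addrC.
  rewrite fourier_coef_lin; [|exact: integrable_csqint_circ|exact: integrable_csqint_circ].
  by rewrite fourier_coef_trigsum n2 mulN1r addrC.
have F : csqn mu circ (fun t => v t - trigsum c N t) = fine (circ_L2sq (fun t => v t - trigsum c N t)).
  first [by [] | by rewrite /csqn /Rintegral | have e := csqnE mc (sd N n1); apply: EFin_inj; rewrite (fineK (hN N n1)); exact: e].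
rewrite E; apply: le_trans (csqn_norm_ge1 (sqr_ge0 _)) _.
apply: le_trans (cintegrable_coef_section k (sd N n1)) _.
rewrite F; exact: lexx.
Qed.

Lemma boost_sections s (a b : R * R -> R[i]) : is_boost s a b ->
  {ae mu, forall x, D01 x -> csqint mu circ (fun t => b (x, t)) /\
    forall k, coef b k x = coef a k x * (ew s k)%:C}.
Proof.
move=> [pb h]; apply: filterS h => x hx Dx.
have mb := cmeas_section m01 Dx (Pi_fun_cmeas pb).
by move: (Dx); rewrite segE => /hx /(fourier_sum_coef mb).
Qed.

Lemma is_boost_build s (a b : R * R -> R[i]) : Pi_fun b -> csqint mu2 Pi (b : mR * mR -> R[i]) ->
  (forall k, {ae mu, forall x, D01 x -> coef b k x = (ew s k)%:C * coef a k x}) -> is_boost s a b.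
Proof.
move=> pb sb h; split => //.
apply: filterS2 (csqint_section m01 sb) (ae_forall_int h) => x h1 h2 x01.
have Dx : D01 x by rewrite segE.
have sx := h1 Dx; have cv := cvg_toEFin (fourier_cvg sx).
rewrite /fourier_sum; apply: cvg_trans cv; apply: near_eq_cvg; apply: nearW => N.
rewrite (csqnE mc); last by apply: csqintB => //; exact: csqint_trigsum.
apply: eq_integral => t _; congr ((normc (_ - _) ^+ 2)%:E).
by apply: eq_bigr => i _; congr (_ * _); rewrite [LHS](h2 _ Dx) mulrC.
Qed.

Lemma csqn_modes_le la ga (V : R[i]) (z c : mR -> R[i]) : 0 <= la -> 0 <= la + ga -> cwsq z ->
  csqint mu D01 c -> ae01 c (fun x => (x `^ la)%:C * V + (x `^ (la + ga - 2^-1))%:C * z x) ->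
  csqn mu D01 c <= 2 * normc V ^+ 2 + 2 * cwn z.
Proof.
move=> la0 lg0 cz sc ca.
have [sw <-] := csqn_wt cz.
pose F x := 2 * normc V ^+ 2 + 2 * normc (wtC x * z x) ^+ 2.
have i1 : mu.-integrable D01 (EFin \o (fun x => normc (wtC x * z x) ^+ 2)).
  exact: sqint_sq_integrable (csqint_sqint m01 sw).
have i2 : mu.-integrable D01 (EFin \o (fun _ : mR => normc V ^+ 2)) by exact: integrable_cst_fin.
have iF := integrable_lin m01 2 2 i2 i1.
have EF : \int[mu]_(x in D01) F x = 2 * normc V ^+ 2 + 2 * csqn mu D01 (fun x => wtC x * z x).
  rewrite (Rintegral_lin m01 2 2 i2 i1); congr (2 * _ + _).
  have M1 : fine (mu D01) = 1 by rewrite lebesgue_measure_itv/= lte_fin ltr01 -EFinB subr0.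
  rewrite Rintegral_cst//; transitivity (normc V ^+ 2 * 1); last exact: mulr1.
  by congr (_ * _); exact: M1.
rewrite -EF -lee_fin (csqnE m01 sc) EFin_Rint//.
apply: ae_ge0_le_integral => //.
- by move=> x _; rewrite lee_fin sqr_ge0.
- exact: normc2_meas m01 sc.
- by move=> x _; rewrite lee_fin addr_ge0// mulr_ge0// sqr_ge0.
- by have /integrableP[] := iF.
move/ae01P: ca => ca'; apply: filterS2 ca' (ae01D R) => x h1 h2 Dx; rewrite lee_fin h1//.
have /andP[x0 x1] := h2 Dx; apply: le_trans (normc2_add _ _) _; rewrite /F.
have P (q : R) : 0 <= q -> x `^ q <= 1 by move=> q0; rewrite powR_le1// (ltW x0) ltW.
rewrite !normc_reM ?powR_ge0 ?wt_ge0// !exprMn lerD// ler_wpM2l//; last first.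
  rewrite ler_wpM2r ?sqr_ge0// lerXn2r ?nnegrE ?powR_ge0 ?wt_ge0//.
  rewrite /wt; have -> : la + ga - 2^-1 = - 2^-1 + (la + ga) by ring.
  by rewrite powRD ?(gt_eqF x0) ?implybT// ler_piMr ?powR_ge0// P.
by rewrite ler_piMl ?sqr_ge0// exprn_ile1 ?powR_ge0// P.
Qed.

Lemma coef_csqn_le la ga m a V z k : 0 <= la -> 0 <= la + ga -> rep la ga m a V z ->
  csqn mu D01 (coef a k) <= 2 * normc (V k) ^+ 2 + 2 * cwn (z k 0%N).
Proof.
move=> la0 lg0 [pa sa cz ca].
by apply: csqn_modes_le la0 lg0 ((cz k).2 0%N (leq0n m)) _ (ca k); exact: csqint_coef.
Qed.

Lemma mn_low m k (V : R[i]) z : normc V ^+ 2 + cwn (z 0%N) <= mn m k V z.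
Proof.
have L n : 1 <= Lam R k ^+ n by apply: exprn_ege1; exact: Lam_ge1.
apply: lerD; first by rewrite ler_peMl// sqr_ge0.
apply: le_trans (zsum_term k z (leq0n m)); by rewrite ler_peMl// cwn_ge0.
Qed.

Lemma sn_low s m V (z : int -> nat -> mR -> R[i]) : 0 <= s -> (sn s m V z < +oo)%E -> (sn 0 m V z < +oo)%E.
Proof.
move=> s0 h; apply: (msum_fin_le ler01 _ _ _ h) => k; try exact: sn_term_ge0.
rewrite mul1r mulr0 mul0r ler_wpM2r ?mn_ge0// ler_expR.
by rewrite !mulr_ge0.
Qed.

Lemma boost_fin la ga m a V z s : 0 <= la -> 0 <= la + ga -> rep la ga m a V z -> (sn s m V z < +oo)%E ->
  (msum (fun k => (csqn mu D01 (fun x => (ew s k)%:C * coef a k x))%R) < +oo)%E.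
Proof.
move=> la0 lg0 r fs; have [_ sa _ _] := r.
apply: (msum_fin_le (ler0n R 2) _ _ _ fs) => k; [exact: csqn_ge0|exact: sn_term_ge0|].
have sc := csqint_coef m01 f01 k sa.
have -> : csqn mu D01 (fun x => (ew s k)%:C * coef a k x) = expR (2 * s * `|k%:~R|) * csqn mu D01 (coef a k).
  rewrite -ew2 /csqn -RintegralZl//; last exact: sqint_sq_integrable (csqint_sqint m01 sc).
  by apply: eq_Rintegral => x _; rewrite [in LHS]normcM [LHS]exprMn.
rewrite [leRHS]mulrCA ler_wpM2l ?expR_ge0//.
apply: le_trans (coef_csqn_le k la0 lg0 r) _; rewrite -mulrDr ler_wpM2l//; exact: mn_low.
Qed.

Lemma boost_build la ga m a V z s : 0 <= la -> 0 <= la + ga -> rep la ga m a V z -> (sn s m V z < +oo)%E ->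
  exists b, [/\ is_boost s a b, Pi_fun b, csqint mu2 Pi (b : mR * mR -> R[i]) &
    forall k, {ae mu, forall x, D01 x -> coef b k x = (ew s k)%:C * coef a k x}].
Proof.
move=> la0 lg0 r fs; have [_ sa _ _] := r.
have sk k : csqint mu D01 (fun x => (ew s k)%:C * coef a k x).
  by apply: csqintZ => //; exact: csqint_coef.
have [b [pb sb cb]] := build sk (boost_fin la0 lg0 r fs).
by exists b; split => //; exact: is_boost_build.
Qed.

(** On almost every circle any two boosts have the same coefficients, hence the same norm. *)
Lemma boost_csqint la ga m a V z s b : 0 <= la -> 0 <= la + ga -> rep la ga m a V z ->
  (sn s m V z < +oo)%E -> is_boost s a b -> csqint mu2 Pi (b : mR * mR -> R[i]).
Proof.
move=> la0 lg0 r fs hb; have [b' [hb' pb' sb' _]] := boost_build la0 lg0 r fs.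
have [pb _] := hb; have mb := Pi_fun_cmeas pb.
apply/(csqint_normcP mu2 mPi); split => //.
have /(csqint_normcP mu2 mPi)[mb' L] := sb'.
have [t1 t2] := tonelli_csq m01 mb; have [t1' t2'] := tonelli_csq m01 mb'.
apply: le_lt_trans L; rewrite t2 t2' le_eqVlt; apply/orP; left; apply/eqP.
apply: ae_eq_integral => //.
apply: filterS2 (boost_sections hb) (boost_sections hb') => x h1 h2 Dx.
have [s1 e1] := h1 Dx; have [s2 e2] := h2 Dx.
rewrite -(csqnE mc s1) -(csqnE mc s2) (parseval_circ_esum s1) (parseval_circ_esum s2).
congr (_ * _)%E; apply: eq_esum => k _; congr ((normc _ ^+ 2)%:E).
by have := e1 k; rewrite -(e2 k).
Qed.

Definition eV s (V : int -> R[i]) k := (ew s k)%:C * V k.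
Definition ez s (z : int -> nat -> mR -> R[i]) k p x := (ew s k)%:C * z k p x.

Lemma sn_boost s m V z : (forall k, chain m (z k)) -> sn 0 m (eV s V) (ez s z) = sn s m V z.
Proof.
move=> cz; apply: eq_msum => k; rewrite mulr0 mul0r expR0 mul1r /mn /eV /ez (zsumZ _ _ (cz k)).
by rewrite [in normc (_ * _)]normcM exprMn ew2; ring.
Qed.

Lemma rep_coef_scale la ga m a V z s k : rep la ga m a V z ->
  ae01 (fun x => (ew s k)%:C * coef a k x)
    (fun x => (x `^ la)%:C * eV s V k + (x `^ (la + ga - 2^-1))%:C * ez s z k 0%N x).
Proof.
by move=> [_ _ _ ca]; apply: filterS (ca k) => x h x01; rewrite h// /eV /ez; ring.
Qed.

Lemma boost_coef s (a b : R * R -> R[i]) k : is_boost s a b ->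
  ae01 (coef b k) (fun x => (ew s k)%:C * coef a k x).
Proof.
move=> /boost_sections h; apply/ae01P; apply: filterS h => x h Dx.
by have [_ ->] := h Dx; rewrite mulrC.
Qed.

Lemma boost_rep la ga m a V z s b : 0 <= la -> 0 <= la + ga -> rep la ga m a V z ->
  (sn s m V z < +oo)%E -> is_boost s a b -> rep la ga m b (eV s V) (ez s z).
Proof.
move=> la0 lg0 r fs hb; have [_ _ cz _] := r; split; first by have [] := hb.
- exact: (boost_csqint la0 lg0 r fs hb).
- by move=> k; exact: chainZ.
- by move=> k; exact: ae01_trans (boost_coef k hb) (rep_coef_scale s k r).
Qed.

Lemma rep_Js la ga m (a : R * R -> R[i]) V z s : 0 <= la -> 0 <= la + ga -> 0 <= s -> rep la ga m a V z ->
  (sn s m V z < +oo)%E -> Js_mem la ga m s a.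
Proof.
move=> la0 lg0 s0 r fs; have [pa _ cz _] := r; split.
  by split => //; have [vw h _] := rep_J la0 r (sn_low s0 fs); exists vw.
have [b [hb pb _ _]] := boost_build la0 lg0 r fs.
exists b => //; split => //.
have [|vw h _] := rep_J la0 (boost_rep la0 lg0 r fs hb); first by rewrite sn_boost.
by exists vw.
Qed.

(** Uniqueness of the modes identifies those of the boosted function as [e^(s|k|)] times those
    of the function itself, so that the weights enter the sum of squares. *)
Lemma Js_rep la ga m (a : R * R -> R[i]) s : 0 <= la -> 2^-1 <= ga -> Js_mem la ga m s a ->
  exists V z, rep la ga m a V z /\ (sn s m V z < +oo)%E.
Proof.
move=> la0 hg [[pa [vw da]] [b hb [pb [vw' db]]]].
have lg0 : 0 <= la + ga by rewrite addr_ge0// (le_trans _ hg)// invr_ge0.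
have [C _ J] := J_rep m la0 lg0.
have [z [r _ _ _]] := J a vw pa da; have [z' [r' fs' _ _]] := J b vw' pb db.
exists (fourier_coef vw.1), z; split => //; have [_ _ cz _] := r; have [_ _ cz' cb'] := r'.
rewrite -(sn_boost _ _ cz); move: fs'; congr (_ < _)%E; apply: eq_msum => k.
have [e1 e2] : fourier_coef vw'.1 k = eV s (fourier_coef vw.1) k /\ ae01 (z' k 0%N) (ez s z k 0%N).
  apply: (modes_uniq (la := la) hg); [exact: (cz' k).2|exact: (chainZ _ (cz k)).2|].
  apply: ae01_trans (ae01_sym (cb' k)) _.
  exact: ae01_trans (boost_coef k hb) (rep_coef_scale s k r).
by rewrite e1 /mn (zsum_ae (cz' k) (chainZ _ (cz k)) e2).
Qed.

Lemma J_norm_boost (la ga : R) m s : 0 <= la -> 2^-1 <= ga -> 0 <= s -> exists2 C, 0 <= C &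
  forall a V z, rep la ga m a V z -> (sn s m V z < +oo)%E ->
  J_norm la ga m (boost s a) ^+ 2 <= C * fine (sn s m V z) /\
  fine (sn s m V z) <= C * J_norm la ga m (boost s a) ^+ 2.
Proof.
move=> la0 hg s0.
have lg0 : 0 <= la + ga by rewrite addr_ge0// (le_trans _ hg)// invr_ge0.
have [C C0 J] := J_rep m la0 lg0; exists C => // a V z r fs; have [_ _ cz _] := r.
have [b0 [hb0 _ _ _]] := boost_build la0 lg0 r fs.
have hb : is_boost s a (boost s a) := xgetPex (fun=> 0) (ex_intro _ b0 hb0).
have rb := boost_rep la0 lg0 r fs hb; have [pb _] := hb.
have fb : (sn 0 m (eV s V) (ez s z) < +oo)%E by rewrite sn_boost.
have [vw0 d0 _] := rep_J la0 rb fb.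
rewrite /J_norm; set vw := xget _ _.
have d : J_decomp la ga m (boost s a) vw := xgetPex (fun=> 0, fun=> 0) (ex_intro _ vw0 d0).
have [z' [r' _ h1 h2]] := J _ _ pb d.
rewrite (sn_uniq 0 hg r' rb) (sn_boost _ _ cz) in h1 h2.
rewrite sqr_sqrtr//; rewrite addr_ge0// fine_ge0//.
  apply: esum_ge0 => k _; rewrite lee_fin; apply: mulr_ge0; last exact: sqr_ge0.
  by apply: mulr_ge0; [exact: powR_ge0|exact: expR_ge0].
by apply: sume_ge0 => p _; apply: sume_ge0 => q _; exact: Pi_L2sq_ge0.
Qed.

End JModes.

(** * Estimates for one mode *)

Section ModeEstimates.
Variable R : realType.
Local Notation mu := (@lebesgue_measure R).
Local Notation mR := (measurableTypeR R).
Local Notation D01 := (seg (0 : R) 1).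

(** [y(1)^2 - y(x)^2] is the integral of [2 y y1 / t] over [[x, 1]]. *)
Lemma dprim_sup (y y1 : mR -> R) x : dprim y y1 -> wsq y -> wsq y1 -> 0 < x <= 1 ->
  y x ^+ 2 <= 2 * (wnorm y + wnorm y1).
Proof.
move=> dy sy sy1 /andP[x0 x1]; have m01 := measurable_seg (0 : R) 1.
have mx := measurable_seg x 1.
have sub : seg x 1 `<=` D01 by move=> s; rewrite !segE => /andP[/(le_trans (ltW x0)) -> ->].
have T := trace_bound ltr01 dy sy sy1; rewrite mul1r invr1 mul1r in T.
have E := dprim_sq dy x0 x1.
pose a s := wt s * y s; pose b s := wt s * y1 s.
have i1 : mu.-integrable D01 (EFin \o (fun s => a s * b s)) := integrableM_sqint m01 sy sy1.
have i2 : mu.-integrable D01 (EFin \o (fun s => a s ^+ 2)) := sqint_sq_integrable sy.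
have i3 : mu.-integrable D01 (EFin \o (fun s => b s ^+ 2)) := sqint_sq_integrable sy1.
have i4 := integrable_lin m01 1 1 i2 i3.
have i5 : mu.-integrable D01 (EFin \o (fun s => 2 * (a s * b s))).
  have := integrable_lin m01 2 0 i1 i1; apply: eq_integrable => // s _.
  by rewrite /= mul0r addr0.
have i6 : mu.-integrable D01 (EFin \o (fun s => (- 1) * (2 * (a s * b s)))).
  have := integrable_lin m01 (- 1) 0 i5 i5; apply: eq_integrable => // s _.
  by rewrite /= mul0r addr0.
have h1 : \int[mu]_(s in seg x 1) ((- 1) * (2 * (a s * b s))) <=
    \int[mu]_(s in seg x 1) (1 * a s ^+ 2 + 1 * b s ^+ 2).
  apply: le_Rintegral => //; [exact: (integrableS m01 mx sub i6)|exact: (integrableS m01 mx sub i4)|].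
  by move=> s _; have := sqr_ge0 (a s + b s); move: (a s) (b s) => u v; nra.
have h2 : \int[mu]_(s in seg x 1) (1 * a s ^+ 2 + 1 * b s ^+ 2) <= wnorm y + wnorm y1.
  rewrite -[wnorm y]mul1r -[wnorm y1]mul1r -(Rintegral_lin m01 1 1 i2 i3).
  by apply: Rintegral_sub => // s; rewrite !mul1r addr_ge0 ?sqr_ge0.
have h3 : \int[mu]_(s in seg x 1) ((- 1) * (2 * (a s * b s))) = - (y 1 ^+ 2 - y x ^+ 2).
  transitivity ((- 1) * \int[mu]_(s in seg x 1) (2 * (a s * b s))); last by rewrite mulN1r E.
  by apply: RintegralZl => //; exact: (integrableS m01 mx sub i5).
rewrite h3 in h1; move: T (le_trans h1 h2); clear.
move: (y 1 ^+ 2) (y x ^+ 2) (wnorm y) (wnorm y1) => p q r s; lra.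
Qed.

Lemma cdprim_sup (y y1 : mR -> R[i]) x : cdprim y y1 -> cwsq y -> cwsq y1 -> 0 < x <= 1 ->
  normc (y x) ^+ 2 <= 2 * (cwn y + cwn y1).
Proof.
move=> [d1 d2] [s1 s2] [s3 s4] x01; rewrite normc2.
have := dprim_sup d1 s1 s3 x01; have := dprim_sup d2 s2 s4 x01; rewrite /cwn /=.
move: (Re _ ^+ 2) (Im _ ^+ 2) (wnorm _) (wnorm _) (wnorm _) (wnorm _) => *; lra.
Qed.

(** The factor of the leading term [V_k x^(1/2)] in the equation; it vanishes at [|k| = 2], which
    is the origin of the two orthogonality conditions. *)
Definition vfac (k : int) : R := (4 - k%:~R ^+ 2) / 4.
Definition vf k (V : R[i]) : R[i] := (vfac k)%:C * V.

Lemma normc_vf k V : normc (vf k V) ^+ 2 = vfac k ^+ 2 * normc V ^+ 2.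
Proof. by rewrite /vf mulrC normc_realM exprMn mulrC real_normK ?num_real. Qed.

Lemma vf_up n k V : Lam R k ^+ n * normc (vf k V) ^+ 2 <= Lam R k ^+ n.+2 * normc V ^+ 2.
Proof.
have -> : Lam R k ^+ n.+2 * normc V ^+ 2 = Lam R k ^+ n * (Lam R k ^+ 2 * normc V ^+ 2).
  by rewrite -addn2 exprD mulrA.
rewrite normc_vf; apply: ler_wpM2l; first by rewrite exprn_ge0// (le_trans ler01)// Lam_ge1.
apply: ler_wpM2r; first exact: sqr_ge0.
rewrite /vfac /Lam; have := sqr_ge0 (k%:~R : R); move: (k%:~R ^+ 2 : R) => x x0; nra.
Qed.

Lemma int_sq (k : int) : (k%:~R ^+ 2 : R) = (`|k| ^ 2)%N%:R.
Proof. by rewrite natrX natr_absz intr_norm real_normK ?num_real. Qed.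

Lemma vf_low n k V : (`|k| != 2)%N ->
  Lam R k ^+ n.+2 * normc V ^+ 2 <= 64 * (Lam R k ^+ n * normc (vf k V) ^+ 2).
Proof.
move=> k2; have -> : Lam R k ^+ n.+2 * normc V ^+ 2 = Lam R k ^+ n * (Lam R k ^+ 2 * normc V ^+ 2).
  by rewrite -addn2 exprD mulrA.
have -> : 64 * (Lam R k ^+ n * normc (vf k V) ^+ 2) = Lam R k ^+ n * ((64 * vfac k ^+ 2) * normc V ^+ 2).
  by rewrite normc_vf; ring.
apply: ler_wpM2l; first by rewrite exprn_ge0// (le_trans ler01)// Lam_ge1.
apply: ler_wpM2r; first exact: sqr_ge0.
rewrite /vfac /Lam int_sq.
have [h|h] : (`|k| <= 1)%N \/ (3 <= `|k|)%N by lia.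
  have : (`|k| ^ 2)%N%:R <= 1 :> R by rewrite (ler_nat R _ 1) -(exp1n 2) leq_exp2r.
  have := ler0n R (`|k| ^ 2)%N; move: ((`|k| ^ 2)%N%:R : R) => x x0 x1; nra.
have : 9 <= (`|k| ^ 2)%N%:R :> R by rewrite (ler_nat R 9) -[9%N]/(3 ^ 2)%N leq_exp2r.
move: ((`|k| ^ 2)%N%:R : R) => x x9; nra.
Qed.

Definition bw n k : R := Lam R k ^+ n.+1 * Num.sqrt (Lam R k).

Lemma bw_ge0 n k : 0 <= bw n k.
Proof. by rewrite mulr_ge0 ?sqrtr_ge0// exprn_ge0// (le_trans ler01)// Lam_ge1. Qed.

Lemma bw_le n k : bw n k <= Lam R k ^+ n.+2.
Proof.
have L1 := Lam_ge1 R k; have L0 : 0 <= Lam R k by apply: le_trans L1.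
rewrite /bw [leRHS]exprSr ler_wpM2l ?exprn_ge0//.
have S1 : 1 <= Num.sqrt (Lam R k) by rewrite -[leLHS]sqrtr1 ler_wsqrtr.
have := sqr_sqrtr L0; move: (Num.sqrt _) S1 => q q1 <-.
by rewrite expr2 ler_peMl// (le_trans ler01).
Qed.

Lemma trace_up n k (V : R[i]) z : chain n.+2 z ->
  bw n k * normc (V + z 0%N 1) ^+ 2 <= 4 * (Lam R k ^+ n.+2 * normc V ^+ 2 + zsum k n.+2 z).
Proof.
move=> cz; have T := mode_trace k cz; rewrite -/(bw n k) in T.
have h := ler_wpM2l (bw_ge0 n k) (normc2_add V (z 0%N 1)).
have h2 := ler_wpM2r (sqr_ge0 (normc V)) (bw_le n k).
have V0 : 0 <= Lam R k ^+ n.+2 * normc V ^+ 2.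
  by rewrite mulr_ge0 ?sqr_ge0// exprn_ge0// (le_trans ler01)// Lam_ge1.
move: h h2 T V0; rewrite mulrDr !(mulrCA _ 2).
move: (bw n k * normc V ^+ 2) (bw n k * normc (z 0%N 1) ^+ 2) (zsum _ _ _) (bw n k * _) (Lam R k ^+ _ * _) => *; lra.
Qed.

Lemma arith_expand (C A H G : R) : (64 + 128 * C) * ((A + H) + G) =
  64 * A + 64 * H + 64 * G + 128 * (C * A) + 128 * (C * H) + 128 * (C * G).
Proof. by ring. Qed.

Lemma arith_low (C A H G Y Z : R) : 0 <= C -> 0 <= A -> 0 <= H -> 0 <= G ->
  Z <= C * H -> Y <= 64 * A -> Y + Z <= (64 + 128 * C) * ((A + H) + G).
Proof.
move=> C0 A0 H0 G0 hZ hY; rewrite arith_expand.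
have := mulr_ge0 C0 A0; have := mulr_ge0 C0 H0; have := mulr_ge0 C0 G0; move: hZ.
move: (C * A) (C * H) (C * G) => x y t h1 h2 h3 h4; lra.
Qed.

Lemma arith_high (C A H G Y Z B : R) : 0 <= C -> 0 <= A -> 0 <= H -> 0 <= G ->
  Z <= C * (H + B) -> Y <= 64 * A -> B <= 2 * G + 128 * A ->
  Y + Z <= (64 + 128 * C) * ((A + H) + G).
Proof.
move=> C0 A0 H0 G0 hZ hY hB; rewrite arith_expand; have {hB} := ler_wpM2l C0 hB.
move: hZ; rewrite !mulrDr !(mulrCA C).
have := mulr_ge0 C0 A0; have := mulr_ge0 C0 H0; have := mulr_ge0 C0 G0.
move: (C * A) (C * H) (C * G) (C * B) => x y t b h1 h2 h3 h4 h5; lra.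
Qed.

Lemma arith_two (C A H G Y Z W T : R) : 0 <= C -> 0 <= A -> 0 <= H -> 0 <= G ->
  Z <= C * H -> Y <= 3 * W -> W <= 2 * G + 2 * T -> T <= 2 * Z ->
  Y + Z <= (64 + 128 * C) * ((A + H) + G).
Proof.
move=> C0 A0 H0 G0 hZ hY hW hT; rewrite arith_expand.
have := mulr_ge0 C0 A0; have := mulr_ge0 C0 H0; have := mulr_ge0 C0 G0; move: hZ.
move: (C * A) (C * H) (C * G) => x y t h1 h2 h3 h4; lra.
Qed.

(** The a priori estimate for one mode: [G] stands for the value of the mode on the boundary,
    which is known for [|k| >= 2]. For [|k| > 2] it controls [z(1)]; for [|k| = 2] the equation
    controls [z] but not [V], which is then recovered from [G]. *)
Lemma mode_apriori (g : R) n : 2^-1 < g < 1 -> exists2 C, 0 <= C & forall k (V G : R[i]) z, chain n.+2 z ->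
  ((2 <= `|k|)%N -> G = V + z 0%N 1) ->
  Lam R k ^+ n.+2 * normc V ^+ 2 + zsum k n.+2 z <=
  C * ((Lam R k ^+ n * normc (vf k V) ^+ 2 + zsum k n (euler g k z)) + bw n k * normc G ^+ 2).
Proof.
move=> hg; have [C C0 hC] := euler_inverse n hg.
exists (64 + 128 * C); first by rewrite addr_ge0// mulr_ge0.
move=> k V G z cz hG; have Z := hC k z cz; rewrite /bdry -/(bw n k) in Z.
have T := mode_trace k cz; rewrite -/(bw n k) in T.
have A0 : 0 <= Lam R k ^+ n * normc (vf k V) ^+ 2.
  by rewrite mulr_ge0 ?sqr_ge0// exprn_ge0// (le_trans ler01)// Lam_ge1.
have H0 : 0 <= zsum k n (euler g k z) by exact: zsum_ge0.
have G0 : 0 <= bw n k * normc G ^+ 2 by rewrite mulr_ge0 ?bw_ge0 ?sqr_ge0.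
have [k2|k2] := eqVneq `|k|%N 2%N; last first.
  have Y := vf_low n V k2.
  have [k3|k3] := ltnP 2 `|k|; last first.
    by rewrite ltnNge k3 /= addr0 in Z; exact: arith_low.
  rewrite k3 in Z; apply: (arith_high C0 A0 H0 G0 Z Y).
  have E : z 0%N 1 = G - V by rewrite hG ?(ltnW k3)// addrC addKr.
  have h := ler_wpM2l (bw_ge0 n k) (normc2_sub G V); rewrite -E mulrDr !(mulrCA (bw n k) 2) in h.
  have h2 := ler_wpM2r (sqr_ge0 (normc V)) (bw_le n k).
  apply: le_trans h _; rewrite lerD2l; move: h2 Y; clear.
  move: (bw n k * _) (Lam R k ^+ n * _) (Lam R k ^+ _ * _) => *; lra.
rewrite k2 ltnn addr0 in Z.
have S3 : Num.sqrt (Lam R k) <= 3.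
  rewrite -[leRHS]ger0_norm// -sqrtr_sqr ler_wsqrtr// /Lam int_sq k2.
  by rewrite -(natrD _ 1 4) -natrX ler_nat.
have Y : Lam R k ^+ n.+2 * normc V ^+ 2 <= 3 * (bw n k * normc V ^+ 2).
  rewrite mulrA; apply: ler_wpM2r; first exact: sqr_ge0.
  have L0 : 0 <= Lam R k by apply: le_trans ler01 (Lam_ge1 R k).
  rewrite exprSr -[X in _ * X <= _](sqr_sqrtr L0) expr2 mulrA -/(bw n k) mulrC.
  by apply: ler_wpM2r => //; exact: bw_ge0.
have E : V = G - z 0%N 1 by rewrite hG ?k2// addrK.
have h := ler_wpM2l (bw_ge0 n k) (normc2_sub G (z 0%N 1)); rewrite -E mulrDr !(mulrCA (bw n k) 2) in h.
exact: (arith_two C0 A0 H0 G0 Z Y h T).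
Qed.

End ModeEstimates.

(** * The operator and the trace in terms of modes *)

Section Operator.
Variable R : realType.
Local Notation mu := (@lebesgue_measure R).
Local Notation mR := (measurableTypeR R).
Local Notation mu2 := (mu \x mu)%E.
Local Notation circ := (@circ R : set mR).
Local Notation D01 := (seg (0 : R) 1).
Local Notation Pi := (D01 `*` circ).
Let m01 := measurable_seg (0 : R) 1.
Let f01 := seg_fin (0 : R) 1.
Let mPi : measurable Pi := measurable_cyl m01.

Lemma cwsq_powM (q : R) (y : mR -> R[i]) : 0 <= q -> cwsq y ->
  cwsq (fun x => (x `^ q)%:C * y x) /\ cwn (fun x => (x `^ q)%:C * y x) <= cwn y.
Proof.
move=> q0 sy; have [s <-] := csqn_wt sy.
have b (x : mR) : D01 x -> normc ((x `^ q)%:C : R[i]) <= 1 by rewrite segE => x01; exact: powC_le1.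
have s' := csqint_bounded m01 (cmeas_pow q D01) b s.
have sq : cwsq (fun x => (x `^ q)%:C * y x).
  by apply: cwsq_of_csqint; move: s'; congr (csqint _ _ _); apply/funext => x; ring.
split => //; have [s2 <-] := csqn_wt sq; rewrite /csqn.
apply: le_Rintegral => //; [exact: sqint_sq_integrable (csqint_sqint m01 s2)|exact: sqint_sq_integrable (csqint_sqint m01 s)|].
move=> x Dx; rewrite lerXn2r ?nnegrE ?normc_ge0// mulrCA normcM ler_piMl ?normc_ge0//; exact: b.
Qed.

Lemma cwn_clin_le (a : R[i]) (y z : mR -> R[i]) : cwsq y -> cwsq z ->
  cwn (fun x => a * y x + z x) <= 2 * (normc a ^+ 2 * cwn y + cwn z).
Proof.
move=> sy sz; have := cwn_lin_le 1 1 (cwsqZ a sy) sz; rewrite expr1n !mul1r (cwnZ a sy).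
by congr (cwn _ <= _); apply/funext => x; rewrite /lin2 rmorph1 !mul1r.
Qed.

(** Multiplication by [x^q] turns derivatives shifted by [q] into derivatives. *)
Lemma chain_powM (q : R) m Z : 0 <= q -> gchain (fun=> q) m Z ->
  chain m (fun p x => (x `^ q)%:C * Z p x : R[i]).
Proof.
move=> q0 [d s]; split => j jm; last by have [] := cwsq_powM q0 (s j jm).
have E (u v : mR -> R) : dprim u (fun x => 1 * v x + - q * u x) ->
    dprim (fun x => x `^ q * u x) (fun x => x `^ q * v x).
  move=> du; apply: eq_prim (prim_mul (powR_prim q) du) => // x /andP[x0 _].
  by rewrite powR_m1//; ring.
have [d1 d2] := d j jm; rewrite Re_lin2 in d1; rewrite Im_lin2 in d2.
by split; [apply: eq_prim (E _ _ d1)|apply: eq_prim (E _ _ d2)] => x _; rewrite /= ?Re_realM ?Im_realM.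
Qed.

Definition hpow p (x : mR) : R[i] := (2^-1 ^+ p * x `^ 2^-1)%:C.

Lemma chain_hpow m : chain m hpow.
Proof.
have S : wsq (fun x : R => x `^ 2^-1).
  have i2 : 0 < 2^-1 :> R by rewrite invr_gt0.
  have [s _] := powR_sqint i2 ltr01 (lexx 1).
  have mm (q : R) : measurable_fun D01 (fun x : mR => x `^ q) by exact: (measurable_funTS (measurable_powR _)).
  apply: sqint_ae s => //.
    by apply: measurable_funM; [exact: wt_measurable|exact: mm].
  have := ae01D R; apply: filterS => x h Dx; have /andP[x0 _] := h Dx.
  rewrite /wt -powRD ?(gt_eqF x0) ?implybT//; congr (_ `^ _); ring.
split => p _; last first.
  have Z : wsq (fun=> 0 : R) by have [] := cwsq0 R.
  split; first by apply: eq_wsq (wsq_lin (2^-1 ^+ p) 0 S Z) => x /=; rewrite mul0r addr0.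
  by apply: eq_wsq Z.
split.
  apply: eq_prim (prim_lin (2^-1 ^+ p) 0 (powR_prim 2^-1) (prim_cst 0)) => x /andP[x0 _] /=.
    by rewrite mul0r addr0.
  by rewrite mul0r addr0 powR_m1// exprSr; ring.
by apply: eq_prim (prim_cst 0) => x _ //=; rewrite mulr0.
Qed.

Definition Zu (ga : R) (z : nat -> mR -> R[i]) p := conv (fun=> 0) (fun=> ga) p z.
Definition Yu ga (V : R[i]) z p (x : mR) : R[i] := V * hpow p x + (x `^ ga)%:C * Zu ga z p x.
Definition Pu ga V z p := conv (fun=> 0) (fun j => 0 - j%:R) p (Yu ga V z).

Lemma chain_Yu ga m V z : 0 <= ga -> chain m z -> chain m (Yu ga V z).
Proof.
move=> g0 cz; apply: chain_clin; first exact: chain_hpow.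
by apply: chain_powM => //; apply: conv_gchain; apply/chain_gchain.
Qed.

Lemma zsum_Yu ga m : 0 <= ga -> exists2 C, 0 <= C & forall k V z, chain m z ->
  zsum k m (Yu ga V z) <= C * mn m k V z.
Proof.
move=> g0; have [C1 C10 h1] := conv_zsum (fun=> 0 : R) (fun=> ga) m.
pose B := \sum_(p < m.+1) cwn (hpow p); have B0 : 0 <= B by apply: sumr_ge0 => p _; exact: cwn_ge0.
exists (m.+1%:R * (2 * (B + C1))); first by rewrite !mulr_ge0// addr_ge0.
move=> k V z cz; rewrite -mulrA; apply: zsum_le => p pm.
have gz : gchain (fun=> 0) m z by apply/chain_gchain.
have gZ : gchain (fun=> ga) m (Zu ga z) by exact: conv_gchain.
have [s1 le1] := cwsq_powM g0 (gZ.2 p pm).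
have hp := cwn_clin_le V ((chain_hpow m).2 p pm) s1.
have L0 := LamX_ge0 R k (m - p).
apply: le_trans (ler_wpM2l L0 hp) _; rewrite [leLHS]mulrCA -[leRHS]mulrA; apply: ler_wpM2l => //.
rewrite mulrDr mulrDl /mn.
have Z0 : 0 <= zsum k m z by exact: zsum_ge0.
have V0 := mnV_ge0 m k V; have N0 := sqr_ge0 (normc V).
apply: lerD.
  apply: (@le_trans _ _ (B * (Lam R k ^+ m * normc V ^+ 2))); last by rewrite ler_wpM2l// lerDl.
  rewrite mulrA mulrC; apply: ler_pM; [exact: cwn_ge0|exact: mulr_ge0| |].
    by rewrite /B (bigD1 (Ordinal (pm : (p < m.+1)%N)))//= lerDl sumr_ge0// => i _; exact: cwn_ge0.
  by rewrite ler_wpM2r// ler_weXn2l ?Lam_ge1// leq_subr.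
apply: (@le_trans _ _ (C1 * zsum k m z)); last by rewrite ler_wpM2l// lerDr.
apply: le_trans (h1 k z gz).
apply: le_trans (zsum_term k (Zu ga z) pm); exact: ler_wpM2l.
Qed.

(** An element of the leading exponent 1/2 has its derivatives in the space of exponent 1/2. *)
Lemma rep_wrep ga m (u : R * R -> R[i]) V z : 0 < ga -> rep 2^-1 ga m u V z -> wrep 0 m u (fun k => Pu ga (V k) (z k)).
Proof.
move=> g0 [pu su cz cu]; split => //.
  by move=> k; apply: conv_gchain; apply/chain_gchain; apply: chain_Yu => //; exact: ltW.
move=> k; apply: filterS (cu k) => x h x01; rewrite h// powRr0 mul1r /Pu /= /Yu /hpow /Zu /=.
by rewrite expr0 mul1r [V k * _]mulrC; congr (_ + (_ `^ _)%:C * _); ring.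
Qed.

Lemma rep_K ga m (u : R * R -> R[i]) V z : 0 < ga -> rep 2^-1 ga m u V z -> (sn 0 m V z < +oo)%E ->
  K_mem (0 + 2^-1) m u.
Proof.
move=> g0 r fs; have [pu su cz _] := r; have wr := rep_wrep g0 r.
apply: (wrep_K wr su).
have [C1 C10 h1] := conv_zsum (fun=> 0 : R) (fun j => 0 - j%:R) m.
have [C2 C20 h2] := zsum_Yu m (ltW g0).
have esn := sn0E m V z.
rewrite esn in fs.
apply: (msum_fin_le (C := m.+1%:R * (C1 * C2)) _ _ _ _ fs).
- by rewrite !mulr_ge0.
- by move=> k; exact: ksum_ge0.
- by move=> k; exact: mn_ge0.
move=> k; apply: le_trans (ksum_le _ _ _) _; rewrite -!mulrA ler_wpM2l//.
have gY : gchain (fun=> 0) m (Yu ga (V k) (z k)) by apply/chain_gchain; apply: chain_Yu => //; exact: ltW.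
by apply: le_trans (h1 k _ gY) _; rewrite ler_wpM2l// h2.
Qed.

Lemma ik2 (k : int) : ik k ^+ 2 = - (k%:~R ^+ 2)%:C :> R[i].
Proof.
rewrite /ik exprMn rmorphXn -mulN1r; congr (_ * _).
by apply: complex_eq; rewrite /iC /= ?(mulr0, mul0r, mulr1, mul1r, sub0r, addr0)// oppr0.
Qed.

(** [x^2 d^2 + 2 x d = D^2 + D] for [D = x d/dx], applied to [x^(1/2) V + x^ga z]. *)
Lemma Pu_euler ga k V z x : 0 < x -> Pu ga V z 2%N x + 2 * Pu ga V z 1%N x +
    4^-1 * (Pu ga V z 0%N x + ik k ^+ 2 * Pu ga V z 0%N x) =
  (x `^ 2^-1)%:C * vf k V + (x `^ ga)%:C * euler ga k z 0%N x.
Proof.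
move=> x0; rewrite ik2 /Pu /= /dshift /lin2 /Yu /hpow /Zu /= /dshift /lin2 /vf /vfac /euler /lin2 /eq0.
rewrite !(rmorphD, rmorphM, rmorphN, rmorphXn, rmorph1, rmorph0, fmorphV, rmorph_nat, expr0, expr1, oppr0).
by field.
Qed.

Lemma f_rep ga n (u : R * R -> R[i]) V z : 2^-1 < ga < 1 -> rep 2^-1 ga n.+2 u V z -> (sn 0 n.+2 V z < +oo)%E ->
  rep 0 ga n (f_op u) (fun k => vf k (V k)) (fun k => euler ga k (z k)).
Proof.
move=> /andP[g1 g2] r fs; have g0 : 0 < ga by apply: lt_trans g1; rewrite invr_gt0.
have Ku := rep_K g0 r fs; have wr := rep_wrep g0 r; have [pu su cz cu] := r.
have T p q := @K_term_csqint R (0 + 2^-1) n.+2 u p q Ku.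
have [w00 s00] := T 0%N 0%N isT; have [w02 s02] := T 0%N 2%N isT.
have [w10 s10] := T 1%N 0%N isT; have [w20 s20] := T 2%N 0%N isT.
pose S p q := fun y : mR * mR => (y.1 `^ (p%:R - (0 + 2^-1)))%:C * wderiv p q u y : R[i].
pose c2 : R[i] := 2; pose c4 : R[i] := 4^-1.
pose A (y : mR * mR) : R[i] := 1 * S 0%N 0%N y + S 0%N 2%N y.
pose B (y : mR * mR) : R[i] := c2 * S 1%N 0%N y + S 2%N 0%N y.
pose F (y : mR * mR) : R[i] := c4 * A y + B y.
have sA : csqint mu2 Pi A by exact: (csqint_lin mPi 1 s00 s02).
have sB : csqint mu2 Pi B by exact: (csqint_lin mPi c2 s10 s20).
have sF : csqint mu2 Pi F by exact: (csqint_lin mPi c4 sA sB).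
have mw p q : is_wderiv p q u (wderiv p q u) -> cmeas Pi (wderiv p q u : mR * mR -> R[i]).
  by move=> [_ [h _] _]; exact: Pi_fun_cmeas.
have mf : cmeas Pi (f_op u : mR * mR -> R[i]).
  have mx : measurable_fun D01 (fun x : mR => x : R) by exact: measurable_id.
  apply: cmeasM; first exact: cmeas_pow2.
  apply: cmeasD; last first.
    by apply: cmeasZ; apply: cmeasD; [exact: Pi_fun_cmeas|exact: mw].
  apply: cmeasD; apply: cmeasM; try exact: mw.
    by apply: (cmeas_fst m01 (c := fun x : mR => (x ^+ 2)%:C)); apply: cmeasR; exact: measurable_funX.
  apply: (cmeas_fst m01 (c := fun x : mR => (2 * x)%:C)); apply: cmeasR.
  by apply: measurable_funM => //; exact: measurable_cst.
have pf : Pi_fun (f_op u).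
  have [m1 m2] := mf; split; [exact: m1|exact: m2|] => x t.
  have [_ [_ p00] _] := w00; have [_ [[_ _ p02] _] _] := w02; have [_ [[_ _ p10] _] _] := w10.
  have [_ [[_ _ p20] _] _] := w20; have [_ _ pu'] := pu.
  by rewrite /f_op /= p02 p10 p20 pu'.
have [lu _ _] := w00.
have eF : {ae mu2, forall y, Pi y -> F y = f_op u y}.
  apply: filterS2 (aePi01 R) (wderiv_uniq w00 (is_wderiv00 lu)) => y h1 h2 Dy.
  have /andP[y0 _] := h1 Dy.
  have E p : (y.1 `^ (p%:R - (0 + 2^-1)))%:C = (y.1 `^ (- 2^-1))%:C * (y.1%:C) ^+ p :> R[i].
    rewrite -rmorphXn -rmorphM; congr (_%:C).
    by rewrite -powR_mulrn ?(ltW y0)// -powRD ?(gt_eqF y0) ?implybT// addrC add0r.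
  have e1 : (y.1 ^+ 2)%:C = y.1%:C ^+ 2 :> R[i] by rewrite rmorphXn.
  have e2 : (2 * y.1)%:C = 2 * y.1%:C :> R[i] by rewrite rmorphM rmorph_nat.
  rewrite /F /A /B /S /c2 /c4 (E 0%N) (E 1%N) (E 2%N) (h2 Dy) /f_op e1 e2 expr0 expr1.
  move: ((y.1 `^ (- 2^-1))%:C : R[i]) (y.1%:C : R[i]) (u y) (wderiv 0 2 u y) (wderiv 1 0 u y) (wderiv 2 0 u y) (4^-1 : R[i]); clear.
  by move=> t x u0 u1 u2 u3 q; ring.
have sf : csqint mu2 Pi (f_op u : mR * mR -> R[i]) by exact: csqint_aeG mPi mf eF sF.
split => //; first by move=> k; apply: chain_euler; exact: cz.
move=> k; apply: ae01_trans (ae01_sym (coef_ae k sF sf eF)) _.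
have ci p q := fun s : csqint mu2 Pi (S p q) => csqint_cyl_int m01 f01 s.
have cA := csqint_cyl_int m01 f01 sA; have cB := csqint_cyl_int m01 f01 sB.
have L1 := coef_lin m01 1 k (ci 0%N 0%N s00) (ci 0%N 2%N s02).
have L2 := coef_lin m01 c2 k (ci 1%N 0%N s10) (ci 2%N 0%N s20).
have L3 := coef_lin m01 c4 k cA cB.
have [_ gP cP] := wr.
have cu0 : {ae mu, forall x, 0 < x < 1 -> coef u k x = rder 0 (Pu ga (V k) (z k)) 0%N x}.
  by apply: filterS (cP k) => x h x01; rewrite h// /rder subr0.
have D p q : (p <= n.+2)%N -> is_wderiv p q u (wderiv p q u) -> csqint mu2 Pi (S p q) ->
    {ae mu, forall x, D01 x -> coef (S p q) k x = (x `^ (- 2^-1))%:C * (ik k ^+ q * Pu ga (V k) (z k) p x)}.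
  move=> pm w s.
  have c1 := coef_wderiv w (fun j jp => rder_cprim (gP k) (leq_trans jp pm)) (rder_clocint (gP k)) cu0.
  have c3 := coef_pow_inv k m01 f01 s.
  apply: filterS3 c1 c3 (ae01D R) => x h1 h2 h3 Dx; have /andP[x0 x1] := h3 Dx.
  rewrite h2// h1 ?x0// /rder; rewrite mulrCA [in RHS]mulrCA; congr (_ * _).
  rewrite mulrA -rmorphM -powRD ?(gt_eqF x0) ?implybT//; congr ((_ `^ _)%:C * _).
  by ring.
have D00 := D 0%N 0%N isT w00 s00; have D02 := D 0%N 2%N isT w02 s02.
have D0 p : (p <= n.+2)%N -> is_wderiv p 0 u (wderiv p 0 u) -> csqint mu2 Pi (S p 0%N) ->
    {ae mu, forall x, D01 x -> coef (S p 0%N) k x = (x `^ (- 2^-1))%:C * Pu ga (V k) (z k) p x}.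
  move=> pm w sp; apply: filterS (D p 0%N pm w sp) => x h Dx.
  rewrite (h Dx); congr (_ * _); rewrite expr0; exact: mul1r.
have D10 := D0 1%N isT w10 s10; have D20 := D0 2%N isT w20 s20.
apply/ae01P.
have Q1 : {ae mu, forall x, D01 x -> coef A k x = (x `^ (- 2^-1))%:C *
    (Pu ga (V k) (z k) 0%N x + ik k ^+ 2 * Pu ga (V k) (z k) 0%N x)}.
  by apply: filterS3 L1 D00 D02 => x l d0 d2 Dx; rewrite l// d0// d2// expr0; ring.
have Q2 : {ae mu, forall x, D01 x -> coef B k x = (x `^ (- 2^-1))%:C *
    (Pu ga (V k) (z k) 2%N x + c2 * Pu ga (V k) (z k) 1%N x)}.
  apply: filterS3 L2 D10 D20 => x l d0 d2 Dx; apply: etrans (l Dx) _.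
  apply: etrans (congr2 (fun a b => c2 * a + b) (d0 Dx) (d2 Dx)) _.
  by rewrite [RHS]mulrDr [RHS]addrC; congr (_ + _); exact: mulrCA.
have Q3 : {ae mu, forall x, D01 x -> coef F k x = (x `^ (- 2^-1))%:C *
    (Pu ga (V k) (z k) 2%N x + c2 * Pu ga (V k) (z k) 1%N x +
     c4 * (Pu ga (V k) (z k) 0%N x + ik k ^+ 2 * Pu ga (V k) (z k) 0%N x))}.
  apply: filterS3 L3 Q1 Q2 => x l d0 d2 Dx; apply: etrans (l Dx) _.
  apply: etrans (congr2 (fun a b => c4 * a + b) (d0 Dx) (d2 Dx)) _.
  by rewrite [RHS]mulrDr [RHS]addrC; congr (_ + _); exact: mulrCA.
apply: filterS2 Q3 (ae01D R) => x q h Dx; have /andP[x0 _] := h Dx.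
rewrite q// /c2 /c4 Pu_euler// mulrDr !mulrA -!rmorphM -!powRD ?(gt_eqF x0) ?implybT//.
by rewrite addNr add0r [- 2^-1 + ga]addrC.
Qed.

Lemma trace_of (u : R * R -> R[i]) t : is_trace u t -> is_trace u (trace u).
Proof. by move=> h; exact: (xgetPex (fun=> 0) (ex_intro _ t h)). Qed.

Lemma trace_eq (u u' : R * R -> R[i]) : is_trace u (trace u) -> is_trace u' (trace u') ->
  Pi_eq u u' -> trace u = trace u'.
Proof.
move=> h [U [a b p e ->]] uu; apply: (trace_uniq h); exists U; split => //.
by apply: filterS2 uu e => y h1 h2 Dy; rewrite h1// h2.
Qed.

Lemma mn_sup m k (V : R[i]) z x : chain m.+1 z -> 0 < x <= 1 ->
  normc V ^+ 2 + normc (z 0%N x) ^+ 2 <= 4 * mn m.+1 k V z.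
Proof.
move=> cz x01; have S := cdprim_sup (cz.1 0%N isT) (cz.2 0%N isT) (cz.2 1%N isT) x01.
have L n : 1 <= Lam R k ^+ n by apply: exprn_ege1; exact: Lam_ge1.
have h0 : cwn (z 0%N) <= zsum k m.+1 z.
  by apply: le_trans (zsum_term k z (leq0n m.+1)); rewrite ler_peMl// cwn_ge0.
have h1 : cwn (z 1%N) <= zsum k m.+1 z.
  by apply: le_trans (zsum_term k z (isT : (1 <= m.+1)%N)); rewrite ler_peMl// cwn_ge0.
have hV : normc V ^+ 2 <= Lam R k ^+ m.+1 * normc V ^+ 2 by rewrite ler_peMl// sqr_ge0.
have Z0 := zsum_ge0 k m.+1 z; have V0 := sqr_ge0 (normc V).
rewrite /mn; move: S h0 h1 hV V0; clear; move: (normc V ^+ 2) (normc (z 0%N x) ^+ 2) => a b.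
by move: (cwn (z 0%N)) (cwn (z 1%N)) (zsum k m.+1 z) (Lam R k ^+ m.+1 * a) => *; lra.
Qed.

(** The exponential decay of the modes makes their Fourier series uniformly convergent on
    (0, 1], so that its sum is the continuous representative. *)
Lemma u_trace s ga m (u : R * R -> R[i]) V z : 0 < s -> 0 < ga -> rep 2^-1 ga m.+1 u V z -> (sn s m.+1 V z < +oo)%E ->
  [/\ is_trace u (trace u), circle_fun (trace u), csqint mu circ (trace u : mR -> R[i]) &
      forall k, fourier_coef (trace u) k = V k + z k 0%N 1].
Proof.
move=> s0 g0 [pu su cz cu] fs.
pose c k (x : R) : R[i] := (x `^ 2^-1)%:C * V k + (x `^ ga)%:C * z k 0%N x.
pose S := fine (sn s m.+1 V z); have S0 : 0 <= S.
  by apply: fine_ge0; apply: msum_ge0 => k; exact: sn_term_ge0.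
have hS k : expR (2 * s * `|k%:~R|) * mn m.+1 k (V k) (z k) <= S.
  rewrite -lee_fin /S -msum_fin//; last by move=> j; exact: sn_term_ge0.
  by apply: (msum_term (a := fun k => expR (2 * s * `|k%:~R|) * mn m.+1 k (V k) (z k))) => j; exact: sn_term_ge0.
have bc k x : 0 < x <= 1 -> normc (c k x) <= Num.sqrt (8 * S) * expR (- (s * `|k%:~R|)).
  move=> x01; have /andP[x0 x1] := x01; rewrite -ler_sqr ?nnegrE ?normc_ge0 ?mulr_ge0 ?sqrtr_ge0 ?expR_ge0//.
  rewrite exprMn sqr_sqrtr; last by rewrite mulr_ge0.
  have P (q : R) : 0 < q -> x `^ q <= 1 by move=> q0; apply: powR_le1; [exact: ltW|rewrite (ltW x0) x1].
  have e2 : expR (2 * s * `|k%:~R|) * expR (- (s * `|k%:~R|)) ^+ 2 = 1 :> R.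
    by rewrite expr2 -!expRD -[RHS]expR0; congr expR; ring.
  have ep := expR_ge0 (- (s * `|k%:~R|) : R).
  have M8 : normc (c k x) ^+ 2 <= 8 * mn m.+1 k (V k) (z k).
    apply: le_trans (normc2_add _ _) _; rewrite !normc_reM ?powR_ge0// !exprMn.
    have := mn_sup k (V k) (cz k) x01.
    have a1 : (x `^ 2^-1) ^+ 2 * normc (V k) ^+ 2 <= normc (V k) ^+ 2.
      by rewrite ler_piMl ?sqr_ge0// exprn_ile1 ?powR_ge0// P// invr_gt0.
    have a2 : (x `^ ga) ^+ 2 * normc (z k 0%N x) ^+ 2 <= normc (z k 0%N x) ^+ 2.
      by rewrite ler_piMl ?sqr_ge0// exprn_ile1 ?powR_ge0// P.
    move: a1 a2; clear; move: (_ * normc (V k) ^+ 2) (_ * normc (z k 0%N x) ^+ 2) => a b.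
    move: (normc (V k) ^+ 2) (normc (z k 0%N x) ^+ 2) (mn _ _ _ _) => *; lra.
  apply: le_trans M8 _; rewrite -mulrA ler_wpM2l//.
  have hm := ler_wpM2r (sqr_ge0 (expR (- (s * `|k%:~R|)))) (hS k).
  by rewrite mulrAC e2 mul1r in hm.
have cR (a : R) (y y1 : mR -> R) : prim y y1 ->
    {within `]0 : R, 1], continuous (fun x : R => a * x `^ 2^-1 + 1 * (x `^ ga * y x))}.
  by move=> py; exact: prim_continuous0 (prim_lin a 1 (powR_prim 2^-1) (prim_mul (powR_prim ga) py)).
have c1 k : {within `]0 : R, 1], continuous (fun x => Re (c k x))}.
  have [d _] := (cz k).1 0%N isT.
  have -> : (fun x => Re (c k x)) =
      (fun x => Re (V k) * x `^ 2^-1 + 1 * (x `^ ga * (Re \o z k 0%N) x)).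
    by apply/funext => x; rewrite /c ReD !Re_realM /=; ring.
  exact: cR d.
have c2 k : {within `]0 : R, 1], continuous (fun x => Im (c k x))}.
  have [_ d] := (cz k).1 0%N isT.
  have -> : (fun x => Im (c k x)) =
      (fun x => Im (V k) * x `^ 2^-1 + 1 * (x `^ ga * (Im \o z k 0%N) x)).
    by apply/funext => x; rewrite /c ImD !Im_realM /=; ring.
  exact: cR d.
have [U [U1 U2 U3 U4 U5]] := abs_trig (sqrtr_ge0 _) s0 bc c1 c2.
have eU : Pi_eq u U.
  apply: (coef_inj m01 (csqint_cyl_int m01 f01 su) (csqint_cyl_int m01 f01 U4)) => k.
  move/ae01P: (cu k) => ck; apply: filterS2 ck (ae01D R) => x h1 h2 Dx; have /andP[x0 x1] := h2 Dx.
  have [|_ h] := U5 x; first by rewrite x0 ltW.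
  rewrite h1// /coef h /c; congr (_ + (_ `^ _)%:C * _); ring.
have t0 : is_trace u (fun th => U (1, th)) by exists U.
have tr := trace_of t0; have et : trace u = fun th => U (1, th) := trace_uniq tr t0.
have [|sU cU] := U5 1; first by rewrite ltr01 lexx.
split => //; rewrite et //.
  by have [m1 m2] := csqint_meas sU; split; [exact: m1|exact: m2|move=> t; exact: U3].
by move=> k; rewrite cU /c !powR1 !mul1r.
Qed.

End Operator.

(** * The isomorphism *)

Section Bounds.
Variable R : realType.
Local Notation mR := (measurableTypeR R).
Local Notation iC := (@iC R).

Lemma le_of_sq (K a b : R) : 0 <= K -> 0 <= a -> 0 <= b -> a ^+ 2 <= K * b ^+ 2 -> a <= Num.sqrt K * b.
Proof.
move=> K0 a0 b0 h; rewrite -ler_sqr ?nnegrE ?mulr_ge0 ?sqrtr_ge0//.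
by rewrite exprMn sqr_sqrtr.
Qed.

Lemma iC2 : iC * iC = -1.
Proof. by apply: complex_eq; rewrite /iC /= ?(mulr0, mul0r, mulr1, mul1r, sub0r, addr0)// oppr0. Qed.

Lemma normc_iCM (w : R[i]) : normc (iC * w) ^+ 2 = normc w ^+ 2.
Proof. by rewrite !normc2 ReM ImM /= !mul0r !mul1r sub0r add0r sqrrN addrC. Qed.

Lemma normc_half (w : R[i]) : normc (w / 2) ^+ 2 = normc w ^+ 2 / 4.
Proof.
have -> : w / 2 = w * (2^-1)%:C by rewrite fmorphV rmorph_nat.
by rewrite normc_realM exprMn ger0_norm ?invr_ge0// exprVn -natrX.
Qed.

(** The modes of the part of [g] which comes from [R] and [p]. *)
Definition Dc (r px py : R[i]) (k : int) : R[i] :=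
  if k == 0 then r else if k == 1 then (px - iC * py) / 2
  else if k == -1 then (px + iC * py) / 2 else 0.

Lemma Dc_px r px py : px = Dc r px py 1 + Dc r px py (-1).
Proof. by rewrite /Dc /=; field. Qed.

Lemma Dc_py r px py : py = iC * (Dc r px py 1 - Dc r px py (-1)).
Proof.
rewrite /Dc /=; have -> : (px - iC * py) / 2 - (px + iC * py) / 2 = - (iC * py) by field.
by rewrite mulrN mulrA iC2 mulN1r opprK.
Qed.

Lemma Dc_lin c r px py r' px' py' k :
  Dc (c * r + r') (c * px + px') (c * py + py') k = c * Dc r px py k + Dc r' px' py' k.
Proof. by rewrite /Dc; do 3 (case: ifP => _; first by field); rewrite mulr0 addr0. Qed.

Definition pn (r px py : R[i]) : R := normc r ^+ 2 + normc px ^+ 2 + normc py ^+ 2.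

Lemma pn_ge0 r px py : 0 <= pn r px py.
Proof. by rewrite !addr_ge0// sqr_ge0. Qed.

Lemma Dc_out r px py k : (2 <= `|k|)%N -> Dc r px py k = 0.
Proof.
move=> k2; rewrite /Dc; have -> : (k == 0) = false by lia.
have -> : (k == 1) = false by lia.
by have -> : (k == -1) = false by lia.
Qed.

Lemma Dc_le r px py k : normc (Dc r px py k) ^+ 2 <= pn r px py.
Proof.
have r0 := sqr_ge0 (normc r); have p0 := sqr_ge0 (normc px); have q0 := sqr_ge0 (normc py).
have h1 := normc2_sub px (iC * py); have h2 := normc2_add px (iC * py).
rewrite normc_iCM in h1; rewrite normc_iCM in h2.
rewrite /pn /Dc; do 3 (case: ifP => _; first by
  rewrite ?normc_half; move: r0 p0 q0 h1 h2; clear;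
  move: (normc r ^+ 2) (normc px ^+ 2) (normc py ^+ 2) (normc _ ^+ 2) (normc _ ^+ 2) => *; lra).
by rewrite normc0 expr0n /= !addr_ge0.
Qed.

Lemma pn_le r px py B : (forall k, (`|k| <= 1)%N -> normc (Dc r px py k) ^+ 2 <= B) -> pn r px py <= 9 * B.
Proof.
move=> h; have h0 := h 0 isT; have h1 := h 1 isT; have h2 := h (-1) isT.
have er : r = Dc r px py 0 by [].
have e1 : normc px ^+ 2 <= 4 * B.
  rewrite [px](Dc_px r px py); have := normc2_add (Dc r px py 1) (Dc r px py (-1)).
  by move: h1 h2; clear; move: (normc _ ^+ 2) (normc _ ^+ 2) (normc _ ^+ 2) => *; lra.
have e2 : normc py ^+ 2 <= 4 * B.
  rewrite [py](Dc_py r px py) normc_iCM; have := normc2_sub (Dc r px py 1) (Dc r px py (-1)).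
  by move: h1 h2; clear; move: (normc _ ^+ 2) (normc _ ^+ 2) (normc _ ^+ 2) => *; lra.
rewrite -er in h0; rewrite /pn; move: h0 e1 e2; clear.
by move: (normc r ^+ 2) (normc px ^+ 2) (normc py ^+ 2) => *; lra.
Qed.

Variables (s : R) (n : nat).
Hypothesis s0 : 0 < s.

Definition xs (G : int -> R[i]) k : R := expR (2 * s * `|k%:~R|) * (bw R n k * normc (G k) ^+ 2).

Lemma xs_ge0 G k : 0 <= xs G k.
Proof. by rewrite mulr_ge0 ?expR_ge0// mulr_ge0 ?bw_ge0 ?sqr_ge0. Qed.

Lemma X_norm (g : R -> R[i]) : X_normsq s (n.+2%:R - 2^-1) g = msum (xs (fourier_coef g)).
Proof.
have L0 k : 0 < Lam R k by exact: Lam_gt0.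
apply: eq_esum => k _; congr EFin; rewrite /xs mulrA; congr (_ * _); rewrite mulrC; congr (_ * _).
have -> : n.+2%:R - 2^-1 = n.+1%:R + 2^-1 :> R by rewrite -(natr1 n.+1); field.
rewrite powRD; last by rewrite -/(Lam R k) (gt_eqF (L0 k)) implybT.
by rewrite powR_mulrn ?powR12_sqrt// -/(Lam R k) ltW.
Qed.

Definition Tc (V : int -> R[i]) (z : int -> nat -> mR -> R[i]) k : R[i] := V k + z k 0%N 1.

(** The trace theorem, mode by mode: [bw] is the weight [(1 + k^2)^(n + 3/2)]. *)
Lemma xs_Tc V z k : chain n.+2 (z k) -> xs (Tc V z) k <= 4 * (expR (2 * s * `|k%:~R|) * mn n.+2 k (V k) (z k)).
Proof.
by move=> cz; rewrite /xs [leRHS]mulrCA ler_wpM2l ?expR_ge0//; exact: trace_up.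
Qed.

Lemma symsum_supp (d : int -> R) N : (forall k, 0 <= d k) -> (forall k, (1 < `|k|)%N -> d k = 0) ->
  symsum d N <= d 0 + d 1 + d (-1).
Proof.
move=> d0 h; elim: N => [|N ih].
  by rewrite /symsum big_ord1 subrr -addrA lerDl addr_ge0.
rewrite symsum_recr; case: N ih => [|N] ih.
  by rewrite /symsum big_ord1 subrr [d (- _) + _]addrC -addrA [d (- _) + _]addrC addrA.
have e1 : d (- Posz N.+2) = 0 by apply: h; rewrite abszN.
have e2 : d (Posz N.+2) = 0 by apply: h.
by rewrite e1 e2 add0r addr0.
Qed.

Lemma xs_up : exists2 C, 0 <= C & forall r px py V z, (forall k, chain n.+2 (z k)) ->
  (sn s n.+2 V z < +oo)%E ->
  (msum (xs (fun k => (Dc r px py k + Tc V z k)%R)) < +oo)%E /\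
  fine (msum (xs (fun k => Dc r px py k + Tc V z k))) <= C * (fine (sn s n.+2 V z) + pn r px py).
Proof.
pose w k := expR (2 * s * `|k%:~R|) * bw R n k; have w0 k : 0 <= w k by rewrite mulr_ge0 ?expR_ge0 ?bw_ge0.
pose K := w 0 + w 1 + w (-1); have K0 : 0 <= K by rewrite !addr_ge0.
exists (8 + 2 * K); first by rewrite addr_ge0// mulr_ge0.
move=> r px py V z cz fs; set G := fun k => _.
pose a k := expR (2 * s * `|k%:~R|) * mn n.+2 k (V k) (z k).
have a0 k : 0 <= a k by exact: sn_term_ge0.
have d0 k : 0 <= xs (Dc r px py) k by exact: xs_ge0.
have hd : (msum (xs (Dc r px py)) <= (K * pn r px py)%:E)%E.
  apply: msum_ub => // N; apply: le_trans (symsum_supp N d0 _) _.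
    move=> k k1; rewrite /xs Dc_out//.
    by rewrite normc0 expr0n !mulr0.
  have t k : xs (Dc r px py) k <= w k * pn r px py.
    by rewrite /xs mulrA -/(w k); apply: ler_wpM2l; [exact: w0|exact: Dc_le].
  by rewrite /K !mulrDl; apply: lerD; [apply: lerD|].
have fd : (msum (xs (Dc r px py)) < +oo)%E by apply: le_lt_trans hd _; rewrite ltry.
have fb : (msum (fun k => (8 * a k + 2 * xs (Dc r px py) k)%R) < +oo)%E.
  rewrite msumD; last 2 first.
  - by move=> k; rewrite mulr_ge0.
  - by move=> k; rewrite mulr_ge0.
  by rewrite !msumZ// lte_add_pinfty// lte_mul_pinfty// lee_fin.
have [f1 l1] : (msum (xs G) < +oo)%E /\ fine (msum (xs G)) <= 1 * fine (msum (fun k => 8 * a k + 2 * xs (Dc r px py) k)).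
  apply: msum_le => //; [exact: xs_ge0|by move=> k; rewrite addr_ge0// mulr_ge0|].
  move=> k; rewrite mul1r; have h := xs_Tc V (cz k); rewrite -/(a k) in h.
  apply: (@le_trans _ _ (2 * xs (Dc r px py) k + 2 * xs (Tc V z) k)).
    have E (e b u v : R) : 2 * (e * (b * u)) + 2 * (e * (b * v)) = e * (b * (2 * u + 2 * v)) by ring.
    rewrite /xs E; apply: ler_wpM2l; first exact: expR_ge0.
    by apply: ler_wpM2l; [exact: bw_ge0|exact: normc2_add].
  rewrite addrC lerD2r; move: h; move: (xs _ _) (a k) => *; lra.
split => //; apply: le_trans l1 _; rewrite mul1r msumD; last 2 first.
- by move=> k; rewrite mulr_ge0.
- by move=> k; rewrite mulr_ge0.
rewrite !msumZ// (msum_fin a0 fs) (msum_fin d0 fd) -!EFinM -EFinD /=.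
have fd' : fine (msum (xs (Dc r px py))) <= K * pn r px py by rewrite -lee_fin -msum_fin.
have F0 : 0 <= fine (msum a) by apply: fine_ge0; exact: msum_ge0.
have P0 := pn_ge0 r px py; have KP := mulr_ge0 K0 P0; have KF := mulr_ge0 K0 F0.
rewrite -/(fine (msum a)); have -> : fine (sn s n.+2 V z) = fine (msum a) by [].
move: fd' F0 P0 KP KF; clearbody K; clear.
move: (fine (msum a)) (fine (msum (xs (Dc r px py)))) (pn r px py) K => F D P K fd' F0 P0.
have -> : (8 + 2 * K) * (F + P) = 8 * F + 8 * P + 2 * (K * F) + 2 * (K * P) by ring.
by move: (K * F) (K * P) fd' => x y *; lra.
Qed.

Variable ga : R.
Hypothesis hga : 2^-1 < ga < 1.

Definition fV (V : int -> R[i]) k := vf k (V k).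
Definition fz (z : int -> nat -> mR -> R[i]) k := euler ga k (z k).

Lemma mnf_up k (V : R[i]) z : chain n.+2 z ->
  mn n k (vf k V) (euler ga k z) <= (1 + n.+1%:R * 74) * mn n.+2 k V z.
Proof.
move=> cz; rewrite /mn; have g01 : 0 < ga < 1 by move/andP: hga => [h ->]; rewrite andbT (lt_trans _ h)// invr_gt0.
have h1 := vf_up n k V; have h2 := euler_bound k g01 cz; rewrite mulrA in h2.
have N0 : 0 <= n.+1%:R * 74 :> R by rewrite mulr_ge0.
have V0 : 0 <= Lam R k ^+ n.+2 * normc V ^+ 2 by exact: mnV_ge0.
have Z0 : 0 <= zsum k n.+2 z by exact: zsum_ge0.
have NV := mulr_ge0 N0 V0; rewrite mulrDl mul1r mulrDr.
by apply: le_trans (lerD h1 h2) _; rewrite -addrA lerD2l addrA lerDr addr_ge0.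
Qed.

Lemma sf_up : exists2 C, 0 <= C & forall V z, (forall k, chain n.+2 (z k)) -> (sn s n.+2 V z < +oo)%E ->
  (sn s n (fV V) (fz z) < +oo)%E /\ fine (sn s n (fV V) (fz z)) <= C * fine (sn s n.+2 V z).
Proof.
exists (1 + n.+1%:R * 74); first by rewrite addr_ge0// mulr_ge0.
move=> V z cz fs; apply: msum_le; [by rewrite addr_ge0// mulr_ge0|by move=> k; exact: sn_term_ge0|by move=> k; exact: sn_term_ge0| |exact: fs].
by move=> k; rewrite [leRHS]mulrCA ler_wpM2l ?expR_ge0//; exact: mnf_up.
Qed.

Lemma apriori : exists2 C, 0 <= C & forall V z (G : int -> R[i]), (forall k, chain n.+2 (z k)) ->
  (forall k, (2 <= `|k|)%N -> G k = Tc V z k) -> (sn s n (fV V) (fz z) < +oo)%E ->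
  (msum (xs G) < +oo)%E -> (sn s n.+2 V z < +oo)%E /\
  fine (sn s n.+2 V z) <= C * (fine (sn s n (fV V) (fz z)) + fine (msum (xs G))).
Proof.
have [C C0 h] := mode_apriori n hga; exists C => // V z G cz hG f1 f2.
pose a k := expR (2 * s * `|k%:~R|) * mn n k (fV V k) (fz z k).
have a0 k : 0 <= a k by exact: sn_term_ge0.
have x0 k : 0 <= xs G k by exact: xs_ge0.
have ax0 k : 0 <= a k + xs G k by rewrite addr_ge0.
have fb : (msum (fun k => (a k + xs G k)%R) < +oo)%E by rewrite msumD// lte_add_pinfty.
have [r1 r2] : (sn s n.+2 V z < +oo)%E /\ fine (sn s n.+2 V z) <= C * fine (msum (fun k => a k + xs G k)).
  apply: msum_le => //; first by move=> k; exact: sn_term_ge0.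
  move=> k; rewrite /a /xs -mulrDr [leRHS]mulrCA ler_wpM2l ?expR_ge0//.
  exact: (h k (V k) (G k) (z k) (cz k) (hG k)).
split => //; apply: le_trans r2 _; rewrite msumD// (msum_fin a0 f1) (msum_fin x0 f2) -EFinD.
exact: lexx.
Qed.

(** [R] and [p] are what [g] and the trace of [u] do not share in the modes [|k| <= 1]. *)
Lemma pn_bound : forall r px py V z, (forall k, chain n.+2 (z k)) ->
  (sn s n.+2 V z < +oo)%E -> (msum (xs (fun k => (Dc r px py k + Tc V z k)%R)) < +oo)%E ->
  pn r px py <= 72 * (fine (sn s n.+2 V z) + fine (msum (xs (fun k => Dc r px py k + Tc V z k)))).
Proof.
move=> r px py V z cz fs fx; set G := fun k => _ in fx *.
pose a k := expR (2 * s * `|k%:~R|) * mn n.+2 k (V k) (z k).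
have a0 k : 0 <= a k by exact: sn_term_ge0.
have -> : fine (sn s n.+2 V z) = fine (msum a) by [].
have low (H : int -> R[i]) k : normc (H k) ^+ 2 <= xs H k.
  rewrite /xs mulrA ler_peMl ?sqr_ge0//; apply: mulr_ege1.
    by rewrite -expR0 ler_expR !mulr_ge0// ltW.
  by apply: mulr_ege1; [rewrite exprn_ege1// Lam_ge1|rewrite -[leLHS]sqrtr1 ler_wsqrtr// Lam_ge1].
apply: le_trans (pn_le (B := 8 * (fine (msum a) + fine (msum (xs G)))) _) _; last by rewrite mulrA -natrM.
move=> k _; have E : Dc r px py k = G k - Tc V z k by rewrite /G addrK.
rewrite E; apply: le_trans (normc2_sub _ _) _.
have h1 := low G k; have h2 := low (Tc V z) k; have h3 := xs_Tc V (cz k).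
have h4 : xs G k <= fine (msum (xs G)).
  by rewrite -lee_fin -msum_fin//; [exact: msum_term k (xs_ge0 G)|exact: xs_ge0].
have h5 : a k <= fine (msum a) by rewrite -lee_fin -msum_fin//; exact: msum_term k a0.
have x0 := xs_ge0 G k.
rewrite -/(a k) in h3; move: h1 h2 h3 h4 h5 x0; clear.
by move: (normc _ ^+ 2) (normc _ ^+ 2) (xs _ _) (xs _ _) (a k) (fine _) (fine _) => *; lra.
Qed.

End Bounds.

Section Isomorphism.
Variable R : realType.
Local Notation mu := (@lebesgue_measure R).
Local Notation mR := (measurableTypeR R).
Local Notation mu2 := (mu \x mu)%E.
Local Notation circ := (@circ R : set mR).
Local Notation D01 := (seg (0 : R) 1).
Local Notation Pi := (D01 `*` circ).
Local Notation iC := (@iC R).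
Let m01 := measurable_seg (0 : R) 1.
Let f01 := seg_fin (0 : R) 1.
Let mPi : measurable Pi := measurable_cyl m01.
Let mc := @measurable_circ R.

Lemma circ_coef_eq (v w : R -> R[i]) : csqint mu circ (v : mR -> R[i]) -> csqint mu circ (w : mR -> R[i]) ->
  (forall k, fourier_coef v k = fourier_coef w k) -> circ_eq v w.
Proof.
move=> sv sw h; pose d (t : mR) : R[i] := - 1 * w t + v t.
have sd : csqint mu circ d by exact: (csqint_lin mc (- 1) sw sv).
have d0 k : fourier_coef d k = 0.
  by rewrite fourier_coef_lin ?h ?mulN1r ?addNr//; exact: integrable_csqint_circ.
apply: filterS (fourier_coef_inj0 (integrable_csqint_circ sd) d0) => t ht Ct.
have := Ct : seg 0 (2 * pi) t; rewrite segE => /ht /eqP.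
by rewrite /d mulN1r addrC subr_eq0 => /eqP.
Qed.

Lemma circ_eq_coef (v w : R -> R[i]) : csqint mu circ (v : mR -> R[i]) -> csqint mu circ (w : mR -> R[i]) ->
  circ_eq v w -> forall k, fourier_coef v k = fourier_coef w k.
Proof.
move=> sv sw h k; rewrite !fourier_coefE; congr (_ * _).
apply: (cint_ae mc).
- by apply: cmeasM; [exact: csqint_meas sv|exact: cmeas_mode].
- by apply: cmeasM; [exact: csqint_meas sw|exact: cmeas_mode].
by apply: filterS h => t e Ct; rewrite e.
Qed.

Lemma rep_eq la ga m m' (a a' : R * R -> R[i]) V V' z z' : rep la ga m a V z -> rep la ga m' a' V' z' ->
  (forall k, V k = V' k) -> (forall k, ae01 (z k 0%N) (z' k 0%N)) -> Pi_eq a a'.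
Proof.
move=> [_ sa _ ca] [_ sa' _ ca'] hV hz.
apply: (coef_inj m01 (csqint_cyl_int m01 f01 sa) (csqint_cyl_int m01 f01 sa')) => k.
apply/ae01P; apply: ae01_trans (ca k) _; apply: ae01_trans (ae01_sym (ca' k)).
by apply: filterS (hz k) => x h x01; rewrite hV h.
Qed.

Lemma rep_transfer la ga m (a a' : R * R -> R[i]) V z : rep la ga m a V z -> Pi_fun a' -> Pi_eq a a' ->
  rep la ga m a' V z.
Proof.
move=> [pa sa cz ca] pa' e.
have sa' : csqint mu2 Pi (a' : mR * mR -> R[i]) by exact: csqint_aeG mPi (Pi_fun_cmeas pa') e sa.
by split => // k; exact: ae01_trans (ae01_sym (coef_ae k sa sa' e)) (ca k).
Qed.

Lemma rep_lin la ga m (c : R[i]) (a a' : R * R -> R[i]) V V' z z' : rep la ga m a V z -> rep la ga m a' V' z' ->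
  rep la ga m (c *: a + a') (fun k => c * V k + V' k) (fun k p x => c * z k p x + z' k p x).
Proof.
move=> [[_ _ pa] sa cz ca] [[_ _ pa'] sa' cz' ca'].
have E : (c *: a + a') = fun y => c * a y + a' y by [].
have sl : csqint mu2 Pi (fun y : mR * mR => c * a y + a' y) by exact: (csqint_lin mPi c sa sa').
rewrite E; split => //.
- by have [m1 m2] := csqint_meas sl; split; [exact: m1|exact: m2|move=> x t; rewrite pa pa'].
- by move=> k; exact: chain_clin.
move=> k; have L := coef_lin m01 c k (csqint_cyl_int m01 f01 sa) (csqint_cyl_int m01 f01 sa').
apply/ae01P; move/ae01P: (ca k) => h1; move/ae01P: (ca' k) => h2.
by apply: filterS3 L h1 h2 => x l e1 e2 Dx; rewrite l// e1// e2//; ring.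
Qed.

Lemma sn_lin s m (c : R[i]) V V' (z z' : int -> nat -> mR -> R[i]) : (forall k, chain m (z k)) -> (forall k, chain m (z' k)) ->
  (sn s m V z < +oo)%E -> (sn s m V' z' < +oo)%E ->
  (sn s m (fun k => (c * V k + V' k)%R) (fun k p x => (c * z k p x + z' k p x)%R) < +oo)%E.
Proof.
move=> cz cz' f1 f2; pose K := 2 * normc c ^+ 2; have K0 : 0 <= K by rewrite mulr_ge0// sqr_ge0.
pose a k := expR (2 * s * `|k%:~R|) * mn m k (V k) (z k).
pose b k := expR (2 * s * `|k%:~R|) * mn m k (V' k) (z' k).
have a0 k : 0 <= a k by exact: sn_term_ge0.
have b0 k : 0 <= b k by exact: sn_term_ge0.
have fb : (msum (fun k => (K * a k + 2 * b k)%R) < +oo)%E.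
  rewrite msumD; last 2 first.
  - by move=> k; exact: mulr_ge0.
  - by move=> k; exact: mulr_ge0.
  by rewrite !msumZ// lte_add_pinfty// lte_mul_pinfty// lee_fin.
apply: (msum_fin_le ler01 _ _ _ fb).
- by move=> k; exact: sn_term_ge0.
- by move=> k; rewrite addr_ge0// mulr_ge0.
move=> k; rewrite mul1r /a /b !(mulrCA _ (expR _)) -mulrDr ler_wpM2l ?expR_ge0//.
rewrite /mn; have L0 := LamX_ge0 R k m.
have h1 : Lam R k ^+ m * normc (c * V k + V' k) ^+ 2 <=
    K * (Lam R k ^+ m * normc (V k) ^+ 2) + 2 * (Lam R k ^+ m * normc (V' k) ^+ 2).
  apply: le_trans (ler_wpM2l L0 (normc2_add _ _)) _; rewrite [normc (c * V k)]normcM exprMn /K.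
  by rewrite le_eqVlt; apply/orP; left; apply/eqP; ring.
have h2 : zsum k m (fun p x => c * z k p x + z' k p x) <= K * zsum k m (z k) + 2 * zsum k m (z' k).
  rewrite /zsum !mulr_sumr -big_split; apply: ler_sum => p _ /=.
  have pm : (p <= m)%N := ltn_ord p.
  have L1 := LamX_ge0 R k (m - p).
  apply: le_trans (ler_wpM2l L1 (cwn_clin_le c ((cz k).2 p pm) ((cz' k).2 p pm))) _.
  by rewrite /K le_eqVlt; apply/orP; left; apply/eqP; ring.
apply: le_trans (lerD h1 h2) _; rewrite le_eqVlt; apply/orP; left; apply/eqP; ring.
Qed.

Lemma g_coef (r px py : R[i]) (u : R * R -> R[i]) : circle_fun (trace u) -> csqint mu circ (trace u : mR -> R[i]) ->
  [/\ circle_fun (g_op r px py u), csqint mu circ (g_op r px py u : mR -> R[i]) &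
    forall k, fourier_coef (g_op r px py u) k = Dc r px py k + fourier_coef (trace u) k].
Proof.
move=> [_ _ per] st.
have E : g_op r px py u = fun t => r * mode 0 t + ((px - iC * py) / 2 * mode 1 t +
    ((px + iC * py) / 2 * mode (-1) t + trace u t)).
  apply/funext => t; rewrite /g_op mode0 mulr1.
  have -> : expi t = mode 1 t by rewrite /mode mul1r.
  have -> : expi (- t) = mode (-1) t by rewrite /mode mulrN1z mulN1r.
  by rewrite !addrA.
have s1 : csqint mu circ (fun t : mR => (px + iC * py) / 2 * mode (-1) t + trace u t).
  by apply: (csqint_lin mc _ _ st); exact: csqint_mode.
have s2 : csqint mu circ (fun t : mR => (px - iC * py) / 2 * mode 1 t + ((px + iC * py) / 2 * mode (-1) t + trace u t)).
  by apply: (csqint_lin mc _ _ s1); exact: csqint_mode.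
have sg : csqint mu circ (g_op r px py u : mR -> R[i]).
  by rewrite E; apply: (csqint_lin mc _ _ s2); exact: csqint_mode.
have im k : cintegrable mu circ (mode k : mR -> R[i]) by apply: integrable_csqint_circ; exact: csqint_mode.
split => //.
  have [m1 m2] := csqint_meas sg; split; [exact: m1|exact: m2|move=> t].
  by rewrite E !modeD2pi per.
move=> k; rewrite E (fourier_coef_lin _ _ (im _) (integrable_csqint_circ s2)).
rewrite (fourier_coef_lin _ _ (im _) (integrable_csqint_circ s1)).
rewrite (fourier_coef_lin _ _ (im _) (integrable_csqint_circ st)).
rewrite !fourier_coef_mode ![_ == k]eq_sym /Dc.
case: (eqVneq k 0) => [->|_] /=; first by rewrite mulr1 !mulr0 !add0r.
case: (eqVneq k 1) => [->|_] /=; first by rewrite mulr1 !mulr0 !add0r.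
by case: (eqVneq k (-1)) => [->|_] /=; rewrite ?mulr1 ?mulr0 !add0r.
Qed.

Lemma pi2V_neq0 : ((2 * pi)^-1)%:C != 0 :> R[i].
Proof. by rewrite (inj_eq (@complexI R)) invr_eq0 gt_eqF// pi2_gt0. Qed.

Lemma coef_m2 (v : R -> R[i]) : fourier_coef v (-2) = ((2 * pi)^-1)%:C * circ_int (fun t => v t * expi (2 * t)).
Proof.
rewrite /fourier_coef; congr (_ * circ_int _); apply/funext => t.
by congr (_ * expi _); rewrite mulrNz mulNr opprK.
Qed.

Lemma coef_p2 (v : R -> R[i]) : fourier_coef v 2 = ((2 * pi)^-1)%:C * circ_int (fun t => v t * expi (- (2 * t))).
Proof. by []. Qed.

Variables (s ga : R) (n : nat).
Hypotheses (s0 : 0 < s) (hga : 2^-1 < ga < 1).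
Let g12 : 2^-1 <= ga. Proof. by case/andP: hga => /ltW. Qed.
Let g0 : 0 < ga. Proof. by rewrite (lt_le_trans _ g12)// invr_gt0. Qed.
Let h0 : 0 <= 2^-1 :> R. Proof. by rewrite invr_ge0. Qed.
Let hg0 : 0 <= 2^-1 + ga. Proof. by rewrite addr_ge0// ltW. Qed.
Let zg0 : 0 <= 0 + ga. Proof. by rewrite add0r ltW. Qed.
Let s0' : 0 <= s. Proof. exact: ltW. Qed.

Definition src (u : R * R -> R[i]) V z := rep 2^-1 ga n.+2 u V z /\ (sn s n.+2 V z < +oo)%E.

Lemma Phi_ok r px py (u : R * R -> R[i]) V z : src u V z ->
  [/\ rep 0 ga n (f_op u) (fV V) (fz ga z), (sn s n (fV V) (fz ga z) < +oo)%E,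
      is_trace u (trace u) /\ circle_fun (g_op r px py u),
      csqint mu circ (g_op r px py u : mR -> R[i]) &
      forall k, fourier_coef (g_op r px py u) k = Dc r px py k + Tc V z k].
Proof.
move=> [ru fu]; have [_ _ cz _] := ru.
have [tr ct st ft] := u_trace s0 g0 ru fu; have [cg sg fg] := g_coef r px py ct st.
have [C _ hC] := @sf_up R s n ga hga; have [ff _] := hC V z cz fu.
split => //; first exact: f_rep hga ru (sn_low s0' fu).
by move=> k; rewrite fg ft.
Qed.

Lemma vf2 (V : R[i]) : vf 2 V = 0. Proof. by rewrite /vf /vfac -natrX subrr mul0r mul0r. Qed.
Lemma vfm2 (V : R[i]) : vf (-2) V = 0.
Proof. by rewrite /vf /vfac rmorphN /= sqrrN -natrX subrr mul0r mul0r. Qed.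

Definition Phi (x : source_space ga n.+2 s) : (R * R -> R[i]) * (R -> R[i]) :=
  let: (r, ((px, py), u)) := x in (f_op u, g_op r px py u).

Local Notation tgt := (prod_space (Jtilde_space ga n s) (X_space s (n.+2%:R - 2^-1))).

Lemma Phi_mem (x : source_space ga n.+2 s) : ns_mem x -> ns_mem (Phi x : tgt).
Proof.
case: x => r [[px py] u] hx; have hu : Js_mem 2^-1 ga n.+2 s u := hx.2.2.
have [V [z [ru fu]]] := Js_rep h0 g12 hu; have [_ _ cz _] := ru.
have [rf ff [_ cg] sg eg] := Phi_ok r px py (conj ru fu).
have [vw d fv] := rep_J (lexx 0) rf (sn_low s0' ff).
have jf := rep_Js (lexx 0) zg0 s0' rf ff.
have o1 : circ_int (fun t => vw.1 t * expi (2 * t)) = 0.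
  apply: (mulfI pi2V_neq0); rewrite mulr0 -coef_m2 fv; exact: vfm2.
have o2 : circ_int (fun t => vw.1 t * expi (- (2 * t))) = 0.
  apply: (mulfI pi2V_neq0); rewrite mulr0 -coef_p2 fv; exact: vf2.
have [C _ hC] := @xs_up R s n; have [fx _] := hC r px py V z cz fu.
have fX : (X_normsq s (n.+2%:R - 2^-1) (g_op r px py u) < +oo)%E.
  by rewrite X_norm; move: fx; congr (_ < _)%E; apply: eq_msum => k; rewrite /xs eg.
have [_ l2] := (csqint_normcP mu mc _).1 sg.
by split; [split; [exact: jf|exists vw; [exact: d|split; [exact: o1|exact: o2]]]|split; [exact: cg|exact: l2|exact: fX]].
Qed.

Lemma Phi_lin (c : R[i]) (x y : source_space ga n.+2 s) : ns_mem x -> ns_mem y ->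
  @ns_eq R tgt (Phi (c *: x + y)) (c *: (Phi x : tgt) + (Phi y : tgt)).
Proof.
case: x => r [[px py] u]; case: y => r' [[px' py'] u'] hx hy.
have hu : Js_mem 2^-1 ga n.+2 s u := hx.2.2; have hu' : Js_mem 2^-1 ga n.+2 s u' := hy.2.2.
have [V [z [ru fu]]] := Js_rep h0 g12 hu; have [V' [z' [ru' fu']]] := Js_rep h0 g12 hu'.
have [_ _ cz _] := ru; have [_ _ cz' _] := ru'.
have rl := rep_lin c ru ru'; have fl := sn_lin c cz cz' fu fu'.
have [rf ff _ sg eg] := Phi_ok r px py (conj ru fu).
have [rf' ff' _ sg' eg'] := Phi_ok r' px' py' (conj ru' fu').
have [rfl _ _ sgl egl] := Phi_ok (c * r + r') (c * px + px') (c * py + py') (conj rl fl).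
split.
  apply: (rep_eq rfl (rep_lin c rf rf')) => k; first by rewrite /fV /vf; ring.
  apply: aeW => x _; rewrite /fz /euler /lin2; ring.
have sl := csqint_lin mc c sg sg'.
apply: (circ_coef_eq sgl sl) => k; rewrite egl.
have -> : fourier_coef (fun t => c * g_op r px py u t + g_op r' px' py' u' t) k =
    c * fourier_coef (g_op r px py u) k + fourier_coef (g_op r' px' py' u') k.
  by rewrite fourier_coef_lin//; exact: integrable_csqint_circ.
by rewrite eg eg' Dc_lin /Tc; ring.
Qed.

Lemma Phi_eq (x y : source_space ga n.+2 s) : ns_mem x -> ns_mem y -> ns_eq x y ->
  @ns_eq R tgt (Phi x) (Phi y).
Proof.
case: x => r [[px py] u]; case: y => r' [[px' py'] u'] hx hy [/= er [[epx epy] eu]].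
have hu : Js_mem 2^-1 ga n.+2 s u := hx.2.2; have hu' : Js_mem 2^-1 ga n.+2 s u' := hy.2.2.
have [V [z [ru fu]]] := Js_rep h0 g12 hu; have [V' [z' [ru' fu']]] := Js_rep h0 g12 hu'.
have [_ _ cz _] := ru; have [pu' _ cz' _] := ru'.
have [hV hz] := rep_uniq g12 (rep_transfer ru pu' eu) ru'.
have [rf ff [tu _] sg eg] := Phi_ok r px py (conj ru fu).
have [rf' ff' [tu' _] sg' eg'] := Phi_ok r' px' py' (conj ru' fu').
split.
  apply: (rep_eq rf rf') => k; first by rewrite /fV hV.
  have u0 := chain_uniq (cz k) (cz' k) (hz k).
  apply: filterS3 (u0 0%N isT) (u0 1%N isT) (u0 2%N isT) => x a b d x01.
  by rewrite /fz /euler /lin2 a// b// d.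
apply: aeW => t _; rewrite /Phi /= /g_op; rewrite (trace_eq tu tu' eu).
by move: er epx epy => /= -> -> ->.
Qed.

(** The difference of two solutions is estimated mode by mode, which gives [V], [z] and then
    the modes of [g] for [|k| <= 1]. *)
Lemma Phi_inj (x y : source_space ga n.+2 s) : ns_mem x -> ns_mem y ->
  @ns_eq R tgt (Phi x) (Phi y) -> ns_eq x y.
Proof.
case: x => r [[px py] u]; case: y => r' [[px' py'] u'] hx hy [ef egg].
have hu : Js_mem 2^-1 ga n.+2 s u := hx.2.2; have hu' : Js_mem 2^-1 ga n.+2 s u' := hy.2.2.
have [V [z [ru fu]]] := Js_rep h0 g12 hu; have [V' [z' [ru' fu']]] := Js_rep h0 g12 hu'.
have [_ _ cz _] := ru; have [_ _ cz' _] := ru'.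
have [rf ff _ sg eg] := Phi_ok r px py (conj ru fu).
have [rf' ff' _ sg' eg'] := Phi_ok r' px' py' (conj ru' fu').
have [pf' _ cf' _] := rf'; have [_ _ cf _] := rf.
have [hV hz] := rep_uniq g12 (rep_transfer rf pf' ef) rf'.
have hG k : Dc r px py k + Tc V z k = Dc r' px' py' k + Tc V' z' k.
  by rewrite -eg -eg'; exact: circ_eq_coef sg sg' egg k.
pose d k p x := - 1 * z' k p x + z k p x.
have cd k : chain n.+2 (d k) by exact: chain_clin.
have ed k : zsum k n (euler ga k (d k)) = 0.
  rewrite -[RHS](zsum0 R n k); apply: (zsum_ae (chain_euler _ _ (cd k)) (chain0 R n)).
  apply: filterS (hz k) => x h x01; have := h x01; rewrite /fz /euler /lin2 /d => E.
  transitivity ((1%:C * z k 2%N x + 1%:C * ((2 * ga + 1)%:C * z k 1%N x + (eq0 ga k)%:C * z k 0%N x)) -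
    (1%:C * z' k 2%N x + 1%:C * ((2 * ga + 1)%:C * z' k 1%N x + (eq0 ga k)%:C * z' k 0%N x))); first by ring.
  by rewrite E subrr.
have [C C0 hC] := mode_apriori n hga.
have M k : V k = V' k /\ zsum k n.+2 (d k) = 0.
  have H := hC k (V k - V' k) 0 (d k) (cd k) _.
  have e0 : vf k (V k - V' k) = 0.
    have := hV k; rewrite /fV /vf => E; rewrite mulrBr E subrr //.
  have G0 : (2 <= `|k|)%N -> 0 = V k - V' k + d k 0%N 1.
    move=> k2; have := hG k; rewrite !Dc_out// !add0r /Tc /d mulN1r.
    move: (V k) (V' k) (z k 0%N 1) (z' k 0%N 1); clear => a b c e E.
    by rewrite (_ : a - b + (- e + c) = (a + c) - (b + e)); [rewrite E subrr|ring].
  have := H G0; rewrite e0 ed normc0 expr0n /= !mulr0 !addr0 mulr0 => le0.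
  have v0 : 0 <= Lam R k ^+ n.+2 * normc (V k - V' k) ^+ 2 by exact: mnV_ge0.
  have Z0 : 0 <= zsum k n.+2 (d k) by exact: zsum_ge0.
  have z00 : zsum k n.+2 (d k) = 0 by apply/eqP; rewrite eq_le Z0 andbT (le_trans _ le0)// lerDr.
  split => //; have : Lam R k ^+ n.+2 * normc (V k - V' k) ^+ 2 <= 0 by rewrite (le_trans _ le0)// lerDl.
  rewrite pmulr_rle0; last by rewrite exprn_gt0// Lam_gt0.
  move=> n0; have : normc (V k - V' k) ^+ 2 == 0 by rewrite eq_le n0 sqr_ge0.
  by rewrite sqrf_eq0 => /eqP /eq0_normc /eqP; rewrite subr_eq0 => /eqP.
have L1 m k : 1 <= Lam R k ^+ m by apply: exprn_ege1; exact: Lam_ge1.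
have zz k : ae01 (z k 0%N) (z' k 0%N).
  have [_ zk] := M k; have c0 : cwn (d k 0%N) = 0.
    apply/eqP; rewrite eq_le cwn_ge0 andbT -zk; apply: le_trans (zsum_term k (d k) (leq0n n.+2)).
    by rewrite ler_peMl// cwn_ge0.
  apply: filterS (cwn0_ae ((cd k).2 0%N (leq0n _)) c0) => x h x01; have := h x01.
  by rewrite /d mulN1r addrC => /eqP; rewrite subr_eq0 => /eqP.
have z1 k : z k 0%N 1 = z' k 0%N 1.
  have [_ zk] := M k; have T := mode_trace k (cd k); rewrite zk mulr0 -/(bw R n k) in T.
  have b0 : 0 < bw R n k by rewrite mulr_gt0 ?exprn_gt0 ?sqrtr_gt0 ?Lam_gt0.
  rewrite pmulr_rle0// in T.
  have : normc (d k 0%N 1) ^+ 2 == 0 by rewrite eq_le T sqr_ge0.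
  rewrite sqrf_eq0 => /eqP /eq0_normc /eqP.
  by rewrite /d mulN1r addrC subr_eq0 => /eqP.
have hD k : Dc r px py k = Dc r' px' py' k.
  by have := hG k; rewrite /Tc z1 (M k).1 => /addIr.
split; first exact: (hD 0).
split; first split.
- by rewrite /= (Dc_px r px py) (Dc_px r' px' py') !hD.
- by rewrite /= (Dc_py r px py) (Dc_py r' px' py') !hD.
by apply: (rep_eq ru ru') => // k; have [] := M k.
Qed.

Lemma vfac_neq0 k : (`|k| != 2)%N -> vfac R k != 0.
Proof.
move=> k2; rewrite /vfac mulf_neq0 ?invr_eq0// subr_eq0 int_sq (eqr_nat R 4) -[4%N]/(2 ^ 2)%N.
by rewrite eqn_exp2r// eq_sym.
Qed.

Lemma abs_eq2 (k : int) : `|k|%N = 2%N -> k = 2 \/ k = -2. Proof. lia. Qed.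
Lemma abs_lt2 (k : int) : (`|k| < 2)%N -> [\/ k = 0, k = 1 | k = -1].
Proof.
move=> k2; have [->|[->|->]] : k = 0 \/ k = 1 \/ k = -1 by lia.
- by apply: Or31.
- by apply: Or32.
- by apply: Or33.
Qed.

(** For [|k| = 2] the equation determines [z], and [V] is chosen to meet the boundary value;
    otherwise the equation gives [V], and [z(1)] meets the boundary value for [|k| > 2]. *)
Lemma mode_surj k (Vf G : R[i]) (h : nat -> mR -> R[i]) : chain n h -> ((`|k| == 2)%N -> Vf = 0) ->
  exists P : R[i] * (nat -> mR -> R[i]), [/\ chain n.+2 P.2, forall j, euler ga k P.2 j = h j,
    vf k P.1 = Vf & (2 <= `|k|)%N -> G = P.1 + P.2 0%N 1].
Proof.
move=> ch v2; have [k2|k2] := eqVneq `|k|%N 2%N.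
  have [z [cz ez _]] := @mode_solve R ga k n h 0 hga ch.
  exists (G - z 0%N 1, z); split => //=; last by rewrite subrK.
  rewrite v2 ?k2//; have [->|->] := abs_eq2 k2.
    exact: vf2.
  exact: vfm2.
have n0 : (vfac R k)%:C != 0 :> R[i] by rewrite (inj_eq (@complexI R)) vfac_neq0.
pose V := Vf / (vfac R k)%:C.
have [z [cz ez e1]] := @mode_solve R ga k n h (G - V) hga ch.
exists (V, z); split => //=; first by rewrite /vf /V mulrCA divff// mulr1.
move=> k3; have k4 : (2 < `|k|)%N by rewrite ltn_neqAle eq_sym k2.
by rewrite (e1 k4) addrC subrK.
Qed.

Lemma build_src V z : (forall k, chain n.+2 (z k)) -> (sn s n.+2 V z < +oo)%E ->
  exists u, src u V z.
Proof.
move=> cz fs; have fs0 := sn_low s0' fs.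
pose c k (x : mR) : R[i] := (x `^ 2^-1)%:C * V k + (x `^ (2^-1 + ga - 2^-1))%:C * z k 0%N x.
have sc k : csqint mu D01 (c k).
  have s1 : csqint mu D01 (fun x : mR => (x `^ 2^-1)%:C * V k).
    have b (x : mR) : D01 x -> normc ((x `^ 2^-1)%:C * V k) <= normc (V k).
      by rewrite segE => x01; rewrite normcM ler_piMl ?normc_ge0// powC_le1.
    have mx : cmeas D01 (fun x : mR => (x `^ 2^-1)%:C * V k).
      by apply: cmeasM; [exact: cmeas_pow|exact: cmeas_cst].
    exact: (csqint_bounded_fun m01 f01 mx b).
  apply: (csqintD m01 s1).
  have s2 := (cz k).2 0%N (leq0n _); have [sw _] := csqn_wt s2.
  have b (x : mR) : D01 x -> normc ((x `^ (ga + 2^-1))%:C : R[i]) <= 1.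
    by rewrite segE => x01; apply: powC_le1 => //; rewrite addr_ge0// ltW.
  have mz : cmeas D01 (fun x : mR => (x `^ (2^-1 + ga - 2^-1))%:C * z k 0%N x).
    have [l1 l2] := s2; have [q1 _] := wsq_locint l1; have [q2 _] := wsq_locint l2.
    apply: cmeasM; first exact: cmeas_pow.
    by split; [exact: locint_measurable01 q1|exact: locint_measurable01 q2].
  apply: (csqint_ae m01 mz _ (csqint_bounded m01 (cmeas_pow _ D01) b sw)).
  apply: filterS (ae01D R) => x h Dx; have /andP[x0 _] := h Dx.
  rewrite mulrC mulrA -rmorphM /wt -powRD ?(gt_eqF x0) ?implybT//.
  by congr ((_ `^ _)%:C * _); ring.
have cle k : csqn mu D01 (c k) <= 2 * normc (V k) ^+ 2 + 2 * cwn (z k 0%N).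
  apply: (csqn_modes_le h0 hg0 ((cz k).2 0%N (leq0n _)) (sc k)).
  by apply: aeW.
have fc : (msum (fun k => (csqn mu D01 (c k))%R) < +oo)%E.
  apply: (msum_fin_le (ler0n R 2) _ _ _ fs0) => k; [exact: csqn_ge0|exact: sn_term_ge0|].
  rewrite mulr0 mul0r expR0 mul1r; apply: le_trans (cle k) _; rewrite -mulrDr ler_wpM2l//; exact: mn_low.
have [u [pu su cu]] := build sc fc.
exists u; split => //; split => // k; apply/ae01P; exact: (cu k).
Qed.

Lemma Phi_surj (y : tgt) : ns_mem y -> exists2 x : source_space ga n.+2 s, ns_mem x & @ns_eq R tgt (Phi x) y.
Proof.
case: y => f g hy; have [[hf H1] H2] := hy; have [vw d oo] := H1.
have [w1 w2] := oo; have [cg lg fg] := H2.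
have sg := circ_fun_csqint cg lg.
have [Vf [h [rf ff]]] := Js_rep (lexx 0) g12 hf; have [pf _ ch _] := rf.
have [C _ hC] := J_rep n (lexx 0) zg0; have [z'' [r'' _ _ _]] := hC f vw pf d.
have [eV _] := rep_uniq g12 rf r''.
have v2 k : (`|k| == 2)%N -> Vf k = 0.
  move=> /eqP k2; rewrite eV; have [->|->] := abs_eq2 k2.
    by rewrite coef_p2 w2 mulr0.
  by rewrite coef_m2 w1 mulr0.
pose G := fourier_coef g.
have /choice[P hP] := fun k => mode_surj (G k) (ch k) (v2 k).
pose V k := (P k).1; pose z k := (P k).2.
have cz k : chain n.+2 (z k) by have [] := hP k.
have ez k j : fz ga z k j = h k j by have [_ e _ _] := hP k; exact: e.
have ev k : fV V k = Vf k by have [] := hP k.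
have eG k : (2 <= `|k|)%N -> G k = Tc V z k by have [_ _ _ e] := hP k; exact: e.
have fX : (msum (xs s n G) < +oo)%E by rewrite -X_norm.
have fS : (sn s n (fV V) (fz ga z) < +oo)%E.
  move: ff; congr (_ < _)%E; apply: eq_msum => k; rewrite ev /mn; congr (_ * (_ + zsum _ _ _)).
  by apply/funext => j; rewrite ez.
have [C2 _ hC2] := @apriori R s n ga hga.
have [fs _] := hC2 V z G cz eG fS fX.
have [u hu] := build_src cz fs; have [ru _] := hu.
pose a k := G k - Tc V z k.
pose px := a 1 + a (-1); pose py := iC * (a 1 - a (-1)).
have eD k : Dc (a 0) px py k = a k.
  have ii w : iC * (iC * w) = - w by rewrite mulrA iC2 mulN1r.
  have [k2|k2] := leqP 2 `|k|; first by rewrite Dc_out// /a eG// subrr.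
  have [->|->|->] := abs_lt2 k2.
  - by [].
  - by rewrite /Dc /= /px /py ii; field.
  - by rewrite /Dc /= /px /py ii; field.
have ju := rep_Js h0 hg0 s0' ru fs.
exists (a 0, ((px, py), u)); first by split => //; split => //.
have [rfu _ _ sgu egu] := Phi_ok (a 0) px py hu.
split.
  apply: (rep_eq rfu rf) => k; first exact: ev.
  by apply: aeW => x _; rewrite ez.
by apply: (circ_coef_eq sgu sg) => k; rewrite egu eD /a subrK.
Qed.

Lemma arith_sum (a b c j : R) : 0 <= a -> 0 <= b -> 0 <= c -> 0 <= j ->
  a ^+ 2 + b ^+ 2 + c ^+ 2 <= (a + ((b + c) + j)) ^+ 2 /\ j ^+ 2 <= (a + ((b + c) + j)) ^+ 2.
Proof.
move=> a0 b0 c0 j0.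
have ab := mulr_ge0 a0 b0; have ac := mulr_ge0 a0 c0; have aj := mulr_ge0 a0 j0.
have bc := mulr_ge0 b0 c0; have bj := mulr_ge0 b0 j0; have cj := mulr_ge0 c0 j0.
have aa := sqr_ge0 a; have bb := sqr_ge0 b; have cc := sqr_ge0 c; have jj := sqr_ge0 j.
have -> : (a + ((b + c) + j)) ^+ 2 = a ^+ 2 + b ^+ 2 + c ^+ 2 + j ^+ 2 +
   2 * (a * b) + 2 * (a * c) + 2 * (a * j) + 2 * (b * c) + 2 * (b * j) + 2 * (c * j) by ring.
move: (a ^+ 2) (b ^+ 2) (c ^+ 2) (j ^+ 2) (a * b) (a * c) (a * j) (b * c) (b * j) (c * j) ab ac aj bc bj cj aa bb cc jj.
by clear => *; split; lra.
Qed.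

Lemma X_fine r px py u V z : (forall k, fourier_coef (g_op r px py u) k = Dc r px py k + Tc V z k) ->
  X_normsq s (n.+2%:R - 2^-1) (g_op r px py u) = msum (xs s n (fun k => Dc r px py k + Tc V z k)).
Proof. by move=> eg; rewrite X_norm; apply: eq_msum => k; rewrite /xs eg. Qed.

Lemma Phi_bound : exists M : R, forall x : source_space ga n.+2 s, ns_mem x ->
  ns_norm (Phi x : tgt) <= M * ns_norm x.
Proof.
have [C1 C10 B1] := J_norm_boost n.+2 h0 g12 s0'.
have [C3 C30 B3] := J_norm_boost n (lexx 0) g12 s0'.
have [C2 C20 B2] := @sf_up R s n ga hga.
have [C4 C40 B4] := @xs_up R s n.
exists (Num.sqrt (C3 * (C2 * C1)) + Num.sqrt (C4 * (C1 + 1))).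
case=> r [[px py] u] hx; have hu : Js_mem 2^-1 ga n.+2 s u := hx.2.2.
have [V [z [ru fu]]] := Js_rep h0 g12 hu; have [_ _ cz _] := ru.
have [rf ff _ sg eg] := Phi_ok r px py (conj ru fu).
have [_ l1] := B1 u V z ru fu; have [l3 _] := B3 _ _ _ rf ff.
have [_ l2] := B2 V z cz fu; have [fx l4] := B4 r px py V z cz fu.
set j := J_norm 2^-1 ga n.+2 (boost s u) in l1.
set jf := J_norm 0 ga n (boost s (f_op u)) in l3.
have j0 : 0 <= j by exact: sqrtr_ge0.
have jf0 : 0 <= jf by exact: sqrtr_ge0.
pose N := normc r + ((normc px + normc py) + j).
have N0 : 0 <= N.
  apply: addr_ge0; first exact: normc_ge0.
  by apply: addr_ge0; [apply: addr_ge0; exact: normc_ge0|exact: j0].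
have [hp hj] := arith_sum (normc_ge0 r) (normc_ge0 px) (normc_ge0 py) j0.
rewrite -/N -/(pn r px py) in hp hj.
pose X := fine (X_normsq s (n.+2%:R - 2^-1) (g_op r px py u)).
have X0 : 0 <= X by rewrite /X (X_fine eg); apply: fine_ge0; apply: msum_ge0 => k; exact: xs_ge0.
suff : jf + Num.sqrt X <= (Num.sqrt (C3 * (C2 * C1)) + Num.sqrt (C4 * (C1 + 1))) * N by [].
rewrite mulrDl; apply: lerD.
  apply: le_of_sq => //; first by rewrite !mulr_ge0.
  apply: le_trans l3 _; rewrite -mulrA ler_wpM2l//; apply: le_trans l2 _; rewrite -mulrA ler_wpM2l//.
  by apply: le_trans l1 _; rewrite ler_wpM2l.
apply: le_of_sq; [by rewrite mulr_ge0// addr_ge0|exact: sqrtr_ge0|exact: N0|].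
rewrite sqr_sqrtr// /X (X_fine eg); apply: le_trans l4 _; rewrite -mulrA ler_wpM2l// mulrDl mul1r.
by apply: lerD => //; apply: le_trans l1 _; rewrite ler_wpM2l.
Qed.

Lemma Phi_bound_below : exists M : R, forall x : source_space ga n.+2 s, ns_mem x ->
  ns_norm x <= M * ns_norm (Phi x : tgt).
Proof.
have [C1 C10 B1] := J_norm_boost n.+2 h0 g12 s0'.
have [C3 C30 B3] := J_norm_boost n (lexx 0) g12 s0'.
have [C C0 B2] := @apriori R s n ga hga.
have [C4 C40 B4] := @xs_up R s n.
pose L := C * (C3 + 1); have L0 : 0 <= L by rewrite mulr_ge0// addr_ge0.
pose K := C1 * L + 72 * (L + 1).
have KA : 0 <= C1 * L by exact: mulr_ge0.
have KB : 0 <= 72 * (L + 1) by rewrite mulr_ge0// addr_ge0.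
have K0 : 0 <= K by exact: addr_ge0.
exists (4 * Num.sqrt K).
case=> r [[px py] u] hx; have hu : Js_mem 2^-1 ga n.+2 s u := hx.2.2.
have [V [z [ru fu]]] := Js_rep h0 g12 hu; have [_ _ cz _] := ru.
have [rf ff _ sg eg] := Phi_ok r px py (conj ru fu).
have [l1 _] := B1 u V z ru fu; have [_ l3] := B3 _ _ _ rf ff.
have [fx _] := B4 r px py V z cz fu.
have hG k : (2 <= `|k|)%N -> Dc r px py k + Tc V z k = Tc V z k by move=> k2; rewrite Dc_out// add0r.
have [_ l2] := B2 V z (fun k => Dc r px py k + Tc V z k) cz hG ff fx.
have l5 := @pn_bound R s n s0 r px py V z cz fu fx.
rewrite -(X_fine eg) in l2 l5.
set j := J_norm 2^-1 ga n.+2 (boost s u) in l1.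
set jf := J_norm 0 ga n (boost s (f_op u)) in l3.
set X := fine (X_normsq s (n.+2%:R - 2^-1) (g_op r px py u)) in l2 l5.
set S := fine (sn s n.+2 V z) in l1 l2 l5.
have j0 : 0 <= j by exact: sqrtr_ge0.
have jf0 : 0 <= jf by exact: sqrtr_ge0.
have X0 : 0 <= X by rewrite /X (X_fine eg); apply: fine_ge0; apply: msum_ge0 => k; exact: xs_ge0.
pose T := jf + Num.sqrt X.
have q0 : 0 <= Num.sqrt X by exact: sqrtr_ge0.
have T0 : 0 <= T by exact: addr_ge0.
have hT : jf ^+ 2 + X <= T ^+ 2.
  have E : T ^+ 2 = jf ^+ 2 + Num.sqrt X ^+ 2 + 2 * (jf * Num.sqrt X) by rewrite /T; ring.
  rewrite E (sqr_sqrtr X0) lerDl; apply: mulr_ge0 => //; exact: mulr_ge0.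
have T20 : 0 <= T ^+ 2 by exact: sqr_ge0.
have hX : X <= T ^+ 2 by apply: le_trans hT; rewrite lerDr sqr_ge0.
have hS : S <= L * T ^+ 2.
  apply: le_trans l2 _; rewrite /L -mulrA ler_wpM2l// mulrDl mul1r; apply: lerD => //.
  by apply: le_trans l3 _; rewrite ler_wpM2l//; apply: le_trans hT; rewrite lerDl.
have hj : j ^+ 2 <= K * T ^+ 2.
  apply: (@le_trans _ _ (C1 * L * T ^+ 2)); last by rewrite ler_wpM2r// lerDl.
  by apply: le_trans l1 _; rewrite -mulrA ler_wpM2l.
have hp : pn r px py <= K * T ^+ 2.
  apply: (@le_trans _ _ (72 * (L + 1) * T ^+ 2)); last by rewrite ler_wpM2r// lerDr.
  by apply: le_trans l5 _; rewrite -mulrA ler_wpM2l// mulrDl mul1r lerD.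
have r2 := sqr_ge0 (normc r); have p2 := sqr_ge0 (normc px); have y2 := sqr_ge0 (normc py).
have hr : normc r <= Num.sqrt K * T.
  by apply: le_of_sq; rewrite ?normc_ge0//; apply: le_trans hp; rewrite /pn -addrA lerDl addr_ge0.
have hpx : normc px <= Num.sqrt K * T.
  by apply: le_of_sq; rewrite ?normc_ge0//; apply: le_trans hp; rewrite /pn addrAC lerDr addr_ge0.
have hpy : normc py <= Num.sqrt K * T.
  by apply: le_of_sq; rewrite ?normc_ge0//; apply: le_trans hp; rewrite /pn lerDr addr_ge0.
have hj' : j <= Num.sqrt K * T by exact: le_of_sq.
suff : normc r + ((normc px + normc py) + j) <= 4 * Num.sqrt K * T by [].
rewrite -mulrA; move: hr hpx hpy hj'; clear.
by move: (normc r) (normc px) (normc py) j (Num.sqrt K * T) => *; lra.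
Qed.

Theorem Phi_isomorphism : @isomorphism R (source_space ga n.+2 s) tgt Phi.
Proof.
split.
- exact: Phi_mem.
- by move=> x y hx hy; split; [exact: Phi_eq|exact: Phi_inj].
- exact: Phi_lin.
- exact: Phi_surj.
- by split; [exact: Phi_bound|exact: Phi_bound_below].
Qed.

End Isomorphism.

Theorem theorem14 (R : realType) (m : nat) (sigma gamma : R)
    (hm : (2 <= m)%N) (hsigma : 0 < sigma) (hgamma : 2^-1 < gamma < 1) :
  isomorphism (@bvp_map R gamma m sigma).
Proof.
case: m hm => [|[|n]] // _.
have e : (n.+2 - 2)%N = n by rewrite subn2.
suff H n' : n' = n -> @isomorphism R (source_space gamma n.+2 sigma)
    (prod_space (Jtilde_space gamma n' sigma) (X_space sigma (n.+2%:R - 2^-1)))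
    (@Phi R sigma gamma n) by exact: H _ e.
by move=> ->; exact: Phi_isomorphism.
Qed.
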